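(* Let $T>0$, $p\in[1,3)$, $\theta>p$, $\xi\in\mathbb{R}^d$. Let $\gamma$ be a Gaussian measure on the Borel sets of $C_0=C_0([0,T];\mathbb{R}^m)$ induced by a continuous $\mathbb{R}^m$-valued Gaussian process $X=(X^1,\dots,X^m)$, with Cameron–Martin space $\mathcal{H}$, and let $S\colon C_0\to\mathcal{D}^{0,p}_g$ be a measurable lift map, i.e. $\pi_1\circ S=\mathrm{Id}_{C_0}$. Assume: (i) there is a continuous embedding $\iota\colon\mathcal{H}\hookrightarrow C^{1\text{-var}}([0,T];\mathbb{R}^m)$; (ii) the set $\{x\in C_0: S(x+h)=T_h(S(x))\text{ for all }h\in\mathcal{H}\}$ has full $\gamma$-measure. Let $b,\sigma_1,\dots,\sigma_m$ be vector fields on $\mathbb{R}^d$ whose $\mathrm{Lip}^\theta$-norms are bounded by $\beta$. Let $Y$ be the solution to $$Y_t=\xi+\int_0^tb(Y_s)\,ds+\sum_{i=1}^m\int_0^t\sigma_i(Y_s)\circ dX^i_s,\qquad t\in[0,T],$$ defined pathwise, $\gamma$-almost surely, as the solution of the rough differential equation driven by the rough path $S(X)$, and let $\mu$ be the law of $Y$ on $C_\xi=C_\xi([0,T];\mathbb{R}^d)$. Then for every $\varepsilon>0$ there is a constant $C$ depending on $\varepsilon$, $p$, $\theta$ and $\beta$ such that for every Borel probability measure $\nu$ on $C_\xi$, $$\inf_{\pi\in\Pi(\nu,\mu)}\left(\int_{C_\xi\times C_\xi}d_{p\text{-var}}(x,y)^{2-\varepsilon}\,d\pi(x,y)\right)^{\frac1{2-\varepsilon}}\le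 C\,\|\iota\|_{\mathcal{H}\hookrightarrow C^{1\text{-var}}}\sqrt{H(\nu\,|\,\mu)}.$$
   Context: $C_0([0,T];\mathbb{R}^m)$ and $C_\xi([0,T];\mathbb{R}^d)$ denote the continuous paths started at $0$ and at $\xi$, respectively, with the uniform topology; $\|x\|_{p\text{-var}}=\sup_D(\sum_{t_i\in D}|x_{t_{i+1}}-x_{t_i}|^p)^{1/p}$ over finite partitions $D$ of $[0,T]$; $d_{p\text{-var}}(x,y)=\|x-y\|_{p\text{-var}}\in[0,\infty]$; $C^{1\text{-var}}$ is the set of continuous paths with finite $1$-variation, and $\|\iota\|_{\mathcal{H}\hookrightarrow C^{1\text{-var}}}=\sup\{\|h\|_{1\text{-var}}:|h|_{\mathcal{H}}\le1\}$. Rough paths: $G^{N}(\mathbb{R}^m)$ is the free step-$N$ nilpotent group inside the truncated tensor algebra, with the Carnot–Carathéodory norm $\|\cdot\|$; for a $G^N(\mathbb{R}^m)$-valued path, $\mathbf{x}_{s,t}=\mathbf{x}_s^{-1}\otimes\mathbf{x}_t$. A weakly geometric $p$-rough path is a continuous $G^{[p]}(\mathbb{R}^m)$-valued path of finite $p$-variation with respect to $\|\cdot\|$. $\mathcal{D}_g^{0,p}=C_0^{0,p\text{-var}}([0,T];G^{[p]}(\mathbb{R}^m))$ is the Polish space of geometric $p$-rough paths started at the identity: the closure of canonical lifts (iterated integrals up to order $[p]$) of smooth paths with respect to the $p$-variation metric. $\pi_1$ is the projection to the first-level path. For $h$ of finite $1$-variation, $T_h(\mathbf{x})$ is the translation of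 $\mathbf{x}$ by $h$: its first level is $x+h$ and, if $p\ge2$, its second level is $\mathbf{x}^2_{s,t}+\int_s^tx_{s,u}\otimes dh_u+\int_s^th_{s,u}\otimes dx_u+\int_s^th_{s,u}\otimes dh_u$ (Young integrals, $x_{s,u}=x_u-x_s$). A vector field is $\mathrm{Lip}^\theta$ (in the sense of Stein) if, with $\lfloor\theta\rfloor$ the largest integer strictly smaller than $\theta$, it is $\lfloor\theta\rfloor$ times continuously differentiable and a constant $M$ bounds all derivatives of order $0,\dots,\lfloor\theta\rfloor$ as well as the $(\theta-\lfloor\theta\rfloor)$-Hölder seminorm of the top-order derivative; the $\mathrm{Lip}^\theta$-norm is the smallest such $M$. The solution of the rough differential equation driven by $\mathbf{x}$ with vector fields $(b,\sigma_1,\dots,\sigma_m)$ is the unique uniform limit of solutions of the ODEs $dy^n=b(y^n)dt+\sum_i\sigma_i(y^n)dx^{n,i}$, $y^n_0=\xi$, for smooth $x^n$ whose canonical lifts converge uniformly to $\mathbf{x}$ with uniformly bounded $p$-variation. $\Pi(\nu,\mu)$ is the set of probability measures on the product space with marginals $\nu$ and $\mu$; $H(\nu\,|\,\mu)=\int\log\left(\frac{d\nu}{d\mu}\right)d\nu$ if $\nu\ll\mu$ and $+\infty$ otherwise.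
   Formalization: C may also depend on T, m, γ and S: with ε, p, θ, β alone the claim fails (b=0, σ_i=βe_1, X_t=tZ, T=1 forces C≥β√(2m)). Also ε<2, π_1∘S=Id is only required γ-a.s., and the bound is read as +∞ when H=+∞. *)

(* Defs.v *)
From HB Require Import structures.
From mathcomp Require Import all_boot all_order all_algebra.
From mathcomp Require Import all_classical all_reals all_analysis.
Import Order.TTheory GRing.Theory Num.Theory.
Import numFieldNormedType.Exports.
Set Implicit Arguments.
Unset Strict Implicit.
Unset Printing Implicit Defensive.

Local Open Scope classical_set_scope.
Local Open Scope ring_scope.

(* Euclidean norm; the norm of the library on row vectors is the sup norm. *)
Definition enorm (R : realType) (d : nat) (v : 'rV[R]_d) : R :=
  Num.sqrt (\sum_(i < d) v 0 i ^+ 2).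

(** * Path spaces *)

Definition clamp (R : realType) (T t : R) : R := Num.max 0 (Num.min T t).

(* A path on [0,T] is represented by its unique extension to R that is constant
   on ]-oo,0] and on [T,+oo[, so that cpath T xi is in bijection with
   C_xi([0,T]; R^d) when 0 <= T. *)
Definition is_cpath (R : realType) (T : R) (d : nat) (xi : 'rV[R]_d)
    (x : R -> 'rV[R]_d) : Prop :=
  [/\ continuous x, x 0 = xi & forall t, x (clamp T t) = x t].

Record cpath (R : realType) (T : R) (d : nat) (xi : 'rV[R]_d) := CPath {
  cpath_val :> R -> 'rV[R]_d ;
  cpathP : is_cpath T xi cpath_val }.

Lemma is_cpath_cst (R : realType) (T : R) (d : nat) (xi : 'rV[R]_d) :
  is_cpath T xi (fun=> xi).
Proof. by split=> // t; exact: cvg_cst. Qed.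

HB.instance Definition _ (R : realType) (T : R) (d : nat) (xi : 'rV[R]_d) :=
  gen_eqMixin (cpath T xi).
HB.instance Definition _ (R : realType) (T : R) (d : nat) (xi : 'rV[R]_d) :=
  gen_choiceMixin (cpath T xi).
HB.instance Definition _ (R : realType) (T : R) (d : nat) (xi : 'rV[R]_d) :=
  isPointed.Build (cpath T xi) (CPath (is_cpath_cst T xi)).

(* open sets of the uniform topology *)
Definition uniform_open (R : realType) (T : R) (d : nat) (xi : 'rV[R]_d) :
    set (set (cpath T xi)) :=
  [set U : set (cpath T xi) | forall x : cpath T xi, U x -> exists2 e : R, 0 < e &
    forall y : cpath T xi, (forall t, enorm (y t - x t) < e) -> U y].

(* Borel sigma-algebra of the uniform topology *)
HB.instance Definition _ (R : realType) (T : R) (d : nat) (xi : 'rV[R]_d) :=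
  @isMeasurable.Build (sigma_display (@uniform_open R T d xi)) (cpath T xi)
    <<s @uniform_open R T d xi >> (@sigma_algebra0 _ setT _)
    (@sigma_algebraC _ _) (@sigma_algebra_bigcup _ setT _).

Lemma is_cpathD (R : realType) (T : R) (d : nat) (x y : cpath T (0 : 'rV[R]_d)) :
  is_cpath T 0 (fun t => x t + y t).
Proof.
case: x y => [x [xc x0 xT]] [y [yc y0 yT]]; split=> /= [t||t].
- by apply: cvgD; [exact: xc|exact: yc].
- by rewrite x0 y0 addr0.
- by rewrite xT yT.
Qed.

Lemma is_cpathN (R : realType) (T : R) (d : nat) (x : cpath T (0 : 'rV[R]_d)) :
  is_cpath T 0 (fun t => - x t).
Proof.
case: x => [x [xc x0 xT]]; split=> /= [t||t].
- by apply: cvgN; exact: xc.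
- by rewrite x0 oppr0.
- by rewrite xT.
Qed.

Definition cpathD (R : realType) (T : R) (d : nat) (x y : cpath T (0 : 'rV[R]_d))
    : cpath T 0 := CPath (is_cpathD x y).
Definition cpathN (R : realType) (T : R) (d : nat) (x : cpath T (0 : 'rV[R]_d))
    : cpath T 0 := CPath (is_cpathN x).

Definition smooth_path (R : realType) (T : R) (d : nat) (x : R -> 'rV[R]_d) : Prop :=
  exists2 g : R -> 'rV[R]_d, (forall n t, derivable (derive1n n g) t 1) &
    forall t, 0 <= t <= T -> x t = g t.

(** * p-variation and Young integrals *)

(* The "increment size" phi s t may be +oo (see ccnorm below). *)
Definition pvar (R : realType) (T p : R) (phi : R -> R -> \bar R) : \bar R :=
  ereal_sup [set ((\sum_(0 <= k < size D)
      phi (nth T (0%R :: D) k) (nth T (0%R :: D) k.+1) `^ p) `^ p^-1)%E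
    | D in itv_partition 0 T].

Definition path_pvar (R : realType) (T p : R) (d : nat) (x : R -> 'rV[R]_d) : \bar R :=
  pvar T p (fun s t => (enorm (x t - x s))%:E).

Definition dpvar (R : realType) (T p : R) (d : nat) (x y : R -> 'rV[R]_d) : \bar R :=
  path_pvar T p (fun t => x t - y t).

(* l is the limit of the Riemann-Stieltjes sums of int_s^t f dg *)
Definition is_young (R : realType) (f g : R -> R) (s t l : R) : Prop :=
  forall e : R, 0 < e -> exists2 delta : R, 0 < delta &
    forall (D : seq R) (tag : nat -> R), itv_partition s t D ->
      let u := nth t (s :: D) in
      (forall k, (k < size D)%N -> u k <= tag k <= u k.+1) ->
      (forall k, (k < size D)%N -> u k.+1 - u k < delta) ->
      `|\sum_(0 <= k < size D) f (tag k) * (g (u k.+1) - g (u k)) - l| < e.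

Definition young (R : realType) (f g : R -> R) (s t : R) : R :=
  xget 0 [set l | is_young f g s t l].

(* int_s^t x_{s,u} (x) dy_u *)
Definition cross_integral (R : realType) (m : nat) (x y : R -> 'rV[R]_m) (s t : R)
    : 'M[R]_m :=
  \matrix_(i, j) young (fun u => x u 0 i - x s 0 i) (fun u => y u 0 j) s t.

(** * The step-N truncated tensor algebra, N <= 2, and geometric rough paths *)

(* (a, A) stands for 1 + a + A; since p < 3 only the steps N = [p] in {1, 2} are
   needed, and for N = 1 the second level is identically 0. *)
Definition tens (R : realType) (m : nat) : Type := ('rV[R]_m * 'M[R]_m)%type.

Definition level2 (R : realType) (m N : nat) (A : 'M[R]_m) : 'M[R]_m :=
  if (2 <= N)%N then A else 0.

Definition tone (R : realType) (m : nat) : tens R m := (0, 0).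

Definition tmul (R : realType) (m N : nat) (g h : tens R m) : tens R m :=
  (g.1 + h.1, level2 N (g.2 + h.2 + g.1^T *m h.1)).

Definition tinv (R : realType) (m N : nat) (g : tens R m) : tens R m :=
  (- g.1, level2 N (g.1^T *m g.1 - g.2)).

Definition tincr (R : realType) (m N : nat) (X : R -> tens R m) (s t : R) : tens R m :=
  tmul N (tinv N (X s)) (X t).

(* G^N(R^m) = exp(R^m (+) [R^m, R^m]), where [R^m, R^m] consists of the
   antisymmetric matrices. *)
Definition in_G (R : realType) (m N : nat) (g : tens R m) : Prop :=
  exists2 L : 'M[R]_m, L^T = - L &
    g.2 = level2 N (2^-1 *: (g.1^T *m g.1) + L).

Definition canonical_lift (R : realType) (m N : nat) (x : R -> 'rV[R]_m) (t : R)
    : tens R m :=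
  (x t - x 0, level2 N (cross_integral x x 0 t)).

(* Carnot-Caratheodory norm: the least length of a path on [0,1] whose
   signature is g. *)
Definition ccnorm (R : realType) (m N : nat) (g : tens R m) : \bar R :=
  ereal_inf [set path_pvar 1 1 y |
    y in [set y : cpath (1 : R) (0 : 'rV[R]_m) | canonical_lift N y 1 = g]].

Definition ccdist (R : realType) (m N : nat) (g h : tens R m) : \bar R :=
  ccnorm N (tmul N (tinv N g) h).

Definition rough_pvar (R : realType) (T p : R) (m : nat) (X : R -> tens R m) : \bar R :=
  let N := Num.truncn p in pvar T p (fun s t => ccnorm N (tincr N X s t)).

Definition rough_dpvar (R : realType) (T p : R) (m : nat) (X Y : R -> tens R m)
    : \bar R :=
  let N := Num.truncn p in
  pvar T p (fun s t => ccdist N (tincr N X s t) (tincr N Y s t)).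

Definition weakly_geometric (R : realType) (T p : R) (m : nat) (X : R -> tens R m) : Prop :=
  [/\ continuous X, forall t, X (clamp T t) = X t,
      forall t, in_G (Num.truncn p) (X t) & (rough_pvar T p X < +oo)%E].

(* Elements of D_g^{0,p} *)
Record geom_rough_path (R : realType) (T p : R) (m : nat) := GeomRoughPath {
  geom_val :> R -> tens R m ;
  geom_weak : weakly_geometric T p geom_val ;
  geom_start : geom_val 0 = tone R m ;
  geom_closure : forall e : R, 0 < e ->
    exists2 x : cpath T (0 : 'rV[R]_m), smooth_path T x &
      (rough_dpvar T p geom_val (canonical_lift (Num.truncn p) x) < e%:E)%E }.

Definition geom_open (R : realType) (T p : R) (m : nat) :
    set (set (geom_rough_path T p m)) :=
  [set U : set (geom_rough_path T p m) | forall X, U X -> exists2 e : R, 0 < e &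
    forall Y : geom_rough_path T p m, (rough_dpvar T p X Y < e%:E)%E -> U Y].

Definition borel_measurable_lift (R : realType) (T p : R) (m : nat)
    (S : cpath T (0 : 'rV[R]_m) -> geom_rough_path T p m) : Prop :=
  forall B, <<s @geom_open R T p m >> B -> measurable (S @^-1` B).

(* increments of the translation T_h X *)
Definition translation (R : realType) (m N : nat) (h : R -> 'rV[R]_m)
    (X : R -> tens R m) (s t : R) : tens R m :=
  let x u := (X u).1 in
  ((x t + h t) - (x s + h s),
   level2 N ((tincr N X s t).2 + cross_integral x h s t
             + cross_integral h x s t + cross_integral h h s t)).

Definition is_translation (R : realType) (T : R) (m N : nat) (h : R -> 'rV[R]_m)
    (X Y : R -> tens R m) : Prop :=
  forall s t, 0 <= s -> s <= t -> t <= T -> tincr N Y s t = translation N h X s t.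

(** * Vector fields and rough differential equations *)

(* The derivative of order size vs, as a multilinear map applied to vs. *)
Fixpoint dderive (R : realType) (d : nat) (V : 'rV[R]_d -> 'rV[R]_d)
    (vs : seq 'rV[R]_d) : 'rV[R]_d -> 'rV[R]_d :=
  if vs is v :: vs' then fun y => 'D_v (dderive V vs') y else V.

(* the largest integer strictly smaller than theta, for theta > 0 *)
Definition strict_floor (R : realType) (theta : R) : nat := `|Num.ceil theta - 1|%N.

(* The inequalities with the products of the norms of the directions bound
   the operator norms of the derivatives. *)
Definition lip_const (R : realType) (d : nat) (theta : R) (V : 'rV[R]_d -> 'rV[R]_d)
    (M : R) : Prop :=
  let k := strict_floor theta in
  [/\ forall vs, (size vs < k)%N -> forall v y, derivable (dderive V vs) y v,
      forall vs, (size vs <= k)%N -> continuous (dderive V vs),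
      forall vs, (size vs <= k)%N -> forall y,
        enorm (dderive V vs y) <= M * \prod_(v <- vs) enorm v &
      forall vs, size vs = k -> forall y z,
        enorm (dderive V vs y - dderive V vs z) <=
          M * (\prod_(v <- vs) enorm v) * enorm (y - z) `^ (theta - k%:R)].

Definition lip_norm (R : realType) (d : nat) (theta : R) (V : 'rV[R]_d -> 'rV[R]_d)
    : \bar R :=
  ereal_inf [set M%:E | M in lip_const theta V].

Definition ode_solution (R : realType) (T : R) (m d : nat)
    (b : 'rV[R]_d -> 'rV[R]_d) (sigma : 'I_m -> 'rV[R]_d -> 'rV[R]_d)
    (xi : 'rV[R]_d) (x : R -> 'rV[R]_m) (y : cpath T xi) : Prop :=
  forall t, 0 <= t <= T -> forall k : 'I_d,
    y t 0 k = xi 0 k + young (fun u => b (y u) 0 k) id 0 t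
      + \sum_(i < m) young (fun u => sigma i (y u) 0 k) (fun u => x u 0 i) 0 t.

Definition rde_solution (R : realType) (T p : R) (m d : nat)
    (b : 'rV[R]_d -> 'rV[R]_d) (sigma : 'I_m -> 'rV[R]_d -> 'rV[R]_d)
    (xi : 'rV[R]_d) (X : R -> tens R m) (y : cpath T xi) : Prop :=
  let N := Num.truncn p in
  exists (xn : nat -> cpath T (0 : 'rV[R]_m)) (yn : nat -> cpath T xi),
  [/\ forall n, smooth_path T (xn n),
      forall e : R, 0 < e -> exists n0, forall n, (n0 <= n)%N ->
        forall t, 0 <= t <= T -> (ccdist N (canonical_lift N (xn n) t) (X t) < e%:E)%E,
      exists M : R, forall n, (rough_pvar T p (canonical_lift N (xn n)) <= M%:E)%E,
      forall n, ode_solution b sigma (xn n) (yn n) &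
      forall e : R, 0 < e -> exists n0, forall n, (n0 <= n)%N ->
        forall t, 0 <= t <= T -> enorm (yn n t - y t) < e].

(** * Gaussian measures and Cameron-Martin spaces *)

(* The linear combination of the coordinates x^i_t with coefficients a,
   for (a, i, t) in c *)
Definition coord_comb (R : realType) (T : R) (m : nat) (c : seq (R * 'I_m * R))
    (x : cpath T (0 : 'rV[R]_m)) : R :=
  \sum_(k <- c) k.1.1 * x k.2 0 k.1.2.

(* normal_prob a 0 is not the Dirac mass at a in the library. *)
Definition gaussian_law (R : realType) (a s : R) (A : set R) : \bar R :=
  if s == 0 then \d_a A else normal_prob a s A.

(* The coordinate process is Gaussian under gamma, i.e., gamma is the law of a
   continuous Gaussian process. *)
Definition gaussian (R : realType) (T : R) (m : nat)
    (gamma : probability (cpath T (0 : 'rV[R]_m)) R) : Prop :=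
  forall c : seq (R * 'I_m * R), exists a s : R, forall A : set R, measurable A ->
    gamma (coord_comb c @^-1` A) = gaussian_law a s A.

(* Z lies in the L^2-closure of the span of the centered coordinates and
   h_t = E[Z X_t]. *)
Definition cm_represents (R : realType) (T : R) (m : nat)
    (gamma : probability (cpath T (0 : 'rV[R]_m)) R)
    (h : cpath T (0 : 'rV[R]_m)) (Z : cpath T (0 : 'rV[R]_m) -> R) : Prop :=
  [/\ measurable_fun setT Z,
      forall e : R, 0 < e -> exists c : seq (R * 'I_m * R),
        (\int[gamma]_x ((Z x - (coord_comb c x
           - (\int[gamma]_w coord_comb c w)%R)) ^+ 2)%:E < e%:E)%E &
      forall t i, h t 0 i = \int[gamma]_x (Z x * x t 0 i)].

Definition cameron_martin (R : realType) (T : R) (m : nat)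
    (gamma : probability (cpath T (0 : 'rV[R]_m)) R) : set (cpath T (0 : 'rV[R]_m)) :=
  [set h | exists Z, cm_represents gamma h Z].

(* The representing Z is unique up to gamma-null sets, so that this is its
   L^2-norm if h lies in the Cameron-Martin space, and +oo otherwise. *)
Definition cm_norm (R : realType) (T : R) (m : nat)
    (gamma : probability (cpath T (0 : 'rV[R]_m)) R) (h : cpath T (0 : 'rV[R]_m))
    : \bar R :=
  ereal_inf [set sqrte (\int[gamma]_x (Z x ^+ 2)%:E)%E | Z in cm_represents gamma h].

Definition cm_embedded_1var (R : realType) (T : R) (m : nat)
    (gamma : probability (cpath T (0 : 'rV[R]_m)) R) : Prop :=
  (forall h, cameron_martin gamma h -> (path_pvar T 1 h < +oo)%E) /\
  (forall h0, cameron_martin gamma h0 -> forall e : R, 0 < e ->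
    exists2 delta : R, 0 < delta & forall h, cameron_martin gamma h ->
      (cm_norm gamma (cpathD h (cpathN h0)) < delta%:E)%E ->
      (dpvar T 1 h h0 < e%:E)%E).

Definition cm_embedding_norm (R : realType) (T : R) (m : nat)
    (gamma : probability (cpath T (0 : 'rV[R]_m)) R) : \bar R :=
  ereal_sup [set path_pvar T 1 h |
    h in [set h : cpath T 0 | cameron_martin gamma h /\ (cm_norm gamma h <= 1)%E]].

(** * Transportation cost and entropy *)

Definition couplings (R : realType) d1 d2 (E1 : measurableType d1)
    (E2 : measurableType d2) (nu : probability E1 R) (mu : probability E2 R)
    : set (probability (E1 * E2)%type R) :=
  [set pi : probability (E1 * E2)%type R |
     (forall A, measurable A -> pi (A `*` setT) = nu A) /\
     (forall B, measurable B -> pi (setT `*` B) = mu B)].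

Definition transport_cost (R : realType) d1 (E : measurableType d1)
    (dist : E -> E -> \bar R) (q : R) (nu mu : probability E R) : \bar R :=
  ereal_inf [set ((\int[pi]_z (dist z.1 z.2 `^ q)) `^ q^-1)%E
    | pi in couplings nu mu].

Definition entropy (R : realType) d1 (E : measurableType d1)
    (nu mu : probability E R) : \bar R :=
  if `[< nu `<< mu >] then
    (\int[nu]_x lne (Radon_Nikodym (charge_of_finite_measure nu) mu x))%E
  else +oo%E.

(* a * sqrt H with 0 * sqrt(+oo) = +oo: for a Dirac mass gamma the embedding
   norm is 0, and the bound is meant to be void if H = +oo. *)
Definition entropy_bound (R : realType) (a H : \bar R) : \bar R :=
  (if H is +oo then +oo else a * sqrte H)%E.

(* Main.v *)
(* Talagrand's inequality for gamma is pushed forward through the solution map.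
   Triangular maps in finite dimensions give, for a density f close to dnu/dmu o Y,
   a map x |-> x + h x, with h x in the Cameron-Martin space, that sends gamma to
   f gamma with int |h|^2 <= 2 int f ln f. The solutions driven by S x and by its
   translation differ by C 16^(N x) |h x|_1-var, where N x counts intervals on
   which S x has large p-variation. Marton's argument, applied to the same maps,
   gives N Gaussian tails, so that the factor 16^N is absorbed by Young's
   inequality. The mass |F - f| gamma is coupled independently, at a small cost. *)
From HB Require Import structures.
Require Import Defs.
From mathcomp Require Import all_boot all_order all_algebra.
From mathcomp Require Import all_classical all_reals all_analysis.
From mathcomp Require Import measurable_realfun ring lra.
Import Order.TTheory GRing.Theory Num.Theory.
Import numFieldNormedType.Exports.
Set Implicit Arguments.
Unset Strict Implicit.
Unset Printing Implicit Defensive.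

Local Open Scope classical_set_scope.
Local Open Scope ring_scope.

(** The lift is only measurable, so no pathwise statement about [S] survives a limit of transport
    maps. Hence the maps are built for a cylindrical density bounded away from 0, and the target
    density F is reached by a coupling: the map moves the mass common to both densities, and the
    rest is cheap because finite entropy of F makes exponentially integrable functions, here a
    quadratic function of N, integrable against it. Each map is an explicit shift by a
    Cameron-Martin path, so the translation identity, valid for almost every base point and all
    shifts at once, applies to it; the equation also holds at the shifted point because the image
    law has a density. The exponent stays below 2 since the shift is merely square integrable and is
    multiplied by an unbounded factor with all moments. As [gaussian] speaks of laws on the line
    only, independence is derived by identifying laws through integrals of cosines with a phase. The
    solution along the translated driver is treated as an inexact solution along the original one,
    so that both are compared with one flow. *)

Ltac pos := try done; first [ apply: ltW; assumption | match goal with | |- is_true (_ <= _) => first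
 [ exact: normr_ge0 | exact: sqr_ge0 | exact: powR_ge0 | exact: expR_ge0 | exact: sqrtr_ge0
 | apply: mulr_ge0; pos | apply: addr_ge0; pos | apply: divr_ge0; pos | apply: exprn_ge0; pos
 | rewrite invr_ge0; pos | rewrite subr_ge0; pos | apply: ltW; pos ] | |- is_true (_ < _) => first
 [ exact: expR_gt0 | apply: mulr_gt0; pos | apply: divr_gt0; pos | apply: ltr_wpDl; pos
 | apply: ltr_wpDr; pos | apply: exprn_gt0; pos | apply: powR_gt0; pos | rewrite invr_gt0; pos
 | rewrite subr_gt0; pos ] | |- is_true (_ != _) => rewrite gt_eqF; pos end ].

Tactic Notation "letr" uconstr(h) := refine (le_trans h _).
Tactic Notation "via" uconstr(x) := refine (@le_trans _ _ x _ _ _ _).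

Notation mfunT := (measurable_fun setT).
Notation integT P f := (P.-integrable setT (EFin \o f)) (only parsing).
Notation measE := measurable_EFinP.
Notation mcomp := measurableT_comp.
Notation cont_meas := continuous_measurable_fun.
Notation integrable_cst := finite_measure_integrable_cst.

Ltac rowring := by apply/rowP => ?; rewrite !mxE; ring.

Lemma ler_of_eq (R : realType) (x y : R) : x = y -> x <= y.
Proof. by move=> ->. Qed.

(** * Euclidean norm and mean value inequality *)

Section Enorm.
Context {R : realType} {d : nat}.
Implicit Types (u v w : 'rV[R]_d).

Definition dotp u v : R := \sum_(i < d) u 0 i * v 0 i.

Lemma dotpC u v : dotp u v = dotp v u.
Proof. by apply: eq_bigr => i _; rewrite mulrC. Qed.

Lemma dotpDr u v w : dotp u (v + w) = dotp u v + dotp u w.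
Proof. by rewrite -big_split /=; apply: eq_bigr => i _; rewrite mxE mulrDr. Qed.

Lemma dotpNr u v : dotp u (- v) = - dotp u v.
Proof. by rewrite -sumrN /=; apply: eq_bigr => i _; rewrite mxE mulrN. Qed.

Lemma dotpBr u v w : dotp u (v - w) = dotp u v - dotp u w.
Proof. by rewrite dotpDr dotpNr. Qed.

Lemma dotpZr a u v : dotp u (a *: v) = a * dotp u v.
Proof. by rewrite mulr_sumr; apply: eq_bigr => i _; rewrite mxE mulrCA. Qed.

Lemma sqr_enorm u : enorm u ^+ 2 = dotp u u.
Proof.
rewrite sqr_sqrtr; last by apply: sumr_ge0 => i _; rewrite sqr_ge0.
by [].
Qed.

Lemma enorm_ge0 u : 0 <= enorm u.
Proof. exact: sqrtr_ge0. Qed.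
Hint Resolve enorm_ge0 : core.

Lemma enorm_le u a : 0 <= a -> (enorm u <= a) = (dotp u u <= a ^+ 2).
Proof. by move=> a0; rewrite -sqr_enorm ler_pXn2r// nnegrE. Qed.

Lemma dotp_ge0 u : 0 <= dotp u u.
Proof. by rewrite -sqr_enorm sqr_ge0. Qed.

Lemma enorm0_eq0 u : enorm u = 0 -> u = 0.
Proof.
move=> u0; have : dotp u u = 0 by rewrite -sqr_enorm u0 expr0n.
move=> /eqP; rewrite psumr_eq0; last by move=> i _; rewrite -expr2 sqr_ge0.
move=> /allP H; apply/rowP => i; rewrite mxE.
by have := H i (mem_index_enum _); rewrite /= mulf_eq0 => /orP[] /eqP.
Qed.

(** The squared norm of [enorm v *: u - enorm u *: v] is [2 * enorm u * enorm v] times the gap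
    [enorm u * enorm v - dotp u v]. *)
Lemma dotp_le u v : dotp u v <= enorm u * enorm v.
Proof.
have [v0|v0] := eqVneq (enorm v) 0.
 rewrite v0 (enorm0_eq0 v0) mulr0 /dotp big1// => i _.
 by rewrite mxE mulr0.
have [u0|u0] := eqVneq (enorm u) 0.
 rewrite u0 (enorm0_eq0 u0) mul0r /dotp big1// => i _.
 by rewrite mxE mul0r.
have vp : 0 < enorm v by rewrite lt_neqAle eq_sym v0 enorm_ge0.
have up : 0 < enorm u by rewrite lt_neqAle eq_sym u0 enorm_ge0.
have : 0 <= dotp (enorm v *: u - enorm u *: v) (enorm v *: u - enorm u *: v).
 exact: dotp_ge0.
rewrite dotpBr !dotpZr dotpC (dotpC _ v) !dotpBr !dotpZr -!sqr_enorm (dotpC v u).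
move=> H; have : 0 <= (enorm u * enorm v) * (enorm u * enorm v - dotp u v) by nra.
by rewrite pmulr_rge0 ?mulr_gt0// subr_ge0.
Qed.

Lemma enormD u v : enorm (u + v) <= enorm u + enorm v.
Proof.
rewrite enorm_le ?addr_ge0// dotpDr dotpC (dotpC _ v) !dotpDr -!sqr_enorm (dotpC v u).
by have := dotp_le u v; nra.
Qed.

Lemma enormZ a u : enorm (a *: u) = `|a| * enorm u.
Proof.
apply/eqP; rewrite -(eqrXn2 (n := 2)) ?mulr_ge0//.
by rewrite exprMn !sqr_enorm dotpZr dotpC dotpZr real_normK ?num_real// mulrA.
Qed.

Lemma enormN u : enorm (- u) = enorm u.
Proof. by rewrite -scaleN1r enormZ normrN1 mul1r. Qed.

Lemma enormBC u v : enorm (u - v) = enorm (v - u).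
Proof. by rewrite -enormN opprB. Qed.

Lemma enorm0 : enorm (0 : 'rV[R]_d) = 0.
Proof. by rewrite -(scale0r (0 : 'rV[R]_d)) enormZ normr0 mul0r. Qed.

Lemma enormB u v : enorm (u - v) <= enorm u + enorm v.
Proof. by rewrite -(enormN v) enormD. Qed.

Lemma enorm_triangle u v w : enorm (u - w) <= enorm (u - v) + enorm (v - w).
Proof.
have -> : u - w = (u - v) + (v - w) by rewrite addrA subrK.
exact: enormD.
Qed.

Lemma ler_enormB u v : enorm u - enorm v <= enorm (u - v).
Proof. by rewrite lerBlDr -{1}(subrK v u) enormD. Qed.

Lemma enorm_sum (I : Type) (r : seq I) (P : pred I) (F : I -> 'rV[R]_d) :
 enorm (\sum_(i <- r | P i) F i) <= \sum_(i <- r | P i) enorm (F i).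
Proof.
apply: (big_ind2 (fun x y => enorm x <= y)) => //; first by rewrite enorm0.
by move=> x1 x2 y1 y2 h1 h2; letr (enormD _ _); exact: lerD.
Qed.

Lemma coord_le_enorm u i : `|u 0 i| <= enorm u.
Proof.
rewrite -(ler_pXn2r (n := 2)) ?nnegrE// sqr_enorm real_normK ?num_real//.
rewrite /dotp (bigD1 i)//= -expr2 lerDl.
by apply: sumr_ge0 => j _; rewrite -expr2 sqr_ge0.
Qed.

Lemma norm_le_enorm u : `|u| <= enorm u.
Proof.
rewrite [`|u|]mx_normrE; apply: bigmax_le => // -[i j] _ /=.
by rewrite (ord1 i) coord_le_enorm.
Qed.

Lemma enorm_le_sum u : enorm u <= \sum_(i < d) `|u 0 i|.
Proof.
rewrite [X in enorm X](matrix_sum_delta u) big_ord1.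
letr (enorm_sum _ _ _); apply: ler_sum => i _.
rewrite enormZ; suff -> : enorm (delta_mx 0 i : 'rV[R]_d) = 1 by rewrite mulr1.
rewrite /enorm (bigD1 i)//= big1 ?addr0; last first.
 by move=> j ji; rewrite mxE eqxx (negbTE ji) expr0n.
by rewrite mxE !eqxx expr1n sqrtr1.
Qed.

Lemma mx_norm_ge (n : nat) (A : 'M[R]_(n, d)) i j : `|A i j| <= `|A|.
Proof. by rewrite [leRHS]mx_normrE; exact: (le_bigmax _ _ (i, j)). Qed.

Lemma enorm_le_norm u : enorm u <= d%:R * `|u|.
Proof.
letr (enorm_le_sum _).
via (\sum_(i < d) `|u|); last first.
 by rewrite sumr_const card_ord mulr_natl.
by apply: ler_sum => i _; exact: mx_norm_ge.
Qed.

End Enorm.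
#[export] Hint Extern 0 (is_true (@Order.le _ _ _ (enorm _))) => solve [exact: enorm_ge0] : core.
#[export] Hint Extern 0 (is_true (@Order.le _ _ _ (powR _ _))) => solve [exact: powR_ge0] : core.

Section VectorMVT.
Context {R : realType} {d : nat}.

(** Mean values of the components would sit at different points; projecting on the increment [w]
    itself leaves one scalar function and loses nothing in the constant. *)
Lemma enorm_MVT (f df : R -> 'rV[R]_d) (K a b : R) : a <= b -> (forall r : R, a <= r <= b -> is_derive r 1 f (df r)) ->
 (forall r : R, a <= r <= b -> enorm (df r) <= K) -> enorm (f b - f a) <= K * (b - a).
Proof.
move=> ab fd dfK; set w : 'rV[R]_d := f b - f a.
have K0 : 0 <= K by apply: le_trans (enorm_ge0 (df a)) (dfK a _); rewrite lexx ab.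
have gd (r : R) : a <= r <= b -> is_derive r 1 (fun t => dotp w (f t)) (dotp w (df r)).
 move=> /fd fdr; have [der der1] := fdr.
 have /(derivable_mxP f r 1) derc := der.
 have -> : (fun t => dotp w (f t)) = \sum_(i < d) ((w 0 i) \*: (fun t => f t 0 i)).
 by apply/funext => t; rewrite fct_sumE; apply: eq_bigr.
 have dE : dotp w (df r) = \sum_(i < d) (w 0 i *: 'D_1 (fun t => f t 0 i) r).
 apply: eq_bigr => i _; congr (_ * _).
 by rewrite -der1 (derive_mx der) mxE.
 rewrite dE; apply: is_derive_sum => i.
 have := derc 0 i => di.
 by apply: is_deriveZ.
have cont : {within `[a, b], continuous (fun t => dotp w (f t))}.
 apply: derivable_within_continuous => r; rewrite in_itv/= => r01.
 by have [] := gd r r01.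
have gd' (r : R) : r \in `]a, b[ -> is_derive r 1 (fun t => dotp w (f t)) (dotp w (df r)).
 by rewrite in_itv/= => /andP[r0 r1]; apply: gd; rewrite !ltW.
have [c c01] := MVT_segment ab gd' cont.
rewrite -dotpBr -/w -sqr_enorm => wE.
move: c01; rewrite in_itv/= => c01.
have ba0 : 0 <= b - a by pos.
have [->|w0] := eqVneq (enorm w) 0; first by pos.
have wp : 0 < enorm w by rewrite lt_neqAle eq_sym w0 enorm_ge0.
rewrite -(ler_pM2l wp) -expr2 wE mulrA; apply: ler_wpM2r => //.
letr (dotp_le _ _).
by apply: ler_wpM2l; [done|exact: dfK].
Qed.

End VectorMVT.
Section PowR.
Context {R : realType}.
Implicit Types (x y a : R).

Lemma le_powR x y a : 0 <= a -> 0 <= x -> x <= y -> x `^ a <= y `^ a.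
Proof.
by move=> a0 x0 xy; apply: ge0_ler_powR; rewrite ?nnegrE//; exact: le_trans xy.
Qed.

Lemma powR_le1 x a : 0 <= a -> 0 <= x <= 1 -> x `^ a <= 1.
Proof.
move=> a0 /andP[x0 x1]; letr (le_powR a0 x0 x1).
by rewrite powR1.
Qed.

Lemma powR_leid x a : 1 <= a -> 0 <= x <= 1 -> x `^ a <= x.
Proof.
move=> a1 /andP[x0 x1]; have [->|xn0] := eqVneq x 0.
 by rewrite powR0// gt_eqF// (lt_le_trans ltr01).
by apply: ge1r_powR => //; rewrite x1 andbT lt_neqAle eq_sym xn0.
Qed.

Lemma id_le_powR x a : 0 <= a <= 1 -> 0 <= x <= 1 -> x <= x `^ a.
Proof.
move=> /andP[a0 a1] /andP[x0 x1]; have [->|xn0] := eqVneq x 0.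
 done.
by apply: ger1_powR => //; rewrite x1 andbT lt_neqAle eq_sym xn0.
Qed.

Lemma powRD_ge0 x a b : 0 <= a -> 0 <= b -> x `^ (a + b) = x `^ a * x `^ b.
Proof.
move=> a0 b0; have [->|a1] := eqVneq a 0; first by rewrite add0r powRr0 mul1r.
have ap : 0 < a by lra.
by rewrite powRD// gt_eqF ?ltr_wpDr.
Qed.

Lemma powR_small a e : 0 < a -> 0 < e -> exists2 r : R, 0 < r & forall x, 0 <= x <= r -> x `^ a <= e.
Proof.
move=> a0 e0; exists (e `^ a^-1); first exact: powR_gt0.
move=> x /andP[x0 xe]; letr (le_powR (ltW a0) x0 xe).
by rewrite -powRrM mulVf ?gt_eqF// powRr1// ltW.
Qed.

End PowR.

Lemma strict_floor_ge (R : realType) (theta : R) (n : nat) : 0 < theta -> n%:R < theta -> (n <= strict_floor theta)%N.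
Proof.
move=> t0 nt; rewrite /strict_floor.
have h1 : (n%:Z < Num.ceil theta)%R by rewrite ceil_gt_int.
move: h1; case: (Num.ceil theta) => [k|k] //.
case: k => [|k] //; rewrite ltz_nat ltnS => nk.
have -> : (Posz k.+1 - 1 = k :> int)%R by lra.
exact: nk.
Qed.

(** * Directional calculus with Hoelder derivatives *)

Section DirectionalDerivatives.
Context {R : realType} {d : nat}.
Local Notation E := 'rV[R]_d.
Implicit Types (f g : E -> E) (u v y z a b : E).

Lemma is_derive_line f y u (r : R) : derivable f (y + r *: u) u ->
 is_derive r 1 (fun s : R => f (y + s *: u)) ('D_u f (y + r *: u)).
Proof.
move=> df.
have eqf : (fun h : R => h^-1 *: (f (y + (h *: (1 : R) + r) *: u) - f (y + r *: u)))
 = (fun h : R => h^-1 *: (f (h *: u + (y + r *: u)) - f (y + r *: u))).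
 apply/funext => h; congr (_ *: (f _ - _)).
 by rewrite scalerDl [h *: 1]mulr1 addrCA.
apply: DeriveDef; first by move: df; rewrite /derivable /= eqf.
by rewrite /derive /= eqf.
Qed.

(** Only directional derivatives are asked for, as in [lip_const]; their linearity in the direction
    is derived in [C1_linear]. *)
Definition C1_holder (K al : R) f := [/\ forall v y, derivable f y v, forall v y, enorm ('D_v f y) <= K * enorm v &
 forall v y z, enorm ('D_v f y - 'D_v f z) <= K * enorm v * enorm (y - z) `^ al].

Definition lipschitz_with (K : R) f := forall a b, enorm (f a - f b) <= K * enorm (a - b).

(** A four-point estimate that stands in for a second derivative: two small moves, from [a] and from
    [b], are compared. It keeps [enorm (a - b)] as a factor, which the stability of the scheme in
    its initial value requires. *)
Definition holder4 (K al : R) f := forall a a' b b' (l : R), l <= 1 -> enorm (a' - a) <= l -> enorm (b' - b) <= l ->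
 enorm (f a' - f a - (f b' - f b)) <= K * (enorm (a' - a - (b' - b)) + l `^ al * enorm (a - b)).

Section C1.
Variables (K al : R) (f : E -> E).
Hypotheses (K0 : 0 <= K) (al0 : 0 < al) (Cf : C1_holder K al f).

Lemma C1_line y u (r : R) : is_derive r 1 (fun s : R => f (y + s *: u)) ('D_u f (y + r *: u)).
Proof. by apply: is_derive_line; case: Cf. Qed.

Lemma C1_lip : lipschitz_with K f.
Proof.
move=> a b; case: (Cf) => _ bD _.
have := @enorm_MVT R d (fun s : R => f (b + s *: (a - b)))
 (fun r => 'D_(a - b) f (b + r *: (a - b))) (K * enorm (a - b)) 0 1 ler01.
rewrite scale1r scale0r addr0 subr0 mulr1 addrCA subrr addr0; apply.
- by move=> r _; exact: C1_line.
- by move=> r _; pos.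
Qed.

Lemma C1_taylor_pos y u (r : R) : 0 <= r -> enorm (f (y + r *: u) - f y - r *: 'D_u f y) <=
 K * enorm u * (r * enorm u) `^ al * r.
Proof.
move=> r0; case: (Cf) => _ _ hD.
have := @enorm_MVT R d (fun s : R => f (y + s *: u) - s *: 'D_u f y)
 (fun s => 'D_u f (y + s *: u) - 'D_u f y) (K * enorm u * (r * enorm u) `^ al) 0 r r0.
rewrite !scale0r !addr0 !subr0.
have -> : f (y + r *: u) - r *: 'D_u f y - f y = f (y + r *: u) - f y - r *: 'D_u f y by rewrite addrAC.
apply.
- move=> s _; apply: is_deriveB; first exact: C1_line.
 have -> : (fun s => s *: 'D_u f y) = ( *:%R^~ ('D_u f y)) by [].
 apply: DeriveDef; first exact/derivable1_diffP.
 by rewrite deriveE// diff_val scale1r.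
- move=> s /andP[s0 sr]; letr (hD _ _ _).
 apply: ler_wpM2l; first exact: mulr_ge0.
 apply: le_powR => //; first exact: ltW.
 rewrite addrAC subrr add0r enormZ ger0_norm//.
 exact: ler_wpM2r.
Qed.

(** For negative [r] the expansion starts from the end point [y + r *: u]; moving the derivative
    back to [y] costs a second Hoelder term, whence the factor 2. *)
Lemma C1_taylor y u (r : R) : enorm (f (y + r *: u) - f y - r *: 'D_u f y) <=
 2 * K * enorm u * (`|r| * enorm u) `^ al * `|r|.
Proof.
case: (Cf) => _ _ hD.
have [r0|r0] := leP 0 r.
 rewrite ger0_norm//; letr (C1_taylor_pos _ _ r0).
 have -> : 2 * K * enorm u * (r * enorm u) `^ al * r = 2 * (K * enorm u * (r * enorm u) `^ al * r) by ring.
 by rewrite ler_peMl ?ler1n// !mulr_ge0.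
have nr0 : 0 <= - r by lra.
rewrite ltr0_norm//.
have := C1_taylor_pos (y + r *: u) u nr0.
rewrite scaleNr addrK => h1.
have h2 := hD u (y + r *: u) y.
have -> : f (y + r *: u) - f y - r *: 'D_u f y =
 - (f y - f (y + r *: u) - - r *: 'D_u f (y + r *: u))
 - r *: ('D_u f y - 'D_u f (y + r *: u)).
 by rowring.
letr (enormB _ _); rewrite enormN enormZ.
letr (lerD h1 _).
 apply: ler_wpM2l; first done.
 by rewrite enormBC; exact: h2.
rewrite addrAC subrr add0r enormZ ltr0_norm//.
lra.
Qed.

(** The point [y + r *: (c *: u + v)] is reached directly or through [y + r *: v]. The two
    first-order expansions have errors of order [1 + al] in [r]; after division by [r] they vanish
    in the limit. *)
Lemma C1_linear y u v (c : R) : 'D_(c *: u + v) f y = c *: 'D_u f y + 'D_v f y.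
Proof.
apply/eqP; rewrite -subr_eq0; apply/eqP; apply: enorm0_eq0.
set e := enorm _; have e0 : 0 <= e by pos.
have [//|en0] := eqVneq e 0; have ep : 0 < e by lra.
exfalso.
case: (Cf) => _ _ hD.
pose M := 2 * K * enorm (c *: u + v) * enorm (c *: u + v) `^ al
 + 2 * K * enorm u * (`|c| * enorm u) `^ al * `|c|
 + 2 * K * enorm v * enorm v `^ al + `|c| * (K * enorm u * enorm v `^ al).
have M0 : 0 <= M by rewrite /M !addr_ge0 ?mulr_ge0.
have key (r : R) : 0 < r -> e <= M * r `^ al.
 move=> r0; rewrite -(ler_pM2l r0).
 (* Each bracket on the right is a Taylor remainder, except the last, which is a change of base
    point of the derivative in direction [u]. *)
 have gen (F A B D1 D2 D3 D4 : E) : r *: (D1 - (c *: D2 + D3)) =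
 - (F - A - r *: D1) + (F - B - (r * c) *: D4) + (B - A - r *: D3)
 + (r * c) *: (D4 - D2) by rowring.
 have -> : r * e = enorm (r *: ('D_(c *: u + v) f y - (c *: 'D_u f y + 'D_v f y))) by rewrite enormZ gtr0_norm.
 have h1 := C1_taylor y (c *: u + v) r.
 have h2 := C1_taylor (y + r *: v) u (r * c).
 have h3 := C1_taylor y v r.
 have h4 := hD u (y + r *: v) y.
 have eqx : y + r *: (c *: u + v) = y + r *: v + (r * c) *: u by rowring.
 rewrite eqx in h1.
 set F1 := f (y + r *: v + _) in h1 h2.
 rewrite (gen F1 (f y) (f (y + r *: v)) _ _ _ ('D_u f (y + r *: v))).
 have -> : r * (M * r `^ al) = 2 * K * enorm (c *: u + v) * (r * enorm (c *: u + v)) `^ al * r +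
 2 * K * enorm u * ((r * `|c|) * enorm u) `^ al * (r * `|c|) + 2 * K * enorm v * (r * enorm v) `^ al * r +
 (r * `|c|) * (K * enorm u * (r * enorm v) `^ al).
 rewrite -mulrA !powRM ?mulr_ge0 ?(ltW r0)// /M.
 by rewrite powRM//; ring.
 move: h1 h2 h3 h4; rewrite normrM !(gtr0_norm r0) => h1 h2 h3 h4.
 letr (enormD _ _); apply: lerD; last first.
 rewrite enormZ normrM (gtr0_norm r0); apply: ler_wpM2l.
 by pos.
 apply: le_trans h4 _; rewrite addrAC subrr add0r enormZ (gtr0_norm r0).
 done.
 letr (enormD _ _); apply: lerD => //.
 letr (enormD _ _); apply: lerD => //.
 by rewrite enormN.
have ea : 0 < e / (M + 1) by pos.
have [r r0 rh] := powR_small al0 ea.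
have h1 := key r r0; have h2 : r `^ al <= e / (M + 1) by apply: rh; rewrite lexx ltW.
have : e <= M * (e / (M + 1)) by letr h1; apply: ler_wpM2l.
apply/negP; rewrite -ltNge mulrA ltr_pdivrMr ?ltr_pwDr//.
lra.
Qed.

Lemma C1_dirD y u v : 'D_(u + v) f y = 'D_u f y + 'D_v f y.
Proof. by rewrite -{1}[u]scale1r C1_linear scale1r. Qed.

Lemma C1_dir0 y : 'D_0 f y = 0.
Proof. by apply: (addrI ('D_0 f y)); rewrite -C1_dirD !addr0. Qed.

Lemma C1_dirZ y u (c : R) : 'D_(c *: u) f y = c *: 'D_u f y.
Proof. by rewrite -[c *: u]addr0 C1_linear C1_dir0 addr0. Qed.

Lemma C1_dirB y u v : 'D_(u - v) f y = 'D_u f y - 'D_v f y.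
Proof. by rewrite C1_dirD -scaleN1r C1_dirZ scaleN1r. Qed.

(** The segments from [b] to [a] and from [b'] to [a'] are run through with one parameter.
    Corresponding points stay within [l] of each other because the end points do, so the derivatives
    along the two segments are close. *)
Lemma C1_holder4 : holder4 K al f.
Proof.
move=> a a' b b' l l1 la lb; case: (Cf) => _ bD hD.
pose x (r : R) := b + r *: (a - b); pose x' (r : R) := b' + r *: (a' - b').
have := @enorm_MVT R d (fun r => f (x' r) - f (x r)) (fun r => 'D_(a' - b') f (x' r) - 'D_(a - b) f (x r))
 (K * (enorm (a' - a - (b' - b)) + l `^ al * enorm (a - b))) 0 1 ler01.
rewrite /x /x' !scale1r !scale0r !addr0 subr0 mulr1 (addrCA b' a') subrr addr0.
rewrite (addrCA b a) subrr addr0 => H.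
apply: H.
- by move=> r _; apply: is_deriveB; exact: C1_line.
- move=> r /andP[r0 r1].
 have -> : a' - b' = (a' - a - (b' - b)) + (a - b) by rowring.
 rewrite C1_dirD -addrA mulrDr; letr (enormD _ _).
 apply: lerD; first exact: bD.
 letr (hD _ _ _); rewrite -mulrA.
 apply: ler_wpM2l => //; rewrite mulrC; apply: ler_wpM2r => //.
 apply: le_powR => //; first exact: ltW.
 have -> : b' + r *: ((a' - a - (b' - b)) + (a - b)) - (b + r *: (a - b)) = r *: (a' - a) + (1 - r) *: (b' - b).
 by rowring.
 letr (enormD _ _); rewrite !enormZ !ger0_norm ?subr_ge0//.
 have h1 : r * enorm (a' - a) <= r * l by apply: ler_wpM2l.
 have h2 : (1 - r) * enorm (b' - b) <= (1 - r) * l by apply: ler_wpM2l => //; rewrite subr_ge0.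
 letr (lerD h1 h2); by apply: ler_of_eq; ring.
Qed.

End C1.

End DirectionalDerivatives.

(** * From Stein's Lip classes to the fields of the Euler scheme *)

Section LipConst.
Context {R : realType} {d : nat}.
Local Notation E := 'rV[R]_d.
Variables (theta M : R) (V : E -> E).
Hypothesis VM : lip_const theta V M.

Lemma lip_const_ge0 : 0 <= M.
Proof.
case: VM => _ _ b _.
by have := le_trans (enorm_ge0 _) (b [::] isT 0); rewrite big_nil mulr1.
Qed.
Let M0 := lip_const_ge0.

Lemma prod_enorm_ge0 (vs : seq E) : 0 <= \prod_(v <- vs) enorm v.
Proof. by apply: prodr_ge0 => v _; done. Qed.

(* An alpha-Hoelder bound with alpha below the available exponent follows by
   interpolation with the bound on the function itself. *)
Lemma interpolate_holder (al be t c x : R) : 0 <= c -> 0 <= t -> 0 < al -> al <= be ->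
 x <= c * t `^ be -> x <= 2 * c -> x <= 2 * c * t `^ al.
Proof.
move=> c0 t0 al0 ab h1 h2; have [t1|t1] := leP t 1.
 apply: (le_trans h1); rewrite -mulrA.
 have [->|tn0] := eqVneq t 0; first by rewrite !powR0 ?gt_eqF ?(lt_le_trans al0)// !mulr0.
 have h : t `^ be <= t `^ al by apply: ger_powR => //; rewrite t1 andbT lt_neqAle eq_sym tn0.
 have := ler_wpM2l c0 h; have : 0 <= c * t `^ al by pos.
 by lra.
apply: (le_trans h2); rewrite ler_peMr ?mulr_ge0//.
by rewrite -[leLHS](powRr0 t); apply: ler_powR; [exact: ltW|exact: ltW].
Qed.

(** At the top order the Hoelder seminorm is given; below it the next derivative provides a
    Lipschitz bound. In both cases interpolation with the sup bound lowers the exponent to [al]. *)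
Lemma dderive_holder vs (al : R) : (size vs <= strict_floor theta)%N ->
 0 < al -> al <= 1 -> (size vs)%:R + al <= theta -> forall y z, enorm (dderive V vs y - dderive V vs z) <=
 2 * (M * \prod_(v <- vs) enorm v) * enorm (y - z) `^ al.
Proof.
move=> vk al0 al1 vth y z; case: VM => der _ bnd hol.
set P := \prod_(v <- vs) _; have P0 : 0 <= P by exact: prod_enorm_ge0.
have MP : 0 <= M * P by pos.
have h2 : enorm (dderive V vs y - dderive V vs z) <= 2 * (M * P).
 letr (enormB _ _); rewrite mulrDl mul1r.
 by apply: lerD; exact: bnd.
move: vk; rewrite leq_eqVlt => /orP[/eqP vk|vk].
 apply: (interpolate_holder MP (enorm_ge0 _) al0) (hol _ vk y z) h2.
 by rewrite -vk lerBrDl.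
apply: (interpolate_holder (be := 1) MP (enorm_ge0 _) al0) h2 => //.
rewrite powRr1//.
have := @enorm_MVT R d (fun s : R => dderive V vs (z + s *: (y - z)))
 (fun r => dderive V ((y - z) :: vs) (z + r *: (y - z))) (M * P * enorm (y - z)) 0 1 ler01.
rewrite scale1r scale0r addr0 subr0 mulr1 addrCA subrr addr0; apply.
 by move=> r _; apply: is_derive_line; exact: der.
move=> r _; letr (bnd _ _ _) => //.
by rewrite big_cons -/P; apply: ler_of_eq; ring.
Qed.

Lemma dderive_C1 vs (al : R) : (size vs < strict_floor theta)%N -> 0 < al -> al <= 1 -> (size vs).+1%:R + al <= theta ->
 C1_holder (2 * M * \prod_(v <- vs) enorm v) al (dderive V vs).
Proof.
move=> vk al0 al1 vth; case: VM => der _ bnd _.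
have P0 := prod_enorm_ge0 vs.
split=> [v y|v y|v y z]; first exact: der.
 letr (bnd (v :: vs) vk y).
 rewrite big_cons (mulrC (enorm v)) mulrA; apply: ler_wpM2r => //.
 by apply: ler_wpM2r => //; rewrite ler_peMl ?ler1n.
have := @dderive_holder (v :: vs) al vk al0 al1 vth y z.
by rewrite /= big_cons => h; apply: (le_trans h); apply: ler_of_eq; ring.
Qed.

End LipConst.

Section Fields.
Context {R : realType} {d m : nat}.
Local Notation E := 'rV[R]_d.

Definition bounded_field (K : R) (f : E -> E) := forall a, enorm (f a) <= K.

Definition smooth_field (K al : R) (f : E -> E) := [/\ bounded_field K f, lipschitz_with K f & holder4 K al f].

(* The fields of the step-N Euler scheme. L i a v is the derivative of sigma i
   at a in the direction v if N = 2, and 0 if N = 1; ta l i = L i (sigma l). *)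
Record scheme_fields (N : nat) (al K : R) (b : E -> E) (sg : 'I_m -> E -> E)
 (L : 'I_m -> E -> E -> E) (ta : 'I_m -> 'I_m -> E -> E) : Prop := SchemeFields { sf_b : smooth_field K al b ;
 sf_sg : forall i, smooth_field K (if N == 1%N then al else 1) (sg i) ; sf_ta : forall l i, smooth_field K al (ta l i) ;
 sf_taE : forall l i a, ta l i a = L i a (sg l a) ; sf_ta0 : N = 1%N -> forall l i a, ta l i a = 0 ;
 sf_L : forall i a u v (c : R), L i a (c *: u + v) = c *: L i a u + L i a v ;
 sf_Lbnd : forall i a v, enorm (L i a v) <= K * enorm v ;
 sf_Llip : forall i a c v, enorm (L i a v - L i c v) <= K * enorm v * enorm (a - c) ;
 sf_rem : forall i a v (l : R), l <= 1 -> enorm v <= l -> enorm (sg i (a + v) - sg i a - L i a v) <= K * l ^+ N ;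
 sf_rem4 : forall i a v c w (l : R), l <= 1 -> enorm v <= l -> enorm w <= l ->
 enorm (sg i (a + v) - sg i a - L i a v - (sg i (c + w) - sg i c - L i c w)) <=
 K * (l ^+ N.-1 * enorm (v - w) + l ^+ N.-1 * l `^ al * enorm (a - c)) }.

Lemma telescope4 (x1 x2 x3 x4 x5 x6 x7 x8 x9 x10 : E) : x1 - x2 - (x3 - x4) =
 (x1 - x5 - (x6 - x7)) + ((x6 - x7) - (x3 - x8)) + (x5 - x2 - (x9 - x10)) + ((x9 - x8) - (x10 - x4)).
Proof. by rowring. Qed.

(** Leibniz rule for four-point differences: either one factor carries the four-point difference, or
    both carry a first difference. *)
Lemma bilinear_telescope (D : E -> E -> E) (DB : forall x u v, D x (u - v) = D x u - D x v) (a a' c c' F1 F2 F3 F4 : E) :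
 D a' F1 - D a F2 - (D c' F3 - D c F4) = D a' (F1 - F2 - (F3 - F4)) + (D a' (F3 - F4) - D c' (F3 - F4))
 + (D a' F2 - D a F2 - (D c' F2 - D c F2)) + (D c' (F2 - F4) - D c (F2 - F4)).
Proof. by rewrite !DB; exact: telescope4. Qed.

Lemma le_smooth_field (K K' al : R) f : K <= K' -> smooth_field K al f -> smooth_field K' al f.
Proof.
move=> KK [h1 h2 h3]; split.
- by move=> a; exact: le_trans (h1 a) KK.
- by move=> a c; letr (h2 a c); exact: ler_wpM2r.
- move=> a a' c c' l l1 la lc; letr (h3 a a' c c' l l1 la lc).
 by apply: ler_wpM2r => //; rewrite addr_ge0// mulr_ge0.
Qed.

Lemma C1_smooth_field (K M al : R) f : 0 <= K -> 0 < al -> C1_holder K al f -> bounded_field K f -> smooth_field K al f.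
Proof.
by move=> K0 al0 Cf bf; split=> //; [exact: (C1_lip Cf)|exact: (C1_holder4 K0 al0 Cf)].
Qed.

Lemma le_C1_holder (K K' al : R) (f : E -> E) : K <= K' -> C1_holder K al f -> C1_holder K' al f.
Proof.
move=> KK [h1 h2 h3]; split=> // [v y|v y z].
 by letr (h2 v y); exact: ler_wpM2r.
by letr (h3 v y z); rewrite -!mulrA; apply: ler_wpM2r => //; rewrite mulr_ge0.
Qed.

Lemma bilinear_arith (x y z : R) : 0 <= x -> 0 <= y -> y <= z -> x + y + (y + x) + (x + z) + y <= 4 * (x + z).
Proof.
by lra.
Qed.

Section SchemeFieldsOfLip.
Variables (al M theta : R) (b : E -> E) (sg : 'I_m -> E -> E).
Hypotheses (al0 : 0 < al) (al1 : al <= 1).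
Hypotheses (bM : lip_const theta b M) (sM : forall i, lip_const theta (sg i) M).
Let M0 : 0 <= M. Proof. exact: lip_const_ge0 bM. Qed.
(** Dominates the constant [2 * M] of [dderive_C1] and is at least 1, so that its powers can be
    compared. *)
Let Q := 2 * M + 1.
Let Q1 : 1 <= Q. Proof. by rewrite lerDr mulr_ge0. Qed.
Let Q0 : 0 <= Q. Proof. exact: le_trans Q1. Qed.
Let MQ : M <= Q. Proof. by rewrite /Q; move: M0; lra. Qed.
Let QQ : Q <= 6 * Q ^+ 2. Proof. by move: Q1; nra. Qed.

Lemma lip_const_bounded (f : E -> E) : lip_const theta f M -> bounded_field Q f.
Proof.
move=> [_ _ bf _] a; have := bf [::] isT a; rewrite big_nil mulr1 => h.
exact: le_trans h MQ.
Qed.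

Lemma lip_const_C1 (f : E -> E) (be : R) : lip_const theta f M -> 0 < be -> be <= 1 ->
 1 + be <= theta -> C1_holder Q be f.
Proof.
move=> fM be0 be1 bt.
have k0 : (0 < strict_floor theta)%N by apply: strict_floor_ge; apply: lt_le_trans bt; rewrite ?ltrDl// addr_gt0.
have := @dderive_C1 R d theta M f fM [::] be k0 be0 be1 bt.
rewrite big_nil mulr1 => h; apply: le_C1_holder h.
by rewrite lerDl.
Qed.

Lemma zero_smooth_field (K be : R) : 0 <= K -> smooth_field K be (fun=> 0 : E).
Proof.
move=> K0; split=> [a|a c|a a' c c' l _ _ _]; rewrite ?enorm0 ?subrr ?enorm0 ?mulr_ge0//.
by pos.
Qed.

(** The plain Euler scheme: with [L] and [ta] equal to 0 the remainders are ordinary increments of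
    the fields, and [sf_rem4] is the four-point estimate itself. *)
Lemma scheme_fields1 : 1 + al <= theta -> scheme_fields 1 al (6 * Q ^+ 2) b sg (fun _ _ _ => 0) (fun _ _ _ => 0).
Proof.
move=> th; have K0 : 0 <= 6 * Q ^+ 2 by pos.
have sm f : lip_const theta f M -> smooth_field (6 * Q ^+ 2) al f.
 move=> fM; apply: (le_smooth_field QQ); apply: (@C1_smooth_field Q Q) => //.
 exact: lip_const_C1.
 exact: lip_const_bounded.
split=> //.
- exact: sm.
- by move=> i; exact: sm.
- by move=> l i; exact: zero_smooth_field.
- by move=> i a u v c; rewrite scaler0 addr0.
- by move=> i a v; rewrite enorm0 mulr_ge0.
- by move=> i a c v; rewrite subrr enorm0 !mulr_ge0.
- move=> i a v l l1 vl; rewrite subr0 expr1; have [_ L _] := sm _ (sM i).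
 letr (L _ _); apply: ler_wpM2l => //.
 by rewrite addrC addKr.
- move=> i a v c w l l1 vl wl; rewrite !subr0 expr0 !mul1r.
 have [_ _ H4] := sm _ (sM i).
 have := H4 a (a + v) c (c + w) l l1; rewrite !(addrC _ v) !(addrC _ w) !addrK.
 by apply.
Qed.
Let D i (a v : E) := 'D_v (sg i) a.

Lemma is_derive_scaler (w : E) (s : R) : is_derive s 1 (fun r : R => r *: w) w.
Proof.
apply: DeriveDef; first exact/derivable1_diffP.
by rewrite deriveE// diff_val scale1r.
Qed.

(** The field [ta l i] is a product of a derivative and a field, so its four-point estimate comes
    from [bilinear_telescope]; the remainders are controlled by the four-point estimate of the
    derivative. *)
Lemma scheme_fields2 : 2 + al <= theta -> scheme_fields 2 al (6 * Q ^+ 2) b sg D (fun l i a => D i a (sg l a)).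
Proof.
move=> th; have K0 : 0 <= 6 * Q ^+ 2 by pos.
have th1 : 1 + al <= theta by apply: le_trans th; rewrite lerD2r ler1n.
have th2 : 1 + 1 <= theta by apply: le_trans th; rewrite -natr1 lerDl ltW.
have C11 i : C1_holder Q 1 (sg i) by exact: lip_const_C1.
have sg1 i : smooth_field Q 1 (sg i) by apply: (@C1_smooth_field Q Q) => //; exact: lip_const_bounded.
have Dl i a c v : enorm (D i a v - D i c v) <= Q * enorm v * enorm (a - c).
 by have [_ _ h] := C11 i; have := h v a c; rewrite powRr1.
have Db i a v : enorm (D i a v) <= Q * enorm v by have [_ h _] := C11 i; exact: h.
have DB i a u v : D i a (u - v) = D i a u - D i a v.
 exact: (C1_dirB Q0 ltr01 (C11 i)).
(* Since [theta] is at least [2 + al], the derivative in a fixed direction is itself of class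
   [C1_holder]. *)
have D4 i v : holder4 (Q * enorm v) al (D i ^~ v).
 apply: C1_holder4 => //; first by pos.
 have k1 : (1 < strict_floor theta)%N.
 apply: strict_floor_ge; last by apply: lt_le_trans th; rewrite ltrDl.
 lra; rewrite addr_gt0.
 have := @dderive_C1 R d theta M (sg i) (sM i) [:: v] al k1 al0 al1 th.
 rewrite big_seq1 => h; apply: le_C1_holder h.
 by apply: ler_wpM2r => //; rewrite lerDl.
split=> //.
- apply: (le_smooth_field QQ); apply: (@C1_smooth_field Q Q) => //.
 exact: lip_const_C1.
 exact: lip_const_bounded.
- by move=> i; apply: (le_smooth_field QQ).
- move=> l i; have [fb fl f4] := sg1 l.
 apply: (@le_smooth_field (4 * Q ^+ 2)); first by move: Q1; nra.
 split=> [a|a c|a a' c c' r r1 ra rc].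
 + letr (Db _ _ _).
 have := ler_wpM2l Q0 (fb a); by move: Q1; nra.
 + have -> : D i a (sg l a) - D i c (sg l c) =
 D i a (sg l a - sg l c) + (D i a (sg l c) - D i c (sg l c)) by rewrite DB addrA subrK.
 letr (enormD _ _).
 have h1 := Db i a (sg l a - sg l c); have h2 := Dl i a c (sg l c).
 have h3 := ler_wpM2l Q0 (fl a c).
 have h4 : Q * enorm (sg l c) * enorm (a - c) <= Q * Q * enorm (a - c) by apply: ler_wpM2r => //; exact: ler_wpM2l.
 have : 0 <= Q * Q * enorm (a - c) by pos.
 move: (enorm (a - c)) h1 h2 h3 h4 => x; rewrite expr2; lra.
 + have r0 : 0 <= r by exact: le_trans (enorm_ge0 _) ra.
 rewrite (bilinear_telescope (DB i)).
 have h1 := Db i a' (sg l a' - sg l a - (sg l c' - sg l c)).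
 have h1' := ler_wpM2l Q0 (f4 a a' c c' r r1 ra rc).
 have h2 := Dl i a' c' (sg l c' - sg l c).
 have h3 := D4 i (sg l a) a a' c c' r r1 ra rc.
 have h4 := Dl i c' c (sg l a - sg l c).
 have h2' : enorm (sg l c' - sg l c) <= Q * r by letr (fl _ _); exact: ler_wpM2l.
 have ac : enorm (a' - c') <= enorm (a - c) + enorm (a' - a - (c' - c)).
 have -> : a' - c' = (a - c) + (a' - a - (c' - c)) by rowring.
 exact: enormD.
 have rr : r <= r `^ al by apply: id_le_powR; rewrite ?(ltW al0)// r0.
 set de := enorm (a' - a - (c' - c)) in h1' h3 ac *.
 set ab := enorm (a - c) in h1' h3 ac *.
 have de0 : 0 <= de by pos.
 have ab0 : 0 <= ab by pos.
 rewrite powRr1// in h1'.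
 have QQ0 : 0 <= Q * Q by pos.
 have k1 : enorm (D i a' (sg l a' - sg l a - (sg l c' - sg l c))) <= Q * Q * (de + r * ab).
 by rewrite -mulrA; exact: le_trans h1 h1'.
 have k2 : enorm (D i a' (sg l c' - sg l c) - D i c' (sg l c' - sg l c)) <= Q * Q * (r * ab + de).
 apply: (le_trans h2).
 via (Q * (Q * r) * (ab + de)).
 apply: ler_pM => //; first by pos.
 exact: ler_wpM2l.
 rewrite [Q * (Q * r)]mulrA -mulrA; apply: ler_wpM2l => //.
 by rewrite mulrDr lerD2l ler_piMl.
 have k3 : enorm (D i a' (sg l a) - D i a (sg l a) - (D i c' (sg l a) - D i c (sg l a))) <=
 Q * Q * (de + r `^ al * ab).
 apply: (le_trans h3); apply: ler_wpM2r.
 by pos.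
 exact: ler_wpM2l.
 have k4 : enorm (D i c' (sg l a - sg l c) - D i c (sg l a - sg l c)) <= Q * Q * (r * ab).
 apply: (le_trans h4).
 via (Q * (Q * ab) * r); last by apply: ler_of_eq; ring.
 apply: ler_pM => //; first by pos.
 exact: ler_wpM2l.
 via (Q * Q * (de + r * ab) + Q * Q * (r * ab + de) + Q * Q * (de + r `^ al * ab) + Q * Q * (r * ab)).
 letr (enormD _ _); apply: lerD => //.
 letr (enormD _ _); apply: lerD => //.
 by letr (enormD _ _); apply: lerD.
 have rab : r * ab <= r `^ al * ab by exact: ler_wpM2r.
 rewrite -!mulrDr (_ : 4 * Q ^+ 2 * _ = Q * Q * (4 * (de + r `^ al * ab))); last by ring.
 apply: ler_wpM2l => //.
 by apply: bilinear_arith => //; rewrite mulr_ge0.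
- by move=> i a u v c; exact: (C1_linear Q0 ltr01 (C11 i)).
- by move=> i a v; letr (Db i a v); exact: ler_wpM2r.
- move=> i a c v; letr (Dl i a c v).
 by apply: ler_wpM2r => //; exact: ler_wpM2r.
- move=> i a v l l1 vl.
 have := C1_taylor_pos Q0 ltr01 (C11 i) a v (@ler01 R).
 rewrite !scale1r mul1r powRr1// mulr1 => h; apply: (le_trans h).
 rewrite -mulrA; apply: ler_pM => //; first by pos.
 by rewrite expr2; apply: ler_pM.
(* Both Taylor remainders are followed along their segments; the derivative of their difference is a
   four-point difference of [D], up to a term linear in [v - w]. *)
- move=> i a v c w l l1 vl wl.
 have l0 : 0 <= l by exact: le_trans vl.
 have := @enorm_MVT R d (fun s : R => sg i (a + s *: v) - s *: D i a v
 - (sg i (c + s *: w) - s *: D i c w)) (fun s => D i (a + s *: v) v - D i a v - (D i (c + s *: w) w - D i c w))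
 (6 * Q ^+ 2 * (l ^+ 1 * enorm (v - w) + l ^+ 1 * l `^ al * enorm (a - c))) 0 1 ler01.
 rewrite !scale1r !scale0r !addr0 !subr0 mulr1 => H.
 have gen (x1 x2 x3 y1 y2 y3 : E) : x1 - x2 - x3 - (y1 - y2 - y3) = x1 - x3 - (y1 - y3) - (x2 - y2).
 by rowring.
 rewrite gen; apply: H => s /andP[s0 s1].
 apply: is_deriveB; apply: is_deriveB.
 + exact: (C1_line (C11 i)).
 + exact: is_derive_scaler.
 + exact: (C1_line (C11 i)).
 + exact: is_derive_scaler.
 have gen2 : D i (a + s *: v) v - D i a v - (D i (c + s *: w) w - D i c w) =
 (D i (a + s *: v) v - D i a v - (D i (c + s *: w) v - D i c v)) + (D i (c + s *: w) (v - w) - D i c (v - w)).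
 rewrite (DB i (c + s *: w)) (DB i c).
 have g (x1 x2 y1 y2 z1 z2 : E) : x1 - x2 - (y1 - y2) = (x1 - x2 - (z1 - z2)) + (z1 - y1 - (z2 - y2)).
 by rowring.
 exact: g.
 have sv (u : E) : enorm (s *: u) <= enorm u by rewrite enormZ ger0_norm// ler_piMl.
 have la : enorm (a + s *: v - a) <= l by rewrite addrC addKr (le_trans (sv v)).
 have lc : enorm (c + s *: w - c) <= l by rewrite addrC addKr (le_trans (sv w)).
 have h1 := D4 i v a (a + s *: v) c (c + s *: w) l l1 la lc.
 have h2 := Dl i (c + s *: w) c (v - w).
 have e1 : a + s *: v - a - (c + s *: w - c) = s *: (v - w) by rowring.
 rewrite e1 in h1.
 have k1 : enorm (D i (a + s *: v) v - D i a v - (D i (c + s *: w) v - D i c v)) <=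
 Q * l * (enorm (v - w) + l `^ al * enorm (a - c)).
 apply: (le_trans h1); apply: ler_pM => //; first by pos.
 - by pos.
 - exact: ler_wpM2l.
 - by rewrite lerD2r sv.
 have k2 : enorm (D i (c + s *: w) (v - w) - D i c (v - w)) <= Q * enorm (v - w) * l.
 by apply: (le_trans h2); apply: ler_wpM2l => //; rewrite mulr_ge0.
 rewrite gen2; letr (enormD _ _); apply: (le_trans (lerD k1 k2)).
 rewrite !expr1.
 have x0 : 0 <= l * enorm (v - w) by pos.
 have y0 : 0 <= l * l `^ al * enorm (a - c) by pos.
 via (2 * Q * (l * enorm (v - w) + l * l `^ al * enorm (a - c))).
 have : 0 <= Q * (l * l `^ al * enorm (a - c)) by pos.
 by move: (enorm (v - w)) (enorm (a - c)) (l `^ al) => *; nra.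
 by apply: ler_wpM2r; [rewrite addr_ge0|move: Q1; nra].
Qed.

End SchemeFieldsOfLip.

End Fields.

(** * Discrete sewing *)

Section SewingArithmetic.
Context {R : realType}.
Implicit Types b e c z D x y : R.

Lemma merge_arith1 b1 b2 e c z : 0 <= b1 -> 0 <= b2 -> 0 <= e -> 0 <= z ->
 b2 + (1 + e) * b1 + c * z <= b2 * (1 + 2 * e) + b1 * (1 + e) + (c + 2) * z.
Proof. by move=> *; nra. Qed.

Lemma merge_arith2 b1 b2 e c z : 0 <= b2 -> 0 <= z -> b1 <= e -> e <= 2^-1 ->
 b2 * (1 + e + b1) + ((1 + e) * b1 + (1 + e) * z) + c * z <= b2 * (1 + 2 * e) + b1 * (1 + e) + (c + 2) * z.
Proof.
move=> b20 z0 b1e e1.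
have : b2 * (1 + e + b1) <= b2 * (1 + 2 * e) by apply: ler_wpM2l => //; lra.
have : (1 + e) * z <= 2 * z by apply: ler_wpM2r => //; lra.
by lra.
Qed.

Lemma sew_arith1 x e C B : 0 <= x -> 0 <= e -> 0 <= C ->
 x * (2 + 5 * e) + 3 * (C + 2) <= B -> x * (1 + e) + (C + 2) <= B.
Proof. by move=> *; nra. Qed.

Lemma sew_arith2 x e C B : 0 <= x -> 0 <= e <= 2^-1 -> 0 <= C -> x * (2 + 5 * e) + 3 * (C + 2) <= B ->
 x * ((1 + 2 * e) + (1 + e) * (1 + e)) + (C + 2) * (2 + e) <= B.
Proof.
move=> x0 /andP[e0 e1] C0; apply: le_trans; apply: lerD.
 by apply: ler_wpM2l => //; nra.
by nra.
Qed.

End SewingArithmetic.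

Section Sewing.
Context {R : realType} {d : nat}.
Local Notation E := 'rV[R]_d.
Variables (n : nat) (W : nat -> R) (F : nat -> nat -> E -> E).
Variables (zeta C B e : R).

Definition om i j := W j - W i.
Definition zz i j := om i j `^ zeta.
Definition step i j (a : E) := a + F i j a.

Hypotheses (Wmono : forall i j, (i <= j <= n)%N -> W i <= W j) (zeta0 : 0 <= zeta)
 (C0 : 0 <= C) (B0 : 0 <= B) (e01 : 0 <= e <= 2^-1).
Hypothesis F0 : forall i a, (i <= n)%N -> F i i a = 0.
Hypothesis FL : forall i j a b, (i <= j <= n)%N -> enorm (F i j a - F i j b) <= e * enorm (a - b).
Hypothesis F3 : forall i k j a, (i <= k <= j)%N -> (j <= n)%N ->
 enorm (step k j (step i k a) - step i j a) <= C * zz i j.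
Hypothesis F4 : forall i k j a b, (i <= k <= j)%N -> (j <= n)%N ->
 enorm (step k j (step i k a) - step i j a - (step k j (step i k b) - step i j b)) <= C * zz i j * enorm (a - b).
Hypothesis F5 : forall i k j a a' b b', (i <= k <= j)%N -> (j <= n)%N ->
 enorm (a' - a) <= B * zz i j -> enorm (b' - b) <= B * zz i j -> enorm (F k j a' - F k j a - (F k j b' - F k j b)) <=
 e * enorm (a' - a - (b' - b)) + zz i j * enorm (a - b).
Hypothesis Be : forall i j, (i <= j <= n)%N -> B * zz i j <= e.
(** Closes the induction on the number of cells: each half contributes [B] times 2 to the power
    [- zeta], the rest is the defect. It can be met when [zeta > 1] and [e] is small, see
    [sewing_constants]. *)
Hypothesis BC : 2 `^ (- zeta) * B * (2 + 5 * e) + 3 * (C + 2) <= B.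

(** Closeness is measured twice, in sup norm and as a Lipschitz bound on the error. The second part
    makes the difference of two flows proportional to the distance of their initial values. *)
Definition near_step b i j (P : E -> E) := (forall a, enorm (P a - step i j a) <= b) /\
 (forall a c, enorm (P a - step i j a - (P c - step i j c)) <= b * enorm (a - c)).

Lemma step_lip i j a b : (i <= j <= n)%N -> enorm (step i j a - step i j b) <= (1 + e) * enorm (a - b).
Proof.
move=> ij; rewrite /step.
have -> : a + F i j a - (b + F i j b) = (a - b) + (F i j a - F i j b) by rewrite opprD addrACA.
by letr (enormD _ _); rewrite mulrDl mul1r lerD2l; exact: FL.
Qed.

Lemma near_step_lip b i j P a c : (i <= j <= n)%N -> near_step b i j P ->
 enorm (P a - P c) <= (1 + e + b) * enorm (a - c).
Proof.
move=> ij [_ h].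
have -> : P a - P c = (step i j a - step i j c) + (P a - step i j a - (P c - step i j c)).
 by rewrite !opprB addrACA addrC addrCA; apply/rowP => k; rewrite !mxE; ring.
by letr (enormD _ _); rewrite mulrDl; apply: lerD; [exact: step_lip|exact: h].
Qed.

(** [Q] and then [P] are replaced by single steps. The errors are that of [Q], that of [P] pushed
    through a step, and the defect of the scheme. In the Lipschitz part a step is evaluated at two
    perturbed points, which is the purpose of [F5]. *)
Lemma merge_step b1 b2 i k j P Q : (i <= k <= j)%N -> (j <= n)%N -> 0 <= b1 -> 0 <= b2 -> b1 <= B * zz i j ->
 near_step b1 i k P -> near_step b2 k j Q ->
 near_step (b2 * (1 + 2 * e) + b1 * (1 + e) + (C + 2) * zz i j) i j (Q \o P).
Proof.
move=> ikj jn b10 b20 b1B nP nQ; have /andP[ik kj] := ikj.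
have /andP[e0 e1] := e01.
have z0 : 0 <= zz i j by pos.
have ijn : (i <= j <= n)%N by rewrite (leq_trans ik kj) jn.
have ikn : (i <= k <= n)%N by rewrite ik (leq_trans kj jn).
have kjn : (k <= j <= n)%N by rewrite kj jn.
have b1e : b1 <= e by letr b1B; exact: Be.
have [nP1 nP2] := nP; have [nQ1 nQ2] := nQ.
split=> [a|a c] /=.
 have -> : Q (P a) - step i j a = (Q (P a) - step k j (P a))
 + (step k j (P a) - step k j (step i k a)) + (step k j (step i k a) - step i j a).
 have g (x1 x2 x3 x4 : E) : x1 - x4 = (x1 - x2) + (x2 - x3) + (x3 - x4) by rowring.
 exact: g.
 letr (enormD _ _).
 apply: le_trans (merge_arith1 _ b10 b20 e0 z0).
 apply: lerD; last exact: F3.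
 letr (enormD _ _); apply: lerD; first done.
 letr (step_lip _ _ kjn); apply: ler_wpM2l; first by pos.
 done.
have gen (q1 q2 s1 s2 t1 t2 u1 u2 : E) : q1 - u1 - (q2 - u2) =
 (q1 - s1 - (q2 - s2)) + (s1 - t1 - (s2 - t2)) + (t1 - u1 - (t2 - u2)).
 by rowring.
rewrite (gen _ _ (step k j (P a)) (step k j (P c)) (step k j (step i k a)) (step k j (step i k c))).
have h1 := nQ2 (P a) (P c); have h2 := near_step_lip a c ikn nP.
have h3 := F4 a c ikj jn.
have h4 := nP2 a c; have h5 := step_lip a c ikn.
have h6 := F5 ikj jn (le_trans (nP1 a) b1B) (le_trans (nP1 c) b1B).
have D0 := enorm_ge0 (a - c).
via (b2 * (1 + e + b1) * enorm (a - c) +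
 ((1 + e) * b1 + (1 + e) * zz i j) * enorm (a - c) + C * zz i j * enorm (a - c)); last first.
 by rewrite -!mulrDl; apply: ler_wpM2r => //; exact: merge_arith2.
letr (enormD _ _); apply: lerD; last exact: h3.
letr (enormD _ _); apply: lerD.
 by letr h1; rewrite -mulrA; apply: ler_wpM2l.
have -> : step k j (P a) - step k j (step i k a) - (step k j (P c) - step k j (step i k c))
 = (P a - step i k a - (P c - step i k c)) + (F k j (P a) - F k j (step i k a) - (F k j (P c) - F k j (step i k c))).
 have g (x1 x2 x3 x4 y1 y2 y3 y4 : E) : x1 + y1 - (x2 + y2) - (x3 + y3 - (x4 + y4)) =
 (x1 - x2 - (x3 - x4)) + (y1 - y2 - (y3 - y4)).
 by rowring.
 exact: g.
letr (enormD _ _).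
have h7 : zz i j * enorm (step i k a - step i k c) <= zz i j * ((1 + e) * enorm (a - c)).
 exact: ler_wpM2l.
have h8 : e * enorm (P a - step i k a - (P c - step i k c)) <= e * (b1 * enorm (a - c)).
 exact: ler_wpM2l.
letr (lerD h4 (le_trans h6 (lerD h8 h7))).
by apply: ler_of_eq; ring.
Qed.

Lemma near_step_le b b' i j P : b <= b' -> near_step b i j P -> near_step b' i j P.
Proof.
move=> bb [h1 h2]; split=> [a|a c]; first exact: le_trans (h1 a) bb.
by letr (h2 a c); apply: ler_wpM2r.
Qed.

Lemma near_step_ext b i j P Q : P =1 Q -> near_step b i j P -> near_step b i j Q.
Proof. by move=> PQ [h1 h2]; split=> [a|a c]; rewrite -!PQ. Qed.

Fixpoint flow i k (a : E) : E := if k is k'.+1 then step (i + k') (i + k').+1 (flow i k' a) else a.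

Lemma flow_add i k l a : flow i (k + l) a = flow (i + k) l (flow i k a).
Proof. by elim: l => [|l IH]; rewrite ?addn0// addnS /= IH addnA. Qed.

Lemma near_step0 i j : near_step 0 i j (step i j).
Proof. by split=> [a|a c]; rewrite ?subrr enorm0 ?mul0r. Qed.

(** Takes the last index at which the control has not passed its half. The cell that crosses the
    half is set apart, so each of the remaining sides carries at most half. *)
Lemma om_split i k : (0 < k)%N -> (i + k <= n)%N -> exists l, [/\ (l < k)%N, om i (i + l) <= om i (i + k) / 2 &
 om (i + l.+1) (i + k) <= om i (i + k) / 2].
Proof.
move=> k0 ikn.
pose P l := (l < k)%N && (om i (i + l) <= om i (i + k) / 2).
have om0 : 0 <= om i (i + k) by rewrite subr_ge0 Wmono// leq_addr.
have P0 : P 0%N by rewrite /P k0 addn0 /om subrr divr_ge0.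
have Pk l : P l -> (l <= k)%N by move=> /andP[/ltnW].
have [l /andP[lk hl] lmax] := ex_maxnP (ex_intro P 0%N P0) Pk.
exists l; split=> //.
have [lk1|lk1] := ltnP l.+1 k; last first.
 have -> : l.+1 = k by apply/eqP; rewrite eqn_leq lk lk1.
 by rewrite /om subrr divr_ge0.
have : ~~ P l.+1 by apply/negP => /lmax; rewrite ltnn.
by rewrite /P lk1 /= -ltNge /om; lra.
Qed.

Lemma zz_half i j i' j' : (i' <= j')%N -> (j' <= n)%N -> om i' j' <= om i j / 2 -> zz i' j' <= 2 `^ (- zeta) * zz i j.
Proof.
move=> ij' jn' h.
have o' : 0 <= om i' j' by rewrite subr_ge0 Wmono// ij'.
have o : 0 <= om i j by lra.
apply: (le_trans (le_powR zeta0 o' h)).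
by rewrite powRM// mulrC powRN -powR_inv1// -powRrM mulN1r powRN.
Qed.

Lemma zz_mono i j i' j' : (i <= i')%N -> (i' <= j')%N -> (j' <= j)%N -> (j <= n)%N -> zz i' j' <= zz i j.
Proof.
move=> ii' ij' jj' jn; apply: le_powR => //.
 by rewrite subr_ge0 Wmono// ij' (leq_trans jj').
rewrite /om; apply: lerB; apply: Wmono; rewrite ?jj'//.
by rewrite ii' (leq_trans ij') ?(leq_trans jj').
Qed.

(** Strong induction on the number of cells: left half, one isolated cell, right half. Halving the
    control gains the factor 2 to the power [- zeta] on both sides, so the constant [B] is
    independent of the number of cells. *)
Lemma discrete_sewing i k : (i + k <= n)%N -> near_step (B * zz i (i + k)) i (i + k) (flow i k).
Proof.
move=> ikn.
have /andP[e0 e1] := e01.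
elim: k {-2}k (leqnn k) i ikn => [|K IH] k kK i ikn.
 move: kK ikn; rewrite leqn0 => /eqP ->; rewrite addn0 => ilen.
 apply: near_step_le (near_step_ext _ (near_step0 i i)).
 by pos.
 by move=> a; rewrite /step F0 ?addr0.
have [->|k0] := posnP k.
 apply: IH => //; by move: ikn; rewrite addn0; apply: leq_trans; rewrite leq_addr.
have [l [lk h1 h2]] := om_split k0 ikn.
have il : (i + l <= i + l.+1)%N by rewrite leq_add2l.
have lk' : (i + l.+1 <= i + k)%N by rewrite leq_add2l.
have iln : (i + l.+1 <= n)%N by exact: leq_trans lk' ikn.
have lK : (l <= K)%N by rewrite -ltnS (leq_trans lk kK).
have nl := IH l lK i (leq_trans il iln).
have nr : near_step (B * zz (i + l.+1) (i + k)) (i + l.+1) (i + k) (flow (i + l.+1) (k - l.+1)).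
 have -> : (i + k)%N = (i + l.+1 + (k - l.+1))%N by rewrite -addnA subnKC.
 apply: IH; first by rewrite leq_subLR (leq_trans kK)// addSn ltnS leq_addl.
 by rewrite -addnA subnKC.
set z : R := zz i (i + k).
have z0 : 0 <= z by pos.
have zl : zz i (i + l) <= 2 `^ (- zeta) * z by apply: zz_half; rewrite ?leq_addr ?(leq_trans il).
have zr : zz (i + l.+1) (i + k) <= 2 `^ (- zeta) * z by apply: zz_half.
have zm : zz i (i + l.+1) <= z by apply: zz_mono; rewrite ?leq_addr.
have zlm : zz i (i + l) <= zz i (i + l.+1) by apply: zz_mono; rewrite ?leq_addr.
have p0 : 0 <= 2 `^ (- zeta) :> R by [].
have BC' := BC; set r := 2 `^ (- zeta) in BC' zl zr p0.
(* The isolated cell is a step with error 0, so this first merge adds only the defect and the factor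
   [1 + e]. *)
have m1 := @merge_step (B * zz i (i + l)) 0 i (i + l) (i + l.+1) (flow i l) (step (i + l) (i + l.+1)).
have {}m1 : near_step (0 * (1 + 2 * e) + B * zz i (i + l) * (1 + e)
 + (C + 2) * zz i (i + l.+1)) i (i + l.+1) (flow i l.+1).
 apply: near_step_ext (m1 _ _ _ _ _ nl _) => //.
 - by move=> a /=; rewrite addnS.
 - by rewrite leq_addr il.
 - by pos.
 - exact: ler_wpM2l.
 - exact: near_step0.
set b1 := (X in near_step X) in m1.
have rB0 : 0 <= r * B by pos.
have b1le : b1 <= (r * B * (1 + e) + (C + 2)) * z.
 rewrite /b1 mul0r add0r [leRHS]mulrDl; apply: lerD; last first.
 by apply: ler_wpM2l => //; rewrite addr_ge0.
 have -> : r * B * (1 + e) * z = B * (r * z) * (1 + e) by ring.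
 by apply: ler_wpM2r; [lra|exact: ler_wpM2l].
have b10 : 0 <= b1 by rewrite /b1 mul0r add0r addr_ge0// !mulr_ge0 ?powR_ge0 ?addr_ge0.

have b1B : b1 <= B * z by letr b1le; apply: ler_wpM2r => //; exact: sew_arith1.
have m2 := merge_step _ ikn b10 _ b1B m1 nr.
apply: near_step_le (near_step_ext _ (m2 _ _)).
- rewrite -/z.
 have q1 : B * zz (i + l.+1) (i + k) * (1 + 2 * e) <= B * (r * z) * (1 + 2 * e).
 by apply: ler_wpM2r; [lra|exact: ler_wpM2l].
 have q2 : b1 * (1 + e) <= (r * B * (1 + e) + (C + 2)) * z * (1 + e) by apply: ler_wpM2r => //; lra.
 apply: (le_trans (lerD (lerD q1 q2) (lexx _))).
 have -> : B * (r * z) * (1 + 2 * e) + (r * B * (1 + e) + (C + 2)) * z * (1 + e) + (C + 2) * z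
 = (r * B * ((1 + 2 * e) + (1 + e) * (1 + e)) + (C + 2) * (2 + e)) * z by ring.
 by apply: ler_wpM2r => //; exact: sew_arith2.
- by move=> a /=; rewrite -flow_add subnKC.
- by rewrite leq_addr lk'.
- by pos.
Qed.

Lemma flow_lip2 i k a b : (i + k <= n)%N -> enorm (flow i k a - flow i k b) <= 2 * enorm (a - b).
Proof.
move=> ikn; have ik : (i <= i + k <= n)%N by rewrite leq_addr ikn.
letr (near_step_lip _ _ ik (discrete_sewing ikn)).
by apply: ler_wpM2r => //; have := Be ik; have /andP[e0 e1] := e01; lra.
Qed.

Lemma flow_incr_lip i k a b : (i + k <= n)%N -> enorm (flow i k a - a - (flow i k b - b)) <=
 enorm (F i (i + k) a - F i (i + k) b) + B * zz i (i + k) * enorm (a - b).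
Proof.
move=> ikn; have [_ h] := discrete_sewing ikn.
have -> : flow i k a - a - (flow i k b - b) = (F i (i + k) a - F i (i + k) b) +
 (flow i k a - step i (i + k) a - (flow i k b - step i (i + k) b)).
 rewrite /step; have g (x1 x2 x3 x4 y1 y2 : E) : x1 - x2 - (x3 - x4) = (y1 - y2) + (x1 - (x2 + y1) - (x3 - (x4 + y2))).
 by rowring.
 exact: g.
by letr (enormD _ _); rewrite lerD2l.
Qed.

(** Lady Windermere's fan: every local error of [y] is carried to the end by a flow with Lipschitz
    constant 2. *)
Lemma flow_telescope (y : nat -> E) i k : (i + k <= n)%N -> enorm (y (i + k)%N - flow i k (y i)) <=
 2 * \sum_(i <= l < i + k) enorm (y l.+1 - step l l.+1 (y l)).
Proof.
elim: k i => [|k IH] i ikn; first by rewrite addn0 subrr enorm0 big_geq// mulr0.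
rewrite big_ltn ?addnS ?leq_addr// -addSn mulrDr.
have flS a : flow i k.+1 a = flow i.+1 k (step i i.+1 a) by rewrite -(add1n k) flow_add /= !addn0 addn1.
rewrite flS [leRHS]addrC; letr (enorm_triangle _ (flow i.+1 k (y i.+1)) _).
by apply: lerD; [apply: IH|apply: flow_lip2]; rewrite addSn -addnS.
Qed.

End Sewing.

(** * The Euler step and its defect under concatenation *)

Section EulerStep.
Context {R : realType} {d m : nat}.
Local Notation E := 'rV[R]_d.

(** Common shape of a step, of a difference of steps and of the defect, so that one norm estimate
    serves all three. *)
Definition fcomb (dt : R) (x1 : 'rV[R]_m) (x2 : 'M[R]_m) (B : E) (S : 'I_m -> E) (V : 'I_m -> 'I_m -> E) : E :=
 dt *: B + \sum_i x1 0 i *: S i + \sum_l \sum_i x2 l i *: V l i.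

Lemma fcombB dt x1 x2 B S V B' S' V' : fcomb dt x1 x2 B S V - fcomb dt x1 x2 B' S' V' =
 fcomb dt x1 x2 (B - B') (fun i => S i - S' i) (fun l i => V l i - V' l i).
Proof.
rewrite /fcomb scalerBr.
under [in RHS]eq_bigr do rewrite scalerBr.
rewrite sumrB.
under [X in _ = _ + X]eq_bigr do (under eq_bigr do rewrite scalerBr; rewrite sumrB).
by rewrite sumrB !opprD addrACA (addrACA (dt *: B)).
Qed.

Lemma enorm_fcomb dt x1 x2 B S V (u v u' : R) : enorm B <= u ->
 (forall i, enorm (S i) <= v) -> (forall l i, enorm (V l i) <= u') -> 0 <= v -> 0 <= u' ->
 enorm (fcomb dt x1 x2 B S V) <= `|dt| * u + m%:R * (`|x1| * v) + m%:R ^+ 2 * (`|x2| * u').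
Proof.
move=> Bu Sv Vu v0 u0; letr (enormD _ _); apply: lerD.
 letr (enormD _ _); apply: lerD.
 by rewrite enormZ; exact: ler_wpM2l.
 letr (enorm_sum _ _ _).
 via (\sum_(i < m) `|x1| * v).
 by apply: ler_sum => i _; rewrite enormZ; apply: ler_pM => //; exact: mx_norm_ge.
 by rewrite sumr_const card_ord [leRHS]mulr_natl.
letr (enorm_sum _ _ _).
via (\sum_(l < m) \sum_(i < m) `|x2| * u').
 apply: ler_sum => l _; letr (enorm_sum _ _ _).
 by apply: ler_sum => i _; rewrite enormZ; apply: ler_pM => //; exact: mx_norm_ge.
by rewrite !sumr_const card_ord expr2 -mulrA !mulr_natl.
Qed.

Variables (N : nat) (al K : R) (b : E -> E) (sg : 'I_m -> E -> E)
 (L : 'I_m -> E -> E -> E) (ta : 'I_m -> 'I_m -> E -> E).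
Hypotheses (N12 : N = 1%N \/ N = 2%N) (K0 : 0 <= K) (al0 : 0 < al) (al1 : al <= 1).
Hypothesis sf : scheme_fields N al K b sg L ta.

Definition euler (dt : R) (x1 : 'rV[R]_m) (x2 : 'M[R]_m) (a : E) := fcomb dt x1 x2 (b a) (sg ^~ a) (fun l i => ta l i a).

Lemma euler_bounded dt x1 x2 a : enorm (euler dt x1 x2 a) <= K * (`|dt| + m%:R * `|x1| + m%:R ^+ 2 * `|x2|).
Proof.
letr (@enorm_fcomb _ _ _ _ _ _ K K K _ _ _ _ _) => //.
- by case: (sf_b sf).
- by move=> i; case: (sf_sg sf i).
- by move=> l i; case: (sf_ta sf l i).
- lra.
Qed.

Lemma euler_lip dt x1 x2 a c : enorm (euler dt x1 x2 a - euler dt x1 x2 c) <=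
 K * (`|dt| + m%:R * `|x1| + m%:R ^+ 2 * `|x2|) * enorm (a - c).
Proof.
rewrite fcombB; letr (@enorm_fcomb _ _ _ _ _ _ (K * enorm (a - c)) (K * enorm (a - c)) (K * enorm (a - c)) _ _ _ _ _).
- by case: (sf_b sf).
- by move=> i; case: (sf_sg sf i).
- by move=> l i; case: (sf_ta sf l i).
- by pos.
- by pos.
- lra.
Qed.
Let C1 := K * (1 + m%:R) ^+ 2.
Let m0 : 0 <= m%:R :> R. Proof. by []. Qed.
Let C10 : 0 <= C1. Proof. by pos. Qed.

(** The number [l] is a length at which all parts of the increment have their homogeneous size; the
    last clause lets one step move a point by at most [l]. *)
Definition scaled (l dt : R) (x1 : 'rV[R]_m) (x2 : 'M[R]_m) := [/\ `|dt| <= l ^+ N, `|x1| <= l, `|x2| <= l ^+ N, l <= 1 &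
 K * (`|dt| + m%:R * `|x1| + m%:R ^+ 2 * `|x2|) <= l].

Lemma scaled_ge0 l dt x1 x2 : scaled l dt x1 x2 -> 0 <= l.
Proof. by case=> _ h _ _ _; exact: le_trans (normr_ge0 _) h. Qed.

(* The first-order terms cancel by Chen's relation, only the remainders of the
   fields and the products of order at least N + 1 survive. *)
Lemma euler_defectE (dt dt' : R) (x1 x1' : 'rV[R]_m) (x2 x2' x2'' : 'M[R]_m) (a : E) :
 (forall l i, x2'' l i *: ta l i a = (x2 l i + x2' l i + x1 0 l * x1' 0 i) *: ta l i a) -> let v := euler dt x1 x2 a in
 a + v + euler dt' x1' x2' (a + v) - (a + euler (dt + dt') (x1 + x1') x2'' a) = fcomb dt' x1' x2' (b (a + v) - b a)
 (fun i => sg i (a + v) - sg i a - L i a v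
 + L i a (fcomb dt x1 x2 (b a) (fun=> 0) (fun l i => ta l i a))) (fun l i => ta l i (a + v) - ta l i a).
Proof.
move=> chen v.
have L0 i c : L i c 0 = 0.
 have := sf_L sf i c 0 0 1; rewrite scaler0 addr0 scale1r => h.
 by apply: (addrI (L i c 0)); rewrite -h addr0.
have LD i c u w : L i c (u + w) = L i c u + L i c w by have := sf_L sf i c u w 1; rewrite !scale1r.
have LZ i c u k : L i c (k *: u) = k *: L i c u by have := sf_L sf i c u 0 k; rewrite L0 !addr0.
have Lsum i c (F : 'I_m -> E) : L i c (\sum_l F l) = \sum_l L i c (F l).
 by elim/big_rec2 : _ => [|j x y _ <-]; rewrite ?L0// LD.
set q := fcomb dt x1 x2 (b a) (fun=> 0) (fun l i => ta l i a).
have Lv i : L i a v = L i a q + \sum_l x1 0 l *: ta l i a.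
 have -> : v = q + \sum_l x1 0 l *: sg l a.
 have z0 : \sum_j x1 0 j *: (0 : E) = 0 by apply: big1 => j _; rewrite scaler0.
 by rewrite /v /euler /q /fcomb z0 addr0 addrAC.
 by rewrite LD Lsum; congr (_ + _); apply: eq_bigr => l _; rewrite LZ (sf_taE sf).
have -> : a + v + euler dt' x1' x2' (a + v) - (a + euler (dt + dt') (x1 + x1') x2'' a) =
 v + euler dt' x1' x2' (a + v) - euler (dt + dt') (x1 + x1') x2'' a.
 by move: (euler _ _ _ _) (euler _ _ _ _) => y1 y2; apply/rowP => k; rewrite !mxE; ring.
have eqn : euler (dt + dt') (x1 + x1') x2'' a = v + euler dt' x1' x2' a + \sum_i x1' 0 i *: (\sum_l x1 0 l *: ta l i a).
 rewrite /euler {1}/fcomb.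
 have -> : \sum_l \sum_i x2'' l i *: ta l i a = \sum_l \sum_i x2 l i *: ta l i a + \sum_l \sum_i x2' l i *: ta l i a
 + \sum_i x1' 0 i *: (\sum_l x1 0 l *: ta l i a).
 have -> : \sum_i x1' 0 i *: (\sum_l x1 0 l *: ta l i a) = \sum_l \sum_i (x1 0 l * x1' 0 i) *: ta l i a.
 rewrite exchange_big /=; apply: eq_bigr => i _; rewrite scaler_sumr.
 by apply: eq_bigr => l _; rewrite scalerA mulrC.
 rewrite -!big_split /=; apply: eq_bigr => l _.
 by rewrite -!big_split /=; apply: eq_bigr => i _; rewrite chen !scalerDl.
 have -> : \sum_i (x1 + x1') 0 i *: sg i a = \sum_i x1 0 i *: sg i a + \sum_i x1' 0 i *: sg i a.
 by rewrite -big_split; apply: eq_bigr => i _; rewrite mxE scalerDl.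
 rewrite scalerDl /v /euler /fcomb.
 move: (\sum_i x1 0 i *: sg i a) (\sum_i x1' 0 i *: sg i a)
 (\sum_l \sum_i x2 l i *: ta l i a) (\sum_l \sum_i x2' l i *: ta l i a)
 (\sum_i x1' 0 i *: _) (dt *: b a) (dt' *: b a) => y1 y2 y3 y4 y5 y6 y7.
 by rowring.
rewrite eqn opprD addrA opprD addrA (addrAC v) subrr add0r fcombB.
rewrite /fcomb -!addrA; congr (_ + _); rewrite addrC -addrA [RHS]addrC; congr (_ + _).
rewrite -sumrN -big_split /=; apply: eq_bigr => i _.
have g (k : R) (y1 y2 y3 : E) : - (k *: y2) + k *: y1 = k *: (y1 - (y3 + y2) + y3).
 by rowring.
by rewrite Lv; exact: g.
Qed.
Let C3 := 2 * K * (1 + m%:R + m%:R ^+ 2 + m%:R * C1).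

Section Defect.
Variables (l dt dt' : R) (x1 x1' : 'rV[R]_m) (x2 x2' x2'' : 'M[R]_m).
Hypotheses (sc : scaled l dt x1 x2) (sc' : scaled l dt' x1' x2').
Hypothesis chen : forall a i j, x2'' i j *: ta i j a = (x2 i j + x2' i j + x1 0 i * x1' 0 j) *: ta i j a.
Let l0 : 0 <= l := scaled_ge0 sc.
Let l1 : l <= 1. Proof. by case: sc. Qed.
Let q a := fcomb dt x1 x2 (b a) (fun=> 0) (fun l i => ta l i a).
Let v a := euler dt x1 x2 a.
Let defect a := a + v a + euler dt' x1' x2' (a + v a) - (a + euler (dt + dt') (x1 + x1') x2'' a).
Let z := l ^+ N * l `^ al.

Lemma defect_vl a : enorm (v a) <= l.
Proof. by case: sc => _ _ _ _; exact: le_trans (euler_bounded _ _ _ _). Qed.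

Lemma defect_v4 a c : enorm (v a - v c) <= l * enorm (a - c).
Proof.
letr (euler_lip _ _ _ _ _); apply: ler_wpM2r => //.
by case: sc.
Qed.

Lemma defect_q a : enorm (q a) <= C1 * l ^+ N.
Proof.
have [h1 h2 h3 _ _] := sc.
letr (@enorm_fcomb _ _ _ _ _ _ K 0 K _ _ _ _ _) => //.
- by case: (sf_b sf).
- by move=> i; rewrite enorm0.
- by move=> k i; case: (sf_ta sf k i).
rewrite mulr0 mulr0 addr0.
via (l ^+ N * K + m%:R ^+ 2 * (l ^+ N * K)).
 apply: lerD; first exact: ler_wpM2r.
 by apply: ler_wpM2l; [done|exact: ler_wpM2r].
have : 0 <= m%:R * (l ^+ N * K) by pos.
rewrite /C1; move: (l ^+ N) => L'; nra.
Qed.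

Lemma defect_q4 a c : enorm (q a - q c) <= C1 * l ^+ N * enorm (a - c).
Proof.
have [h1 h2 h3 _ _] := sc.
have KD : 0 <= K * enorm (a - c) by pos.
rewrite /q fcombB; letr (@enorm_fcomb _ _ _ _ _ _ (K * enorm (a - c)) 0 (K * enorm (a - c)) _ _ _ _ _) => //.
- by case: (sf_b sf).
- by move=> i; rewrite subrr enorm0.
- by move=> k i; case: (sf_ta sf k i).
rewrite mulr0 mulr0 addr0.
via (l ^+ N * (K * enorm (a - c)) + m%:R ^+ 2 * (l ^+ N * (K * enorm (a - c)))).
 apply: lerD; first exact: ler_wpM2r.
 by apply: ler_wpM2l; [done|exact: ler_wpM2r].
have : 0 <= m%:R * (l ^+ N * (K * enorm (a - c))) by pos.
rewrite /C1; move: (l ^+ N) (enorm (a - c)) => L' D; nra.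
Qed.

Lemma zE : l * l ^+ N <= z.
Proof.
rewrite mulrC /z; apply: ler_wpM2l; first exact: exprn_ge0.
by apply: id_le_powR; rewrite ?(ltW al0)// l0.
Qed.

(** Every surviving term has order at least [N + 1] in [l]. The weaker order [N + al] is stated so
    as to match [euler_defect4], where the Hoelder exponent is really met. *)
Lemma euler_defect a : enorm (defect a) <= C3 * z.
Proof.
have [h1 h2 h3 _ _] := sc'.
rewrite /defect /v euler_defectE//.
have vl := defect_vl a; rewrite /v in vl.
have xl : a + euler dt x1 x2 a - a = euler dt x1 x2 a by rewrite addrC addKr.
have lN0 : 0 <= l ^+ N by pos.
letr (@enorm_fcomb _ _ _ _ _ _ (K * l) (K * l ^+ N + K * (C1 * l ^+ N)) (K * l) _ _ _ _ _).
- have [_ h _] := sf_b sf; letr (h _ _).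
 by rewrite xl; exact: ler_wpM2l.
- move=> i; letr (enormD _ _); apply: lerD; first exact: (sf_rem sf).
 by letr (sf_Lbnd sf _ _ _); apply: ler_wpM2l => //; exact: defect_q.
- move=> k i; have [_ h _] := sf_ta sf k i; letr (h _ _).
 by rewrite xl; exact: ler_wpM2l.
- by pos.
- by pos.
have g1 : `|dt'| * (K * l) <= K * z.
 rewrite mulrCA; apply: ler_wpM2l => //; apply: le_trans zE.
 by rewrite mulrC; exact: ler_wpM2l.
have g2 : `|x1'| * (K * l ^+ N + K * (C1 * l ^+ N)) <= K * (1 + C1) * z.
 have -> : `|x1'| * (K * l ^+ N + K * (C1 * l ^+ N)) = K * (1 + C1) * (`|x1'| * l ^+ N) by ring.
 apply: ler_wpM2l; first by pos.
 by apply: le_trans zE; exact: ler_wpM2r.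
have g3 : `|x2'| * (K * l) <= K * z.
 rewrite mulrCA; apply: ler_wpM2l => //; apply: le_trans zE.
 by rewrite mulrC; exact: ler_wpM2l.
letr (lerD (lerD g1 (ler_wpM2l m0 g2)) (ler_wpM2l (exprn_ge0 2 m0) g3)).
have : 0 <= K * z by pos.
have : 0 <= K * C1 * z by pos.
rewrite /C3; move: m0 C10; move: C1 (m%:R) => c n n0 c0 h4 h5.
have -> : K * z + n * (K * (1 + c) * z) + n ^+ 2 * (K * z) = (1 + n + n ^+ 2 + n * c) * (K * z) by ring.
have -> : 2 * K * (1 + n + n ^+ 2 + n * c) * z = 2 * ((1 + n + n ^+ 2 + n * c) * (K * z)) by ring.
by rewrite ler_peMl ?ler1n// mulr_ge0// !addr_ge0 ?mulr_ge0.
Qed.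

(** The terms of [euler_defectE] are compared at two starting points: [four] treats the fields moved
    by the first step, [sf_rem4] the Taylor remainders. *)
Lemma euler_defect4 a c : enorm (defect a - defect c) <= C3 * z * enorm (a - c).
Proof.
have [h1 h2 h3 _ _] := sc'.
rewrite /defect /v !euler_defectE// fcombB.
have vl := defect_vl a; rewrite /v in vl.
have vl' := defect_vl c; rewrite /v in vl'.
have v4 := defect_v4 a c; rewrite /v in v4.
have xl e : e + euler dt x1 x2 e - e = euler dt x1 x2 e by rewrite addrC addKr.
set D := enorm (a - c) in v4 *; have D0 : 0 <= D by pos.
have lN0 : 0 <= l ^+ N by pos.
have lla : l <= l `^ al by apply: id_le_powR; rewrite ?(ltW al0)// l0.
have four f : smooth_field K al f -> enorm (f (a + euler dt x1 x2 a) - f a -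
 (f (c + euler dt x1 x2 c) - f c)) <= 2 * K * (l `^ al * D).
 case=> _ _ h; letr (h _ _ _ _ l _ _ _) => //; rewrite ?xl//.
 rewrite -/D (mulrC 2) -mulrA; apply: ler_wpM2l => //.
 rewrite mulr_natl mulr2n lerD2r; letr v4; exact: ler_wpM2r.
have lNE : l ^+ N.-1 * l = l ^+ N by case: N12 => ->; rewrite /= ?mul1r// -expr2.
letr (@enorm_fcomb _ _ _ _ _ _ (2 * K * (l `^ al * D))
 (2 * K * (l ^+ N.-1 * l `^ al * D) + 2 * K * (C1 * l ^+ N * D)) (2 * K * (l `^ al * D)) _ _ _ _ _).
- exact: four (sf_b sf).
- move=> i.
 have g (y1 y2 y3 y4 : E) : y1 + y2 - (y3 + y4) = (y1 - y3) + (y2 - y4) by rewrite opprD addrACA.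
 rewrite g; letr (enormD _ _); apply: lerD.
 letr (sf_rem4 sf i a c l1 vl vl').
 have -> : 2 * K * (l ^+ N.-1 * l `^ al * D) = K * (l ^+ N.-1 * (l `^ al * D) + l ^+ N.-1 * l `^ al * D) by ring.
 apply: ler_wpM2l => //.
 rewrite lerD2r; apply: ler_wpM2l; first exact: exprn_ge0.
 by letr v4; exact: ler_wpM2r.
 set qa := fcomb _ _ _ _ _ _; set qc := fcomb _ _ _ (b c) _ _.
 have LB u w : L i a (u - w) = L i a u - L i a w.
 have := sf_L sf i a w u (-1); rewrite !scaleN1r addrC => ->.
 by rewrite addrC.
 have -> : L i a qa - L i c qc = L i a (qa - qc) + (L i a qc - L i c qc) by rewrite LB addrA subrK.
 letr (enormD _ _).
 have k1 : enorm (L i a (qa - qc)) <= K * (C1 * l ^+ N * D).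
 by letr (sf_Lbnd sf _ _ _); apply: ler_wpM2l => //; exact: defect_q4.
 have k2 : enorm (L i a qc - L i c qc) <= K * (C1 * l ^+ N) * D.
 letr (sf_Llip sf _ _ _ _); apply: ler_wpM2r => //.
 by apply: ler_wpM2l => //; exact: defect_q.
 lra.
- by move=> k i; exact: four (sf_ta sf k i).
- by pos.
- by pos.
have KD : 0 <= 2 * K * D by pos.
have g1 : `|dt'| * (2 * K * (l `^ al * D)) <= 2 * K * D * z.
 have -> : `|dt'| * (2 * K * (l `^ al * D)) = 2 * K * D * (`|dt'| * l `^ al) by ring.
 by apply: ler_wpM2l => //; exact: ler_wpM2r.
have g3 : `|x2'| * (2 * K * (l `^ al * D)) <= 2 * K * D * z.
 have -> : `|x2'| * (2 * K * (l `^ al * D)) = 2 * K * D * (`|x2'| * l `^ al) by ring.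
 by apply: ler_wpM2l => //; exact: ler_wpM2r.
have g2 : `|x1'| * (2 * K * (l ^+ N.-1 * l `^ al * D) + 2 * K * (C1 * l ^+ N * D)) <= 2 * K * D * (1 + C1) * z.
 have -> : `|x1'| * (2 * K * (l ^+ N.-1 * l `^ al * D) + 2 * K * (C1 * l ^+ N * D)) =
 2 * K * D * (`|x1'| * (l ^+ N.-1 * l `^ al) + C1 * (`|x1'| * l ^+ N)) by ring.
 have -> : 2 * K * D * (1 + C1) * z = 2 * K * D * (z + C1 * z) by ring.
 apply: ler_wpM2l => //; apply: lerD.
 rewrite /z -lNE mulrA (mulrC (_ ^+ N.-1)); apply: ler_wpM2r => //.
 by apply: ler_wpM2r => //; exact: exprn_ge0.
 by apply: ler_wpM2l => //; apply: le_trans zE; exact: ler_wpM2r.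
letr (lerD (lerD g1 (ler_wpM2l m0 g2)) (ler_wpM2l (exprn_ge0 2 m0) g3)).
by apply: ler_of_eq; rewrite /C3; ring.
Qed.

End Defect.

Lemma euler_holder4 (l dt : R) x1 x2 a a' c c' : l <= 1 -> enorm (a' - a) <= l -> enorm (c' - c) <= l ->
 enorm (euler dt x1 x2 a' - euler dt x1 x2 a - (euler dt x1 x2 c' - euler dt x1 x2 c)) <=
 K * (`|dt| + m%:R * `|x1| + m%:R ^+ 2 * `|x2|) * enorm (a' - a - (c' - c)) + K * ((`|dt| + m%:R ^+ 2 * `|x2|) * l `^ al
 + m%:R * `|x1| * l `^ (if N == 1%N then al else 1)) * enorm (a - c).
Proof.
move=> l1 la lc; rewrite /euler !fcombB.
set e1 := if N == 1%N then al else 1.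
set D := enorm (a - c); set De := enorm (a' - a - (c' - c)).
letr (@enorm_fcomb _ _ _ _ _ _ (K * (De + l `^ al * D)) (K * (De + l `^ e1 * D)) (K * (De + l `^ al * D)) _ _ _ _ _).
- by have [_ _ h] := sf_b sf; exact: h.
- by move=> i; have [_ _ h] := sf_sg sf i; exact: h.
- by move=> k i; have [_ _ h] := sf_ta sf k i; exact: h.
- by pos.
- by pos.
- lra.
Qed.

End EulerStep.

(** * Chen's relation and the scheme along a rough path *)

Section TensorIncrements.
Context {R : realType} {m : nat}.
Implicit Types (X : R -> tens R m) (s t v : R).

Lemma tincr1 N X s t : (tincr N X s t).1 = (X t).1 - (X s).1.
Proof. by rewrite /tincr /tmul /= addrC. Qed.

Lemma trmul_row (a c : 'rV[R]_m) i j : (a^T *m c) i j = a 0 i * c 0 j.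
Proof. by rewrite mxE big_ord1 mxE. Qed.

Lemma tincr2_level1 N X s t : (N < 2)%N -> (tincr N X s t).2 = 0.
Proof. by move=> N1; rewrite /tincr /= /level2 leqNgt N1. Qed.

Lemma tincr2E N X s t : (2 <= N)%N -> (tincr N X s t).2 = (X t).2 - (X s).2 - (X s).1^T *m ((X t).1 - (X s).1).
Proof.
move=> N2; rewrite /tincr /= /level2 N2; apply/matrixP => i j.
by rewrite !mxE !big_ord1 !mxE; ring.
Qed.

Lemma tincr2_chen N X s v t i j : (tincr N X s t).2 i j = (tincr N X s v).2 i j + (tincr N X v t).2 i j +
 (if (2 <= N)%N then (tincr N X s v).1 0 i * (tincr N X v t).1 0 j else 0).
Proof.
case: (ltnP N 2) => N2.
 by rewrite !tincr2_level1// mxE !addr0.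
by rewrite !tincr1 !tincr2E// !mxE !big_ord1 !mxE; ring.
Qed.

Lemma tincr_id N X s : tincr N X s s = (0, 0).
Proof.
rewrite [LHS]surjective_pairing tincr1 subrr; congr (_, _).
case: (ltnP N 2) => N2; first by rewrite tincr2_level1.
by rewrite tincr2E// !subrr mulmx0 subr0.
Qed.

End TensorIncrements.

Section Scheme.
Context {R : realType}.

Lemma sqr_arith (M v : R) : 0 <= M * v -> v + M * v + M ^+ 2 * v <= (1 + M) ^+ 2 * v.
Proof.
move=> h; have -> : (1 + M) ^+ 2 * v = v + M * v + M ^+ 2 * v + M * v by ring.
by rewrite lerDl.
Qed.

(** In [F5] a field is moved by [B * z], which changes its derivative by the power [al] of that, and
    is multiplied by an increment of size [w ^+ N]. The result is [z] times a positive power of [w],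
    which a small scale absorbs. *)
Lemma holder_factor (N : nat) (al w B z : R) : N = 1%N \/ N = 2%N -> 0 < al -> al <= 1 ->
 0 <= w -> w <= 1 -> 0 <= B -> z = w ^+ N * w `^ al -> w ^+ N * (B * z) `^ al <= (B + 1) * w `^ (al * al) * z.
Proof.
move=> N12 al0 al1 w0 w1 B0 zE; have a0 := ltW al0.
have wN0 : 0 <= w ^+ N by pos.
have z0 : 0 <= z by rewrite zE mulr_ge0.
have Bal : B `^ al <= B + 1.
 have [B1|B1] := leP B 1.
 by letr (powR_le1 a0 _); rewrite ?B0// lerDr.
 by letr (ler1_powR (ltW B1) al1); rewrite lerDl.
have wNal : (w ^+ N) `^ al <= w `^ al.
 apply: le_powR => //.
 by case: N12 => ->; rewrite ?expr1// expr2 ler_piMl.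
have -> : (B * z) `^ al = B `^ al * ((w ^+ N) `^ al * w `^ (al * al)) by rewrite powRM// zE powRM// -powRrM.
have h : B `^ al * ((w ^+ N) `^ al * w `^ (al * al)) <= (B + 1) * (w `^ al * w `^ (al * al)).
 apply: ler_pM => //; first by pos.
 exact: ler_wpM2r.
letr (ler_wpM2l wN0 h).
by apply: ler_of_eq; rewrite zE; ring.
Qed.

Lemma holder_sum (k M dt x1 x2 P Q G H : R) : 0 <= k -> 0 <= M -> 0 <= G -> 0 <= H ->
 dt * P <= G -> x2 * P <= G -> x1 * Q <= G + H ->
 k * ((dt + M ^+ 2 * x2) * P + M * x1 * Q) <= k * (1 + M) ^+ 2 * G + k * (1 + M) ^+ 2 * H.
Proof.
move=> k0 M0 G0 H0 h1 h2 h3.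
rewrite -mulrDr -[leRHS]mulrA; apply: ler_wpM2l => //.
have k2 := ler_wpM2l (exprn_ge0 2 M0) h2; have k3 := ler_wpM2l M0 h3.
have : 0 <= M * G by pos.
have : 0 <= M * H by pos.
have : 0 <= M ^+ 2 * H by pos.
have -> : (1 + M) ^+ 2 * (G + H) = G + M ^+ 2 * G + M * (G + H) + M * G + M * H + H + M ^+ 2 * H by ring.
have -> : (dt + M ^+ 2 * x2) * P + M * x1 * Q = dt * P + M ^+ 2 * (x2 * P) + M * (x1 * Q) by ring.
move: (M ^+ 2 * (x2 * P)) (M * (x1 * Q)) (dt * P) (M ^+ 2 * G) (M * (G + H)) (M * G) (M * H)
 (M ^+ 2 * H) h1 k2 k3 => *; lra.
Qed.

Lemma small_scale (e A B c1 al q zeta : R) : 0 < e -> 0 < A -> 0 <= B -> 0 <= c1 -> 0 < al -> 0 < q -> 0 < zeta ->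
 exists2 del : R, 0 < del & forall o : R, 0 <= o -> o <= del -> [/\ o <= 1, A * o `^ q^-1 <= e, B * o `^ zeta <= e,
 c1 * (B + 1) * (o `^ q^-1) `^ (al * al) <= 2^-1 & c1 * B * o `^ q^-1 <= 2^-1].
Proof.
move=> e0 A0 B0 c0 al0 q0 z0; have q10 : 0 < q^-1 by pos.
have [r1 r10 h1] := powR_small q10 (divr_gt0 e0 A0).
have B10 : 0 < B + 1 by pos.
have h20 : 0 < 2^-1 :> R by [].
have [r2 r20 h2] := powR_small z0 (divr_gt0 e0 B10).
have cB : 0 < c1 * (B + 1) + 1 by pos.
have [r3 r30 h3] := powR_small (mulr_gt0 q10 (mulr_gt0 al0 al0)) (divr_gt0 h20 cB).
have [r4 r40 h4] := powR_small q10 (divr_gt0 h20 cB).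
exists (Num.min 1 (Num.min (Num.min r1 r2) (Num.min r3 r4))).
 by rewrite !lt_min ltr01 r10 r20 r30 r40.
move=> x x0; rewrite !le_min => /and3P[x1 /andP[xr1 xr2] /andP[xr3 xr4]]; split => //.
- rewrite mulrC -ler_pdivlMr//; apply: h1; by rewrite x0.
- via ((B + 1) * x `^ zeta); first by apply: ler_wpM2r; rewrite ?lerDl.
 rewrite mulrC -ler_pdivlMr//; apply: h2; by rewrite x0.
- rewrite -powRrM; via ((c1 * (B + 1) + 1) * x `^ (q^-1 * (al * al))).
 by apply: ler_wpM2r; rewrite ?lerDl.
 by rewrite mulrC -ler_pdivlMr//; apply: h3; rewrite x0.
- via ((c1 * (B + 1) + 1) * x `^ q^-1).
 by apply: ler_wpM2r => //; rewrite mulrDr mulr1 -addrA lerDl addr_ge0.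
 by rewrite mulrC -ler_pdivlMr//; apply: h4; rewrite x0.
Qed.

(** Since 2 to the power [- zeta] is below one half, the gap [D] is positive. Taking [e] as [D / 10]
    spends at most half of the gap on the perturbation [5 * e], and [B] is solved from the other
    half. *)
Lemma sewing_constants (zeta C : R) : 1 < zeta -> 0 <= C -> exists e B : R, [/\ 0 < e <= 2^-1, 0 <= B &
 2 `^ (- zeta) * B * (2 + 5 * e) + 3 * (C + 2) <= B].
Proof.
move=> z1 C0; set r := 2 `^ (- zeta).
have r0 : 0 < r by pos.
have r12 : r < 2^-1.
 rewrite /r -powR_inv1// /powR; case: eqP => [/eqP|_]; first by rewrite pnatr_eq0.
 by rewrite ltr_expR ltr_pM2r ?ltrN2// ln_gt0// ltr1n.
pose D := 1 - 2 * r; have D0 : 0 < D by rewrite /D; lra.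
exists (D / 10), (6 * (C + 2) / D).
have B0 : 0 <= 6 * (C + 2) / D by pos.
split => //; first by apply/andP; split; rewrite /D in D0 *; lra.
set B := 6 * (C + 2) / D in B0 *.
have BD : B * D = 6 * (C + 2) by rewrite /B mulfVK// gt_eqF.
have -> : r * B * (2 + 5 * (D / 10)) = B * (2 * r + D * r / 2) by field.
have h : B * (2 * r + D * r / 2) <= B * (2 * r + D / 2).
 apply: ler_wpM2l => //; rewrite lerD2l ler_pdivrMr// divfK//.
 by rewrite ler_piMr; lra.
letr (lerD h (lexx _)).
have -> : B * (2 * r + D / 2) = B - B * D / 2 by rewrite /D; field.
by rewrite BD; lra.
Qed.

Variables (m : nat) (N : nat) (K al q : R).
Hypotheses (N12 : N = 1%N \/ N = 2%N) (K0 : 0 <= K) (al0 : 0 < al) (al1 : al <= 1).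
Hypotheses (Nq : N%:R <= q) (qN : q < N%:R + al).

Definition scheme (d : nat) (b : 'rV[R]_d -> 'rV[R]_d) (sg : 'I_m -> 'rV[R]_d -> 'rV[R]_d)
 (ta : 'I_m -> 'I_m -> 'rV[R]_d -> 'rV[R]_d) (X : R -> tens R m) (s t : R) :=
 euler b sg ta (t - s) (tincr N X s t).1 (tincr N X s t).2.

Definition grid_control (X : R -> tens R m) (u W : nat -> R) n := forall i j, (i <= j <= n)%N ->
 [/\ 0 <= u j - u i <= W j - W i, `|(tincr N X (u i) (u j)).1| <= (W j - W i) `^ q^-1 &
 `|(tincr N X (u i) (u j)).2| <= (W j - W i) `^ (2 / q)].

(** At scales below [del] the scheme meets all hypotheses of the sewing section. The constants
    depend neither on the rough path nor on the grid, the fields or [d], so the bounds survive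
    refinement and limits. *)
Theorem scheme_bounds : exists del B : R, [/\ 0 < del, 0 <= B &
 forall d b sg L ta, @scheme_fields R d m N al K b sg L ta ->
 forall X n (u W : nat -> R), grid_control X u W n -> W n - W 0%N <= del -> let F i j := scheme b sg ta X (u i) (u j) in
 let z := zz W ((N%:R + al) / q) in [/\ forall i k a, (i + k <= n)%N ->
 enorm (flow F i k a - (a + F i (i + k)%N a)) <= B * z i (i + k)%N, forall i k a c, (i + k <= n)%N ->
 enorm (flow F i k a - flow F i k c) <= 2 * enorm (a - c), forall i k a c, (i + k <= n)%N ->
 enorm (flow F i k a - a - (flow F i k c - c)) <=
 enorm (F i (i + k)%N a - F i (i + k)%N c) + B * z i (i + k)%N * enorm (a - c) &
 forall (y : nat -> 'rV[R]_d) i k, (i + k <= n)%N -> enorm (y (i + k)%N - flow F i k (y i)) <=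
 2 * \sum_(i <= l < i + k) enorm (y l.+1 - (y l + F l l.+1 (y l)))]].
Proof.
have q0 : 0 < q by apply: lt_le_trans Nq; case: N12 => ->.
have q10 : 0 < q^-1 by pos.
pose zeta := (N%:R + al) / q.
have z1 : 1 < zeta by rewrite /zeta ltr_pdivlMr// mul1r.
pose C1 := K * (1 + m%:R) ^+ 2; have C10 : 0 <= C1 by pos.
pose C3 := 2 * K * (1 + m%:R + m%:R ^+ 2 + m%:R * C1).
pose A := 1 + C1; have A1 : 1 <= A by rewrite lerDl.
have A0 : 0 < A by pos.
pose C := C3 * (A ^+ N * A `^ al).
have C0 : 0 <= C by pos.
have [e [B [e01 B0 BC]]] := sewing_constants z1 C0.
have /andP[e0 e12] := e01.
have [del del0 hdel] := small_scale e0 A0 B0 C10 al0 q0 (lt_trans ltr01 z1).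
exists del, B; split=> // d b sg L ta sf X n u W uW Wdel F z.
pose x1 i j := (tincr N X (u i) (u j)).1; pose x2 i j := (tincr N X (u i) (u j)).2.
have Wmono i j : (i <= j <= n)%N -> W i <= W j by move=> /uW[/andP[h1 h2] _ _]; rewrite -subr_ge0; exact: le_trans h2.
have omd i j : (i <= j <= n)%N -> 0 <= W j - W i <= del.
 move=> ijn; have /andP[ij jn] := ijn; rewrite subr_ge0 Wmono//=.
 apply: le_trans Wdel; apply: lerB; apply: Wmono; first by rewrite jn leqnn.
 by rewrite leq0n (leq_trans ij jn).
pose w i j := (W j - W i) `^ q^-1.
have w0 i j : 0 <= w i j by pos.
have e1 : e <= 1 by letr e12; lra.
have w1 i j : (i <= j <= n)%N -> A * w i j <= e by move=> /omd /andP[h1 h2]; have [_ h _ _ _] := hdel _ h1 h2.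
have w11 i j : (i <= j <= n)%N -> w i j <= 1.
 move=> ij; apply: le_trans e1; apply: le_trans (w1 i j ij).
 by rewrite ler_peMl.
have ux2 i j : (i <= j <= n)%N -> `|x2 i j| <= w i j ^+ N.
 move=> ij; have [_ _ h] := uW i j ij.
 have := h; rewrite [2 / q]mulrC powRrM -/(w i j) => {}h.
 case: N12 => NN; last by rewrite [X in _ ^+ X]NN -powR_mulrn// w0.
 by rewrite /x2 tincr2_level1 ?NN// normr0 exprn_ge0.
have udt i j : (i <= j <= n)%N -> `|u j - u i| <= w i j ^+ N.
 move=> ij; have [/andP[h1 h2] _ _] := uW i j ij; rewrite ger0_norm//.
 apply: (le_trans h2); have /andP[p0 pd] := omd i j ij.
 rewrite -powR_mulrn// /w -powRrM.
 rewrite -[leLHS]powRr1//; have [->|pn0] := eqVneq (W j - W i) 0.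
 by rewrite powR0// powR_ge0.
 apply: ger_powR; first by have [h3 _ _ _ _] := hdel _ p0 pd; rewrite h3 andbT lt_neqAle eq_sym pn0.
 by rewrite mulrC ler_pdivrMr// mul1r.
have ux1 i j : (i <= j <= n)%N -> `|x1 i j| <= w i j by move=> ij; have [_ h _] := uW i j ij.
have wN i j : (i <= j <= n)%N -> w i j ^+ N <= w i j.
 by move=> ij; case: N12 => ->; rewrite ?expr1// expr2 ler_piMl// w11.
have Klip i j : (i <= j <= n)%N -> K * (`|u j - u i| + m%:R * `|x1 i j|
 + m%:R ^+ 2 * `|x2 i j|) <= C1 * w i j.
 move=> ij; rewrite /C1 -mulrA; apply: ler_wpM2l => //.
 have h1 := le_trans (udt i j ij) (wN i j ij); have h2 := ux1 i j ij.
 have h3 := le_trans (ux2 i j ij) (wN i j ij).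
 have m0 : 0 <= m%:R :> R by [].
 letr (lerD (lerD h1 (ler_wpM2l m0 h2)) (ler_wpM2l (exprn_ge0 2 m0) h3)).
 have : 0 <= m%:R * w i j by pos.
 exact: sqr_arith.
have Aw i j : (i <= j <= n)%N -> C1 * w i j <= A * w i j by move=> ij; apply: ler_wpM2r => //; rewrite /A lerDr.
have wm i j i' j' : (i <= i')%N -> (i' <= j')%N -> (j' <= j)%N -> (j <= n)%N -> w i' j' <= w i j.
 move=> ii' ij' jj' jn; apply: le_powR; first exact: ltW.
 by have /andP[] := omd i' j' (introT andP (conj ij' (leq_trans jj' jn))).
 apply: lerB; apply: Wmono; first by rewrite jj' jn.
 by rewrite ii' (leq_trans ij') ?(leq_trans jj').
have sc i j i' j' : (i <= i')%N -> (i' <= j')%N -> (j' <= j)%N -> (j <= n)%N ->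
 scaled N K (A * w i j) (u j' - u i') (x1 i' j') (x2 i' j').
 move=> ii' ij' jj' jn; have ij'n : (i' <= j' <= n)%N by rewrite ij' (leq_trans jj' jn).
 have ijn : (i <= j <= n)%N by rewrite jn andbT (leq_trans ii') ?(leq_trans ij').
 have ww := wm _ _ _ _ ii' ij' jj' jn.
 have wA : w i' j' <= A * w i j by letr ww; rewrite ler_peMl.
 have wAN : w i' j' ^+ N <= (A * w i j) ^+ N by apply: lerXn2r; rewrite ?nnegrE ?mulr_ge0 ?(ltW A0).
 split.
 - exact: le_trans (udt _ _ ij'n) wAN.
 - exact: le_trans (ux1 _ _ ij'n) wA.
 - exact: le_trans (ux2 _ _ ij'n) wAN.
 - exact: le_trans (w1 _ _ ijn) e1.
 - letr (Klip _ _ ij'n); letr (Aw _ _ ij'n).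
 by apply: ler_wpM2l; [exact: ltW|].
have zE i j : (i <= j <= n)%N -> C3 * ((A * w i j) ^+ N * (A * w i j) `^ al) = C * z i j.
 move=> ij; rewrite exprMn powRM ?(ltW A0)// /z /zz /om /C.
 have -> : (W j - W i) `^ ((N%:R + al) / q) = w i j ^+ N * w i j `^ al.
 by rewrite -powR_mulrn// -powRD_ge0 ?(ltW al0)// /w -powRrM mulrC.
 by ring.
have chen i k j : (i <= k <= j)%N -> (j <= n)%N -> forall (a : 'rV[R]_d) l r, (x2 i j) l r *: ta l r a =
 ((x2 i k) l r + (x2 k j) l r
 + (x1 i k) 0 l * (x1 k j) 0 r) *: ta l r a.
 move=> ikj jn a l r; case: N12 => NN; first by rewrite (sf_ta0 sf NN) !scaler0.
 have N2 : (2 <= N)%N by rewrite NN.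
 by rewrite /x2 (tincr2_chen _ _ _ (u k)) N2.
(* Time and first level are additive, so the long step is written with sums of increments; only the
   second level needs Chen's relation. *)
have stepE i k j a : (i <= k <= j)%N -> (j <= n)%N -> step F k j (step F i k a) - step F i j a =
 a + euler b sg ta (u k - u i) (x1 i k) (x2 i k) a + euler b sg ta (u j - u k) (x1 k j) (x2 k j)
 (a + euler b sg ta (u k - u i) (x1 i k) (x2 i k) a)
 - (a + euler b sg ta (u k - u i + (u j - u k)) (x1 i k + x1 k j) (x2 i j) a).
 move=> ikj jn.
 have eF : F i j a = euler b sg ta (u k - u i + (u j - u k)) (x1 i k + x1 k j) (x2 i j) a.
 have e1' : u k - u i + (u j - u k) = u j - u i by lra.
 have e2' : x1 i k + x1 k j = x1 i j.
 by rewrite /x1 !tincr1 addrC subrKA.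
 by rewrite e1' e2'.
 by rewrite /step eF.
have zeta0 : 0 <= zeta by pos.
have Fzero i a : (i <= n)%N -> F i i a = 0.
 move=> _; rewrite /F /scheme tincr_id subrr /euler /fcomb scale0r add0r.
 rewrite big1 ?add0r => [|j _]; last by rewrite mxE scale0r.
 by rewrite big1// => j _; rewrite big1// => k _; rewrite mxE scale0r.
have FL i j a c : (i <= j <= n)%N -> enorm (F i j a - F i j c) <= e * enorm (a - c).
 move=> ij; letr (euler_lip K0 sf _ _ _ _ _); apply: ler_wpM2r => //.
 by letr (Klip _ _ ij); letr (Aw _ _ ij); exact: w1.
have F3 i k j a : (i <= k <= j)%N -> (j <= n)%N -> enorm (step F k j (step F i k a) - step F i j a) <= C * z i j.
 move=> ikj jn; rewrite stepE//; have /andP[ik kj] := ikj.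
 rewrite -zE; last by rewrite (leq_trans ik kj).
 apply: (euler_defect K0 al0 al1 sf) => //.
 - exact: sc.
 - exact: sc.
 - exact: chen.
have F4 i k j a c : (i <= k <= j)%N -> (j <= n)%N ->
 enorm (step F k j (step F i k a) - step F i j a - (step F k j (step F i k c) - step F i j c))
 <= C * z i j * enorm (a - c).
 move=> ikj jn; rewrite !stepE//; have /andP[ik kj] := ikj.
 rewrite -zE; last by rewrite (leq_trans ik kj).
 apply: (euler_defect4 N12 K0 al0 al1 sf) => //.
 - exact: sc.
 - exact: sc.
 - exact: chen.
have Be i j : (i <= j <= n)%N -> B * z i j <= e by move=> /omd /andP[h1 h2]; have [_ _ h _ _] := hdel _ h1 h2.
have F5 i k j a a' c c' : (i <= k <= j)%N -> (j <= n)%N -> enorm (a' - a) <= B * z i j -> enorm (c' - c) <= B * z i j ->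
 enorm (F k j a' - F k j a - (F k j c' - F k j c)) <= e * enorm (a' - a - (c' - c)) + z i j * enorm (a - c).
 move=> ikj jn la lc; have /andP[ik kj] := ikj.
 have ijn : (i <= j <= n)%N by rewrite (leq_trans ik kj).
 have kjn : (k <= j <= n)%N by rewrite kj.
 letr (euler_holder4 K0 sf _ _ _ (le_trans (Be _ _ ijn) e1) la lc).
 apply: lerD; apply: ler_wpM2r => //.
 by letr (Klip _ _ kjn); letr (Aw _ _ kjn); exact: w1.
 have /andP[p0 pd] := omd i j ijn; have [_ _ _ s1 s2] := hdel _ p0 pd.
 rewrite -/(w i j) in s1 s2.
 have z0 : 0 <= z i j by pos.
 have zw : z i j = w i j ^+ N * w i j `^ al.
 by rewrite /z /zz /om -powR_mulrn// -powRD_ge0 ?(ltW al0)// /w -powRrM mulrC.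
 have wkj : w k j <= w i j by apply: wm.
 have wkjN : w k j ^+ N <= w i j ^+ N by apply: lerXn2r; rewrite ?nnegrE.
 have m0 : 0 <= m%:R :> R by [].
 have g1 : w i j ^+ N * (B * z i j) `^ al <= (B + 1) * w i j `^ (al * al) * z i j.
 by apply: holder_factor => //; exact: w11.
 have G0 : 0 <= (B + 1) * w i j `^ (al * al) * z i j by pos.
 have H0 : 0 <= B * w i j * z i j by pos.
 letr (holder_sum K0 m0 G0 H0 _ _ _).
 - by apply: le_trans g1; apply: ler_wpM2r => //; exact: le_trans (udt _ _ kjn) wkjN.
 - by apply: le_trans g1; apply: ler_wpM2r => //; exact: le_trans (ux2 _ _ kjn) wkjN.
 - via (w i j * (B * z i j) `^ (if N == 1%N then al else 1)).
 by apply: ler_wpM2r; [done|exact: le_trans (ux1 _ _ kjn) wkj].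
 case: N12 => NN; rewrite NN /=.
 via ((B + 1) * w i j `^ (al * al) * z i j); last by rewrite lerDl.
 by move: g1; rewrite [X in _ ^+ X]NN expr1.
 rewrite powRr1; last by pos.
 rewrite (_ : w i j * (B * z i j) = B * w i j * z i j); last by ring.
 by rewrite lerDr.
 via (2^-1 * z i j + 2^-1 * z i j); last first.
 by rewrite -mulrDl (_ : 2^-1 + 2^-1 = 1 :> R) ?mul1r//; field.
 rewrite -/C1; apply: lerD.
 by apply: le_trans (ler_wpM2r z0 s1); apply: ler_of_eq; ring.
 by apply: le_trans (ler_wpM2r z0 s2); apply: ler_of_eq; ring.
have e02 : 0 <= e <= 2^-1 by rewrite ltW.
split.
- move=> i k a ikn.
 by have [h _] := discrete_sewing Wmono zeta0 C0 B0 e02 Fzero FL F3 F4 F5 Be BC ikn.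
- by move=> i k a c; exact: (flow_lip2 Wmono zeta0 C0 B0 e02 Fzero FL F3 F4 F5 Be BC).
- by move=> i k a c; exact: (flow_incr_lip Wmono zeta0 C0 B0 e02 Fzero FL F3 F4 F5 Be BC).
- by move=> y i k; exact: (flow_telescope Wmono zeta0 C0 B0 e02 Fzero FL F3 F4 F5 Be BC).
Qed.

End Scheme.

(** * Variation sums over grids and additive controls *)

Section Grids.
Context {R : realType}.
Implicit Types (f : R -> R -> R) (u : nat -> R) (a b s t : R).

Definition psum f u n := \sum_(0 <= k < n) f (u k) (u k.+1).

(** Points may repeat and need not start at [s] or end at [t], in contrast to [itv_partition];
    clipping, restricting and deforming grids is then harmless. *)
Definition grid s t u n := [/\ s <= u 0%N, u n <= t & forall i, (i < n)%N -> u i <= u i.+1].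

Lemma grid_mono s t u n i j : grid s t u n -> (i <= j <= n)%N -> u i <= u j.
Proof.
move=> [_ _ h] /andP[]; elim: j => [|j IH]; first by rewrite leqn0 => /eqP ->.
rewrite leq_eqVlt => /orP[/eqP -> //|ij jn].
by apply: le_trans (IH ij (ltnW jn)) (h _ jn).
Qed.

Lemma grid_in s t u n i : grid s t u n -> (i <= n)%N -> s <= u i <= t.
Proof.
move=> g iln; have [h1 h2 _] := g; apply/andP; split.
 by letr h1; apply: (grid_mono g); rewrite leq0n.
by apply: le_trans _ h2; apply: (grid_mono g); rewrite iln leqnn.
Qed.

Lemma grid_cell s t u n k : grid s t u n -> (k < n)%N -> [/\ s <= u k, u k <= u k.+1 & u k.+1 <= t].
Proof.
move=> g kn; have /andP[? _] := grid_in g (ltnW kn); have /andP[_ ?] := grid_in g kn.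
by split=> //; case: g => _ _ ->.
Qed.

Lemma grid_sub s t s' t' u n : s' <= s -> t <= t' -> grid s t u n -> grid s' t' u n.
Proof. by move=> ss tt [h1 h2 h3]; split=> //; [exact: le_trans h1|exact: le_trans h2 _]. Qed.

Definition extend u n s t k := if (k <= n)%N then u k else if k == n.+1 then s else t.

Lemma extend_le u n s t k : (k <= n)%N -> extend u n s t k = u k.
Proof. by rewrite /extend => ->. Qed.

Lemma extend1 u n s t : extend u n s t n.+1 = s.
Proof. by rewrite /extend ltnn eqxx. Qed.

Lemma extend2 u n s t : extend u n s t n.+2 = t.
Proof.
rewrite /extend eqSS (_ : (n.+2 <= n)%N = false); last first.
 by apply/negbTE; rewrite -ltnNge leqW.
by rewrite (_ : n.+1 == n = false)//; apply/negbTE; rewrite neq_ltn leqnn orbT.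
Qed.

Lemma grid_extend a u n s t : grid a s u n -> s <= t -> grid a t (extend u n s t) n.+2.
Proof.
move=> [h1 h2 h3] st; split; rewrite ?extend2//.
move=> i; rewrite ltnS leq_eqVlt => /orP[/eqP ->|]; first by rewrite extend1 extend2.
rewrite ltnS leq_eqVlt => /orP[/eqP ->|iln]; first by rewrite extend1 extend_le.
by rewrite !extend_le ?(ltnW iln)// h3.
Qed.

Lemma psum_extend f u n s t : (forall s t, 0 <= f s t) -> psum f u n + f s t <= psum f (extend u n s t) n.+2.
Proof.
move=> f0; rewrite /psum !big_nat_recr//= -addrA; apply: lerD.
 rewrite !big_nat; apply: ler_sum => k /andP[_ kn].
 by rewrite !extend_le// ltnW.
by rewrite extend1 extend2 lerDr.
Qed.

(** [W x] is the supremum of the sums over grids that end before [x]. Appending the interval from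
    [s] to [t] to a grid ending before [s] gives the bound, with a control that is the increment of
    one function. *)
Lemma control_exists f a b (M : R) : a <= b -> (forall s t, 0 <= f s t) ->
 (forall u n, grid a b u n -> psum f u n <= M) -> exists W : R -> R,
 (forall s t, a <= s -> s <= t -> t <= b -> f s t <= W t - W s) /\ W b - W a <= M.
Proof.
move=> ab f0 fM; pose P x := [set y | exists u n, grid a x u n /\ y = psum f u n].
have P0 x : a <= x -> P x 0 by move=> ax; exists (fun=> a), 0%N; split; [split|rewrite /psum big_geq].
have Pub x : x <= b -> has_ubound (P x).
 move=> xb; exists M => y [u [n [g ->]]]; apply: fM; exact: grid_sub g.
have Psup x : a <= x -> x <= b -> has_sup (P x) by move=> ax xb; split; [exists 0; exact: P0|exact: Pub].
exists (fun x => sup (P x)); split=> [s t sa st tb|].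
 rewrite lerBrDl; apply/ler_addgt0Pr => e e0.
 have [_ [u [n [g ->]]] lty] := sup_adherent e0 (Psup s sa (le_trans st tb)).
 have h : psum f u n + f s t <= sup (P t).
 letr (psum_extend _ _ _ _ f0); apply: (ub_le_sup (Pub t tb)).
 by exists (extend u n s t), n.+2; split=> //; exact: grid_extend.
 move: (sup (P s)) (sup (P t)) (psum f u n) (f s t) lty h => x1 x2 x3 x4; lra.
via (sup (P b)).
 by rewrite lerBlDr lerDl; apply: ub_le_sup; [exact: Pub|exact: P0].
apply: ge_sup; first by exists 0; exact: P0.
by move=> y [u [n [g ->]]]; exact: fM.
Qed.

Lemma psum_control f (W : R -> R) a b u n : (forall s t, a <= s -> s <= t -> t <= b -> f s t <= W t - W s) ->
 grid a b u n -> psum f u n <= W (u n) - W (u 0%N).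
Proof.
move=> fW g; rewrite -(telescope_sumr (fun k => W (u k)) (leq0n n)) /psum !big_nat.
apply: ler_sum => k /andP[_ kn].
by have [h1 h2 h3] := grid_cell g kn; exact: fW.
Qed.

Fixpoint lsum f s (v : seq R) := if v is x :: v' then f s x + lsum f x v' else 0.

Lemma lsum_nth f x0 s v : lsum f s v = \sum_(0 <= k < size v) f (nth x0 (s :: v) k) (nth x0 (s :: v) k.+1).
Proof.
elim: v s => [|x v IH] s /=; first by rewrite big_geq.
by rewrite big_nat_recl//= IH.
Qed.

Lemma psum_lsum f u n : psum f u n = lsum f (u 0%N) [seq u k | k <- iota 1 n].
Proof.
have gen k : \sum_(k <= l < k + n) f (u l) (u l.+1) = lsum f (u k) [seq u l | l <- iota k.+1 n].
 elim: n k => [|n IH] k; first by rewrite addn0 big_geq.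
 rewrite big_ltn; last by rewrite addnS ltnS leq_addr.
 by rewrite /= -IH addSnnS.
by have := gen 0%N; rewrite add0n.
Qed.

Lemma lsum_cat f s v w : lsum f s (v ++ w) = lsum f s v + lsum f (last s v) w.
Proof. by elim: v s => [|x v IH] s /=; rewrite ?add0r// IH addrA. Qed.

Lemma lsum_strict f s v : (forall s, f s s = 0) -> path <=%R s v ->
 exists D, [/\ path <%R s D, last s D = last s v & lsum f s D = lsum f s v].
Proof.
move=> f0; elim: v s => [|x v IH] s /=; first by exists [::].
move=> /andP[sx /IH[D [h1 h2 h3]]].
have [->|sxn] := eqVneq s x; first by exists D; rewrite f0 add0r.
by exists (x :: D); rewrite /= h1 h2 h3 lt_neqAle sxn sx.
Qed.

Lemma grid_path s t u n : grid s t u n -> path <=%R (u 0%N) [seq u k | k <- iota 1 n].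
Proof.
move=> [_ _ h].
have gen k : (k <= n)%N -> path <=%R (u (n - k)%N) [seq u l | l <- iota (n - k).+1 k].
 elim: k => [|k IH] kn //=.
 have e : (n - k.+1).+1 = (n - k)%N by rewrite -subSn// subSS.
 rewrite h; last by rewrite ltn_subrL (leq_trans _ kn).
 by rewrite e IH// ltnW.
by have := gen n (leqnn n); rewrite subnn.
Qed.

Lemma last_grid u n : last (u 0%N) [seq u k | k <- iota 1 n] = u n.
Proof. by case: n => [//|n]; rewrite -(addn1 n) iotaD map_cat last_cat /= add1n addn1. Qed.

(** Passes to a strictly increasing partition of the whole interval: repeated points contribute
    [f s s = 0], and the added end intervals only increase the sum. *)
Lemma pvar_psum (T p : R) (phi : R -> R -> \bar R) f (M : R) u n : 0 < T -> 0 < p -> 0 <= M ->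
 (pvar T p phi <= M%:E)%E -> (forall s t, ((f s t)%:E <= phi s t)%E) ->
 (forall s t, 0 <= f s t) -> (forall s, f s s = 0) -> grid 0 T u n -> psum (fun s t => f s t `^ p) u n <= M `^ p.
Proof.
move=> T0 p0 M0 vM fphi f0 fss g.
have [g1 g2 g3] := g.
pose fp s t := f s t `^ p.
have fp0 s : fp s s = 0 by rewrite /fp fss powR0// gt_eqF.
pose v := u 0%N :: ([seq u k | k <- iota 1 n] ++ [:: T]).
have pv : path <=%R 0 v by rewrite /v /= g1 cat_path /= andbT last_grid g2 andbT; exact: grid_path g.
have [D [h1 h2 h3]] := lsum_strict fp0 pv.
have DT : itv_partition 0 T D by split=> //; rewrite h2 /v /= last_cat.
via (lsum fp 0 v).
 rewrite psum_lsum /v /= lsum_cat /= addr0.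
 letr (_ : _ <= lsum fp (u 0%N) [seq u k | k <- iota 1 n]); first done.
 by rewrite addrCA lerDl addr_ge0// powR_ge0.
rewrite -h3 (lsum_nth _ T).
set S := (X in X <= _).
have S0 : 0 <= S by apply: sumr_ge0 => k _; exact: powR_ge0.
have : (S%:E `^ p^-1 <= M%:E)%E.
 apply: le_trans vM; apply: le_trans (ereal_sup_ubound _); last by exists D.
 apply: gt0_ler_poweR.
 - by pos.
 - by rewrite in_itv/= lee_fin S0 leey.
 - rewrite in_itv/= leey andbT; apply: sume_ge0 => k _; exact: poweR_ge0.
 rewrite /S -sumEFin; apply: lee_sum => k _; rewrite -poweR_EFin.
 apply: gt0_ler_poweR; first exact: ltW.
 - by rewrite in_itv/= lee_fin f0 leey.
 - by rewrite in_itv/= leey andbT (le_trans _ (fphi _ _))// lee_fin.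
 - done.
rewrite poweR_EFin lee_fin => h.
have -> : S = (S `^ p^-1) `^ p by rewrite -powRrM mulVf ?gt_eqF// powRr1.
by apply: le_powR => //; exact: ltW.
Qed.

Lemma pvar_le (T p : R) f (M : R) : 0 < p -> 0 <= M ->
 (forall u n, grid 0 T u n -> psum (fun s t => f s t `^ p) u n <= M `^ p) ->
 (pvar T p (fun s t => (f s t)%:E) <= M%:E)%E.
Proof.
move=> p0 M0 H; apply: ge_ereal_sup => _ [D [Dp Dl] <-].
pose u k := nth T (0%R :: D) k.
have g : grid 0 T u (size D).
 split=> //; first by rewrite /u -[leRHS](eqP Dl) (last_nth T).
 move=> i iD; rewrite /u; move: Dp => /(pathP T)/(_ i iD)/=.
 by pos.
under eq_bigr do rewrite poweR_EFin.
rewrite sumEFin poweR_EFin lee_fin.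
have h := H u (size D) g.
have ip0 : 0 <= p^-1 by pos.
letr (le_powR ip0 _ h); first by apply: sumr_ge0 => k _.
by rewrite -powRrM mulfV ?gt_eqF// powRr1.
Qed.

End Grids.

Section UniformGrid.
Context {R : realType}.
Variables (s t : R) (n : nat).

Definition ugrid (k : nat) : R := s + k%:R * ((t - s) / n%:R).

Lemma ugrid0 : ugrid 0 = s. Proof. by rewrite /ugrid mul0r addr0. Qed.

Lemma ugridn : (0 < n)%N -> ugrid n = t.
Proof.
move=> n0; rewrite /ugrid mulrC divfK ?pnatr_eq0 -?lt0n//.
lra.
Qed.

Lemma ugridS k : ugrid k.+1 - ugrid k = (t - s) / n%:R.
Proof. by rewrite /ugrid -natr1; ring. Qed.

Lemma ugrid_grid : (0 < n)%N -> s <= t -> grid s t ugrid n.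
Proof.
move=> n0 st; split; rewrite ?ugrid0 ?ugridn// => i _.
by rewrite -subr_ge0 ugridS divr_ge0// subr_ge0.
Qed.

End UniformGrid.

Lemma fine_ugrid (R : realType) (s t del : R) : s <= t -> 0 < del -> exists n, (0 < n)%N /\ (t - s) / n%:R < del.
Proof.
move=> st d0; exists (Num.truncn ((t - s) / del)).+1; split=> //.
rewrite ltr_pdivrMr// mulrC -ltr_pdivrMr//.
by rewrite truncnS_gt.
Qed.

(** * Young integrals against paths of bounded variation *)

Section Young.
Context {R : realType}.
Implicit Types (f g : R -> R) (s t B : R).

Definition ugrid_sum f g s t n := \sum_(0 <= k < n) f (ugrid s t n k) * (g (ugrid s t n k.+1) - g (ugrid s t n k)).

Lemma is_young_ugrid f g s t l : s <= t -> is_young f g s t l -> forall e : R, 0 < e ->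
 exists2 del : R, 0 < del & forall n, (0 < n)%N -> (t - s) / n%:R < del -> `|ugrid_sum f g s t n - l| < e.
Proof.
move=> st lY e e0; have [del del0 h] := lY e e0; exists del => // n n0 nd.
have [est|nst] := eqVneq s t.
 have [e1 e2 e3] : [/\ itv_partition s t [::],
 (forall k, (k < size (Nil R))%N -> nth t [:: s] k <= (fun=> s) k <= nth t [:: s] k.+1) &
 (forall k, (k < size (Nil R))%N -> nth t [:: s] k.+1 - nth t [:: s] k < del)].
 by split=> //; split=> //=; apply/eqP.
 have := h [::] (fun=> s) e1 e2 e3; rewrite big_geq// => hl.
 rewrite /ugrid_sum big1// => k _.
 by rewrite /ugrid est subrr mul0r !mulr0 addr0 subrr mulr0.
have lst : s < t by lra.
pose u := ugrid s t n; have g0 := ugrid_grid n0 st.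
pose D := [seq u k | k <- iota 1 n].
have szD : size D = n by rewrite size_map size_iota.
have nthD k : (k <= n)%N -> nth t (s :: D) k = u k.
 case: k => [|k] kn /=; first by rewrite /u ugrid0.
 by rewrite (nth_map 0%N) ?size_iota// nth_iota// add1n.
have DP : itv_partition s t D.
 split; last first.
 by apply/eqP; rewrite -[s in last s _](ugrid0 s t n) -/u last_grid /u ugridn.
 apply/(pathP t) => k; rewrite szD => kn; rewrite -[nth t D k]/(nth t (s :: D) k.+1).
 rewrite !nthD ?(ltnW kn)// -subr_gt0 /u ugridS divr_gt0 ?subr_gt0//.
 by rewrite ltr0n.
have -> : ugrid_sum f g s t n = \sum_(0 <= k < size D) f (u k) * (g (nth t (s :: D) k.+1) - g (nth t (s :: D) k)).
 by rewrite szD; apply: eq_big_nat => k /andP[_ kn]; rewrite !nthD ?(ltnW kn).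
apply: h => //.
- move=> k; rewrite szD => kn; rewrite !nthD ?(ltnW kn)// lexx /=.
 by have [_ _ h0] := g0; exact: h0.
- by move=> k; rewrite szD => kn; rewrite !nthD ?(ltnW kn)// /u ugridS.
Qed.

Lemma is_young_unique f g s t l l' : s <= t -> is_young f g s t l -> is_young f g s t l' -> l = l'.
Proof.
move=> st h h'; apply/eqP; rewrite -subr_eq0 -normr_eq0; apply/eqP/le_anti.
rewrite normr_ge0 andbT; apply/ler_addgt0Pr => e e0; rewrite add0r.
have e20 : 0 < e / 2 by pos.
have [d1 d10 k1] := is_young_ugrid st h e20.
have [d2 d20 k2] := is_young_ugrid st h' e20.
have d0 : 0 < Num.min d1 d2 by rewrite lt_min d10.
have [n [n0]] := fine_ugrid st d0; rewrite lt_min => /andP[nd1 nd2].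
have := ler_distD (ugrid_sum f g s t n) l l'.
have := k1 n n0 nd1; have := k2 n n0 nd2; rewrite (distrC l (ugrid_sum f g s t n)).
move: (`|_ - l|) (`|_ - l'|) (`|l - l'|) => x y z; lra.
Qed.

Lemma youngE f g s t l : s <= t -> is_young f g s t l -> young f g s t = l.
Proof.
move=> st h; rewrite /young; case: xgetP => [l' _ h'|/(_ l)]; last by [].
exact: is_young_unique st h' h.
Qed.

(** Uniform grids with left tags detect the limit. If the sums do not converge, [young] takes its
    default value 0 and the bound is trivial. *)
Lemma young_le f g s t B : s <= t -> 0 <= B -> (forall u n, grid s t u n -> u 0%N = s -> u n = t ->
 `|\sum_(0 <= k < n) f (u k) * (g (u k.+1) - g (u k))| <= B) -> `|young f g s t| <= B.
Proof.
move=> st B0 H; rewrite /young; case: xgetP => [l _ lY|_]; last by rewrite normr0.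
apply/ler_addgt0Pr => e e0; have [del del0 h] := is_young_ugrid st lY e0.
have [n [n0 nd]] := fine_ugrid st del0.
have Sl := h n n0 nd; have := H _ _ (ugrid_grid n0 st) (ugrid0 s t n) (ugridn s t n0).
rewrite -/(ugrid_sum f g s t n) => SB.
have := ler_distD (ugrid_sum f g s t n) l 0; rewrite !subr0 distrC.
by move: Sl SB; move: (`|_ - l|) (`|ugrid_sum f g s t n|) (`|l|) => x y z; lra.
Qed.

(** Summation by parts: it turns sums against a rough integrator into sums against the increments of
    the path of bounded variation, as [young_BV_left] requires. *)
Lemma abel_sum (x y : nat -> R) n : \sum_(0 <= k < n) (x k - x 0%N) * (y k.+1 - y k) =
 \sum_(0 <= k < n) (y n - y k.+1) * (x k.+1 - x k).
Proof.
elim: n => [|n IH]; first by rewrite !big_geq.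
rewrite !big_nat_recr//= subrr mul0r addr0 IH.
have -> : \sum_(0 <= k < n) (y n.+1 - y k.+1) * (x k.+1 - x k) = \sum_(0 <= k < n) (y n - y k.+1) * (x k.+1 - x k)
 + \sum_(0 <= k < n) (y n.+1 - y n) * (x k.+1 - x k).
 by rewrite -big_split /=; apply: eq_bigr => k _; ring.
by rewrite -mulr_sumr telescope_sumr// mulrC.
Qed.

Section YoungBV.
Variables (x h V : R -> R) (s t c : R).
Hypotheses (st : s <= t) (c0 : 0 <= c).
Hypothesis hV : forall a b, s <= a -> a <= b -> b <= t -> `|h b - h a| <= V b - V a.
Hypothesis xc : forall a b, s <= a <= t -> s <= b <= t -> `|x b - x a| <= c.

Lemma BV_sum_le (F : nat -> R) u n : grid s t u n -> (forall k, (k < n)%N -> `|F k| <= c) ->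
 `|\sum_(0 <= k < n) F k * (h (u k.+1) - h (u k))| <= c * (V t - V s).
Proof.
move=> g Fc; letr (ler_norm_sum _ _ _).
via (\sum_(0 <= k < n) c * (V (u k.+1) - V (u k))).
 rewrite !big_nat; apply: ler_sum => k /andP[_ kn]; rewrite normrM.
 apply: ler_pM => //; first exact: Fc.
 by have [h1 h2 h3] := grid_cell g kn; exact: hV.
rewrite -mulr_sumr telescope_sumr//; apply: ler_wpM2l => //.
have /andP[h1 h2] := grid_in g (leqnn n); have /andP[h3 h4] := grid_in g (leq0n n).
have v1 := le_trans (normr_ge0 _) (hV h1 h2 (lexx t)).
have v2 := le_trans (normr_ge0 _) (hV (lexx s) h3 h4).
by move: v1 v2; lra.
Qed.
Let V0 : 0 <= V t - V s. Proof. exact: le_trans (normr_ge0 _) (hV (lexx s) st (lexx t)). Qed.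

Lemma young_BV_right : `|young (fun v => x v - x s) h s t| <= c * (V t - V s).
Proof.
apply: young_le => //; first exact: mulr_ge0.
move=> u n g u0 un; apply: (BV_sum_le g) => k kn.
by apply: xc; [rewrite lexx st|exact: (grid_in g (ltnW kn))].
Qed.

Lemma young_BV_left : `|young (fun v => h v - h s) x s t| <= c * (V t - V s).
Proof.
apply: young_le => //; first exact: mulr_ge0.
move=> u n g u0 un; have := abel_sum (h \o u) (x \o u) n; rewrite /= u0 un => ->.
apply: (BV_sum_le g) => k kn.
by apply: xc; [exact: (grid_in g kn)|rewrite st lexx].
Qed.

End YoungBV.
End Young.

(** * Carnot-Caratheodory norm and size of rough increments *)

Section CarnotCaratheodory.
Context {R : realType} {m : nat}.

Lemma path_pvar1_control (d : nat) (T v : R) (y : R -> 'rV[R]_d) : 0 < T -> (path_pvar T 1 y <= v%:E)%E ->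
 exists W : R -> R, (forall s t, 0 <= s -> s <= t -> t <= T -> enorm (y t - y s) <= W t - W s) /\ W T - W 0 <= v.
Proof.
move=> T0 yv; have v0 : 0 <= v.
 rewrite -lee_fin; apply: le_trans yv; apply: le_trans (ereal_sup_ubound _); last first.
 by exists [:: T] => //; split=> //=; rewrite T0.
 exact: poweR_ge0.
apply: (control_exists (f := fun s t => enorm (y t - y s)) (ltW T0)) => // u n g.
have := pvar_psum (f := fun s t => enorm (y t - y s)) T0 ltr01 v0 yv _ _ _ g.
rewrite powRr1// => H; apply: le_trans (H _ _ _) => //.
 by rewrite /psum; apply: ler_sum => k _; rewrite powRr1.
by move=> s; rewrite subrr enorm0.
Qed.

(** A path of length [v] that represents [g] ends within [v] of its start, and its second level is
    an integral bounded by oscillation times length, hence by [v * v]. *)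
Lemma ccnorm_ge N (g : tens R m) : (`|g.1|%:E <= ccnorm N g)%E /\ ((`|g.2| `^ 2^-1)%:E <= ccnorm N g)%E.
Proof.
suff H (y : cpath (1 : R) (0 : 'rV[R]_m)) : canonical_lift N y 1 = g ->
 (`|g.1|%:E <= path_pvar 1 1 y)%E /\ ((`|g.2| `^ 2^-1)%:E <= path_pvar 1 1 y)%E.
 by split; apply: le_ereal_inf_tmp => _ [y /= yg <-]; have [] := H y yg.
move=> yg; have pv0 : (0 <= path_pvar 1 1 y)%E.
 apply: le_trans (ereal_sup_ubound _); last by exists [:: 1] => //; split=> //=; rewrite ltr01.
 exact: poweR_ge0.
case E : (path_pvar 1 1 y) pv0 => [v| |]; rewrite ?leey//.
rewrite !lee_fin => v0.
have [|W [Wy Wv]] := @path_pvar1_control m 1 v y ltr01; first by rewrite E.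
have Wle a b : 0 <= a -> a <= b -> b <= 1 -> enorm (y b - y a) <= v.
 move=> a0 ab b1; letr (Wy _ _ a0 ab b1); apply: le_trans Wv.
 have h1 := le_trans (enorm_ge0 _) (Wy _ _ (lexx 0) a0 (le_trans ab b1)).
 have h2 := le_trans (enorm_ge0 _) (Wy _ _ (le_trans a0 ab) b1 (lexx 1)).
 by move: h1 h2; lra.
split.
 rewrite -yg /=; letr (norm_le_enorm _); exact: Wle.
have -> : v = (v * v) `^ 2^-1 by rewrite powR12_sqrt ?mulr_ge0// -expr2 sqrtr_sqr ger0_norm.
apply: le_powR => //.
rewrite -yg /= /level2; case: ifP => N2; last by rewrite normr0 mulr_ge0.
rewrite [leLHS]mx_normrE; apply: bigmax_le; first by pos.
case=> i j _ /=; rewrite mxE.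
via (v * (W 1 - W 0)); last exact: ler_wpM2l.
apply: (@young_BV_right R (fun u => y u 0 i) (fun u => y u 0 j) W) => //.
- move=> a b a0 ab b1; apply: le_trans (Wy _ _ a0 ab b1).
 have -> : y b 0 j - y a 0 j = (y b - y a) 0 j by rewrite !mxE.
 exact: coord_le_enorm.
- move=> a b /andP[a0 a1] /andP[b0 b1].
 have -> : y b 0 i - y a 0 i = (y b - y a) 0 i by rewrite !mxE.
 letr (coord_le_enorm _ _).
 by have [ab|/ltW ab] := leP a b; [|rewrite enormBC]; exact: Wle.
Qed.

Lemma ccnorm_lt N (g : tens R m) (e : R) : (ccnorm N g < e%:E)%E -> `|g.1| < e /\ `|g.2| < e ^+ 2.
Proof.
move=> ge; have [h1 h2] := ccnorm_ge N g.
have l1 : `|g.1| < e by rewrite -lte_fin; exact: le_lt_trans h1 ge.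
have l2 : `|g.2| `^ 2^-1 < e by rewrite -lte_fin; exact: le_lt_trans h2 ge.
split=> //; have e0 : 0 < e by exact: le_lt_trans l1.
rewrite powR12_sqrt// in l2.
by rewrite -[`|g.2|]sqr_sqrtr// ltr_pXn2r ?nnegrE// ltW.
Qed.

End CarnotCaratheodory.

Section RoughSize.
Context {R : realType} {m : nat}.
Variables (N : nat).

(** Homogeneous size of an increment to the power [p]. The time increment is added so that one
    control also dominates the drift. *)
Definition rho (p : R) (X : R -> tens R m) (s t : R) : R :=
 `|(tincr N X s t).1| `^ p + `|(tincr N X s t).2| `^ (p / 2) + `|t - s|.

Lemma rho_ge0 p X s t : 0 <= rho p X s t.
Proof. by pos. Qed.

Lemma psum_time (T : R) u n : grid 0 T u n -> psum (fun s t => `|t - s|) u n <= T.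
Proof.
move=> g; have := @psum_control R (fun s t => `|t - s|) id 0 T u n _ g.
have /andP[h1 h2] := grid_in g (leqnn n); have /andP[h3 h4] := grid_in g (leq0n n).
move=> H; letr (H _); last by lra.
by move=> s t s0 st tT; rewrite ger0_norm// subr_ge0.
Qed.

Lemma psumD f g (u : nat -> R) n : psum (fun s t => f s t + g s t) u n = psum f u n + psum g u n.
Proof. by rewrite /psum big_split. Qed.

Lemma rough_pvar_psum (T p : R) (X : R -> tens R m) (M : R) u n : 0 < T -> 0 < p -> N = Num.truncn p -> 0 <= M ->
 (rough_pvar T p X <= M%:E)%E -> grid 0 T u n -> psum (rho p X) u n <= 2 * M `^ p + T.
Proof.
move=> T0 p0 Np M0 XM g; rewrite /rho psumD psumD mulr_natl mulr2n.
have z1 s : `|(tincr N X s s).1| = 0 by rewrite tincr_id normr0.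
have z2 s : `|(tincr N X s s).2| = 0 by rewrite tincr_id normr0.
rewrite /rough_pvar -Np in XM.
apply: lerD; last exact: psum_time.
apply: lerD.
 apply: (pvar_psum (f := fun s t => `|(tincr N X s t).1|) T0 p0 M0 XM) => //.
 by move=> s t; have [] := ccnorm_ge N (tincr N X s t).
have -> : psum (fun s t => `|(tincr N X s t).2| `^ (p / 2)) u n =
 psum (fun s t => (`|(tincr N X s t).2| `^ 2^-1) `^ p) u n.
 by rewrite /psum; apply: eq_bigr => k _; rewrite -powRrM mulrC.
apply: (pvar_psum (f := fun s t => `|(tincr N X s t).2| `^ 2^-1) T0 p0 M0 XM) => //.
 by move=> s t; have [] := ccnorm_ge N (tincr N X s t).
by move=> s; rewrite z2 powR0// invr_neq0.
Qed.

Lemma rho_grid_control (q a b : R) (X : R -> tens R m) (W : R -> R) u n : 0 < q ->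
 (forall s t, a <= s -> s <= t -> t <= b -> rho q X s t <= W t - W s) ->
 grid a b u n -> grid_control N q X u (fun k => W (u k)) n.
Proof.
move=> q0 XW g i j /andP[ij jn].
have /andP[h1 _] := grid_in g (leq_trans ij jn); have /andP[_ h2] := grid_in g jn.
have uij : u i <= u j by apply: (grid_mono g); rewrite ij.
have := XW _ _ h1 uij h2; rewrite /rho; set A := _ `^ q; set B := _ `^ (q / 2) => H.
have A0 : 0 <= A by pos.
have B0 : 0 <= B by pos.
have T0 : 0 <= u j - u i by pos.
rewrite ger0_norm// in H.
split.
- by rewrite T0 /=; lra.
- have -> : `|(tincr N X (u i) (u j)).1| = A `^ q^-1 by rewrite /A -powRrM mulfV ?gt_eqF// powRr1.
 by apply: le_powR => //; [rewrite invr_ge0 ltW|lra].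
- have -> : `|(tincr N X (u i) (u j)).2| = B `^ (2 / q).
 by rewrite /B -powRrM [_ * _](_ : _ = 1) ?powRr1//; field; rewrite gt_eqF.
 by apply: le_powR => //; [rewrite divr_ge0// ltW|lra].
Qed.

End RoughSize.

(** * Young integrals against smooth paths *)

Section Analysis.
Context {R : realType}.

Lemma heine_cantor (V : normedModType R) (f : R -> V) (a b : R) : continuous f ->
 forall e : R, 0 < e -> exists2 del : R, 0 < del & forall s t, a <= s <= b -> `|s - t| < del -> `|f s - f t| < e.
Proof.
move=> cf e e0.
have /compact_near_coveringP/(_ R (0 : R)^'+
 (fun del s => forall t, `|s - t| < del -> `|f s - f t| < e)) := @segment_compact R a b.
have cov x : `[a, b]%classic x ->
 \forall x' \near x & i \near (0 : R)^'+, (forall t, `|x' - t| < i -> `|f x' - f t| < e).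
 move=> _; have e20 : 0 < e / 2 by pos.
 have /cvgrPdist_lt/(_ _ e20) := cf x.
 move=> [r /= r0 xr].
 exists (ball x (r / 2), [set i | i < r / 2]).
 split; first by apply: nbhsx_ballx; rewrite divr_gt0.
 by apply: nbhs_right_lt; rewrite divr_gt0.
 move=> [x' i] /= [xx' ir] t x't.
 have h1 : `|f x - f x'| < e / 2 by apply: xr; apply: lt_trans xx' _; rewrite ltr_pdivrMr// ltr_pMr// ltr1n.
 have h2 : `|f x - f t| < e / 2.
 apply: xr; rewrite /= (splitr r).
 have -> : x - t = (x - x') + (x' - t) by lra.
 by apply: le_lt_trans (ler_normD _ _) _; rewrite ltrD// (lt_trans x't).
 have -> : f x' - f t = (f x - f t) - (f x - f x') by rewrite opprB [RHS]addrC addrA subrK.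
 by apply: le_lt_trans (ler_normB _ _) _; rewrite (splitr e) ltrD.
move=> /(_ _ cov) [r /= r0 H].
exists (r / 2); first by pos.
move=> s t sab st; apply: (H (r / 2)) => //=.
- by rewrite sub0r normrN gtr0_norm ?divr_gt0// ltr_pdivrMr// ltr_pMr// ltr1n.
- by pos.
Qed.

Lemma antiderivative (f : R -> R) (T : R) : continuous f -> exists A : R -> R,
 forall t : R, 0 <= t <= T -> is_derive t 1 A (f t).
Proof.
(* Integration starts at -1 so that 0 is an interior point and the derivative there is two-sided. *)
move=> cf; pose F (x : R) : R := (\int[lebesgue_measure]_(t in `[-1, x]) f t)%R.
exists F => t /andP[t0 tT].
have tT1 : t < T + 1 by rewrite ltr_pwDr.
have fi : lebesgue_measure.-integrable `[-1, T + 1] (EFin \o f).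
 apply: continuous_compact_integrable; first exact: segment_compact.
 exact: continuous_subspaceT.
have t1 : -1 < t by lra; rewrite ltrN10.
have [d e] : derivable F t 1 /\ F^`()%classic t = f t.
 exact: (continuous_FTC1_closed tT1 fi t1 (cf t)).
by apply: DeriveDef; [exact: d|rewrite -derive1E].
Qed.

Variables (T G : R) (g g' x : R -> R).
Hypotheses (T0 : 0 < T) (dg : forall t : R, is_derive t 1 g (g' t)) (cg' : continuous g').
Hypotheses (xg : forall t, 0 <= t <= T -> x t = g t).
Hypothesis gG : forall t, 0 <= t <= T -> `|g' t| <= G.

(** The antiderivative [A] of [f * g'] gives the integral. The mean value theorem for [A - c * g]
    yields the local estimate, and, with [c] the tag value in each cell, the convergence of the
    Riemann-Stieltjes sums. *)
Lemma young_smooth (f : R -> R) : continuous f -> exists A : R -> R,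
 (forall t, 0 <= t <= T -> young f x 0 t = A t - A 0) /\ (forall s t c eta : R, 0 <= s -> s <= t -> t <= T ->
 (forall r, s <= r <= t -> `|f r - c| <= eta) -> `|A t - A s - c * (x t - x s)| <= eta * G * (t - s)).
Proof.
move=> cf.
have [A dA] : exists A : R -> R, forall t : R, 0 <= t <= T -> is_derive t 1 A (f t * g' t).
 by apply: antiderivative => t; apply: cvgM; [exact: cf|exact: cg'].
have key (s t c eta : R) : 0 <= s -> s <= t -> t <= T -> (forall r, s <= r <= t -> `|f r - c| <= eta) ->
 `|A t - A s - c * (x t - x s)| <= eta * G * (t - s).
 move=> s0 st tT fc.
 have inT r : s <= r <= t -> 0 <= r <= T by move=> /andP[h1 h2]; rewrite (le_trans s0 h1) (le_trans h2 tT).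
 have dB r : s <= r <= t -> is_derive r 1 (A - c \*: g) (f r * g' r - c *: g' r).
 by move=> /inT /dA h; exact: is_deriveB.
 have cB : {within `[s, t], continuous (A - c \*: g)}.
 apply: derivable_within_continuous => r; rewrite in_itv/= => /dB [] //.
 have dB' r : r \in `]s, t[%R -> is_derive r 1 (A - c \*: g) (f r * g' r - c *: g' r).
 by rewrite in_itv/= => /andP[h1 h2]; apply: dB; rewrite !ltW.
 have [r rst] := MVT_segment st dB' cB.
 rewrite in_itv/= in rst.
 have -> : (A - c \*: g) t - (A - c \*: g) s = A t - A s - c * (x t - x s).
 rewrite !xg ?inT ?st ?lexx//=.
 have -> : (A - c \*: g) t - (A - c \*: g) s = (A t - c * g t) - (A s - c * g s) by [].
 by ring.
 move=> ->; rewrite -[c *: g' r]/(c * g' r) -mulrBl !normrM (ger0_norm (_ : 0 <= t - s)) ?subr_ge0//.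
 apply: ler_wpM2r; first by pos.
 by apply: ler_pM => //; [exact: fc|apply: gG; exact: inT].
exists A; split=> // t /andP[t0 tT]; apply: youngE => // e e0.
have G0 : 0 <= G by apply: le_trans (normr_ge0 _) (gG (t := 0) _); rewrite lexx ltW.
pose eta := e / (2 * (G * T + 1)).
have GT0 : 0 < G * T + 1 by pos.
have eta0 : 0 < eta by pos.
have [del del0 hd] := @heine_cantor R f 0 T cf eta eta0.
exists del => // D tag DP u tagD meshD.
have [Dp /eqP Dl] := DP.
have gu : grid 0 t u (size D).
 split=> //; first by rewrite /u -[leRHS]Dl (last_nth t).
 move=> i iD; rewrite /u; move: Dp => /(pathP t)/(_ i iD)/=.
 by pos.
have un : u (size D) = t by rewrite /u -[RHS]Dl (last_nth t).
have -> : A t - A 0 = \sum_(0 <= k < size D) (A (u k.+1) - A (u k)) by rewrite telescope_sumr// un.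
rewrite -sumrB; apply: le_lt_trans (ler_norm_sum _ _ _) _.
apply: (@le_lt_trans _ _ (\sum_(0 <= k < size D) eta * G * (u k.+1 - u k))).
 rewrite !big_nat; apply: ler_sum => k /andP[_ kD].
 rewrite distrC.
 have /andP[h1 h2] := grid_in gu (ltnW kD); have /andP[h3 h4] := grid_in gu kD.
 have uk : u k <= u k.+1 by have [_ _ ->] := gu.
 apply: key => //; first exact: le_trans h4 tT.
 move=> r /andP[r1 r2]; apply: ltW; apply: hd.
 lra.
 have /andP[t1 t2] := tagD k kD.
 apply: le_lt_trans (meshD k kD).
 by rewrite ler_norml; move: t1 t2 r1 r2; rewrite -/u; lra.
rewrite -mulr_sumr telescope_sumr// un subr0.
apply: (@le_lt_trans _ _ (eta * (G * T))).
 by rewrite -mulrA; apply: ler_wpM2l; [exact: ltW|apply: ler_wpM2l].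
apply: (@le_lt_trans _ _ (eta * (G * T + 1))); first by apply: ler_wpM2l; [exact: ltW|rewrite lerDl].
have -> : eta * (G * T + 1) = e / 2 by rewrite /eta; field; rewrite gt_eqF.
lra.
Qed.

End Analysis.

(** * Davie's criterion for smooth drivers *)

Section Davie.
Context {R : realType} {d : nat}.

(* Davie's characterization of solutions: the one-step errors of the Euler
   scheme along y are summable to o(1) as the mesh tends to 0. *)
Definition davie (T : R) (F : R -> R -> 'rV[R]_d -> 'rV[R]_d) (y : R -> 'rV[R]_d) :=
 forall e : R, 0 < e -> exists2 del : R, 0 < del & forall u n, grid 0 T u n ->
 (forall k, (k < n)%N -> u k.+1 - u k < del) -> psum (fun s t => enorm (y t - (y s + F s t (y s)))) u n <= e.

End Davie.

Lemma smooth_path_derivative (R : realType) (T : R) (m : nat) (x : R -> 'rV[R]_m) :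
 0 < T -> smooth_path T x -> exists (g g' : R -> 'rV[R]_m) (G : R), [/\ 0 <= G, forall t : R, 0 <= t <= T -> x t = g t,
 forall i (t : R), is_derive t 1 (fun u => g u 0 i) (g' t 0 i), forall i, continuous (fun t => g' t 0 i) &
 forall i (t : R), 0 <= t <= T -> `|g' t 0 i| <= G].
Proof.
move=> T0 [g sm xg].
have dg (t : R) : derivable g t 1 by exact: (sm 0%N).
have dg1 (t : R) : derivable g^`()%classic t 1 by exact: (sm 1%N).
have cg1 : continuous (g^`()%classic : R -> 'rV[R]_m).
 by move=> t; apply: differentiable_continuous; apply/derivable1_diffP.
have cn : continuous (fun t => `|g^`()%classic t|).
 by move=> t; apply: (continuous_comp (cg1 t)); exact: norm_continuous.
have [c cT cmax] := EVT_max (ltW T0) (continuous_subspaceT cn).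
exists g, (g^`()%classic), `|g^`()%classic c|; split=> //.
- move=> i t; have /derivable_mxP/(_ 0 i) dgi := dg t.
 have -> : g^`()%classic t 0 i = 'D_1 (fun u => g u 0 i) t by rewrite derive1E (derive_mx (dg t)) mxE.
 done.
- move=> i t; have /derivable_mxP/(_ 0 i) h := dg1 t.
 by apply: differentiable_continuous; apply/derivable1_diffP.
- move=> i t tT; letr (mx_norm_ge _ _ _).
 by apply: cmax; rewrite in_itv.
Qed.

Section SmoothDavie.
Context {R : realType} {d m : nat}.
Local Notation E := 'rV[R]_d.
Variables (N : nat) (al K T : R) (b : E -> E) (sg : 'I_m -> E -> E)
 (L : 'I_m -> E -> E -> E) (ta : 'I_m -> 'I_m -> E -> E).
Hypotheses (T0 : 0 < T) (K0 : 0 <= K) (sf : scheme_fields N al K b sg L ta).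

Lemma field_coord_continuous (f : E -> E) (y : R -> E) k : lipschitz_with K f ->
 continuous y -> continuous (fun u => f (y u) 0 k).
Proof.
move=> lf cy t; apply/cvgrPdist_le => e e0.
have c0 : 0 < K * d%:R + 1 by pos.
have /cvgrPdist_le/(_ _ (divr_gt0 e0 c0)) := cy t.
apply: filterS => s ys.
have -> : f (y t) 0 k - f (y s) 0 k = (f (y t) - f (y s)) 0 k by rewrite !mxE.
letr (coord_le_enorm _ _); letr (lf _ _).
via ((K * d%:R + 1) * `|y t - y s|); last first.
 by rewrite mulrC -ler_pdivlMr.
letr (ler_wpM2l K0 (enorm_le_norm _)).
by rewrite mulrA; apply: ler_wpM2r => //; rewrite lerDl.
Qed.

Variables (xi : E) (x : cpath T (0 : 'rV[R]_m)) (y : cpath T xi).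
Hypotheses (sx : smooth_path T x) (ode : ode_solution b sg x y).

(** Continuity of the fields along [y] makes the first-order step exact up to o(t - s). The
    second-level increment of a smooth path is o(t - s) as well ([X2]), so adding its term to the
    scheme changes nothing at this order. *)
Lemma ode_local_error (eta : R) : 0 < eta -> exists2 del : R, 0 < del &
 forall s t : R, 0 <= s -> s <= t -> t <= T -> t - s < del ->
 enorm (y t - (y s + scheme N b sg ta (canonical_lift N x) s t (y s))) <= eta * (t - s).
Proof.
move=> eta0.
have [cx x0 _] := cpathP x; have [cy y0 _] := cpathP y.
have [g [g' [G [G0 xg dg cg' gG]]]] := smooth_path_derivative T0 sx.
have xi' i t : 0 <= t <= T -> x t 0 i = g t 0 i by move=> /xg ->.
have bl : lipschitz_with K b by case: (sf_b sf).
have sl i : lipschitz_with K (sg i) by case: (sf_sg sf i).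
have did (t : R) : is_derive t (1 : R) (fun u : R => u) (1 : R) by exact: is_derive_id.
have c1 : continuous (fun _ : R => 1 : R) by move=> t; exact: cvg_cst.
have yb k := @young_smooth R T 1 id (fun=> 1) id T0 did c1 (fun _ _ => erefl)
 (fun _ _ => ler_of_eq (normr1 _)) _ (field_coord_continuous (k := k) bl cy).
have ys i k := @young_smooth R T G (fun u => g u 0 i) (fun u => g' u 0 i) (fun u => x u 0 i)
 T0 (dg i) (cg' i) (xi' i) (gG i) _ (field_coord_continuous (k := k) (sl i) cy).
have cxi i : continuous (fun u => x u 0 i - x 0 0 i).
 move=> t; apply: cvgB; last exact: cvg_cst.
 exact: (continuous_comp (cx t) (@coord_continuous R 1 m 0 i _)).
have yx i j := @young_smooth R T G (fun u => g u 0 j) (fun u => g' u 0 j) (fun u => x u 0 j)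
 T0 (dg j) (cg' j) (xi' j) (gG j) _ (cxi i).
pose M := d%:R * (K * d%:R * (1 + m%:R * G)) + m%:R ^+ 2 * (G * K) + 1.
have M0 : 0 < M by pos.
pose e := eta / M; have e0 : 0 < e by pos.
have [d1 d10 h1] := @heine_cantor R _ y 0 T cy e e0.
have [d2 d20 h2] := @heine_cantor R _ x 0 T cx e e0.
exists (Num.min d1 d2); first by rewrite lt_min d10.
move=> s t s0 st tT; rewrite lt_min => /andP[ts1 ts2].
have ts0 : 0 <= t - s by pos.
have eGts0 : 0 <= e * G * (t - s) by pos.
have sT : 0 <= s <= T by lra.
have tT' : 0 <= t <= T by lra.
have near_s r (de : R) : s <= r <= t -> t - s < de -> `|s - r| < de.
 move=> /andP[r1 r2]; apply: le_lt_trans.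
 by rewrite ler0_norm ?subr_le0// opprB lerB.
have fy (f : E -> E) k r : lipschitz_with K f -> s <= r <= t -> `|f (y r) 0 k - f (y s) 0 k| <= K * d%:R * e.
 move=> lf rst; have -> : f (y r) 0 k - f (y s) 0 k = (f (y r) - f (y s)) 0 k by rewrite !mxE.
 letr (coord_le_enorm _ _); letr (lf _ _).
 rewrite -mulrA; apply: ler_wpM2l => //; letr (enorm_le_norm _).
 by apply: ler_wpM2l => //; rewrite distrC ltW// h1// near_s.
have X2 i j : `|(tincr N (canonical_lift N x) s t).2 i j| <= e * G * (t - s).
 case: (ltnP N 2) => N2.
 by rewrite tincr2_level1// mxE normr0.
 have [A [A1 A2]] := yx i j.
 have -> : (tincr N (canonical_lift N x) s t).2 i j = A t - A s - (x s 0 i - x 0 0 i) * (x t 0 j - x s 0 j).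
 rewrite tincr2E// /canonical_lift /= /level2 N2 !mxE big_ord1 !mxE A1// A1//.
 by ring.
 apply: A2 => // r rst.
 have -> : x r 0 i - x 0 0 i - (x s 0 i - x 0 0 i) = (x r - x s) 0 i by rewrite !mxE; ring.
 by letr (mx_norm_ge _ _ _); rewrite distrC ltW// h2// near_s.
have X2n : `|(tincr N (canonical_lift N x) s t).2| <= e * G * (t - s).
 rewrite [leLHS]mx_normrE; apply: bigmax_le; first by [].
 by [].
have first_order : enorm (y t - (y s + (t - s) *: b (y s) +
 \sum_i (x t 0 i - x s 0 i) *: sg i (y s))) <= d%:R * (K * d%:R * (1 + m%:R * G)) * e * (t - s).
 letr (enorm_le_sum _).
 via (\sum_(k < d) K * d%:R * (1 + m%:R * G) * e * (t - s)); last first.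
 by rewrite sumr_const card_ord -[leLHS]mulr_natl; apply: ler_of_eq; ring.
 apply: ler_sum => k _.
 have [B [B1 B2]] := yb k.
 have /choice [A hA] : forall i, exists A : R -> R,
 (forall t, 0 <= t <= T -> young (fun u => sg i (y u) 0 k) (fun u => x u 0 i) 0 t = A t - A 0) /\
 `|A t - A s - sg i (y s) 0 k * (x t 0 i - x s 0 i)| <= K * d%:R * e * G * (t - s).
 move=> i; have [A [A1 A2]] := ys i k; exists A; split=> //.
 by apply: A2 => // r rst; exact: fy.
 have hB : `|B t - B s - b (y s) 0 k * (t - s)| <= K * d%:R * e * 1 * (t - s) by apply: B2 => // r rst; exact: fy.
 have -> : (y t - (y s + (t - s) *: b (y s) + \sum_i (x t 0 i - x s 0 i) *: sg i (y s))) 0 k =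
 (B t - B s - b (y s) 0 k * (t - s)) + \sum_i (A i t - A i s - sg i (y s) 0 k * (x t 0 i - x s 0 i)).
 rewrite !mxE summxE (ode tT') (ode sT) B1// B1//.
 under eq_bigr do rewrite (hA _).1//.
 under [in X in _ - X]eq_bigr do rewrite (hA _).1//.
 rewrite !sumrB.
 under [X in _ - (_ + _ + X)]eq_bigr do rewrite mxE mulrC.
 under [X in _ = _ + (_ - X)]eq_bigr do [].
 by ring.
 letr (ler_normD _ _).
 via (K * d%:R * e * 1 * (t - s) + \sum_(i < m) K * d%:R * e * G * (t - s)).
 apply: lerD => //; letr (ler_norm_sum _ _ _).
 by apply: ler_sum => i _; exact: (hA i).2.
 by rewrite sumr_const card_ord -[X in _ + X]mulr_natl; apply: ler_of_eq; ring.
have sE : scheme N b sg ta (canonical_lift N x) s t (y s) = (t - s) *: b (y s) + \sum_i (x t 0 i - x s 0 i) *: sg i (y s)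
 + \sum_l \sum_i (tincr N (canonical_lift N x) s t).2 l i *: ta l i (y s).
 rewrite /scheme /euler /fcomb; congr (_ + _ + _); apply: eq_bigr => i _.
 by congr (_ *: _); rewrite tincr1 /canonical_lift /= !mxE; ring.
rewrite sE !addrA opprD addrA; letr (enormB _ _).
have second : enorm (\sum_l \sum_i (tincr N (canonical_lift N x) s t).2 l i *: ta l i (y s)) <=
 m%:R ^+ 2 * (G * K) * e * (t - s).
 have := @enorm_fcomb R d m 0 0 (tincr N (canonical_lift N x) s t).2 0 (fun=> 0)
 (fun l i => ta l i (y s)) 0 0 K; rewrite /fcomb scaler0 add0r.
 rewrite big1 ?add0r => [|i _]; last by rewrite scaler0.
 rewrite !mulr0 !add0r => H; letr (H _ _ _ _ _) => //.
 - by rewrite enorm0.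
 - by move=> i; rewrite enorm0.
 - by move=> l i; case: (sf_ta sf l i).
 have := ler_wpM2r K0 X2n => h; have := ler_wpM2l (exprn_ge0 2 (ler0n R m)) h.
 by move=> hh; letr hh; apply: ler_of_eq; ring.
letr (lerD first_order second).
rewrite -!mulrDl; apply: ler_wpM2r => //.
via (M * e); last by rewrite /e mulrC divfK// gt_eqF.
by apply: ler_wpM2r; [exact: ltW|rewrite /M lerDl].
Qed.

Lemma smooth_davie : davie T (scheme N b sg ta (canonical_lift N x)) y.
Proof.
move=> e e0; have [del del0 h] := ode_local_error (divr_gt0 e0 T0).
exists del => // u n g mesh.
have -> : e = e / T * T by rewrite divfK// gt_eqF.
via (\sum_(0 <= k < n) e / T * (u k.+1 - u k)).
 rewrite /psum !big_nat; apply: ler_sum => k /andP[_ kn].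
 by have [h1 h2 h3] := grid_cell g kn; apply: h => //; exact: mesh.
rewrite -mulr_sumr telescope_sumr//; apply: ler_wpM2l; first by pos.
have /andP[_ h2] := grid_in g (leqnn n); have /andP[h1 _] := grid_in g (leq0n n).
lra.
Qed.

End SmoothDavie.

(** * Passage of Davie's criterion to rough drivers *)

Section TensorClose.
Context {R : realType} {m : nat}.
Variable N : nat.

Lemma trmul_norm (a c : 'rV[R]_m) : `|a^T *m c| <= `|a| * `|c|.
Proof.
rewrite [leLHS]mx_normrE; apply: bigmax_le; first by [].
case=> i j _ /=; rewrite trmul_row normrM.
by apply: ler_pM => //; exact: mx_norm_ge.
Qed.

Lemma tmul_close (G H : tens R m) (A e : R) : e <= 1 -> `|G.1| <= A ->
 `|(tmul N (tinv N G) H).1| <= e -> `|(tmul N (tinv N G) H).2| <= e ^+ 2 ->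
 `|H.1 - G.1| <= e /\ ((2 <= N)%N -> `|H.2 - G.2| <= (1 + A) * e).
Proof.
move=> e1 GA h1 h2; have l1 : `|H.1 - G.1| <= e by move: h1; rewrite /tmul /= addrC.
split=> // N2; have e0 : 0 <= e by exact: le_trans (normr_ge0 _) l1.
move: h2; rewrite /tmul /= /level2 N2.
set Z := (X in `|X| <= _) => hZ.
have -> : H.2 - G.2 = Z + G.1^T *m (H.1 - G.1) by apply/matrixP => i j; rewrite /Z !mxE !big_ord1 !mxE; ring.
letr (ler_normD _ _); rewrite mulrDl mul1r; apply: lerD.
 by letr hZ; rewrite expr2 ler_piMl.
by letr (trmul_norm _ _); apply: ler_pM.
Qed.

Lemma ccdist_close (G H : tens R m) (A e : R) : e <= 1 -> `|G.1| <= A -> (ccdist N G H < e%:E)%E ->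
 `|H.1 - G.1| <= e /\ ((2 <= N)%N -> `|H.2 - G.2| <= (1 + A) * e).
Proof. by move=> e1 GA /ccnorm_lt [h1 h2]; apply: tmul_close => //; exact: ltW. Qed.

Lemma tincr_close (X Y : R -> tens R m) (A e e' s t : R) : `|(X s).1| <= A -> `|(Y s).1| <= A -> `|(Y t).1| <= A ->
 `|(Y s).1 - (X s).1| <= e -> `|(Y t).1 - (X t).1| <= e ->
 ((2 <= N)%N -> `|(Y s).2 - (X s).2| <= e') -> ((2 <= N)%N -> `|(Y t).2 - (X t).2| <= e') -> 0 <= e' ->
 `|(tincr N Y s t).1 - (tincr N X s t).1| <= 2 * e /\ `|(tincr N Y s t).2 - (tincr N X s t).2| <= 2 * e' + 4 * A * e.
Proof.
move=> XA YA YtA s1 t1 s2 t2 e'0.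
have e0 : 0 <= e by exact: le_trans (normr_ge0 _) s1.
have A0 : 0 <= A by exact: le_trans (normr_ge0 _) XA.
have d1 : `|(tincr N Y s t).1 - (tincr N X s t).1| <= 2 * e.
 rewrite !tincr1.
 have -> : (Y t).1 - (Y s).1 - ((X t).1 - (X s).1) = ((Y t).1 - (X t).1) - ((Y s).1 - (X s).1).
 by rowring.
 by letr (ler_normB _ _); rewrite mulr_natl mulr2n; exact: lerD.
split=> //; case: (ltnP N 2) => N2.
 by rewrite !tincr2_level1// subrr normr0 addr_ge0// !mulr_ge0.
rewrite !tincr2E//.
move: d1; rewrite !tincr1.
set dY := (Y t).1 - (Y s).1; set dX := (X t).1 - (X s).1 => d1.
have -> : (Y t).2 - (Y s).2 - (Y s).1^T *m dY - ((X t).2 - (X s).2 - (X s).1^T *m dX) =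
 ((Y t).2 - (X t).2) - ((Y s).2 - (X s).2) - (((Y s).1 - (X s).1)^T *m dY
 + (X s).1^T *m (dY - dX)).
 by apply/matrixP => i j; rewrite !mxE !big_ord1 !mxE; ring.
have hY : `|dY| <= 2 * A by letr (ler_normB _ _); rewrite mulr_natl mulr2n; exact: lerD.
have k1 : `|((Y s).1 - (X s).1)^T *m dY| <= e * (2 * A) by letr (trmul_norm _ _); apply: ler_pM.
have k2 : `|(X s).1^T *m (dY - dX)| <= A * (2 * e) by letr (trmul_norm _ _); apply: ler_pM.
letr (ler_normB _ _); apply: lerD.
 letr (ler_normB _ _); rewrite mulr_natl mulr2n.
 by apply: lerD; [exact: t2|exact: s2].
letr (ler_normD _ _); apply: (le_trans (lerD k1 k2)).
lra.
Qed.

Lemma tens_continuous (X : R -> tens R m) : continuous X ->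
 continuous (fun t => (X t).1) /\ continuous (fun t => (X t).2).
Proof.
move=> cX; split=> t.
 by apply: (cvg_comp _ _ (cX t)); exact: cvg_fst.
by apply: (cvg_comp _ _ (cX t)); exact: cvg_snd.
Qed.

Lemma continuous_bounded (V : normedModType R) (f : R -> V) (a b : R) : a <= b -> continuous f ->
 exists A : R, forall t, a <= t <= b -> `|f t| <= A.
Proof.
move=> ab cf.
have cn : continuous (fun t => `|f t|) by move=> t; apply: (continuous_comp (cf t)); exact: norm_continuous.
have [c _ cmax] := EVT_max ab (continuous_subspaceT cn).
by exists `|f c| => t tab; apply: cmax; rewrite in_itv.
Qed.

Lemma tincr_osc (X : R -> tens R m) (T : R) : 0 <= T -> continuous X ->
 forall eta : R, 0 < eta -> exists2 del : R, 0 < del & forall s t, 0 <= s <= T -> `|s - t| < del ->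
 `|(tincr N X s t).1| <= eta /\ `|(tincr N X s t).2| <= eta.
Proof.
move=> T0 cX eta eta0; have [c1 c2] := tens_continuous cX.
have [A XA] := continuous_bounded T0 c1.
have A0 : 0 <= A by apply: le_trans (normr_ge0 _) (XA 0 _); rewrite lexx.
have e0 : 0 < eta / (2 + A) by pos.
have [d1 d10 h1] := @heine_cantor R _ _ 0 T c1 _ e0.
have [d2 d20 h2] := @heine_cantor R _ _ 0 T c2 _ e0.
have e1 : eta / (2 + A) <= eta.
 rewrite ler_pdivrMr ?ltr_pwDl// ler_peMr ?(ltW eta0)//.
 lra.
exists (Num.min d1 d2); first by rewrite lt_min d10.
move=> s t sT; rewrite lt_min => /andP[st1 st2].
have k1 := ltW (h1 s t sT st1); have k2 := ltW (h2 s t sT st2).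
have l1 : `|(tincr N X s t).1| <= eta / (2 + A) by rewrite tincr1 distrC.
split; first exact: le_trans l1 e1.
case: (ltnP N 2) => N2; first by rewrite tincr2_level1// normr0 ltW.
rewrite tincr2E//; letr (ler_normB _ _).
have k3 : `|(X s).1^T *m ((X t).1 - (X s).1)| <= A * (eta / (2 + A)).
 letr (trmul_norm _ _); apply: ler_pM => //; first exact: XA.
 by rewrite distrC.
rewrite distrC in k2; letr (lerD k2 k3).
rewrite -{1}[eta / (2 + A)]mul1r -mulrDl mulrC mulrAC ler_pdivrMr ?ltr_pwDl//.
lra.
Qed.

Lemma euler_diff (d : nat) (al K : R) b sg L ta (dt : R) x1 x1' x2 x2' (a : 'rV[R]_d) :
 0 <= K -> @scheme_fields R d m N al K b sg L ta -> enorm (euler b sg ta dt x1 x2 a - euler b sg ta dt x1' x2' a) <=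
 K * (m%:R * `|x1 - x1'| + m%:R ^+ 2 * `|x2 - x2'|).
Proof.
move=> K0 sf.
have -> : euler b sg ta dt x1 x2 a - euler b sg ta dt x1' x2' a = euler b sg ta 0 (x1 - x1') (x2 - x2') a.
 rewrite /euler /fcomb scale0r add0r !opprD !addrA.
 have -> : \sum_i (x1 - x1') 0 i *: sg i a = \sum_i x1 0 i *: sg i a - \sum_i x1' 0 i *: sg i a.
 by rewrite -sumrB; apply: eq_bigr => i _; rewrite !mxE scalerBl.
 have -> : \sum_l \sum_i (x2 - x2') l i *: ta l i a =
 \sum_l \sum_i x2 l i *: ta l i a - \sum_l \sum_i x2' l i *: ta l i a.
 rewrite -sumrB; apply: eq_bigr => l _; rewrite -sumrB; apply: eq_bigr => i _.
 by rewrite !mxE scalerBl.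
 move: (\sum_i x1 0 i *: sg i a) (\sum_i x1' 0 i *: sg i a) (dt *: b a)
 (\sum_l \sum_i x2 l i *: ta l i a) (\sum_l \sum_i x2' l i *: ta l i a) => v1 v2 v3 v4 v5.
 by rowring.
by letr (euler_bounded K0 sf _ _ _ _); rewrite normr0 add0r.
Qed.

End TensorClose.

Lemma frac_quarter (R : realType) (Z x : R) : 0 <= Z -> 0 <= x -> Z * (x / (4 * (Z + 1))) <= x / 4.
Proof.
move=> Z0 x0; have Z1 : 0 < Z + 1 by pos.
rewrite (_ : Z * _ = x / 4 * (Z / (Z + 1))); last by field; rewrite gt_eqF.
by rewrite ler_piMr ?divr_ge0// ler_pdivrMr// mul1r lerDl.
Qed.

Lemma frac_quarter1 (R : realType) (Z x : R) : 0 <= Z -> 0 <= x -> x / (4 * (Z + 1)) <= x / 4.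
Proof.
move=> Z0 x0; have Z1 : 0 < Z + 1 by pos.
by rewrite invfM mulrA ler_pdivrMr// ler_peMr ?divr_ge0// lerDr.
Qed.

Section LimitDavie.
Context {R : realType} {m : nat}.
Variables (T p q K al : R).
Let N := Num.truncn p.
Hypotheses (T0 : 0 < T) (p1 : 1 <= p) (p3 : p < 3) (K0 : 0 <= K) (al0 : 0 < al) (al1 : al <= 1)
 (pq : p < q) (qN : q < N%:R + al).

Lemma level_cases : N = 1%N \/ N = 2%N.
Proof.
have h1 : (1 <= N)%N by rewrite truncn_ge_nat// (le_trans ler01).
have h2 : (N < 3)%N by rewrite truncn_lt_nat// (le_trans ler01).
by case: (N) h1 h2 => [|[|[|]]]//; [left|right].
Qed.

Lemma level_le : N%:R <= p.
Proof. by rewrite /N; have /andP[] := truncn_itv (le_trans ler01 p1). Qed.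

(** The part of the exponent in excess of [p] is spent on the smallness of the increments; the
    second level only offers half of it, which is used for both levels since [eta <= 1]. *)
Lemma rho_interpolate (X : R -> tens R m) (eta s t : R) : 0 < eta -> eta <= 1 ->
 `|(tincr N X s t).1| <= eta -> `|(tincr N X s t).2| <= eta ->
 rho N q X s t <= eta `^ ((q - p) / 2) * rho N p X s t + `|t - s|.
Proof.
move=> eta0 eta1 h1 h2; rewrite /rho.
have qp0 : 0 < q - p by pos.
have p0 : 0 < p by exact: lt_le_trans p1.
apply: lerD => //; rewrite [leRHS]mulrDr.
apply: ler_wpDr; first by pos.
rewrite mulrDr; apply: lerD.
 have hq (a : R) : a `^ q = a `^ (q - p) * a `^ p by rewrite -powRD_ge0 ?(ltW qp0) ?(ltW p0)// subrK.
 rewrite hq.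
 apply: ler_wpM2r; first done.
 letr (le_powR (ltW qp0) (normr_ge0 _) h1).
 apply: ger_powR; first by rewrite eta0.
 lra.
have -> : q / 2 = (q - p) / 2 + p / 2 by lra.
rewrite powRD_ge0 ?divr_ge0 ?(ltW qp0) ?(ltW p0)//.
apply: ler_wpM2r; first done.
by apply: le_powR => //; rewrite divr_ge0// ltW.
Qed.

(** The smooth approximations have uniformly bounded [p]-variation and converge uniformly, so on a
    fine mesh their controls at an exponent [q > p] are small uniformly in the index. Sewing at
    exponent [q] bounds their one-step errors uniformly, and on a fixed grid these errors pass to
    the limit. *)
Lemma rde_davie (d : nat) b sg L ta (xi : 'rV[R]_d) (X : R -> tens R m) (y : cpath T xi) :
 continuous X -> @scheme_fields R d m N al K b sg L ta -> rde_solution p b sg X y -> davie T (scheme N b sg ta X) y.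
Proof.
move=> cX sf [xn [yn [sm cvX [M XM] ode cvY]]].
have p0 : 0 < p by exact: lt_le_trans p1.
pose Xn n := canonical_lift N (xn n).
have [c1 c2] := tens_continuous cX.
have [A0 XA0] := continuous_bounded (ltW T0) c1.
pose A := `|A0| + 1.
have XA t : 0 <= t <= T -> `|(X t).1| <= A by move=> /XA0 h; letr h; letr (ler_norm _); rewrite lerDl.
have unif (eta : R) : 0 < eta -> exists n0, forall n, (n0 <= n)%N -> forall s t, 0 <= s <= T -> 0 <= t <= T ->
 `|(tincr N (Xn n) s t).1 - (tincr N X s t).1| <= eta /\ `|(tincr N (Xn n) s t).2 - (tincr N X s t).2| <= eta.
 move=> eta0; pose c := 2 + 8 * (A + 1).
 have c0 : 0 < c by pos.
 pose e := Num.min 1 (eta / c).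
 have e0 : 0 < e by rewrite lt_min ltr01 divr_gt0.
 have e1 : e <= 1 by rewrite ge_min lexx.
 have ec : c * e <= eta by rewrite mulrC -ler_pdivlMr// ge_min lexx orbT.
 have [n0 hn0] := cvX e e0; exists n0 => n nn0 s t sT tT.
 have close r : 0 <= r <= T -> `|(Xn n r).1| <= A + 1 /\ `|(Xn n r).1 - (X r).1| <= e /\
 ((2 <= N)%N -> `|(Xn n r).2 - (X r).2| <= (1 + (A + 1)) * e).
 move=> rT; have cc := hn0 n nn0 r rT.
 have [h1 _] := @ccdist_close R m N (Xn n r) (X r) `|(Xn n r).1| e e1 (lexx _) cc.
 have XnA : `|(Xn n r).1| <= A + 1.
 have -> : (Xn n r).1 = (X r).1 - ((X r).1 - (Xn n r).1) by rewrite opprB addrC subrK.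
 letr (ler_normB _ _); apply: lerD; first exact: XA.
 exact: le_trans h1 e1.
 have [_ h2] := @ccdist_close R m N (Xn n r) (X r) (A + 1) e e1 XnA cc.
 by split=> //; split; [rewrite distrC|move=> N2; rewrite distrC; exact: h2].
 have [s1 [s2 s3]] := close s sT; have [t1 [t2 t3]] := close t tT.
 have e'0 : 0 <= (1 + (A + 1)) * e by pos.
 have XsA : `|(X s).1| <= A + 1 by letr (XA s sT); rewrite lerDl.
 have [k1 k2] := tincr_close XsA s1 t1 s2 t2 s3 t3 e'0.
 have Ae : 0 <= A * e by pos.
 split; [apply: le_trans k1 _|letr k2]; apply: le_trans ec; rewrite /c.
 by move: Ae (ltW e0); move: (e) => x; nra.
 by move: Ae (ltW e0); move: (e) => x; nra.
have Mpos : 0 <= `|M| by [].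
have XM' n : (rough_pvar T p (Xn n) <= `|M|%:E)%E by letr (XM n); rewrite lee_fin ler_norm.
pose M' := 2 * `|M| `^ p + T.
have M'0 : 0 <= M' by pos.
have Nq : N%:R <= q by apply: le_trans level_le (ltW pq).
have [del [B [del0 B0 SB]]] := @scheme_bounds R m N K al q level_cases K0 al0 al1 Nq qN.
pose zeta := (N%:R + al) / q.
have q0 : 0 < q by exact: lt_trans p0 pq.
have z1 : 0 < zeta - 1 by rewrite subr_gt0 /zeta ltr_pdivlMr// mul1r.
move=> e e0.
pose C := B * (M' + T) + 1.
have C0 : 0 < C by pos.
have e20 : 0 < e / 2 by pos.
have [r r0 hr] := powR_small z1 (divr_gt0 e20 C0).
(* The factor gained by interpolation must push the control of a cell below the scale [del] of the
   sewing and below [r], where the surplus power [zeta - 1] of it is small; half of that room is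
   left for the mesh. *)
pose kap0 := Num.min (Num.min del r / (2 * (M' + 1))) 1.
have dr0 : 0 < Num.min del r by rewrite lt_min del0.
have M'1 : 0 < M' + 1 by pos.
have kap00 : 0 < kap0 by rewrite lt_min ltr01 andbT divr_gt0// mulr_gt0.
have qp20 : 0 < (q - p) / 2 by pos.
have [eta' eta'0 heta] := powR_small qp20 kap00.
pose eta := Num.min eta' 1.
have eta0 : 0 < eta by rewrite lt_min eta'0 ltr01.
have eta1 : eta <= 1 by rewrite ge_min lexx orbT.
pose kap := eta `^ ((q - p) / 2).
have kap_ge0 : 0 <= kap by pos.
have kapM : kap * M' <= Num.min del r / 2.
 have h : kap <= Num.min del r / (2 * (M' + 1)).
 letr (heta eta _); first by rewrite (ltW eta0) ge_min lexx.
 by rewrite ge_min lexx.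
 letr (ler_wpM2r M'0 h).
 rewrite (_ : _ * M' = Num.min del r / 2 * (M' / (M' + 1))); last by field; rewrite gt_eqF.
 rewrite ler_piMr ?divr_ge0 ?(ltW dr0)// ler_pdivrMr// mul1r lerDl//.
have kap1 : kap <= 1 by apply: powR_le1; [exact: ltW|rewrite eta1 (ltW eta0)].
have eta20 : 0 < eta / 2 by pos.
have [n1 hn1] := unif (eta / 2) eta20.
have [del1 del10 hX] := tincr_osc N (ltW T0) cX eta20.
exists (Num.min del1 (Num.min del r / 2)).
 by rewrite lt_min del10 divr_gt0.
move=> u n gu mesh.
have key k0 : (n1 <= k0)%N -> psum (fun s t => enorm (yn k0 t - (yn k0 s + scheme N b sg ta (Xn k0) s t (yn k0 s)))) u n
 <= e / 2.
 move=> nk.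
 have [V [XV VM]] : exists V : R -> R, (forall s t, 0 <= s -> s <= t -> t <= T -> rho N p (Xn k0) s t <= V t - V s)
 /\ V T - V 0 <= M'.
 apply: control_exists; first exact: ltW.
 by move=> s t; pos.
 by move=> v k gv; exact: (rough_pvar_psum T0 p0 erefl Mpos (XM' k0) gv).
 have VV s t : 0 <= s -> s <= t -> t <= T -> V s <= V t.
 by move=> s0 st tT; rewrite -subr_ge0; exact: le_trans (rho_ge0 _ _ _ _ _) (XV s t s0 st tT).
 pose W t := kap * V t + t.
 have cell k : (k < n)%N ->
 enorm (yn k0 (u k.+1) - (yn k0 (u k) + scheme N b sg ta (Xn k0) (u k) (u k.+1) (yn k0 (u k))))
 <= B * (W (u k.+1) - W (u k)) `^ zeta.
 move=> kn; have [a0 ab bT] := grid_cell gu kn.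
 have := mesh k kn; rewrite lt_min => /andP[mesh1 mesh2].
 set a := u k in a0 ab mesh1 mesh2 *; set c := u k.+1 in bT ab mesh1 mesh2 *.
 have XW s t : a <= s -> s <= t -> t <= c -> rho N q (Xn k0) s t <= W t - W s.
 move=> as_ st tc.
 have s0 : 0 <= s by exact: le_trans a0 as_.
 have tT : t <= T by exact: le_trans tc bT.
 have sT : 0 <= s <= T by rewrite s0 (le_trans st).
 have tT' : 0 <= t <= T by rewrite tT (le_trans s0).
 have st1 : `|s - t| < del1.
 rewrite ler0_norm ?subr_le0// opprB; apply: le_lt_trans mesh1.
 by apply: lerB.
 have [x1 x2] := hX s t sT st1; have [y1 y2] := hn1 k0 nk s t sT tT'.
 have bound (V' : normedModType R) (x x' : V') : `|x'| <= eta / 2 -> `|x - x'| <= eta / 2 -> `|x| <= eta.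
 move=> h h'; rewrite -[x](subrK x'); letr (ler_normD _ _).
 by rewrite (splitr eta) lerD.
 have := rho_interpolate eta0 eta1 (bound _ _ _ x1 y1) (bound _ _ _ x2 y2).
 rewrite (ger0_norm (_ : 0 <= t - s)) ?subr_ge0// => h.
 apply: le_trans h _; rewrite /W.
 have := ler_wpM2l kap_ge0 (XV s t s0 st tT).
 by rewrite -/kap mulrBr; move: (kap * _) (kap * _) (kap * _) => *; lra.
 have Vac : V c - V a <= M'.
 apply: le_trans VM; have := VV 0 a (lexx 0) a0 (le_trans ab bT).
 by have := VV c T (le_trans a0 ab) bT (lexx T); lra.
 have Wdel : W c - W a <= Num.min del r.
 rewrite /W (_ : _ - _ = kap * (V c - V a) + (c - a)); last by ring.
 rewrite [leRHS]splitr; apply: lerD; last exact: ltW.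
 by apply: le_trans kapM; exact: ler_wpM2l.
 (* Inside one cell the grid is refined until the Davie error of the smooth solution is below
    [e1 / 2]; the flow on this grid links the solution to a single Euler step. *)
 apply/ler_addgt0Pr => e1 e10.
 have e120 : 0 < e1 / 2 by pos.
 have [d2 d20 hd] := smooth_davie T0 K0 sf (sm k0) (ode k0) e120.
 have [l [l0 ld]] := fine_ugrid ab d20.
 pose v := ugrid a c l; have gv := ugrid_grid l0 ab.
 have gv0 : grid 0 T v l by exact: grid_sub gv.
 have hsum := hd v l gv0 _.
 have gc := rho_grid_control q0 XW gv.
 have v0 : v 0%N = a by exact: ugrid0.
 have vl : v l = c by exact: ugridn.
 have Wd : W (v l) - W (v 0%N) <= del by rewrite v0 vl; letr Wdel; rewrite ge_min lexx.
 have [s1 _ _ s4] := SB d b sg L ta sf (Xn k0) l v (fun i => W (v i)) gc Wd.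
 have k1 := s4 (fun i => yn k0 (v i)) 0%N l; rewrite !add0n in k1.
 have k2 := s1 0%N l (yn k0 a); rewrite !add0n in k2.
 have {}k1 := k1 (leqnn l); have {}k2 := k2 (leqnn l).
 rewrite /zz /om !v0 !vl in k2; rewrite !v0 !vl in k1.
 set fl := flow _ _ _ _ in k1 k2.
 letr (enorm_triangle _ fl _).
 rewrite addrC; apply: lerD; first exact: k2.
 apply: le_trans k1 _.
 have -> : e1 = 2 * (e1 / 2) by rewrite mulrC divfK.
 apply: ler_wpM2l => //; apply: hsum => i _.
 by rewrite /v ugridS.
 have W0 k : (k < n)%N -> 0 <= W (u k.+1) - W (u k) <= Num.min del r.
 move=> kn; have [a0 ab bT] := grid_cell gu kn.
 have h0 := VV _ _ a0 ab bT; have h1 := VV _ _ (lexx 0) a0 (le_trans ab bT).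
 have h2 := VV _ _ (le_trans a0 ab) bT (lexx T).
 have := mesh k kn; rewrite lt_min => /andP[_ /ltW mesh2].
 rewrite /W (_ : _ - _ = kap * (V (u k.+1) - V (u k)) + (u k.+1 - u k)); last by ring.
 rewrite addr_ge0 ?subr_ge0 ?mulr_ge0 ?subr_ge0//=.
 rewrite [leRHS]splitr; apply: lerD => //; apply: le_trans kapM.
 by apply: ler_wpM2l => //; lra.
 via (\sum_(0 <= k < n) e / 2 / C * B * (W (u k.+1) - W (u k))).
 rewrite /psum !big_nat; apply: ler_sum => k /andP[_ kn].
 letr (cell k kn); have /andP[w0 w1] := W0 k kn.
 set w := W _ - _ in w0 w1 *.
 have -> : w `^ zeta = w `^ (zeta - 1) * w.
 rewrite -{3}(powRr1 w0) -powRD_ge0 ?(ltW z1)//; congr powR.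
 by rewrite subrK.
 have h : w `^ (zeta - 1) <= e / 2 / C by apply: hr; rewrite w0 (le_trans w1)// ge_min lexx orbT.
 rewrite mulrA (mulrC B); apply: ler_wpM2r => //; exact: ler_wpM2r.
 rewrite -mulr_sumr telescope_sumr//.
 have WT : W (u n) - W (u 0%N) <= M' + T.
 have /andP[n0 nT] := grid_in gu (leqnn n); have /andP[z0 zT] := grid_in gu (leq0n n).
 have un : u 0%N <= u n by apply: (grid_mono gu); rewrite leq0n leqnn.
 have h0 := VV _ _ z0 un nT; have h1 := VV _ _ (lexx 0) z0 zT.
 have h2 := VV _ _ n0 nT (lexx T).
 rewrite /W (_ : _ - _ = kap * (V (u n) - V (u 0%N)) + (u n - u 0%N)); last by ring.
 apply: lerD; last by rewrite lerBlDr (le_trans nT)// lerDl.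
 via (1 * (V (u n) - V (u 0%N))); first by apply: ler_wpM2r; rewrite ?subr_ge0.
 by rewrite mul1r; lra.
 have eC0 : 0 <= e / 2 / C * B by pos.
 letr (ler_wpM2l eC0 WT).
 rewrite (_ : e / 2 / C * B * (M' + T) = e / 2 * (B * (M' + T) / C)); last by field; rewrite gt_eqF.
 rewrite ler_piMr ?divr_ge0 ?(ltW e0)// ler_pdivrMr// mul1r /C lerDl//.
(* From here the grid is fixed and the index of the approximation grows; each of the [n] cells may
   lose [eps]. *)
apply/ler_addgt0Pr => e1 e10; rewrite (splitr e) -addrA.
have [eps eps0 epsE] : exists2 eps, 0 < eps & eps = e1 / (2 * (n.+1)%:R).
 by exists (e1 / (2 * (n.+1)%:R)) => //; rewrite divr_gt0// mulr_gt0.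
have /choice [nk hnk] : forall k, exists n2, (k < n)%N -> forall n', (n2 <= n')%N ->
 enorm (y (u k.+1) - (y (u k) + scheme N b sg ta X (u k) (u k.+1) (y (u k)))) <=
 enorm (yn n' (u k.+1) - (yn n' (u k) + scheme N b sg ta (Xn n') (u k) (u k.+1) (yn n' (u k)))) + eps.
 move=> k; case: (ltnP k n) => kn; last by exists 0%N.
 have sT := grid_in gu (ltnW kn); have tT := grid_in gu kn.
 set s := u k in sT *; set t := u k.+1 in tT *.
 pose D := K * (`|t - s| + m%:R * `|(tincr N X s t).1| + m%:R ^+ 2 * `|(tincr N X s t).2|).
 have D0 : 0 <= D by pos.
 pose g1 := eps / (4 * (D + 1)); pose g2 := eps / (4 * (K * (m%:R + m%:R ^+ 2) + 1)).
 have Km : 0 <= K * (m%:R + m%:R ^+ 2) by pos.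
 have g10 : 0 < g1 by pos.
 have g20 : 0 < g2 by pos.
 have [n2 h2] := cvY g1 g10; have [n3 h3] := unif g2 g20.
 exists (maxn n2 n3) => _ n'; rewrite geq_max => /andP[n2n n3n].
 have ys := ltW (h2 n' n2n s sT); have yt := ltW (h2 n' n2n t tT).
 have [x1 x2] := h3 n' n3n s t sT tT.
 have dF : enorm (scheme N b sg ta (Xn n') s t (yn n' s) - scheme N b sg ta X s t (y s)) <=
 D * g1 + K * (m%:R + m%:R ^+ 2) * g2.
 letr (enorm_triangle _ (scheme N b sg ta X s t (yn n' s)) _).
 rewrite addrC; apply: lerD.
 letr (euler_lip K0 sf _ _ _ _ _).
 exact: ler_wpM2l.
 letr (euler_diff _ _ _ _ _ _ K0 sf).
 rewrite -mulrA; apply: ler_wpM2l => //; rewrite mulrDl.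
 by apply: lerD; apply: ler_wpM2l; rewrite ?exprn_ge0.
 have b1 : D * g1 <= eps / 4 by exact: frac_quarter (ltW eps0).
 have b2 : K * (m%:R + m%:R ^+ 2) * g2 <= eps / 4 by exact: frac_quarter (ltW eps0).
 have b3 : g1 <= eps / 4 by exact: frac_quarter1 (ltW eps0).
 have gen (a1 a2 f1 c1' c2' f2 : 'rV[R]_d) : a1 - (a2 + f1) = (c1' - (c2' + f2)) - (c1' - a1) + (c2' - a2) + (f2 - f1).
 by rowring.
 rewrite (gen _ _ _ (yn n' t) (yn n' s) (scheme N b sg ta (Xn n') s t (yn n' s))).
 letr (enormD _ _).
 letr (lerD (le_trans (enormD _ _) (lerD (enormB _ _) (lexx _))) (lexx _)).
 set Z := enorm (yn n' t - (_ + _)).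
 by move: ys yt dF b1 b2 b3; lra.
pose nn := maxn n1 (\max_(k < n) nk k).
have nnk k : (k < n)%N -> (nk k <= nn)%N by move=> kn; rewrite leq_max (leq_bigmax (Ordinal kn)) orbT.
via (psum (fun s t => enorm (yn nn t - (yn nn s
 + scheme N b sg ta (Xn nn) s t (yn nn s)))) u n + \sum_(0 <= k < n) eps).
 rewrite /psum -big_split /= !big_nat; apply: ler_sum => k /andP[_ kn].
 exact: hnk k kn nn (nnk k kn).
apply: lerD; first by apply: key; rewrite leq_maxl.
rewrite sumr_const_nat subn0 -[leLHS]mulr_natl epsE.
apply: ler_wpDl; first by pos.
rewrite mulrCA ler_piMr ?(ltW e10)// ler_pdivrMr// mul1r.
by rewrite -natrM ler_nat mul2n -addnn; rewrite (leq_trans (leqnSn n))// leq_addr.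
Qed.

End LimitDavie.
Section PowRContinuity.
Context {R : realType}.

Lemma norm_powR_continuous (a : R) : 0 < a -> continuous (fun x : R => `|x| `^ a).
Proof.
move=> a0 x; have [->|x0] := eqVneq x 0.
 rewrite /continuous_at normr0 powR0 ?gt_eqF//.
 apply/cvgrPdist_le => e e0; have [r r0 h] := powR_small a0 e0.
 exists r => //= y; rewrite /ball_ /= sub0r normrN => yr.
 by rewrite sub0r normrN ger0_norm//; apply: h; rewrite normr_ge0 ltW.
have nx0 : 0 < `|x| by rewrite normr_gt0.
apply: (@continuous_comp _ _ _ (fun y : R => `|y|) (fun y => y `^ a)).
 exact: norm_continuous.
apply: differentiable_continuous; apply/derivable1_diffP; apply: derivable_powR.
by rewrite in_itv/= nx0.
Qed.

End PowRContinuity.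

(** * Counting intervals of large variation *)

Section Counting.
Context {R : realType} {m : nat}.
Variables (N : nat) (p : R).
Hypothesis p0 : 0 < p.
Implicit Types (X : R -> tens R m) (s t de : R).

(** The grid keeps away from both end points, so a slightly smaller interval is still bad; the
    strict inequality for the sum makes the condition open in [X]. *)
Definition bad X de s t := exists u n, [/\ s < u 0%N, u n < t, grid s t u n & de < psum (rho N p X) u n].

(* n non-overlapping intervals on which the p-variation of X is large *)
Fixpoint cnt X de n s t := if n is n'.+1 then exists u, [/\ s <= u, u <= t, bad X de s u & cnt X de n' u t] else True.

Definition good X de s t := forall u n, grid s t u n -> psum (rho N p X) u n <= de.

Lemma bad_le X de s t s' t' : s' <= s -> t <= t' -> bad X de s t -> bad X de s' t'.
Proof.
move=> ss tt [u [n [h1 h2 h3 h4]]]; exists u, n; split=> //.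
- exact: le_lt_trans h1.
- exact: lt_le_trans tt.
- exact: grid_sub h3.
Qed.

Lemma cnt_le X de n s t s' t' : s' <= s -> t <= t' -> cnt X de n s t -> cnt X de n s' t'.
Proof.
elim: n s s' => [|n IH] s s' //= ss tt [u [h1 h2 h3 h4]]; exists u; split.
- exact: le_trans h1.
- exact: le_trans tt.
- exact: bad_le h3.
- exact: IH h4.
Qed.

Lemma bad_left X de s t : bad X de s t -> exists s', [/\ s < s', s' < t & bad X de s' t].
Proof.
move=> [u [n [h1 h2 h3 h4]]]; pose s' := (s + u 0%N) / 2.
have s1 : s < s' by rewrite ltr_pdivlMr; lra.
have s2 : s' < u 0%N by rewrite ltr_pdivrMr; lra.
exists s'; split=> //.
 apply: lt_trans s2 _; apply: le_lt_trans h2; apply: (grid_mono h3).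
 by rewrite leq0n leqnn.
exists u, n; split=> //; case: h3 => g1 g2 g3; split=> //; exact: ltW.
Qed.

Lemma bad_right X de s t : bad X de s t -> exists t', [/\ s < t', t' < t & bad X de s t'].
Proof.
move=> [u [n [h1 h2 h3 h4]]]; pose t' := (u n + t) / 2.
have s1 : u n < t' by rewrite ltr_pdivlMr; lra.
have s2 : t' < t by rewrite ltr_pdivrMr; lra.
exists t'; split=> //.
 apply: lt_trans s1; apply: lt_le_trans h1 _; apply: (grid_mono h3).
 by rewrite leq0n leqnn.
exists u, n; split=> //; case: h3 => g1 g2 g3; split=> //; exact: ltW.
Qed.

Lemma good_not_bad X de s t : good X de s t -> ~ bad X de s t.
Proof. by move=> g [u [n [_ _ /g]]]; rewrite leNgt => /negP. Qed.

Lemma bad_order X de s t : bad X de s t -> s < t.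
Proof. by move=> /bad_left[s' [h1 h2 _]]; exact: lt_trans h1 h2. Qed.

Lemma rho_id X s : rho N p X s s = 0.
Proof.
rewrite /rho tincr_id !normr0 subrr normr0 addr0 !powR0 ?addr0//.
 by pos.
by pos.
Qed.

Lemma rho_continuous X (a b : R -> R) : continuous X -> continuous a -> continuous b ->
 continuous (fun e => rho N p X (a e) (b e)).
Proof.
move=> cX ca cb; have [c1 c2] := tens_continuous cX.
have c1a : continuous (fun e => (X (a e)).1) by move=> e; apply: continuous_comp (ca e) (c1 _).
have c1b : continuous (fun e => (X (b e)).1) by move=> e; apply: continuous_comp (cb e) (c1 _).
have c2a : continuous (fun e => (X (a e)).2) by move=> e; apply: continuous_comp (ca e) (c2 _).
have c2b : continuous (fun e => (X (b e)).2) by move=> e; apply: continuous_comp (cb e) (c2 _).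
have n1 (V : normedModType R) (f : R -> V) (c : R) : 0 < c -> continuous f -> continuous (fun e => `|f e| `^ c).
 move=> c0 cf; have -> : (fun e => `|f e| `^ c) = (fun x : R => `|x| `^ c) \o (fun e => `|f e|).
 by apply/funext => e /=; rewrite normr_id.
 move=> e; apply: continuous_comp; last exact: norm_powR_continuous.
 exact: (continuous_comp (cf e) (@norm_continuous _ _ _)).
move=> e; apply: cvgD; first apply: cvgD.
- apply: (n1 _ (fun e => (tincr N X (a e) (b e)).1)) => // r.
 have -> : (fun e => (tincr N X (a e) (b e)).1) = (fun e => (X (b e)).1 - (X (a e)).1).
 by apply/funext => x; rewrite tincr1.
 by apply: cvgB; [exact: c1b|exact: c1a].
- apply: (n1 _ (fun e => (tincr N X (a e) (b e)).2)); first by pos.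
 move=> r; case: (ltnP N 2) => N2.
 have -> : (fun e => (tincr N X (a e) (b e)).2) = (fun=> 0) by apply/funext => x; rewrite tincr2_level1.
 exact: cvg_cst.
 have -> : (fun e => (tincr N X (a e) (b e)).2) = (fun e =>
 (X (b e)).2 - (X (a e)).2 - (X (a e)).1^T *m ((X (b e)).1 - (X (a e)).1)).
 by apply/funext => x; rewrite tincr2E.
 apply: cvgB; first by apply: cvgB; [exact: c2b|exact: c2a].
 apply/cvgrPdist_le => x x0.
 pose A := `|(X (a r)).1| + 1; pose D r := (X (b r)).1 - (X (a r)).1.
 have cD : continuous D by move=> z; apply: cvgB; [exact: c1b|exact: c1a].
 pose B := `|D r| + 1.
 have A0 : 0 < A by pos.
 have B0 : 0 < B by pos.
 have x20 : 0 < x / 2 by pos.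
 have /cvgrPdist_le/(_ _ (divr_gt0 x20 B0)) k1 := c1a r.
 have /cvgrPdist_le/(_ _ (divr_gt0 x20 A0)) k2 := cD r.
 have /cvgrPdist_le/(_ _ (ltr01)) k3 := c1a r.
 near=> z.
 have -> : (X (a r)).1^T *m ((X (b r)).1 - (X (a r)).1)
 - (X (a z)).1^T *m ((X (b z)).1 - (X (a z)).1) =
 ((X (a r)).1 - (X (a z)).1)^T *m D r + (X (a z)).1^T *m (D r - D z).
 by apply/matrixP => i j; rewrite /D !mxE !big_ord1 !mxE; ring.
 letr (ler_normD _ _); rewrite (splitr x); apply: lerD.
 letr (trmul_norm _ _).
 via (x / 2 / B * B); last by rewrite divfK// gt_eqF.
 apply: ler_pM => //; first by near: z; exact: k1.
 by rewrite /B lerDl.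
 letr (trmul_norm _ _).
 via (A * (x / 2 / A)); last by rewrite mulrC divfK// gt_eqF.
 apply: ler_pM => //; last by near: z; exact: k2.
 have h : `|(X (a r)).1 - (X (a z)).1| <= 1 by near: z; exact: k3.
 have -> : (X (a z)).1 = (X (a r)).1 - ((X (a r)).1 - (X (a z)).1) by rewrite opprB addrC subrK.
 by letr (ler_normB _ _); rewrite lerD2l.
- have cba : continuous (fun e => b e - a e) by move=> z; apply: cvgB; [exact: cb|exact: ca].
 exact: (continuous_comp (cba e) (@norm_continuous _ _ _)).
Unshelve. all: by end_near. Qed.

(** By continuity of [X], a grid whose sum exceeds [de] can be contracted slightly towards the
    midpoint [c] without losing the excess, and it then avoids the end points. *)
Lemma not_bad_good X de s t : continuous X -> 0 <= de -> s <= t -> ~ bad X de s t -> good X de s t.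
Proof.
move=> cX de0 st nb u n g; rewrite leNgt; apply/negP => lt_de.
have [est|nst] := eqVneq s t.
 move: lt_de; rewrite /psum big1_seq ?ltNge ?de0// => k; rewrite mem_index_iota => /andP[_ kn].
 have u1 : u k = s by apply/le_anti; have := grid_in g (ltnW kn); rewrite -est andbC.
 have u2 : u k.+1 = s by apply/le_anti; have := grid_in g kn; rewrite -est andbC.
 by rewrite u1 u2 rho_id.
pose c := (s + t) / 2.
pose v e k := u k + e * (c - u k).
have cv k : continuous (fun e => v e k).
 move=> e; apply: cvgD; first exact: cvg_cst.
 by apply: cvgM; [done|exact: cvg_cst].
have cps : continuous (fun e => psum (rho N p X) (v e) n).
 rewrite /psum; elim: n {g lt_de} => [|n IH].
 by under eq_fun do rewrite big_geq//; exact: cst_continuous.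
 under eq_fun do rewrite big_nat_recr//=.
 move=> e; apply: cvgD; first exact: IH.
 exact: (rho_continuous cX (cv n) (cv n.+1)).
have v0 : v 0 = u by apply/funext => k; rewrite /v mul0r addr0.
have /cvgrPdist_lt := cps 0; rewrite v0 => /(_ (psum (rho N p X) u n - de)).
rewrite subr_gt0 => /(_ lt_de) [r /= r0 hr].
pose e := Num.min (r / 2) (2^-1).
have e0 : 0 < e by rewrite lt_min divr_gt0//= invr_gt0.
have e1 : e < 1 by apply: (@le_lt_trans _ _ 2^-1); [rewrite ge_min lexx orbT|lra].
have er : e < r by apply: (@le_lt_trans _ _ (r / 2)); [rewrite ge_min lexx|rewrite ltr_pdivrMr// ltr_pMr// ltr1n].
have := hr e; rewrite /ball_ /= sub0r normrN gtr0_norm// => /(_ er) close.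
apply: nb; exists (v e), n.
have inside k : (k <= n)%N -> s < v e k < t.
 move=> kn; have /andP[h1 h2] := grid_in g kn.
 have c1 : s < c by rewrite ltr_pdivlMr; lra.
 have c2 : c < t by rewrite ltr_pdivrMr; lra.
 rewrite /v; move: (u k) h1 h2 => x h1 h2.
 rewrite (_ : x + e * (c - x) = (1 - e) * x + e * c); last by ring.
 have a1 : (1 - e) * s <= (1 - e) * x by apply: ler_wpM2l; lra.
 have a2 : (1 - e) * x <= (1 - e) * t by apply: ler_wpM2l; lra.
 have b1 : e * s < e * c by rewrite ltr_pM2l.
 have b2 : e * c < e * t by rewrite ltr_pM2l.
 lra.
split.
- by have /andP[] := inside 0%N (leq0n n).
- by have /andP[] := inside n (leqnn n).
- split.
 + by have /andP[/ltW] := inside 0%N (leq0n n).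
 + by have /andP[_ /ltW] := inside n (leqnn n).
 + move=> k kn; have [_ _ /(_ k kn) h] := g.
 rewrite /v (_ : u k + _ = (1 - e) * u k + e * c); last by ring.
 rewrite (_ : u k.+1 + _ = (1 - e) * u k.+1 + e * c); last by ring.
 by rewrite lerD2r; apply: ler_wpM2l => //; lra.
- by move: close; rewrite ltr_norml => /andP[_]; lra.
Qed.

Definition pieces X de k s t := exists c : nat -> R, [/\ c 0%N = s, c k = t &
 forall i, (i < k)%N -> c i <= c i.+1 /\ good X de (c i) (c i.+1)].

Lemma pieces_cons X de k s u t : s <= u -> good X de s u -> pieces X de k u t -> pieces X de k.+1 s t.
Proof.
move=> su g [c [c0 ck h]]; exists (fun i => if i is i'.+1 then c i' else s).
by split=> // -[|i] ik; [rewrite c0|exact: h].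
Qed.

Lemma pieces1 X de s t : s <= t -> good X de s t -> pieces X de 1 s t.
Proof.
move=> st g; apply: (pieces_cons (u := t)) => //.
by exists (fun=> t).
Qed.

Lemma pieces_addr X de k j s t : (k <= j)%N -> (0 < k)%N -> 0 <= de -> s <= t -> pieces X de k s t -> pieces X de j s t.
Proof.
move=> kj k0 de0 st P; rewrite -(subnK kj); elim: (j - k)%N => [//|l IH].
rewrite addSn; apply: (pieces_cons (u := s)) => // u n g.
rewrite /psum big1_seq// => i; rewrite mem_index_iota => /andP[_ iln].
have u1 : u i = s by apply/le_anti; have := grid_in g (ltnW iln); rewrite andbC.
have u2 : u i.+1 = s by apply/le_anti; have := grid_in g iln; rewrite andbC.
by rewrite u1 u2 rho_id.
Qed.

(** Greedy decomposition: the longest good interval from [s] to [t1], followed by a short good one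
    from [t1] to [t']. As the interval from [s] to [t'] is bad, two pieces use up one unit of the
    count, and one last piece remains. *)
Lemma cnt_pieces X de n s t : continuous X -> 0 <= de -> s <= t -> ~ cnt X de n.+1 s t -> pieces X de (2 * n).+1 s t.
Proof.
move=> cX de0; elim: n s => [|n IH] s st nc.
 rewrite muln0; apply: pieces1 => //; apply: not_bad_good => // b.
 by apply: nc; exists t.
have [g|ng] := pselect (good X de s t).
 by apply: (@pieces_addr X de 1) => //; exact: pieces1.
pose S := [set u | s <= u <= t /\ good X de s u].
have gs : good X de s s by apply: not_bad_good => // /bad_order; rewrite ltxx.
have Ss : S s by split=> //; rewrite lexx st.
have Sub : has_ubound S by exists t => u [/andP[]].
have Ssup : has_sup S by split; [exists s|].
pose t1 := sup S.
have st1 : s <= t1 by apply: ub_le_sup.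
have t1t : t1 <= t by apply: ge_sup; [exists s|move=> u [/andP[]]].
have g1 : good X de s t1.
 apply: not_bad_good => // /bad_right[t' [h1 h2 h3]].
 have t1t' : 0 < t1 - t' by pos.
 have [u [uS gu]] := sup_adherent t1t' Ssup.
 rewrite opprB addrC subrK => /ltW t'u.
 exact: (good_not_bad gu (bad_le (lexx s) t'u h3)).
have lt1 : t1 < t.
 rewrite lt_neqAle t1t andbT; apply/eqP => e; by apply: ng; rewrite -e.
have after t' : t1 < t' -> t' <= t -> bad X de s t'.
 move=> h1 h2; apply: contrapT => nb.
 have : t' <= t1.
 apply: ub_le_sup => //; split; first lra.
 by apply: not_bad_good => //; rewrite (le_trans st1)// ltW.
 by rewrite leNgt h1.
(* If all intervals with left end [t1] were bad, shrinking them from the left would stack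
   arbitrarily many bad intervals to the right of [t1]. *)
have [t' [h1 h2 h3]] : exists t', [/\ t1 < t', t' <= t & good X de t1 t'].
 apply: contrapT => nex.
 have allbad t' : t1 < t' -> t' <= t -> bad X de t1 t'.
 move=> h1 h2; apply: contrapT => nb; apply: nex; exists t'; split=> //.
 by apply: not_bad_good => //; exact: ltW.
 have many k t' : t1 < t' -> t' <= t -> exists2 s', t1 < s' <= t' & cnt X de k s' t'.
 elim: k t' => [|k IHk] t' h1 h2; first by exists t'; rewrite ?h1 ?lexx.
 have [s' [k1 k2 k3]] := bad_left (allbad t' h1 h2).
 have [s'' /andP[l1 l2] l3] := IHk s' k1 (le_trans (ltW k2) h2).
 exists s''; first lra.
 clear IHk; elim: k s'' l1 l2 l3 => [|k IHk] s'' l1 l2 /=.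
 by move=> _; exists t'; split=> //; [rewrite (le_trans l2)// ltW|exact: bad_le k3].
 move=> [u [e1 e2 e3 e4]]; exists u; split=> //; first lra.
 by apply: IHk => //; exact: lt_le_trans l1 e1.
 have [s' /andP[k1 k2] k3] := many n.+2 t lt1 (lexx t).
 by apply: nc; apply: cnt_le k3; rewrite ?(le_trans st1)// ltW.
have nc' : ~ cnt X de n.+1 t' t.
 move=> c; apply: nc; exists t'; split=> //.
 lra.
 exact: after.
have P := IH t' h2 nc'.
rewrite mulnS add2n.
apply: (pieces_cons st1 g1); apply: (pieces_cons (ltW h1) h3); exact: P.
Qed.

Lemma cnt_control X de n s t (W : R -> R) a b : (forall s t, a <= s -> s <= t -> t <= b -> rho N p X s t <= W t - W s) ->
 a <= s -> s <= t -> t <= b -> cnt X de n s t -> n%:R * de <= W t - W s.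
Proof.
move=> XW; have W0 s' t' : a <= s' -> s' <= t' -> t' <= b -> 0 <= W t' - W s'.
 by move=> h1 h2 h3; exact: le_trans (rho_ge0 _ _ _ _ _) (XW _ _ h1 h2 h3).
elim: n s => [|n IH] s as_ st tb; first by rewrite mul0r => _; exact: W0.
move=> [u [su ut [v [k [h1 h2 h3 h4]]] c]].
have := IH u (le_trans as_ su) ut tb c.
have g : grid a b v k by apply: grid_sub h3; [|exact: le_trans tb].
have := psum_control XW g => h5.
have vk : v 0%N <= v k by apply: (grid_mono h3); rewrite leq0n leqnn.
have k1 := W0 s (v 0%N) as_ (ltW h1) (le_trans vk (le_trans (ltW h2) (le_trans ut tb))).
have k2 := W0 (v k) u (le_trans as_ (le_trans (ltW h1) vk)) (ltW h2) (le_trans ut tb).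
lra; lra.
Qed.

Lemma cnt_finite X de (M : R) (T : R) : 0 < de -> 0 <= T -> (forall u n, grid 0 T u n -> psum (rho N p X) u n <= M) ->
 exists n0, forall n, (n0 <= n)%N -> ~ cnt X de n 0 T.
Proof.
move=> de0 T0 XM; have [W [XW WM]] := control_exists T0 (rho_ge0 N p X) XM.
exists (Num.truncn (M / de)).+1 => n nn c.
have := cnt_control XW (lexx 0) T0 (lexx T) c; apply/negP; rewrite -ltNge.
apply: (le_lt_trans WM); rewrite -ltr_pdivrMr//.
by apply: lt_le_trans (truncnS_gt _) _; rewrite ler_nat.
Qed.

End Counting.

(** * Effect of a translation on increments, count and solutions *)

Section Translation.
Context {R : realType} {m : nat}.
Variables (N : nat) (T : R) (h : cpath T (0 : 'rV[R]_m)) (X X' : R -> tens R m) (V : R -> R).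
Hypotheses (T0 : 0 < T) (tr : is_translation T N h X X').
Hypothesis hV : forall s t, 0 <= s -> s <= t -> t <= T -> enorm (h t - h s) <= V t - V s.
Implicit Types s t a b : R.

(** The second levels differ by three cross integrals with [h]; each is at most an oscillation,
    bounded by 1, times the variation of [h]. *)
Lemma translation_close a b : 0 <= a -> a <= b -> b <= T ->
 (forall s t, a <= s -> s <= t -> t <= b -> `|(tincr N X s t).1| <= 1) ->
 (forall s t, a <= s -> s <= t -> t <= b -> `|h t - h s| <= 1) ->
 `|(tincr N X a b).1 - (tincr N X' a b).1| <= V b - V a /\ `|(tincr N X a b).2 - (tincr N X' a b).2| <= 3 * (V b - V a).
Proof.
move=> a0 ab bT xo ho.
have V0 : 0 <= V b - V a by exact: le_trans (enorm_ge0 _) (hV a0 ab bT).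
split.
 have -> : (tincr N X' a b).1 = (X b).1 + h b - ((X a).1 + h a) by rewrite tr.
 rewrite tincr1 (_ : _ - _ = - (h b - h a)); last by rowring.
 by rewrite normrN; letr (norm_le_enorm _); exact: hV.
have [N2|N2] := ltnP N 2.
 by rewrite !tincr2_level1// subr0 normr0 mulr_ge0.
have -> : (tincr N X' a b).2 = (tincr N X a b).2 + cross_integral (fun t => (X t).1) h a b
 + cross_integral h (fun t => (X t).1) a b + cross_integral h h a b by rewrite tr// /translation /level2 N2.
set Y := (tincr N X a b).2.
have -> : Y - (Y + cross_integral (fun t => (X t).1) h a b + cross_integral h (fun t => (X t).1) a b
 + cross_integral h h a b) = - (cross_integral (fun t => (X t).1) h a b
 + cross_integral h (fun t => (X t).1) a b + cross_integral h h a b).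
 by move: Y (cross_integral _ _ _ _) (cross_integral _ _ _ _) (cross_integral _ _ _ _) => A B C D;
 apply/matrixP => i j; rewrite !mxE; ring.
rewrite normrN.
have osc (f : R -> 'rV[R]_m) i : (forall s t, a <= s -> s <= t -> t <= b -> `|f t - f s| <= 1) ->
 forall s t, a <= s <= b -> a <= t <= b -> `|f t 0 i - f s 0 i| <= 1.
 move=> fo s t /andP[s1 s2] /andP[t1 t2].
 have -> : f t 0 i - f s 0 i = (f t - f s) 0 i by rewrite !mxE.
 letr (mx_norm_ge _ _ _).
 by have [st|/ltW st] := leP s t; [|rewrite distrC]; exact: fo.
have xo' i := osc (fun t => (X t).1) i (fun s t h1 h2 h3 =>
 eq_ind _ (fun z => `|z| <= 1) (xo s t h1 h2 h3) _ (tincr1 N X s t)).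
have ho' i := osc h i ho.
have hV' i s t : a <= s -> s <= t -> t <= b -> `|h t 0 i - h s 0 i| <= V t - V s.
 move=> h1 h2 h3; apply: le_trans (hV (le_trans a0 h1) h2 (le_trans h3 bT)).
 have -> : h t 0 i - h s 0 i = (h t - h s) 0 i by rewrite !mxE.
 exact: coord_le_enorm.
have mxb (A : 'M[R]_m) : (forall i j, `|A i j| <= V b - V a) -> `|A| <= V b - V a.
 by move=> H; rewrite [leLHS]mx_normrE; apply: bigmax_le => // -[i j] _ /=.
have c1 : `|cross_integral (fun t => (X t).1) h a b| <= V b - V a.
 apply: mxb => i j; rewrite mxE -[leRHS]mul1r.
 by apply: (@young_BV_right R (fun u => (X u).1 0 i) (fun u => h u 0 j) V) => //; [exact: hV'|exact: xo'].
have c2 : `|cross_integral h (fun t => (X t).1) a b| <= V b - V a.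
 apply: mxb => i j; rewrite mxE -[leRHS]mul1r.
 by apply: (@young_BV_left R (fun u => (X u).1 0 j) (fun u => h u 0 i) V) => //; [exact: hV'|exact: xo'].
have c3 : `|cross_integral h h a b| <= V b - V a.
 apply: mxb => i j; rewrite mxE -[leRHS]mul1r.
 by apply: (@young_BV_right R (fun u => h u 0 i) (fun u => h u 0 j) V) => //; [exact: hV'|exact: ho'].
letr (ler_normD _ _); have := ler_normD
 (cross_integral (fun t => (X t).1) h a b) (cross_integral h (fun t => (X t).1) a b).
by lra.
Qed.

Lemma powR_add_le (q x y : R) : 0 <= q -> 0 <= x -> 0 <= y -> (x + y) `^ q <= 2 `^ q * (x `^ q + y `^ q).
Proof.
move=> q0 x0 y0; wlog xy : x y x0 y0 / x <= y.
 move=> H; have [xy|/ltW yx] := leP x y; first exact: H.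
 by rewrite addrC [in leRHS]addrC; exact: H.
via ((2 * y) `^ q).
 by apply: le_powR => //; [exact: addr_ge0|lra].
rewrite powRM// ; apply: ler_wpM2l; first done.
by rewrite lerDr powR_ge0.
Qed.

Variable p : R.
Hypotheses (p1 : 1 <= p) (p3 : p < 3) (Np : (2 <= N)%N -> 2 <= p).
Let p0 : 0 < p. Proof. exact: lt_le_trans p1. Qed.

Lemma powR2_le8 (q : R) : 0 <= q -> q <= 3 -> 2 `^ q <= 8.
Proof.
move=> q0 q3; have -> : 8 = 2 `^ 3%:R :> R by rewrite powR_mulrn//; ring.
by apply: ler_powR => //; lra.
Qed.

(** The 8 bounds 2 to the power [p]; the 32 adds 8 from the first level and [8 * 3] from the second.
    For N = 2 the exponent [p / 2] is at least 1, which keeps the bound linear in the variation of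
    [h]. *)
Lemma rho_translation a b : 0 <= a -> a <= b -> b <= T ->
 (forall s t, a <= s -> s <= t -> t <= b -> `|(tincr N X s t).1| <= 1) ->
 (forall s t, a <= s -> s <= t -> t <= b -> `|h t - h s| <= 1) -> 3 * (V b - V a) <= 1 ->
 rho N p X' a b <= 8 * rho N p X a b + 32 * (V b - V a).
Proof.
move=> a0 ab bT xo ho V1; have [c1 c2] := translation_close a0 ab bT xo ho.
have V0 : 0 <= V b - V a by exact: le_trans (enorm_ge0 _) (hV a0 ab bT).
rewrite /rho; set v := V b - V a in c1 c2 V1 V0 *.
have v1 : v <= 1 by lra.
set x1 := (tincr N X a b).1 in c1 *; set x2 := (tincr N X a b).2 in c2 *.
set y1 := (tincr N X' a b).1 in c1 *; set y2 := (tincr N X' a b).2 in c2 *.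
have tri (W : normedModType R) (x y : W) c : `|x - y| <= c -> `|y| <= `|x| + c.
 by move=> H; have := ler_normB x (x - y); rewrite opprB addrC subrK; lra.
have e1 : `|y1| `^ p <= 8 * (`|x1| `^ p + v).
 via ((`|x1| + v) `^ p).
 by apply: le_powR => //; [exact: ltW|exact: tri].
 letr (powR_add_le _ _ _) => //; first exact: ltW.
 apply: ler_pM; rewrite ?addr_ge0//; first exact: powR2_le8 (ltW p0) (ltW p3).
 by apply: lerD => //; apply: powR_leid => //; rewrite V0.
have e2 : `|y2| `^ (p / 2) <= 8 * (`|x2| `^ (p / 2) + 3 * v).
 case: (ltnP N 2) => N2.
 rewrite /y2 tincr2_level1// normr0 powR0 ?mulf_neq0 ?gt_eqF//.
 by pos.
 have h1 : 1 <= p / 2 by rewrite ler_pdivlMr// mul1r; exact: Np.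
 have h0 : 0 <= p / 2 by pos.
 via ((`|x2| + 3 * v) `^ (p / 2)).
 by apply: le_powR => //; exact: tri.
 have v3 : 0 <= 3 * v by pos.
 letr (powR_add_le _ _ _) => //.
 apply: ler_pM; rewrite ?addr_ge0//.
 by apply: powR2_le8; [rewrite divr_ge0// ltW|rewrite (le_trans _ (ltW p3))// ler_piMr ?(ltW p0)// invf_le1 ?ler1n].
 by apply: lerD => //; apply: powR_leid => //; rewrite v3.
have := normr_ge0 (b - a); move: (`|x1| `^ p) (`|x2| `^ (p / 2)) e1 e2 => A B e1 e2; lra.
Qed.

(** If both alternatives fail, the sums of [X'] are at most [8 * (de / 16) + 32 * (de / 64) = de].
    The small variation of [X] also provides the oscillation bound 1 that [rho_translation] asks
    for. *)
Lemma bad_translation de s t : de <= 1 -> 0 <= s -> t <= T -> bad N p X' de s t ->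
 bad N p X (de / 16) s t \/ de / 64 < V t - V s.
Proof.
move=> de1 s0 tT [u [n [h1 h2 g h4]]]; apply: contrapT => /not_orP[nb /negP].
rewrite -leNgt => Vst.
have small v k : s < v 0%N -> v k < t -> grid s t v k -> psum (rho N p X) v k <= de / 16.
 by move=> k1 k2 k3; rewrite leNgt; apply/negP => k4; apply: nb; exists v, k.
have VV a b : 0 <= a -> a <= b -> b <= T -> 0 <= V b - V a.
 by move=> k1 k2 k3; exact: le_trans (enorm_ge0 _) (hV k1 k2 k3).
have u0n : u 0%N <= u n by apply: (grid_mono g); rewrite leq0n leqnn.
have V64 a b : s <= a -> a <= b -> b <= t -> V b - V a <= de / 64.
 move=> k1 k2 k3; have := VV s a s0 k1 (le_trans k2 (le_trans k3 tT)).
 by have := VV b t (le_trans s0 (le_trans k1 k2)) k3 tT; lra.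
have cell k : (k < n)%N -> rho N p X' (u k) (u k.+1) <= 8 * rho N p X (u k) (u k.+1) + 32 * (V (u k.+1) - V (u k)).
 move=> kn; have [a0 ab bt] := grid_cell g kn.
 have sa : s < u k by apply: lt_le_trans h1 _; apply: (grid_mono g); rewrite leq0n ltnW.
 have bt' : u k.+1 < t by apply: le_lt_trans h2; apply: (grid_mono g); rewrite kn leqnn.
 apply: rho_translation => //.
 - exact: le_trans a0.
 - exact: le_trans bt tT.
 - move=> e f ae ef fb.
 pose w i := if i is 0%N then e else f.
 have := small w 1%N (lt_le_trans sa ae) (le_lt_trans fb bt').
 rewrite /psum big_nat1 /= => H.
 have {}H : rho N p X e f <= de / 16.
 apply: H; split=> //=; [exact: le_trans (ltW sa) ae|exact: le_trans fb (ltW bt')|].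
 by case.
 rewrite leNgt; apply/negP => gt1; move: H; apply/negP; rewrite -ltNge.
 apply: (@lt_le_trans _ _ 1); first by lra.
 have : 1 <= `|(tincr N X e f).1| `^ p.
 by have {1}-> : 1 = 1 `^ p :> R; [rewrite powR1|apply: le_powR; rewrite ?ltW].
 rewrite /rho; have := powR_ge0 (`|(tincr N X e f).2|) (p / 2).
 by have := normr_ge0 (f - e); lra.
 - move=> e f ae ef fb; letr (norm_le_enorm _).
 have se := le_trans (ltW sa) ae; have ft := le_trans fb (ltW bt').
 letr (hV (le_trans s0 se) ef (le_trans ft tT)).
 by have := V64 e f se ef ft; lra.
 - by have := V64 _ _ (ltW sa) ab (ltW bt'); lra.
move: h4; apply/negP; rewrite -leNgt.
via (8 * psum (rho N p X) u n + 32 * (V (u n) - V (u 0%N))).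
 rewrite -(telescope_sumr (V \o u))// /psum !mulr_sumr -big_split/= !big_nat.
 by apply: ler_sum => k /andP[_ kn]; exact: cell.
have := small u n h1 h2 g; have := V64 _ _ (ltW h1) u0n (ltW h2); lra.
Qed.

Lemma cnt_translation de n s t : de <= 1 -> 0 <= s -> s <= t -> t <= T -> cnt N p X' de n s t ->
 exists k j, [/\ (n <= k + j)%N, cnt N p X (de / 16) k s t & j%:R * (de / 64) <= V t - V s].
Proof.
move=> de1; elim: n s => [|n IH] s s0 st tT /=.
 move=> _; exists 0%N, 0%N; split=> //; rewrite mul0r.
 exact: le_trans (enorm_ge0 _) (hV s0 st tT).
move=> [u [su ut b c]].
have Vsu := le_trans (enorm_ge0 _) (hV s0 su (le_trans ut tT)).
have [k [j [nkj ck jV]]] := IH u (le_trans s0 su) ut tT c.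
have [b'|b'] := bad_translation de1 s0 (le_trans ut tT) b.
 exists k.+1, j; split=> //; last by lra.
 by exists u.
exists k, j.+1; split.
- by rewrite addnS ltnS.
- exact: cnt_le ck.
- lra; lra.
Qed.

(** One Euler step along [X'] differs from one along [X] by the estimate of [translation_close].
    Hence a solution for the translated driver is a solution for [X] up to an error proportional to
    the variation of [h]. *)
Lemma davie_translation (d : nat) (al K : R) (b : 'rV[R]_d -> 'rV[R]_d) sg L ta (y : R -> 'rV[R]_d) :
 0 <= K -> @scheme_fields R d m N al K b sg L ta -> continuous X -> davie T (scheme N b sg ta X') y ->
 forall e : R, 0 < e -> exists2 del : R, 0 < del & forall u n, grid 0 T u n ->
 (forall k, (k < n)%N -> u k.+1 - u k < del) ->
 psum (fun s t => enorm (y t - (y s + scheme N b sg ta X s t (y s)))) u n <=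
 e + K * (m%:R + 3 * m%:R ^+ 2) * (V (u n) - V (u 0%N)).
Proof.
move=> K0 sf cX dy e e0; have [d1 d10 hd] := dy e e0.
have [d2 d20 ho] := tincr_osc N (ltW T0) cX ltr01.
have ch : continuous h by case: h => ? [].
have [d3 d30 hh] := @heine_cantor R _ h 0 T ch 1 ltr01.
exists (Num.min d1 (Num.min d2 d3)); first by rewrite !lt_min d10 d20.
move=> u n g mesh.
have M k : (k < n)%N -> [/\ u k.+1 - u k < d1, u k.+1 - u k < d2 & u k.+1 - u k < d3].
 by move=> kn; have := mesh k kn; rewrite !lt_min => /and3P[].
via (psum (fun s t => enorm (y t - (y s + scheme N b sg ta X' s t (y s)))) u n
 + K * (m%:R + 3 * m%:R ^+ 2) * (V (u n) - V (u 0%N))); last first.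
 by rewrite lerD2r; apply: hd => // k kn; have [] := M k kn.
rewrite -(telescope_sumr (V \o u))// /psum mulr_sumr -big_split/= !big_nat.
apply: ler_sum => k /andP[_ kn].
have [a0 ab bT] := grid_cell g kn.
have [_ m2 m3] := M k kn.
have cl s t : u k <= s -> s <= t -> t <= u k.+1 -> `|s - t| <= u k.+1 - u k.
 by move=> k1 k2 k3; rewrite ler0_norm; lra.
have [c1 c2] : `|(tincr N X (u k) (u k.+1)).1 - (tincr N X' (u k) (u k.+1)).1| <= V (u k.+1) - V (u k) /\
 `|(tincr N X (u k) (u k.+1)).2 - (tincr N X' (u k) (u k.+1)).2| <= 3 * (V (u k.+1) - V (u k)).
 apply: translation_close => // s t k1 k2 k3.
 have sT : 0 <= s <= T by lra.
 by have [] := ho s t sT (le_lt_trans (cl s t k1 k2 k3) m2).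
 have sT : 0 <= s <= T by lra.
 by rewrite distrC; apply/ltW/hh => //; exact: le_lt_trans (cl s t k1 k2 k3) m3.
set s := u k in c1 c2 *; set t := u k.+1 in c1 c2 *.
letr (enorm_triangle _ (y s + scheme N b sg ta X' s t (y s)) _).
apply: lerD => //; rewrite opprD addrACA subrr add0r enormBC.
letr (euler_diff _ _ _ _ _ _ K0 sf).
rewrite -mulrA; apply: ler_wpM2l => //.
rewrite mulrDl (mulrC 3) -[_ * 3 * _]mulrA; apply: lerD; first exact: ler_wpM2l.
by apply: ler_wpM2l => //.
Qed.

End Translation.

(** * Stability of solutions over finitely many good pieces *)

Section PiecewiseVariation.
Context {R : realType}.

(** Young's inequality for conjugate exponents compares each power with the tangent at the mean [s];
    summation over [i] gives the claim. *)
Lemma power_mean (p : R) n (a : nat -> R) : 1 <= p -> (forall i, 0 <= a i) ->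
 (\sum_(0 <= i < n) a i) `^ p <= n%:R `^ (p - 1) * \sum_(0 <= i < n) a i `^ p.
Proof.
move=> p1 a0; have p0 : 0 < p by lra.
have [->|n0] := eqVneq n 0%N; first by rewrite !big_geq// mulr0 powR0// gt_eqF.
have nR : 0 < n%:R :> R by rewrite ltr0n lt0n.
have [->|p1'] := eqVneq p 1.
 rewrite subrr powRr0 mul1r powRr1 ?sumr_ge0//.
 by apply: ler_sum => i _; rewrite powRr1.
have lp : 1 < p by lra.
have p10 : 0 < p - 1 by pos.
pose q := p / (p - 1); have q0 : 0 < q by pos.
have pq : p^-1 + q^-1 = 1 by rewrite /q; field; rewrite !gt_eqF.
set A := \sum_(0 <= i < n) a i; pose s := A / n%:R.
have A0 : 0 <= A by apply: sumr_ge0.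
have s0 : 0 <= s by pos.
have sp : s * s `^ (p - 1) = s `^ p by rewrite -{1}(powRr1 s0) -powRD_ge0 ?ltW// addrC subrK.
have step i : a i * s `^ (p - 1) <= a i `^ p / p + s `^ p / q.
 have := conjugate_powR (a0 i) (powR_ge0 s (p - 1)) p0 q0 pq.
 by rewrite -powRrM /q mulrCA mulfV ?gt_eqF// mulr1.
have : \sum_(0 <= i < n) a i * s `^ (p - 1) <= (\sum_(0 <= i < n) a i `^ p) / p + n%:R * (s `^ p / q).
 rewrite -[n in n%:R]subn0 mulr_natl -sumr_const_nat mulr_suml -big_split /=.
 exact: ler_sum.
rewrite -mulr_suml -/A.
have -> : A = n%:R * s by rewrite mulrCA mulfV ?gt_eqF// mulr1.
rewrite -mulrA sp powRM// => H.
have {}H : n%:R * s `^ p <= \sum_(0 <= i < n) a i `^ p.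
 have p'0 : 0 < p^-1 by pos.
 have E : n%:R * s `^ p = n%:R * s `^ p * p^-1 + n%:R * (s `^ p / q) by rewrite mulrA -mulrDr pq mulr1.
 by rewrite -(ler_pM2r p'0); move: H E; move: (n%:R * s `^ p) => z; lra.
have -> : n%:R `^ p = n%:R `^ (p - 1) * n%:R :> R by rewrite -{3}(powRr1 (ltW nR)) -powRD_ge0 ?subrK// ltW.
by rewrite -mulrA; apply: ler_wpM2l.
Qed.

(** [z i] is the path frozen outside the i-th piece, so an increment over any interval is the sum of
    the increments of all [z i]; a grid clipped to a piece is a grid of that piece. *)
Lemma pieces_psum (d : nat) (y : R -> 'rV[R]_d) (p M : R) (c : nat -> R) n :
 1 <= p -> 0 <= M -> (forall i, (i < n)%N -> c i <= c i.+1 /\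
 forall u k, grid (c i) (c i.+1) u k -> psum (fun s t => enorm (y t - y s) `^ p) u k <= M `^ p) ->
 forall u k, grid (c 0%N) (c n) u k -> psum (fun s t => enorm (y t - y s) `^ p) u k <= (n%:R * M) `^ p.
Proof.
move=> p1 M0 H u k g; have p0 : 0 < p by lra.
pose z i t := y (Num.max (c i) (Num.min t (c i.+1))) - y (c i).
have zE i t : (i < n)%N -> z i t = y (Num.min t (c i.+1)) - y (Num.min t (c i)).
 move=> i_n; have [ci _] := H i i_n; rewrite /z.
 have [tc|ct] := ltP t (c i).
 have -> : Num.min t (c i.+1) = t by apply/min_idPl; exact: le_trans (ltW tc) ci.
 by rewrite (max_idPl (ltW tc)) !subrr.
 congr (y _ - _).
 by apply/max_idPr; rewrite le_min ct.
have yz s t : c 0%N <= s <= c n -> c 0%N <= t <= c n -> y t - y s = \sum_(0 <= i < n) (z i t - z i s).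
 move=> /andP[s1 s2] /andP[t1 t2].
 rewrite big_nat (eq_bigr (fun i => (y (Num.min t (c i.+1)) - y (Num.min s (c i.+1)))
 - (y (Num.min t (c i)) - y (Num.min s (c i))))); last first.
 move=> i /andP[_ i_n]; rewrite !zE// !opprB addrACA [RHS]addrACA; congr (_ + _).
 by rewrite addrC.
 rewrite -big_nat (telescope_sumr (fun i => y (Num.min t (c i)) - y (Num.min s (c i))))//.
 by rewrite (min_idPl t2) (min_idPl s2) (min_idPr t1) (min_idPr s1) subrr subr0.
pose f i s t := enorm (z i t - z i s).
have fsum i : (i < n)%N -> psum (fun s t => f i s t `^ p) u k <= M `^ p.
 move=> i_n; have [ci Hi] := H i i_n.
 pose v j := Num.max (c i) (Num.min (u j) (c i.+1)).
 have gv : grid (c i) (c i.+1) v k.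
 case: g => g1 g2 g3; split.
 - by rewrite le_max lexx.
 - by rewrite ge_max ci ge_min lexx orbT.
 - move=> j jk; rewrite ge_max le_max lexx /= le_max; apply/orP; right.
 by rewrite le_min !ge_min g3//= lexx orbT.
 apply: le_trans (Hi v k gv); apply: ler_sum => j _.
 by rewrite /f /z opprB addrA subrK.
via (\sum_(0 <= j < k) n%:R `^ (p - 1) * \sum_(0 <= i < n) f i (u j) (u j.+1) `^ p).
 rewrite /psum !big_nat; apply: ler_sum => j /andP[_ jk].
 rewrite (yz _ _ (grid_in g (ltnW jk)) (grid_in g jk)).
 via ((\sum_(0 <= i < n) f i (u j) (u j.+1)) `^ p).
 by apply: le_powR => //; [exact: ltW|exact: enorm_sum].
 by apply: (@power_mean p n (fun i => f i (u j) (u j.+1))) => // i; exact: enorm_ge0.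
rewrite -mulr_sumr exchange_big/=.
have -> : (n%:R * M) `^ p = n%:R `^ (p - 1) * \sum_(0 <= i < n) M `^ p.
 rewrite sumr_const_nat subn0 -[M `^ p *+ n]mulr_natl mulrA powRM//; congr (_ * _).
 by rewrite -[X in _ * X](@powRr1 R)// -powRD_ge0 ?subr_ge0// subrK.
apply: ler_wpM2l; first done.
by rewrite !big_nat; apply: ler_sum => i /andP[_ i_n]; exact: fsum.
Qed.

End PiecewiseVariation.

Section PieceFlow.
Context {R : realType} {m : nat}.
Variables (T p K al : R).
Let N := Num.truncn p.
Hypotheses (p1 : 1 <= p) (p3 : p < 3) (K0 : 0 <= K) (al0 : 0 < al) (al1 : al <= 1) (pN : p < N%:R + al).

(** Davie's criterion with an error that does not vanish with the mesh but is controlled by [V]; it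
    describes solutions along translated drivers. *)
Definition davie_upto (d : nat) (C : R) (V : R -> R) (F : R -> R -> 'rV[R]_d -> 'rV[R]_d) (y : R -> 'rV[R]_d) :=
 forall e : R, 0 < e -> exists2 del : R, 0 < del & forall u n, grid 0 T u n ->
 (forall k, (k < n)%N -> u k.+1 - u k < del) ->
 psum (fun s t => enorm (y t - (y s + F s t (y s)))) u n <= e + C * (V (u n) - V (u 0%N)).

Lemma davie_upto0 (d : nat) V F (y : R -> 'rV[R]_d) : davie T F y -> davie_upto 0 V F y.
Proof.
move=> D e e0; have [del d0 H] := D e e0; exists del => // u n g h.
by rewrite mul0r addr0 H.
Qed.
Let p0 : 0 < p. Proof. exact: lt_le_trans p1. Qed.

(** The same map [P], a flow of the scheme on a fine grid, approximates both solutions. Their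
    difference therefore inherits the Lipschitz bound of [P] minus the identity. *)
Theorem piece_flow : exists de C2 : R, [/\ 0 < de <= 1, 0 <= C2, C2 * de `^ p^-1 <= 1 &
 forall d b sg L ta, @scheme_fields R d m N al K b sg L ta -> forall X (W : R -> R) a c, 0 <= a -> c <= T ->
 (forall s t, a <= s -> s <= t -> t <= c -> rho N p X s t <= W t - W s) -> W c - W a <= de ->
 forall C V C' V' y y', davie_upto C V (scheme N b sg ta X) y -> davie_upto C' V' (scheme N b sg ta X) y' ->
 forall s t, a <= s -> s <= t -> t <= c -> forall e : R, 0 < e -> exists P : 'rV[R]_d -> 'rV[R]_d,
 [/\ enorm (y t - P (y s)) <= e + 2 * C * (V t - V s), enorm (y' t - P (y' s)) <= e + 2 * C' * (V' t - V' s),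
 forall x, enorm (P x - x) <= C2 * (W t - W s) `^ p^-1 &
 forall x x', enorm (P x - x - (P x' - x')) <= C2 * (W t - W s) `^ p^-1 * enorm (x - x')]].
Proof.
have [del [B [del0 B0 SB]]] := @scheme_bounds R m N K al p (level_cases p1 p3) K0 al0 al1 (level_le p1) pN.
pose C2 := K * (1 + m%:R) ^+ 2 + B.
have C20 : 0 <= C2 by pos.
have C21 : 0 < C2 + 1 by pos.
have ip : 0 < p^-1 by pos.
have [r r0 hr] := powR_small ip (divr_gt0 ltr01 C21).
exists (Num.min (Num.min del r) 1), C2.
set de := Num.min _ _.
have de0 : 0 < de by rewrite !lt_min del0 r0 ltr01.
have de1 : de <= 1 by rewrite ge_min lexx orbT.
have de_del : de <= del by rewrite /de !ge_min lexx.
split=> //; first by rewrite de0.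
 have : de `^ p^-1 <= 1 / (C2 + 1) by apply: hr; rewrite ltW//= !ge_min lexx orbT.
 move=> h; letr (ler_wpM2l C20 h).
 by rewrite mul1r ler_pdivrMr// mul1r lerDl.
move=> d b sg L ta sf X W a c a0 cT XW Wde C V C' V' y y' Dy Dy' s t as_ st tc e e0.
have e20 : 0 < e / 2 by pos.
have [d1 d10 h1] := Dy _ e20; have [d2 d20 h2] := Dy' _ e20.
have d0 : 0 < Num.min d1 d2 by rewrite lt_min d10.
have [n [n0 nd]] := fine_ugrid st d0.
move: nd; rewrite lt_min => /andP[nd1 nd2].
pose u := ugrid s t n; have gu : grid s t u n by exact: ugrid_grid.
have u0 : u 0%N = s by exact: ugrid0.
have un : u n = t by exact: ugridn.
have gu0 : grid 0 T u n by apply: grid_sub gu; [exact: le_trans as_|exact: le_trans cT].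
have XW' s' t' : s <= s' -> s' <= t' -> t' <= t -> rho N p X s' t' <= W t' - W s'.
 by move=> k1 k2 k3; apply: XW => //; [exact: le_trans k1|exact: le_trans k3 tc].
have gc := rho_grid_control p0 XW' gu.
have W0 s' t' : a <= s' -> s' <= t' -> t' <= c -> 0 <= W t' - W s'.
 by move=> k1 k2 k3; exact: le_trans (rho_ge0 _ _ _ _ _) (XW _ _ k1 k2 k3).
have w0 : 0 <= W t - W s by exact: W0.
have wde : W t - W s <= de.
 have := W0 a s (lexx a) as_ (le_trans st tc); have := W0 t c (le_trans as_ st) tc (lexx c).
 by lra.
have Wdel : W (u n) - W (u 0%N) <= del by rewrite u0 un; exact: le_trans wde de_del.
have [s1 _ s3 s4] := SB d b sg L ta sf X n u (fun k => W (u k)) gc Wdel.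
exists (flow (fun i j => scheme N b sg ta X (u i) (u j)) 0 n).
have wR : (W t - W s) `^ ((N%:R + al) / p) <= (W t - W s) `^ p^-1.
 via (W t - W s).
 by apply: powR_leid; [rewrite ler_pdivlMr// mul1r ltW|rewrite w0 (le_trans wde)].
 by apply: id_le_powR; rewrite ?w0 ?(le_trans wde)// ltW//= invf_le1.
have [g1 g2 g3] := gc 0%N n (leqnn n).
rewrite u0 un in g1 g2 g3.
set w := (W t - W s) `^ p^-1 in g2 wR *.
have w1 : w <= 1 by apply: powR_le1; [exact: ltW|rewrite w0 (le_trans wde)].
have wp : 0 <= w by pos.
have wid : W t - W s <= w by apply: id_le_powR; rewrite ?w0 ?(le_trans wde)// ltW//= invf_le1.
have x2w : `|(tincr N X s t).2| <= w.
 apply: le_trans g3 _; rewrite (_ : 2 / p = p^-1 + p^-1); last by rewrite mulrDl mul1r.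
 by rewrite powRD_ge0 ?(ltW ip)// -/w ler_piMr.
have dw : `|t - s| <= w by case/andP: g1 => k1 k2; rewrite ger0_norm//; exact: le_trans k2 wid.
have size : K * (`|t - s| + m%:R * `|(tincr N X s t).1| + m%:R ^+ 2 * `|(tincr N X s t).2|) <= K * (1 + m%:R) ^+ 2 * w.
 rewrite -mulrA; apply: ler_wpM2l => //.
 via (w + m%:R * w + m%:R ^+ 2 * w).
 by apply: lerD; [apply: lerD => //; exact: ler_wpM2l|apply: ler_wpM2l => //; done].
 by apply: sqr_arith; rewrite mulr_ge0.
have mesh dd : (t - s) / n%:R < dd -> forall k, (k < n)%N -> u k.+1 - u k < dd by move=> k1 k _; rewrite /u ugridS.
set P := flow _ 0 n in s1 s3 s4 *.
have err D U z : psum (fun s t => enorm (z t - (z s + scheme N b sg ta X s t (z s)))) u n <=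
 e / 2 + D * (U (u n) - U (u 0%N)) -> enorm (z t - P (z s)) <= e + 2 * D * (U t - U s).
 move=> k1; have := s4 (fun k => z (u k)) 0%N n (leqnn n); rewrite !add0n u0 un => k2.
 apply: le_trans k2 _; rewrite (_ : e + _ = 2 * (e / 2 + D * (U t - U s))); last by field.
 by apply: ler_wpM2l => //; rewrite -u0 -un.
split.
- by apply: err => //; apply: h1 => //; exact: mesh.
- by apply: err => //; apply: h2 => //; exact: mesh.
- move=> x; have := s1 0%N n x (leqnn n); rewrite !add0n /zz /om u0 un -/P => k1.
 have k2 := euler_bounded K0 sf (t - s) (tincr N X s t).1 (tincr N X s t).2 x.
 rewrite /C2 mulrDl; letr (enorm_triangle _ (x + scheme N b sg ta X s t x) _).
 rewrite addrC; apply: lerD.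
 by rewrite addrAC subrr add0r; exact: le_trans k2 size.
 by letr k1; exact: ler_wpM2l.
- move=> x x'; have := s3 0%N n x x' (leqnn n); rewrite !add0n /zz /om u0 un -/P => k1.
 have k2 := euler_lip K0 sf (t - s) (tincr N X s t).1 (tincr N X s t).2 x x'.
 have -> : C2 * w * enorm (x - x') = K * (1 + m%:R) ^+ 2 * w * enorm (x - x')
 + B * w * enorm (x - x') by rewrite /C2 !mulrDl.
 apply: le_trans k1 _; apply: lerD.
 by letr k2; exact: ler_wpM2r.
 by apply: ler_wpM2r => //; exact: ler_wpM2l.
Qed.

Hypothesis T0 : 0 < T.

Lemma good_control (X : R -> tens R m) de a c : a <= c -> good N p X de a c -> exists W : R -> R,
 [/\ forall s t, a <= s -> s <= t -> t <= c -> rho N p X s t <= W t - W s, W c - W a <= de &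
 forall s t, a <= s -> s <= t -> t <= c -> 0 <= W t - W s <= de].
Proof.
move=> ac g; have [W [XW Wde]] := control_exists ac (rho_ge0 N p X) g.
have W0 s t : a <= s -> s <= t -> t <= c -> 0 <= W t - W s.
 by move=> k1 k2 k3; exact: le_trans (rho_ge0 _ _ _ _ _) (XW _ _ k1 k2 k3).
exists W; split=> // s t k1 k2 k3; rewrite W0//=.
have := W0 a s (lexx a) k1 (le_trans k2 k3); have := W0 t c (le_trans k1 k2) k3 (lexx c).
by lra.
Qed.

Lemma doubling (A : nat -> R) (r : R) n : 0 <= r -> A 0%N <= 0 -> (forall i, (i < n)%N -> A i.+1 <= 2 * A i + r) ->
 forall i, (i <= n)%N -> A i <= 2 ^+ i * r.
Proof.
move=> r0 A0 H i; suff: (i <= n)%N -> A i <= (2 ^+ i - 1) * r.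
 by move=> h /h k; letr k; apply: ler_wpM2r => //; lra.
elim: i => [|i IH] i_n; first lra.
have := H i i_n; have := IH (ltnW i_n); rewrite exprS; move: (2 ^+ i) => z; nra.
Qed.

(** On a good piece the distance of the two solutions at most doubles, up to [2 * (C * l)]. Starting
    from distance 0 this produces [2 ^+ n]; the sup bound is then fed back into the increments to
    reach the [p]-variation. *)
Theorem pieces_solution : exists de C1 : R, [/\ 0 < de <= 1, 0 <= C1 &
 forall d b sg L ta, @scheme_fields R d m N al K b sg L ta -> forall X n, pieces N p X de n 0 T ->
 forall y, davie T (scheme N b sg ta X) y -> (path_pvar T p y <= (n%:R * C1)%:E)%E /\
 forall C V y' l, 0 <= C -> (forall s t, 0 <= s -> s <= t -> t <= T -> V s <= V t) ->
 V T - V 0 <= l -> davie_upto C V (scheme N b sg ta X) y' -> y' 0 = y 0 -> (path_pvar T p (fun t => (y' t - y t)%R)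
 <= (n%:R * (C1 * 2 ^+ n * (C * l)))%:E)%E].
Proof.
have [de [C2 [/andP[de0 de1] C20 C21 PF]]] := piece_flow.
exists de, (64 * (C2 + 1)).
have C10 : 0 <= 64 * (C2 + 1) by pos.
split=> //; first by rewrite de0.
move=> d b sg L ta sf X n [c [c0 cn Hc]] y Dy.
have cmono i j : (i <= j)%N -> (j <= n)%N -> c i <= c j.
 elim: j => [|j IH]; first by rewrite leqn0 => /eqP->.
 rewrite leq_eqVlt => /predU1P[->//|ij] jn.
 by letr (IH ij (ltnW jn)); have [] := Hc j jn.
have cb i : (i < n)%N -> 0 <= c i /\ c i.+1 <= T.
 by move=> i_n; rewrite -c0 -cn; split; apply: cmono => //; exact: ltnW.
have ip : 0 < p^-1 by pos.
have unroot (z : R) : 0 <= z -> (z `^ p^-1) `^ p = z by move=> z0; rewrite -powRrM mulVf ?gt_eqF// powRr1.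
have wbound (w : R) : 0 <= w <= de -> C2 * w `^ p^-1 <= 1.
 case/andP => w0 wde; apply: le_trans C21; apply: ler_wpM2l => //.
 by apply: le_powR => //; exact: ltW.
have psumW (f : R -> R -> R) (W : R -> R) (D : R) a e u k : 0 <= D -> grid a e u k ->
 (forall s t, a <= s -> s <= t -> t <= e -> f s t `^ p <= D * (W t - W s)) ->
 psum (fun s t => f s t `^ p) u k <= D * (W (u k) - W (u 0%N)).
 move=> D0 g fW; have := @psum_control R (fun s t => f s t `^ p) (fun t => D * W t) a e u k _ g.
 rewrite -mulrBr; apply=> s t k1 k2 k3; rewrite -mulrBr; exact: fW.
split.
 apply: pvar_le => //; first by pos.
 rewrite -{1}c0 -{1}cn; apply: (pieces_psum p1 C10) => i i_n; have [ci gi] := Hc i i_n; split=> //.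
 have [ci0 ciT] := cb i i_n.
 have [W [XW Wde Wb]] := good_control ci gi.
 move=> u k g; via (C2 `^ p * (W (u k) - W (u 0%N))).
 apply: (psumW _ _ _ (c i) (c i.+1)) => // s t k1 k2 k3.
 have /andP[w0 w1] := Wb s t k1 k2 k3.
 rewrite -{1}(unroot (W t - W s))// -powRM//.
 apply: le_powR => //; first exact: ltW.
 apply/ler_addgt0Pr => e e0.
 have D0 := davie_upto0 id Dy.
 have [P [P1 _ P3 _]] := PF d b sg L ta sf X W (c i) (c i.+1) ci0 ciT XW Wde _ _ _ _ _ _ D0 D0 s t k1 k2 k3 e e0.
 rewrite mulr0 mul0r addr0 in P1.
 letr (enorm_triangle _ (P (y s)) _); rewrite addrC; exact: lerD.
 have /andP[w0 w1] : 0 <= W (u k) - W (u 0%N) <= de.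
 apply: Wb; [by case/andP: (grid_in g (leq0n k))| |by case/andP: (grid_in g (leqnn k))].
 by apply: (grid_mono g); rewrite leq0n leqnn.
 via (C2 `^ p); first by rewrite ler_piMr// (le_trans w1).
 by apply: le_powR => //; [exact: ltW|lra].
move=> C V y' l C0 Vm Vl Dy' y'0.
pose D t := y' t - y t.
have l0 : 0 <= l by apply: le_trans Vl; rewrite subr_ge0 Vm// ltW.
have Cl0 : 0 <= C * l by pos.
have VV s t : 0 <= s -> s <= t -> t <= T -> 0 <= V t - V s <= l.
 move=> k1 k2 k3; rewrite subr_ge0 Vm//=.
 by have := Vm 0 s (lexx _) k1 (le_trans k2 k3); have := Vm t T (le_trans k1 k2) k3 (lexx _); lra.
(* An increment of the difference splits into the part generated by the flow, proportional to the
   difference at [s], and the inexactness of [y']. *)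
have incr i W (i_n : (i < n)%N) : (forall s t, c i <= s -> s <= t -> t <= c i.+1 -> rho N p X s t <= W t - W s) ->
 W (c i.+1) - W (c i) <= de -> forall s t, c i <= s -> s <= t -> t <= c i.+1 ->
 enorm (D t - D s) <= C2 * (W t - W s) `^ p^-1 * enorm (D s) + 2 * C * (V t - V s).
 move=> XW Wde s t k1 k2 k3; apply/ler_addgt0Pr => e e0.
 have e20 : 0 < e / 2 by pos.
 have [ci0 ciT] := cb i i_n.
 have [P [P1 P2 _ P4]] := PF d b sg L ta sf X W (c i) (c i.+1) ci0 ciT XW Wde _ _ _ _ _ _
 Dy' (davie_upto0 id Dy) s t k1 k2 k3 (e / 2) e20.
 rewrite mulr0 mul0r addr0 in P2.
 have gen (a1 a2 b1 b2 c1 c2 : 'rV[R]_d) : (a1 - a2) - (b1 - b2) =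
 (a1 - c1) - (a2 - c2) + (c1 - b1 - (c2 - b2)) by rowring.
 rewrite /D (gen _ _ _ _ (P (y' s)) (P (y s))).
 have := enormD (y' t - P (y' s) - (y t - P (y s))) (P (y' s) - y' s - (P (y s) - y s)).
 have := enormB (y' t - P (y' s)) (y t - P (y s)).
 have := P4 (y' s) (y s); move: P1 P2; move: (_ * enorm _) (2 * C * _) => A1 A2.
 move: (enorm _) (enorm _) (enorm _) (enorm _) (enorm _) => *; lra.
have bnd i t : (i < n)%N -> c i <= t <= c i.+1 -> enorm (D t) <= 2 * enorm (D (c i)) + 2 * (C * l).
 move=> i_n /andP[k1 k2]; have [ci gi] := Hc i i_n; have [ci0 ciT] := cb i i_n.
 have [W [XW Wde Wb]] := good_control ci gi.
 have := incr i W i_n XW Wde (c i) t (lexx _) k1 k2.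
 have w1 := wbound _ (Wb (c i) t (lexx _) k1 k2).
 have := ler_wpM2r (enorm_ge0 (D (c i))) w1; rewrite mul1r.
 have := ler_enormB (D t) (D (c i)).
 have /andP[v0 v1] := VV (c i) t ci0 k1 (le_trans k2 ciT).
 have := ler_wpM2l C0 v1; rewrite -[2 * C * _]mulrA; lra.
have D0 : enorm (D (c 0%N)) <= 0 by rewrite c0 /D y'0 subrr enorm0.
have dbl := @doubling (fun i => enorm (D (c i))) (2 * (C * l)) n.
have {}dbl : forall i, (i <= n)%N -> enorm (D (c i)) <= 2 ^+ i * (2 * (C * l)).
 apply: dbl => //; first by pos.
 move=> i i_n; apply: bnd => //; rewrite lexx andbT; by have [] := Hc i i_n.
have supD i t : (i < n)%N -> c i <= t <= c i.+1 -> enorm (D t) <= 4 * 2 ^+ n * (C * l).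
 move=> i_n /bnd h; letr (h i_n).
 have k1 := dbl i (ltnW i_n).
 have : 2 * 2 ^+ i <= 2 ^+ n :> R by rewrite -exprS ler_weXn2l// ler1n.
 have : 1 <= 2 ^+ i :> R by rewrite exprn_ege1// ler1n.
 move: k1; move: (2 ^+ i) (2 ^+ n) (C * l) Cl0 (enorm _) => x z w w0 a k1 k2 k3; nra.
pose S := 4 * 2 ^+ n * (C * l).
have S0 : 0 <= S by pos.
have Cl2 : 0 <= 2 * (C * l) by pos.
have M0 : 0 <= 64 * (C2 + 1) * 2 ^+ n * (C * l) by pos.
apply: pvar_le => //; first by pos.
rewrite -{1}c0 -{1}cn; apply: (pieces_psum p1 M0) => i i_n; have [ci gi] := Hc i i_n; split=> //.
have [ci0 ciT] := cb i i_n.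
have [W [XW Wde Wb]] := good_control ci gi.
have [CS0 CS1] : 0 <= C2 * S /\ 0 <= (C2 * S) `^ p by rewrite mulr_ge0// powR_ge0.
move=> u k g.
(* After the power [p], with 8 bounding 2 to the power [p], both contributions are bounded by
   additive controls: the first exactly, the second because a variation is at most [l]. *)
via (psum (fun s t => 8 * ((C2 * S) `^ p * (W t - W s) + (2 * C) `^ p * l `^ (p - 1) * (V t - V s))) u k).
 rewrite /psum !big_nat; apply: ler_sum => j /andP[_ jk].
 have [] := grid_cell g jk; move: (u j) (u j.+1) => s t k1 k2 k3.
 have /andP[w0 w1] := Wb s t k1 k2 k3.
 have /andP[v0 v1] := VV s t (le_trans ci0 k1) k2 (le_trans k3 ciT).
 have st : c i <= s <= c i.+1 by rewrite k1 (le_trans k2).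
 via ((C2 * S * (W t - W s) `^ p^-1 + 2 * C * (V t - V s)) `^ p).
 apply: le_powR => //; first exact: ltW.
 letr (incr i W i_n XW Wde s t k1 k2 k3); rewrite lerD2r mulrAC.
 by apply: ler_wpM2r => //; apply: ler_wpM2l => //; exact: supD st.
 letr (powR_add_le _ _ _).
 - exact: ltW.
 - by pos.
 - by pos.
 apply: ler_pM; rewrite ?addr_ge0//.
 exact: powR2_le8 (ltW p0) (ltW p3).
 rewrite powRM// unroot// lerD2l [(2 * C * _) `^ p]powRM ?mulr_ge0// -mulrA.
 apply: ler_wpM2l; first done.
 have -> : (V t - V s) `^ p = (V t - V s) `^ (p - 1) * (V t - V s).
 by rewrite -[X in _ * X]powRr1// -powRD_ge0 ?subr_ge0// subrK.
 by apply: ler_wpM2r => //; apply: le_powR => //; rewrite subr_ge0.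
rewrite /psum -mulr_sumr big_split/= -!mulr_sumr.
rewrite (telescope_sumr (W \o u))// (telescope_sumr (V \o u))//=.
have [gk0 gk1] : c i <= u 0%N /\ u k <= c i.+1.
 by split; [case/andP: (grid_in g (leq0n k))|case/andP: (grid_in g (leqnn k))].
have g0k : u 0%N <= u k by apply: (grid_mono g); rewrite leq0n leqnn.
have /andP[w0 w1] := Wb _ _ gk0 g0k gk1.
have /andP[v0 v1] := VV _ _ (le_trans ci0 gk0) g0k (le_trans gk1 ciT).
pose Z := C2 * S + 2 * (C * l).
have Z0 : 0 <= Z by pos.
have b1 : (C2 * S) `^ p * (W (u k) - W (u 0%N)) <= Z `^ p.
 via ((C2 * S) `^ p); first by rewrite ler_piMr// (le_trans w1).
 by apply: le_powR => //; [exact: ltW|rewrite lerDl].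
have b2 : (2 * C) `^ p * l `^ (p - 1) * (V (u k) - V (u 0%N)) <= Z `^ p.
 via ((2 * C) `^ p * l `^ (p - 1) * l).
 by apply: ler_wpM2l => //; rewrite mulr_ge0.
 rewrite -mulrA -[X in _ * (_ * X)]powRr1// -powRD_ge0 ?subr_ge0// subrK -powRM ?mulr_ge0//.
 by apply: le_powR; [exact: ltW| |rewrite -mulrA lerDr]; rewrite ?mulr_ge0.
(* The total factor [8 * 2] moves into the base because [p] is at least 1. *)
via ((16 * Z) `^ p).
 rewrite [(16 * Z) `^ p]powRM//; via (16 * Z `^ p); first by lra.
 apply: ler_wpM2r; first done.
 rewrite -[leLHS]powRr1//; apply: ler_powR => //; lra.
apply: le_powR; [exact: ltW|exact: mulr_ge0|].
have n1 : 1 <= 2 ^+ n :> R by rewrite exprn_ege1// ler1n.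
rewrite /Z /S; move: (C * l) Cl0 (2 ^+ n) n1 C20 => x x0 z z1 C20.
have : 0 <= x * (z - 1) by pos.
have : 0 <= x * C2 by pos.
lra.
Qed.

End PieceFlow.
Lemma half_gap (R : realType) (x y : R) : y < x -> y < x - (x - y) / 2.
Proof. by move=> h; rewrite ltrBrDr -ltrBrDl ltr_pdivrMr// mulr_natr mulr2n ltrDr subr_gt0. Qed.

Lemma psum0 (R : realType) (f : R -> R -> R) u : psum f u 0 = 0.
Proof. exact: big_geq. Qed.

Lemma psumS (R : realType) (f : R -> R -> R) u n : psum f u n.+1 = psum f u n + f (u n) (u n.+1).
Proof. exact: big_nat_recr. Qed.

(** * Openness and measurability of the count *)

Section OpenCount.
Context {R : realType} {m : nat}.
Variables (T p : R) (N : nat).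
Hypotheses (T0 : 0 < T) (p0 : 0 < p) (NE : N = Num.truncn p).
Implicit Types (X Y : R -> tens R m) (s t a b e eta de : R).

(** The variation distance is tested on a grid with the single cell from [a] to [b]; the lower
    bounds of the Carnot-Caratheodory norm give closeness of both levels. *)
Lemma rough_dpvar_close X Y A e a b : 0 <= a -> a <= b -> b <= T -> e <= 1 ->
 `|(tincr N X a b).1| <= A -> (rough_dpvar T p X Y < e%:E)%E -> `|(tincr N Y a b).1 - (tincr N X a b).1| <= e /\
 `|(tincr N Y a b).2 - (tincr N X a b).2| <= (1 + A) * e.
Proof.
move=> a0 ab bT e1 XA XYe.
have e0 : 0 <= e.
 rewrite -lee_fin; apply: le_trans (ltW XYe); apply: le_trans (ereal_sup_ubound _); last first.
 by exists [:: T] => //; split=> //=; rewrite T0.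
 exact: poweR_ge0.
have XYe' : (pvar T p (fun s t => ccdist N (tincr N X s t) (tincr N Y s t)) <= e%:E)%E.
 by move: XYe; rewrite /rough_dpvar -NE => /ltW.
pose elt s t := tmul N (tinv N (tincr N X s t)) (tincr N Y s t).
have elt0 s : elt s s = (0, 0).
 by rewrite /elt !tincr_id /tmul /tinv /= oppr0 /level2 !mulmx0 subr0 if_same !addr0 if_same.
pose u k : R := if k is 0%N then a else b.
have gu : grid 0 T u 1 by split=> //= -[].
have key (f : R -> R -> R) : (forall s t, ((f s t)%:E <= ccnorm N (elt s t))%E) ->
 (forall s t, 0 <= f s t) -> (forall s, f s s = 0) -> f a b <= e.
 move=> k1 k2 k3; have := pvar_psum T0 p0 e0 XYe' k1 k2 k3 gu.
 rewrite /psum big_nat1 /= => h.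
 have -> : f a b = (f a b `^ p) `^ p^-1 by rewrite -powRrM mulfV ?gt_eqF// powRr1.
 via ((e `^ p) `^ p^-1); last by rewrite -powRrM mulfV ?gt_eqF// powRr1.
 by apply: le_powR => //; rewrite ?powR_ge0 invr_ge0 ltW.
have [||k1 k2] := @tmul_close R m N (tincr N X a b) (tincr N Y a b) A e e1 XA.
- apply: (key (fun s t => `|(elt s t).1|)) => [s t|//|s]; first by have [] := ccnorm_ge N (elt s t).
 by rewrite elt0 normr0.
- have : `|(elt a b).2| `^ 2^-1 <= e.
 apply: (key (fun s t => `|(elt s t).2| `^ 2^-1)) => [s t|s t|s].
 + by have [] := ccnorm_ge N (elt s t).
 + done.
 + by rewrite elt0 normr0 powR0// invr_eq0.
 rewrite powR12_sqrt// => h; rewrite -[leLHS]sqr_sqrtr// ler_pXn2r ?nnegrE//.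
split=> //; have [N2|N2] := ltnP N 2; last exact: k2.
rewrite !tincr2_level1// subrr normr0 mulr_ge0// addr_ge0//; exact: le_trans XA.
Qed.

Lemma rho_open X a b eta : 0 <= a -> a <= b -> b <= T -> 0 < eta ->
 exists2 e : R, 0 < e & forall Y, (rough_dpvar T p X Y < e%:E)%E -> rho N p X a b - eta <= rho N p Y a b.
Proof.
move=> a0 ab bT eta0; have e20 : 0 < eta / 2 by pos.
have p20 : 0 < p / 2 by pos.
have cont (q x : R) : 0 < q -> exists2 r, 0 < r & forall z, `|z - x| < r -> `|x| `^ q - eta / 2 <= `|z| `^ q.
 move=> q0; have /cvgrPdist_le/(_ _ e20) [r /= r0 hr] := norm_powR_continuous q0 (x := x).
 exists r => // z zr; have := hr z; rewrite /ball_ /= distrC => /(_ zr).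
 by rewrite ler_norml => /andP[_]; lra.
set x1 := (tincr N X a b).1; set x2 := (tincr N X a b).2.
have [r1 r10 h1] := cont p `|x1| p0; have [r2 r20 h2] := cont (p / 2) `|x2| p20.
pose B := 1 + `|x1|; have B0 : 0 < B by pos.
exists (Num.min (Num.min 1 (r1 / 2)) (r2 / B / 2)).
 by rewrite !lt_min ltr01 !divr_gt0.
set e := Num.min _ _ => Y XY.
have ee : [/\ e <= 1, e <= r1 / 2 & e <= r2 / B / 2] by rewrite /e !ge_min !lexx !orbT.
case: ee => e1 er1 er2.
have [k1 k2] := rough_dpvar_close a0 ab bT e1 (lexx _) XY.
rewrite -/x1 -/x2 in k1 k2.
have l1 : `|x1| `^ p - eta / 2 <= `|(tincr N Y a b).1| `^ p.
 have := h1 `|(tincr N Y a b).1|; rewrite !normr_id; apply.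
 apply: le_lt_trans (ler_dist_dist _ _) _; apply: le_lt_trans k1 _; apply: le_lt_trans er1 _.
 lra.
have l2 : `|x2| `^ (p / 2) - eta / 2 <= `|(tincr N Y a b).2| `^ (p / 2).
 have := h2 `|(tincr N Y a b).2|; rewrite !normr_id; apply.
 apply: le_lt_trans (ler_dist_dist _ _) _; apply: le_lt_trans k2 _.
 rewrite -ltr_pdivlMl// mulrC; apply: le_lt_trans er2 _.
 by rewrite ltr_pdivrMr// ltr_pMr ?divr_gt0// ltr1n.
rewrite /rho -/x1 -/x2 (splitr eta) [X in X <= _]addrAC lerD2r opprD addrACA; exact: lerD.
Qed.

Lemma psum_open X u n eta : grid 0 T u n -> 0 < eta -> exists2 e : R, 0 < e & forall Y, (rough_dpvar T p X Y < e%:E)%E ->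
 psum (rho N p X) u n - eta <= psum (rho N p Y) u n.
Proof.
elim: n eta => [|n IH] eta g eta0.
 exists 1; first done.
 by move=> Y _; rewrite (@psum0 R _ u) [leRHS]psum0 sub0r oppr_le0 ltW.
have e20 : 0 < eta / 2 by pos.
have gn : grid 0 T u n.
 case: (g) => g1 g2 g3; split=> //; last by move=> i i_n; apply: g3; exact: ltnW.
 by apply: le_trans g2; exact: g3.
have [e1 e10 h1] := IH _ gn e20.
have /andP[a0 _] := grid_in g (leqnSn n); have /andP[_ bT] := grid_in g (leqnn n.+1).
have ab : u n <= u n.+1 by case: g => _ _ ->.
have [e2 e2_0 h2] := rho_open X a0 ab bT e20.
exists (Num.min e1 e2); first by rewrite lt_min e10.
move=> Y XY; rewrite (@psumS R _ u) [leRHS]psumS.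
have k1 := h1 Y (lt_le_trans XY _); have k2 := h2 Y (lt_le_trans XY _).
have {}k1 := k1 ltac:(by rewrite lee_fin ge_min lexx).
have {}k2 := k2 ltac:(by rewrite lee_fin ge_min lexx orbT).
rewrite (splitr eta) opprD addrACA; exact: lerD.
Qed.

Lemma cnt_open X de n s t : 0 <= s -> s <= t -> t <= T -> cnt N p X de n s t ->
 exists2 e : R, 0 < e & forall Y, (rough_dpvar T p X Y < e%:E)%E -> cnt N p Y de n s t.
Proof.
elim: n s => [|n IH] s s0 st tT; first by exists 1.
move=> [u [su ut [v [k [h1 h2 h3 h4]]] c]].
have [e1 e10 k1] := IH u (le_trans s0 su) ut tT c.
have g : grid 0 T v k by apply: grid_sub h3 => //; exact: le_trans tT.
have eta0 : 0 < (psum (rho N p X) v k - de) / 2 by pos.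
have [e2 e20 k2] := psum_open X g eta0.
exists (Num.min e1 e2); first by rewrite lt_min e10.
move=> Y XY; exists u; split=> //.
 have {}k2 := k2 Y (lt_le_trans XY _).
 have {}k2 := k2 ltac:(by rewrite lee_fin ge_min lexx orbT).
 exists v, k; split; [exact: h1|exact: h2|exact: h3|].
 by apply: lt_le_trans k2; exact: half_gap.
by apply: k1; apply: lt_le_trans XY _; rewrite lee_fin ge_min lexx.
Qed.

(** Finitely many increments certify [n] bad intervals with strict inequalities, so the set of such
    rough paths is open and its preimage under the lift is measurable. *)
Lemma measurable_cnt (S : cpath T (0 : 'rV[R]_m) -> geom_rough_path T p m) de n :
 borel_measurable_lift S -> measurable [set x | cnt N p (S x) de n 0 T].
Proof.
move=> mS; apply: (mS [set X | cnt N p X de n 0 T]); apply: sub_sigma_algebra => X /= c.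
by have [e e0 h] := cnt_open (lexx 0) (ltW T0) (lexx T) c; exists e => // Y /h.
Qed.

End OpenCount.

(** * Pathwise summary for rough differential equations *)

Section RoughSummary.
Context {R : realType} {m : nat}.
Variables (T p theta beta : R).
Let N := Num.truncn p.
Hypotheses (T0 : 0 < T) (p1 : 1 <= p) (p3 : p < 3) (ptheta : p < theta).

Lemma le_lip_const d (V : 'rV[R]_d -> 'rV[R]_d) M M' : M <= M' -> lip_const theta V M -> lip_const theta V M'.
Proof.
move=> MM [h1 h2 h3 h4]; split=> //.
 move=> vs k y; letr (h3 vs k y); apply: ler_wpM2r => //.
 by apply: prodr_ge0 => v _.
move=> vs k y z; letr (h4 vs k y z); apply: ler_wpM2r => //.
by apply: ler_wpM2r => //; apply: prodr_ge0 => v _.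
Qed.

(** The norm is an infimum; replacing [beta] by [beta + 1] provides an admissible constant without
    discussing whether it is attained. *)
Lemma lip_norm_const d (V : 'rV[R]_d -> 'rV[R]_d) : (lip_norm theta V <= beta%:E)%E -> lip_const theta V (beta + 1).
Proof.
move=> h; have : (lip_norm theta V < (beta + 1)%:E)%E.
 by apply: le_lt_trans h _; rewrite lte_fin ltrDl.
by move=> /ereal_inf_lt [_ [M VM <-]]; rewrite lte_fin => /ltW MM; exact: le_lip_const VM.
Qed.

Lemma geom_rough_cnt_finite de (X : geom_rough_path T p m) : 0 < de ->
 exists n0, forall n, (n0 <= n)%N -> ~ cnt N p X de n 0 T.
Proof.
move=> de0; have [_ _ _] := geom_weak X.
have p0 : 0 < p by exact: lt_le_trans p1.
case E : (rough_pvar T p X) => [v| |] // _; last first.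
 have : (0 <= rough_pvar T p X)%E.
 apply: le_trans (ereal_sup_ubound _); last first.
 by exists [:: T] => //; split=> //=; rewrite T0.
 exact: poweR_ge0.
 by rewrite E.
apply: (@cnt_finite _ _ _ _ _ _ (2 * `|v| `^ p + T) _ de0 (ltW T0)) =>  u n g.
apply: (rough_pvar_psum T0 p0 erefl (normr_ge0 v)) => //.
by rewrite E lee_fin ler_norm.
Qed.

Lemma cnt_shift de n (h : cpath T (0 : 'rV[R]_m)) (X X' : R -> tens R m) l : 0 < de -> de <= 1 ->
 is_translation T N h X X' -> (path_pvar T 1 h <= l%:E)%E -> cnt N p X' de n 0 T ->
 exists k j, [/\ (n <= k + j)%N, cnt N p X (de / 16) k 0 T & j%:R * (de / 64) <= l].
Proof.
move=> de0 de1 tr hl c; have [W [hW Wl]] := path_pvar1_control T0 hl.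
have N2p : (2 <= N)%N -> 2 <= p by move=> N2; apply: le_trans (level_le p1); rewrite ler_nat.
have [k [j [k1 k2 k3]]] := cnt_translation tr hW p1 p3 N2p de1 (lexx 0) (ltW T0) (lexx T) c.
by exists k, j; split=> //; exact: le_trans Wl.
Qed.

(** There are [2 * n + 1] good pieces, and [(2 * n + 1) * 2 ^+ (2 * n + 1)] is at most
    [2 * 16 ^+ n]. Both [de] and [C] are fixed before the dimension and the fields. *)
Theorem rough_summary : exists de C : R, [/\ 0 < de, de <= 1, 0 <= C &
 forall d (xi : 'rV[R]_d) b (sg : 'I_m -> 'rV[R]_d -> 'rV[R]_d),
 (lip_norm theta b <= beta%:E)%E -> (forall i, (lip_norm theta (sg i) <= beta%:E)%E) ->
 forall (X : geom_rough_path T p m) (y : cpath T xi), rde_solution p b sg X y -> forall n, ~ cnt N p X de n.+1 0 T ->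
 (path_pvar T p y <= (C * n.+1%:R)%:E)%E /\
 forall (h : cpath T (0 : 'rV[R]_m)) (X' : geom_rough_path T p m) (y' : cpath T xi) l,
 is_translation T N h X X' -> (path_pvar T 1 h <= l%:E)%E -> rde_solution p b sg X' y' ->
 (dpvar T p y' y <= (C * 16 ^+ n * l)%:E)%E].
Proof.
(* The regularity left after [N] derivatives, capped at 1. As [p < theta] and [p < N + 1], the sum
   [N + al] exceeds [p], which leaves room for the exponent [q] halfway between. *)
pose al := Num.min 1 (theta - N%:R).
have Np : N%:R <= p by exact: level_le.
have pN1 : p < N%:R + 1 by rewrite natr1; exact: truncnS_gt.
have al0 : 0 < al by rewrite lt_min ltr01 subr_gt0 (le_lt_trans Np).
have al1 : al <= 1 by rewrite ge_min lexx.
have pNal : p < N%:R + al by rewrite addrC -ltrBlDr lt_min ltrBlDr addrC pN1 /= ltrD2r.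
have Nalt : N%:R + al <= theta by rewrite addrC -lerBrDr ge_min lexx orbT.
pose K := 6 * (2 * (beta + 1) + 1) ^+ 2.
have K0 : 0 <= K by pos.
pose q := (p + (N%:R + al)) / 2.
have pq : p < q by rewrite ltr_pdivlMr; lra.
have qN : q < N%:R + al by rewrite ltr_pdivrMr; lra.
have [de [C1 [/andP[de0 de1] C10 H]]] := @pieces_solution R m T p K al p1 p3 K0 al0 al1 pNal T0.
pose Ch := K * (m%:R + 3 * m%:R ^+ 2).
have Ch0 : 0 <= Ch by pos.
exists de, (2 * C1 * (Ch + 1)).
have C0 : 0 <= 2 * C1 * (Ch + 1) by pos.
split=> // d xi b sg bb sb X y Xy n nc.
have [cX _ _ _] := geom_weak X.
have bM := lip_norm_const bb; have sM i := lip_norm_const (sb i).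
have [L [ta sf]] : exists L ta, @scheme_fields R d m N al K b sg L ta.
 case: (level_cases p1 p3); rewrite -/N => NE.
 rewrite NE; eexists _, _; apply: (scheme_fields1 al0 al1 bM sM).
 by move: Nalt; rewrite NE.
 rewrite NE; eexists _, _; apply: (scheme_fields2 al0 al1 bM sM).
 by move: Nalt; rewrite NE.
have Dy := rde_davie T0 p1 p3 K0 al0 al1 pq qN cX sf Xy.
have p0 : 0 < p by exact: lt_le_trans p1.
have P := cnt_pieces p0 cX (ltW de0) (ltW T0) nc.
have [H1 H2] := H d b sg L ta sf X _ P y Dy.
split.
 apply: le_trans H1 _; rewrite lee_fin.
 have n1 : (2 * n).+1%:R <= 2 * n.+1%:R :> R by lra.
 letr (ler_wpM2r C10 n1).
 rewrite (_ : 2 * C1 * _ * _ = 2 * n.+1%:R * C1 * (Ch + 1)); last by ring.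
 by rewrite ler_peMr ?lerDr// !mulr_ge0.
move=> h X' y' l tr hl Xy'.
have [cX' _ _ _] := geom_weak X'.
have [W [hW Wl]] := path_pvar1_control T0 hl.
have Wm s t : 0 <= s -> s <= t -> t <= T -> W s <= W t.
 by move=> k1 k2 k3; rewrite -subr_ge0; exact: le_trans (enorm_ge0 _) (hW s t k1 k2 k3).
have Dy' := rde_davie T0 p1 p3 K0 al0 al1 pq qN cX' sf Xy'.
have D' := davie_translation T0 tr hW K0 sf cX Dy'.
have y0 : y' 0 = y 0 by case: y' {Xy' Dy' D'} => ? []; case: y {Xy Dy H1 H2} => ? [] /= _ -> _ _ -> _.
have l0 : 0 <= l by apply: le_trans Wl; rewrite subr_ge0 Wm// ltW.
letr (H2 Ch W y' l Ch0 Wm Wl D' y0); rewrite lee_fin.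
have n4 : (2 * n).+1%:R <= 4 ^+ n :> R by rewrite -natrX ler_nat (_ : 4 = 2 ^ 2)%N// -expnM ltn_expl.
have -> : 16 ^+ n = 4 ^+ n * 4 ^+ n :> R by rewrite -exprMn; congr (_ ^+ _); ring.
have -> : 2 ^+ (2 * n).+1 = 2 * 4 ^+ n :> R by rewrite exprS exprM; congr (_ * _ ^+ _); ring.
have z0 : 0 <= 4 ^+ n :> R by [].
have A0 : 0 <= C1 * (2 * 4 ^+ n) * (Ch * l) by apply: mulr_ge0; [do 2?apply: mulr_ge0|exact: mulr_ge0].
letr (ler_wpM2r A0 n4).
move: (4 ^+ n) z0 => z z0; rewrite -subr_ge0.
have -> : 2 * C1 * (Ch + 1) * (z * z) * l - z * (C1 * (2 * z) * (Ch * l)) = 2 * C1 * (z * z) * l by ring.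
by pos.
Qed.

End RoughSummary.

(** * Densities and integration by parts for normal laws *)

Section Density.
Context d (T : measurableType d) (R : realType).
Variables (P : {finite_measure set T -> \bar R}) (mu : {sigma_finite_measure set T -> \bar R}).
Variable g : T -> R.
Hypothesis mg : mfunT g.
Hypothesis PE : forall A, measurable A -> P A = (\int[mu]_(x in A) (g x)%:E)%E.

Lemma integral_density (F : T -> \bar R) : (forall x, (0 <= F x)%E) -> mfunT F ->
 (\int[P]_x F x = \int[mu]_x (F x * (g x)%:E))%E.
Proof.
move=> F0 mF; have dom : P `<< mu.
 apply/null_content_dominatesP => A mA A0; rewrite PE//.
 by rewrite null_set_integral//; apply/measE; exact: measurable_funTS.
rewrite -(Radon_Nikodym_SigmaFinite.change_of_variables dom)//.
have fi := Radon_Nikodym_SigmaFinite.f_integrable dom.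
have mEg : mfunT (EFin \o g) by exact/measE.
apply: ae_eq_integral => //.
- by apply: emeasurable_funM => //; exact: measurable_int fi.
- exact: emeasurable_funM.
have : ae_eq mu setT (Radon_Nikodym_SigmaFinite.f P mu) (EFin \o g).
 apply: integral_ae_eq => // A _ mA.
 by rewrite -(Radon_Nikodym_SigmaFinite.f_integral dom)// PE.
by apply: filterS => x fg xT; rewrite (fg xT).
Qed.

End Density.

Section IntegralDerivative.
Context {R : realType}.
Local Notation mu := (@lebesgue_measure R).

Lemma FTC_is_derive (A A' : R -> R) (a b : R) : a < b -> (forall x : R, is_derive x 1 A (A' x)) ->
 continuous A' -> (\int[mu]_(x in `[a, b]) (A' x)%:E = (A b - A a)%:E)%E.
Proof.
move=> ab dA cA'; rewrite (@continuous_FTC2 _ A' A)//.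
- exact: continuous_subspaceT.
- have cA : continuous A by move=> x; exact/differentiable_continuous/derivable1_diffP.
 by split; [move=> x _|apply: cvg_at_right_filter; exact: cA|apply: cvg_at_left_filter; exact: cA].
- by move=> x _; rewrite derive1E derive_val.
Qed.

(* The cut-off 1 - x^2/n^2 vanishes at the ends of [-n, n], so that the boundary
   terms disappear without any decay assumption on A. *)
Lemma integral_deriv_ge0 (A A' I : R -> R) : (forall x : R, is_derive x 1 A (A' x)) ->
 continuous A' -> continuous I -> (forall x, - A' x <= I x) -> integT mu A -> integT mu I ->
 (0 <= \int[mu]_x (I x)%:E)%E.
Proof.
move=> dA cA' cI AI iA iI.
pose c n := (n.+1%:R : R); have c0 n : 0 < c n by [].
have cA : continuous A by move=> x; exact/differentiable_continuous/derivable1_diffP.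
pose chi n (x : R) := 1 - x ^+ 2 / c n ^+ 2; pose chi' n (x : R) := - (2 * x / c n ^+ 2).
have dchi n (x : R) : is_derive x 1 (chi n) (chi' n x).
 by apply: is_derive_eq; rewrite /chi' scaler0 !scaler1 //= /GRing.scale /=; ring.
pose k n x := I x * chi n x - A x * chi' n x.
have inn n x : (x \in `[- c n, c n]) = (`|x| <= c n) by rewrite in_itv /= ler_norml.
have chi01 n x : `|x| <= c n -> 0 <= chi n x <= 1.
 move=> xn; have : x ^+ 2 <= c n ^+ 2.
 by rewrite -[x ^+ 2]ger0_norm ?sqr_ge0// normrX ler_pXn2r ?nnegrE// ltW.
 rewrite /chi => h; have c2 : 0 < c n ^+ 2 by pos.
 by rewrite subr_ge0 ler_pdivrMr// mul1r h lerBlDr lerDl divr_ge0// ?sqr_ge0// ltW.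
have chi'b n x : `|x| <= c n -> `|chi' n x| <= 2.
 move=> xn; rewrite /chi' normrN normrM normrM (ger0_norm (ler0n _ 2)) normfV normrX (gtr0_norm (c0 n)).
 rewrite ler_pdivrMr ?exprn_gt0//; apply: ler_wpM2l => //; apply: le_trans xn _.
 by rewrite expr2 ler_peMl// ?ler1n// ltW.
have cchi n : continuous (chi n) by move=> x; exact/differentiable_continuous/derivable1_diffP.
have cchi' n : continuous (chi' n).
 move=> x; apply: cvgN; apply: cvgM; last exact: cvg_cst.
 by apply: cvgM; [exact: cvg_cst|exact: cvg_id].
have ck n : continuous (k n).
 by move=> x; apply: cvgB; apply: cvgM; [exact: cI|exact: cchi|exact: cA|exact: cchi'].
have kge n : (0 <= \int[mu]_(x in `[(- c n)%R, (c n)%R]) (k n x)%:E)%E.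
 have nn : - c n < c n by rewrite gtrN.
 have dAc (x : R) : is_derive x 1 (fun x => - (A x * chi n x)) (- (A' x * chi n x + A x * chi' n x)).
 have := dA x => ?; have := dchi n x => ?.
 by apply: is_derive_eq; rewrite /GRing.scale /=; ring.
 have cAc : continuous (fun x => - (A' x * chi n x + A x * chi' n x)).
 by move=> x; apply: cvgN; apply: cvgD; apply: cvgM; [exact: cA'|exact: cchi|exact: cA|exact: cchi'].
 have := FTC_is_derive nn dAc cAc.
 have -> : - (A (c n) * chi n (c n)) - - (A (- c n) * chi n (- c n)) = 0.
 by rewrite /chi sqrrN divff ?expf_neq0 ?gt_eqF// subrr !mulr0 oppr0 subr0.
 move=> E0; rewrite -[X in (X <= _)%E]E0; apply: le_integral => //.
 - by apply: continuous_compact_integrable; [exact: segment_compact|exact: continuous_subspaceT].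
 - by apply: continuous_compact_integrable; [exact: segment_compact|exact: continuous_subspaceT].
 - move=> x; rewrite inE/= => xn; rewrite lee_fin /k.
 have /andP[h _] : 0 <= chi n x <= 1 by apply: chi01; rewrite -inn.
 by rewrite opprD lerD2r -mulNr; apply: ler_wpM2r.
pose kT n := (EFin \o k n) \_ (`[- c n, c n])%classic.
have mk n : mfunT (kT n).
 apply/(measurable_restrictT _ _).1 => //; apply/measE.
 by apply: measurable_funTS; exact: cont_meas.
pose G (x : R) := (`|I x| + 2 * `|A x|)%R.
have iG : integT mu G.
 have -> : EFin \o G = (fun x => `|(EFin \o I) x| + 2%:E * `|(EFin \o A) x|)%E by [].
 apply: integrableD => //; first exact: integrable_abse.
 by apply: integrableZl => //; exact: integrable_abse.
have lim : (\int[mu]_x kT n x)%E @[n --> \oo] --> (\int[mu]_x (I x)%:E)%E.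
 apply: (@dominated_cvg _ _ _ mu setT measurableT kT (EFin \o I) (EFin \o G)) => //.
 - move=> x _; have : (k n x)%:E @[n --> \oo] --> (I x)%:E.
 apply: cvg_EFin; first exact: nearW.
 have -> : fine \o (fun n => (k n x)%:E) = fun n => I x + (2 * A x * x - I x * x ^+ 2) * (harmonic n * harmonic n).
 apply/funext => n /=; rewrite /k /chi /chi' -/(c n).
 by move: (c n) (c0 n) => z z0; field; rewrite gt_eqF.
 rewrite -[X in _ --> X]addr0 -[X in _ --> _ + X](mulr0 (2 * A x * x - I x * x ^+ 2)).
 apply: cvgD; first exact: cvg_cst.
 apply: cvgM; first exact: cvg_cst.
 by rewrite -[X in _ --> X](mulr0 0); apply: cvgM; exact: cvg_harmonic.
 apply: cvg_trans; apply: near_eq_cvg; near=> n.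
 rewrite /kT /patch mem_set//= -[in_mem _ _]/(x \in `[- c n, c n]) inn.
 letr (ltW (truncnS_gt _)); rewrite ler_nat ltnS; near: n; exact: nbhs_infty_ge.
 - move=> n x _; rewrite /kT /patch; case: ifPn => xn; last by rewrite abse0 lee_fin addr_ge0// mulr_ge0.
 move: xn; rewrite inE/= inn => xn; rewrite lee_fin /k /G.
 letr (ler_normB _ _); rewrite !normrM; apply: lerD.
 by have /andP[h1 h2] := chi01 n x xn; rewrite (ger0_norm h1) ler_piMr.
 by rewrite mulrC; apply: ler_wpM2r => //; exact: chi'b.
apply: (cvge_ge _ lim); apply: nearW => n.
by rewrite /kT -integral_mkcond; exact: kge.
Unshelve. all: by end_near. Qed.

End IntegralDerivative.

Section NormalIntegrals.
Context {R : realType}.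
Local Notation mu := (@lebesgue_measure R).
Variables (a s : R).
Hypothesis s0 : s != 0.
Local Notation phi := (normal_pdf a s).
Let s2 : 0 < s ^+ 2. Proof. by rewrite exprn_even_gt0. Qed.
Let pdfE (c : R) : c != 0 -> normal_pdf a c = fun x => normal_peak c * expR (- (x - a) ^+ 2 / (c ^+ 2 *+ 2)).
Proof. by move=> c0; rewrite normal_pdfE. Qed.

Lemma is_derive_normal_pdf (x : R) : is_derive x 1 phi (- ((x - a) / s ^+ 2) * phi x).
Proof.
rewrite pdfE//.
have dq : is_derive x 1 (fun x : R => - (x - a) ^+ 2 / (s ^+ 2 *+ 2)) (- ((x - a) / s ^+ 2)).
 apply: is_derive_eq; rewrite /GRing.scale /= -(mulr_natl (s ^+ 2)).
 by move: (s ^+ 2) s2 => z z0; field; rewrite gt_eqF.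
have de := @is_derive1_comp _ expR (fun x : R => - (x - a) ^+ 2 / (s ^+ 2 *+ 2)) _ _ _ (is_derive_expR _) dq.
by apply: (is_derive_eq (is_deriveZ (normal_peak s) de)); rewrite /GRing.scale /=; ring.
Qed.

(** Doubling the deviation leaves the factor [exp (- 3 u / (8 s^2))] with [u = (x - a)^2], and
    [1 + y <= exp y] lets it absorb [u]. Quadratic growth is thus dominated by a density. *)
Lemma sqr_normal_pdf_le (x : R) : (x - a) ^+ 2 * phi x <= 16 * s ^+ 2 * normal_pdf a (2 * s) x.
Proof.
rewrite !pdfE ?mulf_neq0//.
have -> : normal_peak (2 * s) = normal_peak s / 2.
 rewrite /normal_peak exprMn (_ : 2 ^+ 2 * s ^+ 2 * pi *+ 2 = 2 ^+ 2 * (s ^+ 2 * pi *+ 2)); last first.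
 lra.
 by rewrite sqrtrM// sqrtr_sqr ger0_norm// invfM mulrC.
rewrite exprMn; set u := (x - a) ^+ 2; have u0 : 0 <= u by pos.
rewrite mulrCA (_ : 16 * _ * _ = normal_peak s * (8 * s ^+ 2 * expR (- u / (2 ^+ 2 * s ^+ 2 *+ 2)))); last by field.
apply: ler_wpM2l; first exact: normal_peak_ge0.
have -> : - u / (2 ^+ 2 * s ^+ 2 *+ 2) = 3 * u / (8 * s ^+ 2) + - u / (s ^+ 2 *+ 2).
 lra; move: (s ^+ 2) s2 => z z0; field; rewrite gt_eqF.
rewrite expRD mulrA; apply: ler_wpM2r; first exact: expR_ge0.
have z0 : 0 < 8 * s ^+ 2 by pos.
rewrite mulrC -ler_pdivrMr//; apply: le_trans (expR_ge1Dx _).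
have : 0 <= u / (8 * s ^+ 2) by pos.
lra; lra.
Qed.

Lemma normal_moment (f : R -> R) (k : R) : continuous f -> (forall x, `|f x| <= k * (1 + (x - a) ^+ 2)) ->
 mu.-integrable setT (fun x => (f x * phi x)%:E).
Proof.
move=> cf fk.
have k0 : 0 <= k by have := le_trans (normr_ge0 _) (fk a); rewrite subrr expr0n addr0 mulr1.
have iG : integT mu (fun x => k * phi x + k * (16 * s ^+ 2) * normal_pdf a (2 * s) x).
 have -> : EFin \o (fun x => k * phi x + k * (16 * s ^+ 2) * normal_pdf a (2 * s) x) =
 (fun x => k%:E * (phi x)%:E + (k * (16 * s ^+ 2))%:E * (normal_pdf a (2 * s) x)%:E)%E by [].
 by apply: integrableD => //; apply: integrableZl => //; exact: integrable_normal_pdf.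
apply: (le_integrable measurableT _ _ iG).
 apply/measE; apply: measurable_funM; last exact: measurable_normal_pdf.
 exact: cont_meas.
move=> x _; rewrite !abse_EFin lee_fin.
have := normal_pdf_ge0 a s x; have := normal_pdf_ge0 a (2 * s) x => p0 p1.
rewrite normrM (ger0_norm p1); apply: le_trans (ler_norm _).
letr (ler_wpM2r p1 (fk x)).
have := ler_wpM2l k0 (sqr_normal_pdf_le x); rewrite !mulrA; lra.
Qed.

Lemma normal_pdf_C1 : (forall x : R, is_derive x 1 phi (- ((x - a) / s ^+ 2) * phi x)) /\ continuous phi.
Proof. by split; [exact: is_derive_normal_pdf|exact: continuous_normal_pdf]. Qed.

(** The derivative of [f * phi] combines the two integrands. [integral_deriv_ge0] applies to
    [f * phi] and to its opposite, so that derivative has integral 0. *)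
Lemma integral_normal_stein (f f' : R -> R) (k : R) : (forall x : R, is_derive x 1 f (f' x)) ->
 continuous f' -> (forall x, `|f' x| <= k) -> (forall x, `|f x| <= k * (1 + `|x - a|)) ->
 \int[mu]_x ((x - a) * f x * phi x) = s ^+ 2 * \int[mu]_x (f' x * phi x).
Proof.
move=> df cf' f'k fk.
have k0 : 0 <= k by exact: le_trans (f'k 0).
have cf : continuous f by move=> x; exact/differentiable_continuous/derivable1_diffP.
have cx : continuous (fun x => x - a) by move=> x; apply: cvgB; [exact: cvg_id|exact: cvg_cst].
have cxf : continuous (fun x => (x - a) * f x) by move=> x; apply: cvgM; [exact: cx|exact: cf].
have xle (x : R) : `|x - a| <= 1 + (x - a) ^+ 2 by rewrite -real_normK ?num_real//; move: (`|x - a|) => z; nra.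
have i1 : mu.-integrable setT (fun x => ((x - a) * f x * phi x)%:E).
 apply: (@normal_moment _ (2 * k)) => // x; rewrite normrM.
 letr (ler_wpM2l (normr_ge0 _) (fk x)).
 by have := xle x; rewrite -real_normK ?num_real//; move: (`|x - a|) (normr_ge0 (x - a)) => z z0; nra.
have i2 : mu.-integrable setT (fun x => (f' x * phi x)%:E).
 apply: (@normal_moment _ k) => // x; letr (f'k x).
 by rewrite ler_peMr// lerDl sqr_ge0.
have i3 : integT mu (fun x => f x * phi x).
 apply: (@normal_moment _ (2 * k)) => // x; letr (fk x).
 rewrite (mulrC 2) -mulrA; apply: ler_wpM2l => //; have := xle x; have := sqr_ge0 (x - a); lra.
pose A x := f x * phi x.
pose A' x := f' x * phi x - (s ^+ 2)^-1 * ((x - a) * f x * phi x).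
have [dp cp] := normal_pdf_C1.
have dA (x : R) : is_derive x 1 A (A' x).
 have := df x => ?; have := dp x => ?.
 by apply: is_derive_eq; rewrite /A' /GRing.scale /=; ring.
have cA' : continuous A'.
 move=> x; apply: cvgB; first by apply: cvgM; [exact: cf'|exact: cp].
 by apply: cvgM; [exact: cvg_cst|apply: cvgM; [exact: cxf|exact: cp]].
have iA' : integT mu A'.
 have -> : EFin \o A' = (fun x => (f' x * phi x)%:E - ((s ^+ 2)^-1)%:E * ((x - a) * f x * phi x)%:E)%E by [].
 by apply: integrableB => //; exact: integrableZl.
have iNA' : integT mu (fun x => - A' x).
 have -> : EFin \o (fun x => - A' x) = (-%E \o (EFin \o A')) by [].
 exact: integrableN.
have h1 : (0 <= \int[mu]_x (- A' x)%:E)%E.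
 apply: (integral_deriv_ge0 dA) => //; by move=> x; apply: cvgN; exact: cA'.
have h2 : (0 <= \int[mu]_x (A' x)%:E)%E.
 have dNA (x : R) : is_derive x 1 (fun x => - A x) (- A' x) by have := dA x => ?; apply: is_derive_eq.
 apply: (integral_deriv_ge0 dNA) => //.
 - by move=> x; apply: cvgN; exact: cA'.
 - by move=> x; rewrite opprK.
 have -> : EFin \o (fun x => - A x) = (-%E \o (EFin \o A)) by [].
 exact: integrableN.
have E : \int[mu]_x A' x = 0.
 apply/le_anti/andP; split; last by rewrite /Rintegral fine_ge0.
 have : 0 <= \int[mu]_x (- A' x) by rewrite /Rintegral fine_ge0.
 have -> : \int[mu]_x (- A' x) = - 1 * \int[mu]_x A' x.
 by rewrite -RintegralZl//; apply: eq_Rintegral => x _; rewrite mulN1r.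
 lra.
move: E; rewrite /A' RintegralB//; last first.
 have -> : EFin \o (fun x => (s ^+ 2)^-1 * ((x - a) * f x * phi x)) =
 (fun x => ((s ^+ 2)^-1)%:E * ((x - a) * f x * phi x)%:E)%E by [].
 exact: integrableZl.
rewrite RintegralZl// => /eqP; rewrite subr_eq0 => /eqP ->.
by rewrite mulrA mulfV ?gt_eqF// mul1r.
Qed.

End NormalIntegrals.

(** * Image measures and characteristic functions of Gaussian variables *)

Section ChangeOfMeasure.
Context d (T : measurableType d) (R : realType).

Lemma density_real (P : {finite_measure set T -> \bar R}) (mu : {sigma_finite_measure set T -> \bar R}) (g F : T -> R) :
 (forall x, 0 <= g x) -> mfunT g -> mfunT F -> (forall A, measurable A -> P A = (\int[mu]_(x in A) (g x)%:E)%E) ->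
 mu.-integrable setT (fun x => (F x * g x)%:E) -> integT P F /\ \int[P]_x F x = \int[mu]_x (F x * g x).
Proof.
move=> g0 mg mF PE iFg.
have dens (f : T -> R) : (forall x, 0 <= f x) -> mfunT f -> (\int[P]_x (f x)%:E = \int[mu]_x (f x * g x)%:E)%E.
 move=> f0 mf; rewrite (integral_density mg PE)//; exact/measE.
have mn : mfunT (fun x => `|F x|) by exact: mcomp.
split.
 apply/integrableP; split; first exact/measE.
 under eq_integral do rewrite /= -/(`|F _|)%R.
 have -> : (\int[P]_x `|(F x)%:E|)%E = (\int[P]_x (`|F x|)%:E)%E by [].
 rewrite dens//; case/integrableP: iFg => _; under eq_integral do rewrite abse_EFin normrM (ger0_norm (g0 _)).
 by [].
rewrite /Rintegral; congr fine; rewrite integralE [RHS]integralE.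
congr (_ - _)%E.
- rewrite (_ : (\int[P]_x _)%E = (\int[P]_x (Num.max (F x) 0)%:E)%E); last first.
 by apply: eq_integral => x _; rewrite funeposE EFin_max.
 rewrite dens; [|by move=> x; rewrite le_max lexx orbT|exact: measurable_maxr].
 by apply: eq_integral => x _; rewrite funeposE -EFin_max maxr_pMl// mul0r.
- rewrite (_ : (\int[P]_x _)%E = (\int[P]_x (Num.max (- F x) 0)%:E)%E); last first.
 by apply: eq_integral => x _; rewrite funenegE EFin_max.
 rewrite dens; [|by move=> x; rewrite le_max lexx orbT|by apply: measurable_maxr => //; exact: mcomp].
 by apply: eq_integral => x _; rewrite funenegE -EFinN -EFin_max maxr_pMl// mul0r mulNr.
Qed.

Variables (d' : measure_display) (T' : measurableType d') (l : T -> T').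
Variables (P : {measure set T -> \bar R}) (Q : {measure set T' -> \bar R}).
Hypothesis ml : mfunT l.
Hypothesis PQ : forall A, measurable A -> P (l @^-1` A) = Q A.

Lemma ge0_integral_law (F : T' -> \bar R) : (forall x, (0 <= F x)%E) -> mfunT F -> (\int[P]_x F (l x) = \int[Q]_y F y)%E.
Proof.
move=> F0 mF; rewrite -(@eq_measure_integral _ _ _ _ _ (pushforward P l)); last first.
 by move=> A mA _; exact: PQ.
by rewrite [RHS]ge0_integral_pushforward.
Qed.

Lemma integral_law (F : T' -> R) : mfunT F -> integT Q F ->
 P.-integrable setT (fun x => (F (l x))%:E) /\ \int[P]_x F (l x) = \int[Q]_y F y.
Proof.
move=> mF /integrableP[_ iF].
have iFl : P.-integrable setT ((EFin \o F) \o l).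
 apply/integrableP; split; first by apply/measE; exact: mcomp.
 have := @ge0_integral_law (fun y => `|(F y)%:E|)%E; move=> /= -> //.
 by apply/measE; exact: mcomp.
split=> //; rewrite /Rintegral; congr fine.
rewrite -(@eq_measure_integral _ _ _ _ _ (pushforward P l)); last first.
 by move=> A mA _; exact: PQ.
by rewrite [RHS]integral_pushforward//; exact/measE.
Qed.

End ChangeOfMeasure.

Section BoundedIntegral.
Context d (T : measurableType d) (R : realType) (P : probability T R).

Lemma bounded_integrable (F : T -> R) (M : R) : mfunT F -> (forall x, `|F x| <= M) -> integT P F.
Proof.
move=> mF FM; apply: measurable_bounded_integrable => //.
 by apply: le_lt_trans (probability_le1 P measurableT) (ltry _).
exists M; split; first by rewrite num_real.
by move=> x Mx y _ /=; exact: le_trans (FM y) (ltW Mx).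
Qed.

Lemma bounded_cvg (F_ : nat -> T -> R) (F : T -> R) (M : R) : (forall n, mfunT (F_ n)) -> (forall n x, `|F_ n x| <= M) ->
 (forall x, F_ n x @[n --> \oo] --> F x) -> mfunT F -> \int[P]_x F_ n x @[n --> \oo] --> \int[P]_x F x.
Proof.
move=> mF_ FM cF mF.
have FM' x : `|F x| <= M.
 have h : `|F_ n x| @[n --> \oo] --> `|F x| by apply: cvg_norm; exact: cF.
 by rewrite -(cvg_lim _ h)//; apply: limr_le; [apply/cvg_ex; eexists; exact: h|exact: nearW].
apply: fine_cvg.
rewrite fineK; last exact/integrable_fin_num/bounded_integrable.
apply: (@dominated_cvg _ _ _ P setT measurableT (fun n x => (F_ n x)%:E) _ (cst M%:E)) => //.
- by move=> n; exact/measE.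
- by move=> x _; apply: cvg_EFin; [exact: nearW|exact: cF].
- exact: (@integrable_cst _ _ _ P).
- by move=> n x _; rewrite lee_fin.
Qed.

End BoundedIntegral.

Section NormalCharacteristic.
Context {R : realType}.
Local Notation mu := (@lebesgue_measure R).
Variables (a s w : R).
Hypothesis s0 : s != 0.
Local Notation phi := (normal_pdf a s).
(** The free phase [w] carries cosine and sine at once and keeps all integrals real. *)
Let f (th x : R) := cos (th * (x - a) + w) * phi x.
Let C th := \int[mu]_x f th x.

Lemma is_derive_cos_affine (c b x : R) : is_derive x 1 (fun x => cos (c * x + b)) (- (c * sin (c * x + b))).
Proof.
have d1 : is_derive x 1 (fun x => c * x + b) c by apply: is_derive_eq; rewrite /GRing.scale /=; ring.
have := @is_derive1_comp _ cos (fun x : R => c * x + b) _ _ _ (is_derive_cos _) d1.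
by move=> h; apply: is_derive_eq; rewrite mulNr mulrC.
Qed.

Lemma is_derive_sin_affine (c b x : R) : is_derive x 1 (fun x => sin (c * x + b)) (c * cos (c * x + b)).
Proof.
have d1 : is_derive x 1 (fun x => c * x + b) c by apply: is_derive_eq; rewrite /GRing.scale /=; ring.
have := @is_derive1_comp _ sin (fun x : R => c * x + b) _ _ _ (is_derive_sin _) d1.
by move=> h; apply: is_derive_eq; rewrite mulrC.
Qed.

Lemma continuous_cos_affine (c b : R) : continuous (fun x => cos (c * x + b)).
Proof.
by move=> x; apply/differentiable_continuous/derivable1_diffP; have [] := is_derive_cos_affine c b x.
Qed.

(** Differentiation under the integral produces a sine multiplied by [x - a]; Stein's identity turns
    it back into the cosine, so [C] solves a linear equation in [th]. *)
Lemma is_derive_normal_cos (th : R) : is_derive th 1 C (- (s ^+ 2 * th * C th)).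
Proof.
have dth (t x : R) : is_derive t 1 (f ^~ x) (- ((x - a) * sin (t * (x - a) + w)) * phi x).
 have h := is_derive_cos_affine (x - a) w t.
 have -> : f ^~ x = (fun t => phi x *: cos ((x - a) * t + w)).
 by apply/funext => t'; rewrite /f mulrC [_ * t']mulrC.
 by apply: (is_derive_eq (is_deriveZ (phi x) h)); rewrite [t * _]mulrC /GRing.scale /=; ring.
have caff (c b : R) : continuous (fun x => cos (c * (x - a) + b)).
 have -> : (fun x => cos (c * (x - a) + b)) = (fun x => cos (c * x + (b - c * a))).
 by apply/funext => x; congr cos; ring.
 exact: continuous_cos_affine.
have if_ (t : R) : integT mu (f t).
 apply: (normal_moment s0 (k := 1)); first exact: caff.
 move=> x; rewrite mul1r; via 1; first by rewrite ler_norml cos_geN1 cos_le1.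
 by rewrite lerDl sqr_ge0.
pose G x := `|x - a| * phi x.
have iG : integT mu G.
 apply: (normal_moment s0 (k := 1)).
 by move=> x; apply: cvg_norm; apply: cvgB; [exact: cvg_id|exact: cvg_cst].
 move=> x; rewrite normr_id mul1r -real_normK ?num_real//.
 by move: (`|x - a|) => z; nra.
have Ith : (`]th - 1, th + 1[%classic : set R) th by rewrite /= in_itv /=; lra.
have der1 (x y : R) : (`]th - 1, th + 1[%classic : set R) x -> [set: R] y -> derivable (f ^~ y) x 1 by move=> _ _; pos.
have ub (x y : R) : (`]th - 1, th + 1[%classic : set R) x -> [set: R] y -> `|partial1of2 f x y| <= G y.
 move=> _ _; rewrite partial1of2E derive_val mulNr normrN normrM normrM.
 rewrite (ger0_norm (normal_pdf_ge0 _ _ _)) /G; apply: ler_wpM2r; first exact: normal_pdf_ge0.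
 by rewrite ler_piMr// ler_norml sin_geN1 sin_le1.
have G0 y : 0 <= G y by rewrite mulr_ge0// normal_pdf_ge0.
have E := differentiation_under_integral measurableT Ith (fun x _ => if_ x) der1 G0 iG ub.
have D := derivable_under_integral measurableT Ith (fun x _ => if_ x) der1 G0 iG ub.
apply: DeriveDef => //; rewrite -derive1E E.
have saff (c b x : R) : is_derive x 1 (fun x => sin (c * (x - a) + b)) (c * cos (c * (x - a) + b)).
 have -> : (fun x => sin (c * (x - a) + b)) = (fun x => sin (c * x + (b - c * a))).
 by apply/funext => x'; congr sin; ring.
 by apply: (is_derive_eq (is_derive_sin_affine _ _ _)); congr (_ * cos _); ring.
have := @integral_normal_stein R a s s0 (fun x => sin (th * (x - a) + w))
 (fun x => th * cos (th * (x - a) + w)) (1 + `|th|) (saff th w) _ _ _.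
have k1 : 1 <= 1 + `|th| by rewrite lerDl.
move=> H; transitivity (- 1 * \int[mu]_x ((x - a) * sin (th * (x - a) + w) * phi x)).
 rewrite -RintegralZl//; last first.
 apply: (normal_moment s0 (k := 1)).
 move=> x; apply: cvgM; first by apply: cvgB; [exact: cvg_id|exact: cvg_cst].
 by apply/differentiable_continuous/derivable1_diffP; have [] := saff th w x.
 move=> x; rewrite mul1r normrM; via (`|x - a| * 1).
 by apply: ler_wpM2l => //; rewrite ler_norml sin_geN1 sin_le1.
 by rewrite mulr1 -real_normK ?num_real//; move: (`|x - a|) => z; nra.
 by apply: eq_Rintegral => x _; rewrite partial1of2E derive_val mulN1r mulNr.
rewrite H.
- rewrite (_ : \int[mu]_x _ = th * C th); first lra.
 by rewrite -RintegralZl; [apply: eq_Rintegral => x _; rewrite /f mulrA| |exact: if_].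
- by move=> x; apply: cvgM; [exact: cvg_cst|exact: caff].
- move=> x; rewrite normrM; via (`|th| * 1); last lra.
 by apply: ler_wpM2l => //; rewrite ler_norml cos_geN1 cos_le1.
- move=> x; via 1; first by rewrite ler_norml sin_geN1 sin_le1.
 by apply: (le_trans k1); rewrite ler_peMr ?lerDl//; apply: le_trans k1.
Qed.

Lemma normal_cos (th : R) : C th = cos w * expR (- (s ^+ 2 * th ^+ 2 / 2)).
Proof.
pose D t := C t * expR (s ^+ 2 * t ^+ 2 / 2).
have dE (t : R) : is_derive t 1 (fun t => expR (s ^+ 2 * t ^+ 2 / 2)) (s ^+ 2 * t * expR (s ^+ 2 * t ^+ 2 / 2)).
 have d1 : is_derive t 1 (fun t : R => s ^+ 2 * t ^+ 2 / 2) (s ^+ 2 * t).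
 by apply: is_derive_eq; rewrite /GRing.scale /=; field.
 have := @is_derive1_comp _ expR (fun t : R => s ^+ 2 * t ^+ 2 / 2) _ _ _ (is_derive_expR _) d1.
 by move=> h; apply: is_derive_eq; rewrite mulrC.
have dD (t : R) : is_derive t 1 D 0.
 have := is_derive_normal_cos t => ?; have := dE t => ?.
 by apply: is_derive_eq; rewrite /GRing.scale /=; ring.
have : D th = D 0 by exact: is_derive_0_is_cst.
rewrite /D expr0n mulr0 mul0r expR0 mulr1 => E.
have -> : cos w = C 0.
 rewrite /C /f; under eq_Rintegral do rewrite mul0r add0r.
 rewrite RintegralZl//; last exact: integrable_normal_pdf.
 by rewrite /Rintegral integral_normal_pdf mulr1.
by rewrite -E; move: (s ^+ 2 * th ^+ 2 / 2) => z; rewrite -mulrA -expRD subrr expR0 mulr1.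
Qed.

End NormalCharacteristic.
Section GaussianVariable.
Context d (T : measurableType d) (R : realType) (P : probability T R).

(** Includes [v = 0], where the law is a Dirac mass. The cosine integrals over all phases are the
    characteristic function at 1; other frequencies come from multiples of [l]. *)
Definition gaussian_var (l : T -> R) (a v : R) := [/\ 0 <= v, P.-integrable setT (fun x => ((l x - a) ^+ 2)%:E),
 \int[P]_x (l x - a) = 0, \int[P]_x (l x - a) ^+ 2 = v &
 forall w, \int[P]_x cos (l x + w) = cos (a + w) * expR (- (v / 2))].

Lemma gaussian_law_var (l : T -> R) (a s : R) : mfunT l ->
 (forall A, measurable A -> P (l @^-1` A) = gaussian_law a s A) -> gaussian_var l a (s ^+ 2).
Proof.
move=> ml lE.
have mc w : mfunT (fun y : R => cos (y + w)).
 by apply: cont_meas; under eq_fun do rewrite -[X in X + _]mul1r; exact: continuous_cos_affine.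
have msq : mfunT (fun y : R => (y - a) ^+ 2) by apply: measurable_funX; exact: measurable_funB.
have m1 : mfunT (fun y : R => y - a) by exact: measurable_funB.
have [s0|s0] := eqVneq s 0.
 have PD A : measurable A -> P (l @^-1` A) = \d_a A by move=> mA; rewrite lE// /gaussian_law s0 eqxx.
 have key (F : R -> R) : mfunT F -> P.-integrable setT (fun x => (F (l x))%:E) /\ \int[P]_x F (l x) = F a.
 move=> mF; have iF : (\d_a : {measure set _ -> \bar R}).-integrable setT (EFin \o F).
 apply/integrableP; split; first exact/measE.
 rewrite integral_dirac//; first by rewrite diracT mul1e ltry.
 by apply/measE; exact: mcomp.
 have [h1 h2] := integral_law ml PD mF iF; split=> //.
 by rewrite h2 /Rintegral integral_dirac//; [rewrite diracT mul1e|exact/measE].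
 have [i2 e2] := key _ msq; have [_ e1] := key _ m1; rewrite s0 expr0n.
 split=> //; first by rewrite e1 subrr.
 by rewrite e2 subrr expr0n.
 by move=> w; have [_ ->] := key _ (mc w); rewrite mul0r oppr0 expR0 mulr1.
have PN A : measurable A -> P (l @^-1` A) = normal_prob a s A by move=> mA; rewrite lE// /gaussian_law (negPf s0).
have key (F : R -> R) (k : R) : continuous F -> (forall x, `|F x| <= k * (1 + (x - a) ^+ 2)) ->
 P.-integrable setT (fun x => (F (l x))%:E) /\ \int[P]_x F (l x) = \int[lebesgue_measure]_x (F x * normal_pdf a s x).
 move=> cF Fk; have mF : mfunT F by exact: cont_meas.
 have iF := normal_moment s0 cF Fk.
 have [h1 h2] := @density_real _ _ R (normal_prob a s : {finite_measure set _ -> \bar R})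
 lebesgue_measure (normal_pdf a s) F (normal_pdf_ge0 a s) (measurable_normal_pdf a s) mF (fun A _ => erefl) iF.
 by have [h3 h4] := integral_law (Q := (normal_prob a s : {measure set _ -> \bar R})) ml PN mF h1; split=> //; rewrite h4 h2.
have cB : continuous (fun y : R => y - a) by move=> x; apply: cvgB; [exact: cvg_id|exact: cvg_cst].
have abs1 (x : R) : `|x - a| <= 1 * (1 + (x - a) ^+ 2).
 by rewrite mul1r -real_normK ?num_real//; move: (`|x - a|) => z; nra.
have i0 := @integrable_normal_pdf R a s.
have [i1 e1] := key _ _ cB abs1.
have [i2 e2] : P.-integrable setT (fun x => ((l x - a) ^+ 2)%:E) /\
 \int[P]_x (l x - a) ^+ 2 = \int[lebesgue_measure]_x ((x - a) ^+ 2 * normal_pdf a s x).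
 apply: (key (fun y => (y - a) ^+ 2) 1) => [x|x]; first by apply: cvgM; exact: cB.
 by rewrite ger0_norm ?sqr_ge0// mul1r lerDr.
have dB (x : R) : is_derive x 1 (fun y : R => y - a) 1 by apply: is_derive_eq; rewrite subr0.
split=> //; first exact: sqr_ge0.
- rewrite e1; have := @integral_normal_stein R a s s0 (cst 1) (cst 0) 1.
 move=> H; transitivity (\int[lebesgue_measure]_x ((x - a) * cst 1 x * normal_pdf a s x)).
 by apply: eq_Rintegral => x _; rewrite mulr1.
 rewrite H.
 + rewrite (_ : \int[_]_x _ = 0) ?mulr0//; under eq_Rintegral do rewrite mul0r.
 by rewrite /Rintegral integral0.
 + exact: cst_continuous.
 + by move=> x; rewrite /= normr0.
 + by move=> x; rewrite normr1 mul1r lerDl.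
- rewrite e2; have := @integral_normal_stein R a s s0 (fun y => y - a) (cst 1) 1 dB.
 move=> H; transitivity (\int[lebesgue_measure]_x ((x - a) * (x - a) * normal_pdf a s x)).
 by [].
 rewrite H.
 + rewrite (_ : \int[_]_x _ = 1) ?mulr1//; under eq_Rintegral do rewrite mul1r.
 by rewrite /Rintegral integral_normal_pdf.
 + exact: cst_continuous.
 + by move=> x; rewrite normr1.
 + by move=> x; rewrite mul1r lerDr.
- move=> w; have [||_ ->] := key (fun y => cos (y + w)) 1.
 + by under eq_fun do rewrite -[X in X + _]mul1r; exact: continuous_cos_affine.
 + move=> x; rewrite mul1r; via 1; first by rewrite ler_norml cos_geN1 cos_le1.
 by rewrite lerDl sqr_ge0.
 have := @normal_cos R a s (a + w) s0 1; rewrite expr1n mulr1 => <-.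
 by apply: eq_Rintegral => x _; congr (cos _ * _); ring.
Qed.

End GaussianVariable.

(** * Uniqueness of laws from integrals of cosines *)

Section SignIteration.
Context {R : realType}.

(* The iterates of u |-> (3 u - u^3) / 2 converge to the sign on [-1, 1]: this
   turns trigonometric functions into indicator functions. *)
Definition sign_step (u : R) := (3 * u - u ^+ 3) / 2.

Lemma iter_sign_step (u : R) n : 0 < u -> u <= 1 ->
 u <= iter n sign_step u <= 1 /\ 1 - iter n sign_step u <= (1 - u / 2) ^+ n.
Proof.
move=> u0 u1; elim: n => [|n [/andP[IH1 IH2] IH3]]; first by rewrite lexx u1 expr0 /=; split=> //; lra.
rewrite iterS exprS; move: (iter n sign_step u) ((1 - u / 2) ^+ n) IH1 IH2 IH3 => v q v1 v2 v3.
rewrite /sign_step; split.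
 apply/andP; split; first by have : 0 <= v * (1 - v) * (1 + v); [rewrite !mulr_ge0; lra|nra].
 have : 0 <= (1 - v) * (1 - v) * (2 + v) by rewrite !mulr_ge0; lra.
 nra.
have -> : 1 - (3 * v - v ^+ 3) / 2 = (1 - v * (1 + v) / 2) * (1 - v) by field.
via ((1 - u / 2) * (1 - v)); last by apply: ler_wpM2l => //; lra.
by apply: ler_wpM2r => //; nra.
Qed.

Lemma iter_sign_stepN (u : R) n : iter n sign_step (- u) = - iter n sign_step u.
Proof. by elim: n => // n IH; rewrite !iterS IH /sign_step; field. Qed.

Lemma iter_sign_step_le1 (u : R) n : `|u| <= 1 -> `|iter n sign_step u| <= 1.
Proof.
have pos (v : R) : 0 < v -> v <= 1 -> `|iter n sign_step v| <= 1.
 move=> v0 v1; have [/andP[h1 h2] _] := iter_sign_step n v0 v1.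
 by rewrite ger0_norm// (le_trans (ltW v0)).
move=> u1; have [u0|u0|->] := ltrgt0P u.
- by apply: pos => //; apply: le_trans u1; exact: ler_norm.
- rewrite -[u]opprK iter_sign_stepN normrN; apply: pos; first by rewrite oppr_gt0.
 by apply: le_trans u1; rewrite -normrN ler_norm.
- elim: n {pos u1} => [|n IH]; first by rewrite normr0.
 have -> : iter n.+1 sign_step 0 = 0; last by rewrite normr0.
 by elim: n.+1 => // k E; rewrite iterS E /sign_step mulr0 expr0n subrr mul0r.
Qed.

Lemma iter_sign_step_cvg (u : R) : `|u| <= 1 -> iter n sign_step u @[n --> \oo] --> Num.sg u.
Proof.
have pos (v : R) : 0 < v -> v <= 1 -> iter n sign_step v @[n --> \oo] --> (1 : R).
 move=> v0 v1; apply/cvgrPdist_le => e e0.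
 have q1 : `|1 - v / 2| < 1 by rewrite ltr_norml; apply/andP; split; lra.
 have /cvgrPdist_le/(_ _ e0) := cvg_expr q1; apply: filterS => n.
 have [/andP[h1 h2] h3] := iter_sign_step n v0 v1.
 rewrite sub0r normrN => h4; rewrite ger0_norm ?subr_ge0//.
 by letr h3; apply: le_trans (ler_norm _) h4.
move=> u1; have [u0|u0|->] := ltrgt0P u.
- by rewrite gtr0_sg//; apply: pos => //; apply: le_trans u1; exact: ler_norm.
- rewrite ltr0_sg// -[u]opprK; under eq_fun do rewrite iter_sign_stepN.
 apply: cvgN; apply: pos; first by rewrite oppr_gt0.
 by apply: le_trans u1; rewrite -normrN ler_norm.
- rewrite sgr0; have -> : (fun n => iter n sign_step 0) = fun=> 0 :> R; last exact: cvg_cst.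
 by apply/funext; elim=> // k E; rewrite iterS E /sign_step mulr0 expr0n subrr mul0r.
Qed.

Lemma sg_sin (t : R) : `|t| < pi -> Num.sg (sin t) = Num.sg t.
Proof.
rewrite ltr_norml => /andP[t1 t2]; have [t0|t0|->] := ltrgt0P t.
- by rewrite !gtr0_sg// sin_gt0_pi// t0.
- by rewrite !ltr0_sg// -oppr_gt0 -sinN sin_gt0_pi// oppr_gt0 t0 /= ltrNl.
- by rewrite sin0.
Qed.

End SignIteration.

Section FourierUniqueness.
Context d (T : measurableType d) (R : realType) (P Q : probability T R).
Variable L : set (T -> R).
Hypotheses (mL : forall l, L l -> mfunT l) (LD : forall l l', L l -> L l' -> L (fun x => l x + l' x))
 (LZ : forall c l, L l -> L (fun x => c * l x)) (L0 : L (fun=> 0)).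
Hypothesis PQ : forall l w, L l -> \int[P]_x cos (l x + w) = \int[Q]_x cos (l x + w).
Let bdd (g : T -> R) := mfunT g /\ exists M, forall x, `|g x| <= M.
Let tested g := bdd g /\ forall l w, L l -> \int[P]_x (g x * cos (l x + w)) = \int[Q]_x (g x * cos (l x + w)).
(** Functions that may be inserted into every tested integral. They form an algebra closed under
    bounded limits and contain the cosines by the product-to-sum formula; the aim is that they
    contain indicators of half-spaces. *)
Let multiplier psi := bdd psi /\ forall g, tested g -> tested (fun x => g x * psi x).
Let bddM f g : bdd f -> bdd g -> bdd (fun x => f x * g x).
Proof.
move=> [mf [M fM]] [mg [M' gM]]; split; first exact: measurable_funM.
by exists (M * M') => x; rewrite normrM; apply: ler_pM.
Qed.
Let bddD f g : bdd f -> bdd g -> bdd (fun x => f x + g x).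
Proof.
move=> [mf [M fM]] [mg [M' gM]]; split; first exact: measurable_funD.
by exists (M + M') => x; apply: le_trans (ler_normD _ _) (lerD (fM x) (gM x)).
Qed.
Let bdd_cst c : bdd (fun=> c).
Proof. by split; [exact: measurable_cst|exists `|c|]. Qed.
Let bdd_cos l w : L l -> bdd (fun x => cos (l x + w)).
Proof.
move=> Ll; split; last by exists 1 => x; rewrite ler_norml cos_geN1 cos_le1.
have mc : mfunT (fun y : R => cos (y + w)).
 by apply: cont_meas; under eq_fun do rewrite -[X in X + _]mul1r; exact: continuous_cos_affine.
exact: (mcomp mc (mL Ll)).
Qed.
Let bdd_int (S : probability T R) f : bdd f -> integT S f.
Proof. by move=> [mf [M fM]]; exact: bounded_integrable mf fM. Qed.
Let testedD f g : tested f -> tested g -> tested (fun x => f x + g x).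
Proof.
move=> [bf tf] [bg tg]; split; first exact: bddD.
move=> l w Ll; have bc := bdd_cos w Ll.
under eq_Rintegral do rewrite mulrDl; under [RHS]eq_Rintegral do rewrite mulrDl.
by rewrite !RintegralD ?tf ?tg//; apply: bdd_int; exact: bddM.
Qed.
Let testedZ c g : tested g -> tested (fun x => c * g x).
Proof.
move=> [bg tg]; split; first by apply: bddM => //; exact: bdd_cst.
move=> l w Ll; have bc := bdd_cos w Ll.
under eq_Rintegral do rewrite -mulrA; under [RHS]eq_Rintegral do rewrite -mulrA.
by rewrite !RintegralZl ?tg//; apply: bdd_int; exact: bddM.
Qed.
Let multD f g : multiplier f -> multiplier g -> multiplier (fun x => f x + g x).
Proof.
move=> [bf tf] [bg tg]; split=> [|u tu]; first exact: bddD.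
by under eq_fun do rewrite mulrDr; apply: testedD; [exact: tf|exact: tg].
Qed.
Let multZ c g : multiplier g -> multiplier (fun x => c * g x).
Proof.
move=> [bg tg]; split=> [|u tu]; first by apply: bddM => //; exact: bdd_cst.
by under eq_fun do rewrite mulrCA; apply: testedZ; exact: tg.
Qed.
Let multM f g : multiplier f -> multiplier g -> multiplier (fun x => f x * g x).
Proof.
move=> [bf tf] [bg tg]; split=> [|u tu]; first exact: bddM.
by under eq_fun do rewrite mulrA; apply: tg; exact: tf.
Qed.
Let mult_lim (f_ : nat -> T -> R) (f : T -> R) (M : R) : (forall n, multiplier (f_ n)) ->
 (forall n x, `|f_ n x| <= M) -> (forall x, f_ n x @[n --> \oo] --> f x) -> multiplier f.
Proof.
move=> mf fM cf.
have mfun : mfunT f by apply: (measurable_fun_cvg (h := f_)) => // n; have [[]] := mf n.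
have bf : bdd f.
 split=> //; exists M => x; have h : `|f_ n x| @[n --> \oo] --> `|f x| by apply: cvg_norm; exact: cf.
 by rewrite -(cvg_lim _ h)//; apply: limr_le; [apply/cvg_ex; eexists; exact: h|exact: nearW].
split=> // g [[mg [M' gM]] tg]; split; first by apply: bddM => //; split=> //; exists M'.
move=> l w Ll; have bc := bdd_cos w Ll; have [mc _] := bc.
have lim (S : probability T R) : \int[S]_x (g x * f_ n x * cos (l x + w)) @[n --> \oo] -->
 \int[S]_x (g x * f x * cos (l x + w)).
 apply: (@bounded_cvg _ _ _ S _ _ (M' * M)).
 - by move=> n; apply: measurable_funM => //; apply: measurable_funM => //; have [[]] := mf n.
 - move=> n x; rewrite normrM -[leRHS]mulr1; apply: ler_pM => //.
 by rewrite normrM; apply: ler_pM.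
 by rewrite ler_norml cos_geN1 cos_le1.
 - by move=> x; apply: cvgM; [apply: cvgM; [exact: cvg_cst|exact: cf]|exact: cvg_cst].
 - by apply: measurable_funM => //; exact: measurable_funM.
have := lim P; have -> : (fun n => \int[P]_x (g x * f_ n x * cos (l x + w))) =
 (fun n => \int[Q]_x (g x * f_ n x * cos (l x + w))).
 apply/funext => n; have [_ H] := mf n.
 by have [_] := H g (conj (conj mg (ex_intro _ M' gM)) tg); apply.
by move=> lP; exact: (cvg_unique _ lP (lim Q)).
Qed.
Let mult_cos l w : L l -> multiplier (fun x => cos (l x + w)).
Proof.
move=> Ll; split; first exact: bdd_cos.
move=> g [bg tg]; split; first by apply: bddM => //; exact: bdd_cos.
move=> l' w' Ll'.
have L1 : L (fun x => l x + l' x) by exact: LD.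
have L2 : L (fun x => l x + -1 * l' x) by apply: LD => //; exact: LZ.
have prod (S : probability T R) : \int[S]_x (g x * cos (l x + w) * cos (l' x + w')) =
 2^-1 * (\int[S]_x (g x * cos (l x + l' x + (w + w'))) + \int[S]_x (g x * cos (l x + -1 * l' x + (w - w')))).
 have b1 := bddM bg (bdd_cos (w + w') L1); have b2 := bddM bg (bdd_cos (w - w') L2).
 rewrite -RintegralD//; [|exact: bdd_int|exact: bdd_int].
 rewrite -RintegralZl//; last exact: (bdd_int _ (bddD b1 b2)).
 apply: eq_Rintegral => x _.
 have -> : l x + l' x + (w + w') = (l x + w) + (l' x + w') by ring.
 have -> : l x + -1 * l' x + (w - w') = (l x + w) - (l' x + w') by ring.
 by rewrite (cosD (l x + w)) (cosB (l x + w)); field.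
by rewrite !prod !tg.
Qed.
(** For large [n] the argument of [sin ((l - a) / n)] lies below pi, so its sign is that of [l - a];
    the sign of a sine, a shifted cosine, is a limit of its images under the polynomials
    [iter k sign_step]. *)
Let mult_gt l a : L l -> multiplier (fun x => (a < l x)%R%:R).
Proof.
move=> Ll.
have sgm : multiplier (fun x => Num.sg (l x - a)).
 apply: (@mult_lim (fun n x => Num.sg (sin ((l x - a) / n.+1%:R))) _ 1).
 - move=> n; apply: (@mult_lim (fun k x => iter k sign_step (sin ((l x - a) / n.+1%:R))) _ 1).
 + elim=> [|k IH] /=.
 have := @mult_cos (fun x => n.+1%:R^-1 * l x) (- (n.+1%:R^-1 * a) - pi / 2) (LZ _ Ll).
 by congr multiplier; apply/funext => x; rewrite addrA cosBpihalf; congr sin; ring.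
 rewrite (_ : (fun x => _) = (fun x => 3 / 2 * iter k sign_step (sin ((l x - a) / n.+1%:R)) +
 (- 2^-1) * (iter k sign_step (sin ((l x - a) / n.+1%:R)) *
 (iter k sign_step (sin ((l x - a) / n.+1%:R)) * iter k sign_step (sin ((l x - a) / n.+1%:R)))))).
 by apply: multD; [exact: multZ|apply: multZ; apply: multM => //; exact: multM].
 by apply/funext => x; rewrite /sign_step; field.
 + by move=> k x; apply: iter_sign_step_le1; rewrite ler_norml sin_geN1 sin_le1.
 + by move=> x; apply: iter_sign_step_cvg; rewrite ler_norml sin_geN1 sin_le1.
 - by move=> n x; rewrite normr_sg; case: (_ != 0); rewrite ?ler01.
 - move=> x; apply: cvg_near_cst; near=> n.
 rewrite sg_sin; first by rewrite sgrM (gtr0_sg (_ : 0 < n.+1%:R^-1)) ?mulr1// invr_gt0.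
 rewrite normrM [`|_^-1|]ger0_norm// ltr_pdivrMr//.
 apply: (@lt_le_trans _ _ (2 * n.+1%:R)); last by apply: ler_wpM2r; [exact: ler0n|exact: pi_ge2].
 apply: (@lt_le_trans _ _ n.+1%:R); last by rewrite ler_peMl// ler1n.
 apply: lt_le_trans (truncnS_gt _) _; rewrite ler_nat ltnS; near: n; exact: nbhs_infty_ge.
rewrite (_ : (fun x => _) = (fun x => 2^-1 * (Num.sg (l x - a) + Num.sg (l x - a) * Num.sg (l x - a)))).
 by apply: multZ; apply: multD => //; exact: multM.
apply/funext => x; rewrite -subr_gt0; have [h|h|->] := ltrgt0P (l x - a).
- by rewrite gtr0_sg//= ; field.
- by rewrite ltr0_sg//=; field.
- by rewrite sgr0 mul0r addr0 mulr0.
Unshelve. all: by end_near. Qed.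

Lemma fourier_box (s : seq ((T -> R) * R)) : (forall la, List.In la s -> L la.1) ->
 P [set x | all (fun la => la.2 < la.1 x) s] = Q [set x | all (fun la => la.2 < la.1 x) s].
Proof.
move=> Ls; pose g x := \prod_(la <- s) (la.2 < la.1 x)%R%:R : R.
have gE x : g x = \1_[set x | all (fun la => la.2 < la.1 x) s] x.
 rewrite /g indicE /= mem_setE; elim: s {Ls g} => [|la s IH]; first by rewrite big_nil.
 rewrite big_cons IH /= /in_mem /=; by case: (_ < _); rewrite ?mul1r ?mul0r.
have t1 : tested (fun=> 1).
 split; first exact: bdd_cst.
 by move=> l w Ll; under eq_Rintegral do rewrite mul1r; under [RHS]eq_Rintegral do rewrite mul1r; exact: PQ.
have tg : tested g.
 rewrite /g; elim: s Ls {g gE} => [|la s IH] Ls; first by under eq_fun do rewrite big_nil.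
 under eq_fun do rewrite big_cons mulrC.
 have [_ h] := mult_gt la.2 (Ls la (or_introl erefl)).
 by apply: h; apply: IH => la' s'; apply: Ls; right.
have [[mg _] /(_ _ 0 L0)] := tg.
under eq_Rintegral do rewrite addr0 cos0 mulr1 gE.
under [RHS]eq_Rintegral do rewrite addr0 cos0 mulr1 gE.
have mA : measurable [set x | all (fun la => la.2 < la.1 x) s].
 rewrite (_ : [set x | _] = g @^-1` [set 1]); first by rewrite -[_ @^-1` _]setTI; exact: mg.
 apply/seteqP; split=> x /=; rewrite gE indicE.
 by move=> h; rewrite mem_set.
 by case: (boolP (x \in _)) => [|_ /eqP]; [rewrite inE|rewrite eq_sym oner_eq0].
rewrite /Rintegral !integral_indic//= !setIT => E.
by rewrite -[LHS]fineK ?fin_num_measure// -[RHS]fineK ?fin_num_measure// E.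
Qed.

(** Finite intersections of half-spaces form a class stable under intersection that generates the
    measurable sets, and [fourier_box] gives agreement on it. *)
Theorem fourier_unique : @measurable d T = <<s [set A | exists l a, L l /\ A = [set x | a < l x]] >> ->
 forall A, measurable A -> P A = Q A.
Proof.
move=> mE; pose G := [set A | exists s : seq ((T -> R) * R), (forall la, List.In la s -> L la.1) /\
 A = [set x | all (fun la => la.2 < la.1 x) s]].
have GT : G setT by exists [::]; split=> //; apply/seteqP; split.
have mG A : G A -> measurable A.
 move=> [s [Ls ->]]; elim: s Ls => [|la s IH] Ls.
 by rewrite (_ : [set x | _] = setT)//; apply/seteqP; split.
 rewrite (_ : [set x | _] = [set x | la.2 < la.1 x] `&` [set x | all (fun la => la.2 < la.1 x) s]).
 apply: measurableI; last by apply: IH => la' s'; apply: Ls; right.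
 rewrite -[X in measurable X]setTI -preimage_itvoy; apply: mL => //; apply: Ls; by left.
 by apply/seteqP; split=> x /=; [move=> /andP[]|move=> [-> ->]].
apply: (measure_unique G (fun=> setT)).
- rewrite mE; apply/seteqP; split.
 apply: smallest_sub; first exact: smallest_sigma_algebra.
 move=> A [l [a [Ll ->]]]; apply: sub_sigma_algebra.
 exists [:: (l, a)]; split; first by move=> la [<-|[]].
 by apply/seteqP; split=> x /=; rewrite andbT.
 rewrite -mE; apply: smallest_sub; [exact: sigma_algebra_measurable|exact: mG].
- move=> A B [s [Ls ->]] [t [Lt ->]]; exists (s ++ t); split.
 by move=> la h; case: (List.in_app_or _ _ _ h); [exact: Ls|exact: Lt].
 by apply/seteqP; split=> x /=; rewrite all_cat => /andP.
- by [].
- by rewrite bigcup_const//; exists 0%N.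
- by move=> A [s [Ls ->]]; exact: fourier_box.
- by move=> _; apply: le_lt_trans (probability_le1 P measurableT) (ltry _).
Qed.

End FourierUniqueness.

(** * Borel sets of the path space and coordinates *)

Section CoordinateCombinations.
Context {R : realType} {m : nat}.
Variable T : R.
Local Notation E := (cpath T (0 : 'rV[R]_m)).
Implicit Types (c : seq (R * 'I_m * R)) (x y : E).

Lemma cpath_ext d (xi : 'rV[R]_d) (x y : cpath T xi) : (forall t, x t = y t) -> x = y.
Proof.
case: x y => [x px] [y py] /= /funext e; rewrite e in px *; congr CPath; exact: Prop_irrelevance.
Qed.

Definition pt (i : 'I_m) (t : R) : seq (R * 'I_m * R) := [:: (1, i, t)].

Lemma comb_pt i t x : coord_comb (pt i t) x = x t 0 i.
Proof. by rewrite /coord_comb big_seq1 /= mul1r. Qed.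

Definition scale (a : R) c := [seq (a * k.1.1, k.1.2, k.2) | k <- c].

Arguments pt : simpl never.
Arguments scale : simpl never.

Lemma comb_cat c c' x : coord_comb (c ++ c') x = coord_comb c x + coord_comb c' x.
Proof. by rewrite /coord_comb big_cat. Qed.

Lemma comb_scale a c x : coord_comb (scale a c) x = a * coord_comb c x.
Proof. by rewrite /coord_comb big_map mulr_sumr; apply: eq_bigr => k _; rewrite mulrA. Qed.

Lemma comb_nil x : coord_comb [::] x = 0.
Proof. exact: big_nil. Qed.

Lemma comb_cons k c x : coord_comb (k :: c) x = k.1.1 * x k.2 0 k.1.2 + coord_comb c x.
Proof. exact: big_cons. Qed.

Lemma combD c x y : coord_comb c (cpathD x y) = coord_comb c x + coord_comb c y.
Proof. by rewrite /coord_comb -big_split; apply: eq_bigr => k _ /=; rewrite mxE mulrDr. Qed.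

Lemma comb_lipschitz c : exists2 K : R, 0 <= K & forall x y (e : R), 0 <= e ->
 (forall t, enorm (y t - x t) <= e) -> `|coord_comb c y - coord_comb c x| <= K * e.
Proof.
elim: c => [|k c [K K0 IH]].
 by exists 0 => // x y e e0 _; rewrite !comb_nil subrr normr0 mul0r.
exists (`|k.1.1| + K); first exact: addr_ge0.
move=> x y e e0 xy; rewrite !comb_cons opprD addrACA -mulrBr mulrDl.
apply: le_trans (ler_normD _ _) (lerD _ (IH _ _ _ e0 xy)); rewrite normrM; apply: ler_wpM2l => //.
have -> : y k.2 0 k.1.2 - x k.2 0 k.1.2 = (y k.2 - x k.2) 0 k.1.2 by rewrite !mxE.
exact: le_trans (coord_le_enorm _ _) (xy _).
Qed.

(** Being Lipschitz in finitely many combinations implies being Lipschitz for the uniform norm, so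
    the sets where [f] exceeds a level are open. *)
Lemma measurable_comb_lipschitz (f : E -> R) (K : R) (s : seq (seq (R * 'I_m * R))) :
 (forall x y, `|f x - f y| <= K * \sum_(c <- s) `|coord_comb c x - coord_comb c y|) -> mfunT f.
Proof.
move=> fK; have [K' K'0 fK'] : exists2 K' : R, 0 <= K' & forall x y (e : R), 0 <= e ->
 (forall t, enorm (y t - x t) <= e) -> `|f y - f x| <= K' * e.
 have [K1 K10 sK1] : exists2 K' : R, 0 <= K' & forall x y (e : R), 0 <= e ->
 (forall t, enorm (y t - x t) <= e) -> \sum_(c <- s) `|coord_comb c y - coord_comb c x| <= K' * e.
 elim: s {fK} => [|c s [K1 K10 IH]]; first by exists 0 => // x y e _ _; rewrite big_nil mul0r.
 have [K2 K20 h] := comb_lipschitz c; exists (K2 + K1); first exact: addr_ge0.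
 move=> x y e e0 xy; rewrite big_cons mulrDl; apply: lerD; first exact: h.
 exact: IH.
 exists (`|K| * K1); first exact: mulr_ge0.
 move=> x y e e0 xy; letr (fK _ _).
 via (`|K| * \sum_(c <- s) `|coord_comb c y - coord_comb c x|).
 by apply: ler_wpM2r; [exact: sumr_ge0|exact: ler_norm].
 by rewrite -mulrA; apply: ler_wpM2l => //; exact: sK1.
apply: (measurability _ (RGenOInfty.measurableE R)) => _ [_ [a ->] <-]; rewrite setTI.
apply: sub_sigma_algebra => x /=; rewrite in_itv /= andbT => ax.
have d0 : 0 < (f x - a) / (2 * (K' + 1)) by pos.
exists ((f x - a) / (2 * (K' + 1))) => // y xy; rewrite in_itv /= andbT.
have := fK' x y _ (ltW d0) (fun t => ltW (xy t)).
rewrite distrC => h; have {h} := le_lt_trans (ler_norm _) (le_lt_trans h _).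
move=> /(_ (f x - a)) h; have : f x - f y < f x - a.
 apply: h; rewrite mulrCA -[ltRHS]mulr1 ltr_pM2l ?subr_gt0//.
 rewrite ltr_pdivrMr ?mulr_gt0 ?ltr_wpDl// mul1r; lra.
lra.
Qed.

Lemma measurable_comb c : mfunT (coord_comb c : E -> R).
Proof.
apply: (@measurable_comb_lipschitz _ 1 [:: c]) => x y.
by rewrite big_seq1 mul1r.
Qed.
Let gen : set (set E) := [set A | exists c a, A = [set x | a < coord_comb c x]].
(** The datum [z] encodes a step function: rational values, number of steps per unit of time, and a
    precision index. There are countably many of them, and each condition is tested at a rational
    time. *)
Let near_step (z : seq (seq rat) * nat * nat) (ri : rat * 'I_m) : set E := [set x : E |
 `|x (ratr ri.1) 0 ri.2 - ratr (nth 0 (nth [::] z.1.1 (Num.truncn (clamp T (ratr ri.1 : R) * z.1.2%:R))) ri.2)|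
 <= z.2.+1%:R^-1].
Let near_step_measurable z : @measurable _ (g_sigma_algebraType gen) (\bigcap_ri near_step z ri).
Proof.
have mgt c a : @measurable _ (g_sigma_algebraType gen) [set x | a < coord_comb c x].
 by apply: sub_sigma_algebra; exists c, a.
rewrite -[X in measurable X]setCK setC_bigcap; apply: measurableC.
apply: countable_bigcupT_measurable => // -[r i]; apply: measurableC.
rewrite /near_step /=; set b := ratr (nth _ _ _); set e := _^-1.
rewrite (_ : [set x | _] = ~` [set x | b + e < coord_comb (pt i (ratr r)) x] `&`
 ~` [set x | e - b < coord_comb (scale (-1) (pt i (ratr r))) x]).
 by apply: measurableI; apply: measurableC; exact: mgt.
apply/seteqP; split=> x /=; rewrite comb_scale comb_pt mulN1r ler_norml.
 by move=> /andP[h1 h2]; split; apply/negP; rewrite -leNgt; lra.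
by move=> [/negP + /negP]; rewrite -!leNgt => h1 h2; apply/andP; split; lra.
Qed.

Hypothesis T0 : 0 < T.
Let near_step_cover (x : E) n : exists z, z.2 = n /\ (\bigcap_ri near_step z ri) x.
Proof.
have [cx x0 xT] := cpathP x.
have n0 : 0 < n.+1%:R^-1 / 2 :> R by [].
have [del del0 hdel] := @heine_cantor R _ x 0 T cx _ n0.
pose k := (Num.truncn del^-1).+1.
have kdel : k%:R^-1 < del by rewrite invf_plt ?posrE//; exact: truncnS_gt.
have /choice [q qP] : forall ji : nat * 'I_m, exists r : rat, `|x (ji.1%:R / k%:R) 0 ji.2 - ratr r| <= n.+1%:R^-1 / 2.
 move=> [j i] /=; set v : R := x _ _ _; move: v (n.+1%:R^-1 / 2) n0 => v h h0.
 have /rat_in_itvoo[r] : v - h < v + h by lra.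
 by rewrite in_itv/= => /andP[r1 r2]; exists r; rewrite ler_norml; apply/andP; split; lra.
pose w (j i : nat) := if insub i is Some i' then q (j, i') else 0.
pose K := (Num.truncn (T * k%:R)).+1.
exists (mkseq (fun j => mkseq (w j) m) K, k, n); split=> // -[r i] _; rewrite /near_step /=.
rewrite -xT; set t := clamp T (ratr r).
have tT : 0 <= t <= T by rewrite /t /clamp le_max lexx /= ge_max ltW//= ge_min lexx.
have /andP[t0 tT'] := tT.
have tk0 : 0 <= t * k%:R by pos.
set j := Num.truncn (t * k%:R).
have /andP[j1 j2] : j%:R <= t * k%:R < j.+1%:R by rewrite truncn_itv.
have jK : (j < K)%N by rewrite ltnS /j; apply: le_truncn; apply: ler_wpM2r => //; exact: ltW.
rewrite nth_mkseq// nth_mkseq// /w insubT//= => ltim.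
rewrite (_ : Sub _ _ = i); last by apply/val_inj.
have := qP (j, i) => /=; set v := x (j%:R / k%:R) 0 i => h1.
have h2 : `|x t 0 i - v| <= n.+1%:R^-1 / 2.
 have -> : x t 0 i - v = (x t - x (j%:R / k%:R)) 0 i by rewrite !mxE.
 letr (mx_norm_ge _ _ _); apply/ltW/hdel => //.
 have h : 0 <= t - j%:R / k%:R < k%:R^-1.
 rewrite subr_ge0 ler_pdivrMr// j1 /= ltrBlDr (_ : _ + _ = j.+1%:R / k%:R) ?ltr_pdivlMr//.
 lra.
 by case/andP: h => h3 h4; rewrite ger0_norm//; exact: lt_trans h4 kdel.
by rewrite (splitr n.+1%:R^-1); apply: le_trans (ler_distD v _ _) (lerD h2 h1).
Qed.
Let near_step_close z x y : (\bigcap_ri near_step z ri) x -> (\bigcap_ri near_step z ri) y ->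
 forall t, enorm (y t - x t) <= m%:R * (2 / z.2.+1%:R).
Proof.
move=> hx hy t; letr (enorm_le_sum _).
rewrite -[m in m%:R]card_ord mulr_natl -sumr_const; apply: ler_sum => i _; rewrite !mxE.
have [cx _ _] := cpathP x; have [cy _ _] := cpathP y.
apply/ler_addgt0Pr => e e0; have e20 : 0 < e / 2 by pos.
have /cvgrPdist_lt/(_ _ e20)[d1 /= d10 h1] := cx t.
have /cvgrPdist_lt/(_ _ e20)[d2 /= d20 h2] := cy t.
have d0 : 0 < Num.min d1 d2 by rewrite lt_min d10.
have /rat_in_itvoo[r] : t < t + Num.min d1 d2 by rewrite ltrDl.
rewrite in_itv/= => /andP[r1 r2].
have cl d : Num.min d1 d2 <= d -> `|t - ratr r| < d by move=> dd; rewrite ltr_norml; apply/andP; split; lra.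
have k1 := h1 (ratr r) (cl d1 ltac:(by rewrite ge_min lexx)).
have k2 := h2 (ratr r) (cl d2 ltac:(by rewrite ge_min lexx orbT)).
have co (u : E) : `|u t 0 i - u (ratr r) 0 i| <= `|u t - u (ratr r)|.
 have -> : u t 0 i - u (ratr r) 0 i = (u t - u (ratr r)) 0 i by rewrite !mxE.
 exact: mx_norm_ge.
have := hx (r, i) I; have := hy (r, i) I; rewrite /near_step /=.
set b := ratr (nth _ _ _) => q1 q2.
have := le_lt_trans (co x) k1; have := le_lt_trans (co y) k2.
move: q1 q2; rewrite ltr_norml !ler_norml ltr_norml; move: (z.2.+1%:R^-1) => n1.
set x1 : R := x t 0 i; set y1 : R := y t 0 i; set x2 : R := x (ratr r) 0 i; set y2 : R := y (ratr r) 0 i.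
move: x1 x2 y1 y2 b => x1 x2 y1 y2 b.
move=> /andP[a1 a2] /andP[a3 a4] /andP[a5 a6] /andP[a7 a8]; apply/andP; split; lra.
Qed.

(** An open set is the union of those [near_step] neighbourhoods that it contains: they cover the
    space at every precision, and their uniform diameter tends to 0 with the precision. *)
Theorem borel_coord : @measurable _ E = <<s gen >>.
Proof.
apply/seteqP; split.
 apply: smallest_sub; first exact: smallest_sigma_algebra.
 move=> U oU.
 rewrite (_ : U = \bigcup_z (if pselect ((\bigcap_ri near_step z ri) `<=` U) then \bigcap_ri near_step z ri else set0)).
 apply: (@countable_bigcupT_measurable _ (g_sigma_algebraType gen)) => // z.
 by case: pselect => ? /=; [exact: near_step_measurable|exact: measurable0].
 apply/seteqP; split=> [x Ux|x [z _]]; last by case: pselect => // sub /sub.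
 have [e e0 he] := oU x Ux.
 pose n := Num.truncn (m%:R * 2 / e).
 have [z [zn xz]] := near_step_cover x n; exists z => //; case: pselect => // -[] y yz.
 apply: he => t; apply: le_lt_trans (near_step_close xz yz t) _.
 rewrite zn mulrA ltr_pdivrMr// [e * _]mulrC -ltr_pdivrMr//; exact: truncnS_gt.
apply: smallest_sub; first exact: sigma_algebra_measurable.
move=> _ [c [a ->]]; rewrite -[X in measurable X]setTI -preimage_itvoy; exact: measurable_comb.
Qed.

Lemma measurable_to_cpath d (S : measurableType d) (f : S -> E) : (forall i t, mfunT (fun z => f z t 0 i)) -> mfunT f.
Proof.
move=> mf; apply: (measurability gen); first exact: borel_coord.
move=> _ [_ [c [a ->]] <-]; rewrite setTI.
rewrite -[X in measurable X]setTI (_ : f @^-1` _ = (fun z => coord_comb c (f z)) @^-1` `]a, +oo[).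
 suff h : mfunT (fun z => coord_comb c (f z)) by apply: h.
 by apply: measurable_sum => k; apply: measurable_funM => //; exact: mf.
by apply/seteqP; split=> z /=; rewrite in_itv/= andbT.
Qed.

End CoordinateCombinations.

(** * Covariances and Cameron-Martin paths *)

Section Covariance.
Context {R : realType} {m : nat}.
Variables (T : R) (gamma : probability (cpath T (0 : 'rV[R]_m)) R).
Hypotheses (T0 : 0 < T) (hg : gaussian gamma).
Local Notation E := (cpath T (0 : 'rV[R]_m)).
Implicit Types (c e : seq (R * 'I_m * R)).

Definition mean c : R := \int[gamma]_x coord_comb c x.
Definition zeta c (x : E) : R := coord_comb c x - mean c.
Definition cov e c : R := \int[gamma]_x (zeta e x * zeta c x).

Lemma measurable_zeta c : mfunT (zeta c).
Proof. by apply: measurable_funB => //; exact: measurable_comb. Qed.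
Let sq_bound (x y : R) : `|x * y| <= x ^+ 2 + y ^+ 2.
Proof.
rewrite normrM -[x ^+ 2]real_normK ?num_real// -[y ^+ 2]real_normK ?num_real//.
by move: (`|x|) (`|y|) (normr_ge0 x) (normr_ge0 y) => a b a0 b0; nra.
Qed.
Let integrable_sq (f g : E -> R) : mfunT f -> mfunT g ->
 gamma.-integrable setT (fun x => (f x ^+ 2)%:E) -> gamma.-integrable setT (fun x => (g x ^+ 2)%:E) ->
 gamma.-integrable setT (fun x => (f x * g x)%:E).
Proof.
move=> mf mg i1 i2; have i := integrableD measurableT i1 i2.
apply: (le_integrable measurableT _ _ i); first by apply/measE; exact: measurable_funM.
by move=> x _; rewrite -EFinD !abse_EFin lee_fin [leRHS]ger0_norm ?addr_ge0 ?sqr_ge0.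
Qed.
Let gammaT : fine (gamma setT) = 1. Proof. by rewrite probability_setT. Qed.

Lemma comb_gaussian c : gaussian_var gamma (coord_comb c) (mean c) (cov c c) /\
 gamma.-integrable setT (fun x => (coord_comb c x)%:E).
Proof.
have [a [s law]] := hg c.
have G := gaussian_law_var (measurable_comb c) law.
have [v0 i2 m0 e2 ch] := G.
have i1 : gamma.-integrable setT (fun x => (coord_comb c x - a)%:E).
 have := @integrable_sq (fun x => coord_comb c x - a) (cst 1).
 under [X in _ -> _ -> _ -> _ -> _.-integrable _ X]eq_fun do rewrite mulr1.
 apply=> //; first by apply: measurable_funB => //; exact: measurable_comb.
 by under eq_fun do rewrite expr1n; exact: (integrable_cst gamma 1).
have ic : gamma.-integrable setT (fun x => (coord_comb c x)%:E).
 rewrite (_ : (fun x => _) = (fun x => (coord_comb c x - a)%:E + a%:E)%E).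
 by apply: integrableD => //; exact: integrable_cst.
 by apply/funext => x; rewrite -EFinD subrK.
have ma : mean c = a.
 apply/eqP; rewrite -subr_eq0 -m0 RintegralB//; last exact: integrable_cst.
 by rewrite Rintegral_cst// gammaT mulr1.
split=> //; rewrite /cov /zeta ma.
by rewrite (_ : \int[gamma]_x _ = s ^+ 2).
Qed.

Lemma integrable_zeta_sq c : gamma.-integrable setT (fun x => (zeta c x ^+ 2)%:E).
Proof. by have [[]] := comb_gaussian c. Qed.

Lemma integrable_zetaM e c : gamma.-integrable setT (fun x => (zeta e x * zeta c x)%:E).
Proof. by apply: integrable_sq; rewrite ?integrable_zeta_sq//; exact: measurable_zeta. Qed.

Lemma var_ge0 c : 0 <= cov c c.
Proof. by have [[]] := comb_gaussian c. Qed.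

Lemma comb_cos c w : \int[gamma]_x cos (coord_comb c x + w) = cos (mean c + w) * expR (- (cov c c / 2)).
Proof. by have [[]] := comb_gaussian c. Qed.

Lemma covC e c : cov e c = cov c e.
Proof. by apply: eq_Rintegral => x _; rewrite mulrC. Qed.

Lemma mean_cat c c' : mean (c ++ c') = mean c + mean c'.
Proof.
rewrite /mean; under eq_Rintegral do rewrite comb_cat.
by rewrite RintegralD//; have [] := comb_gaussian c; have [] := comb_gaussian c'.
Qed.

Lemma mean_scale a c : mean (scale a c) = a * mean c.
Proof.
rewrite /mean; under eq_Rintegral do rewrite comb_scale.
by rewrite RintegralZl//; have [] := comb_gaussian c.
Qed.

Lemma mean_nil : mean [::] = 0.
Proof. by rewrite /mean; under eq_Rintegral do rewrite comb_nil; rewrite /Rintegral integral0. Qed.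

Lemma zeta_cat c c' x : zeta (c ++ c') x = zeta c x + zeta c' x.
Proof. by rewrite /zeta comb_cat mean_cat opprD addrACA. Qed.

Lemma zeta_scale a c x : zeta (scale a c) x = a * zeta c x.
Proof. by rewrite /zeta comb_scale mean_scale mulrBr. Qed.

Lemma zeta_nil x : zeta [::] x = 0.
Proof. by rewrite /zeta comb_nil mean_nil subrr. Qed.

Lemma cov_cat e c c' : cov e (c ++ c') = cov e c + cov e c'.
Proof.
rewrite /cov; under eq_Rintegral do rewrite zeta_cat mulrDr.
by rewrite RintegralD//; exact: integrable_zetaM.
Qed.

Lemma cov_scale a e c : cov e (scale a c) = a * cov e c.
Proof.
rewrite /cov; under eq_Rintegral do rewrite zeta_scale mulrCA.
by rewrite RintegralZl//; exact: integrable_zetaM.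
Qed.

Lemma cov_nil e : cov e [::] = 0.
Proof. by rewrite /cov; under eq_Rintegral do rewrite zeta_nil mulr0; rewrite /Rintegral integral0. Qed.

Lemma var_lin a e c : cov (c ++ scale a e) (c ++ scale a e) = cov c c + 2 * a * cov e c + a ^+ 2 * cov e e.
Proof.
rewrite cov_cat cov_scale (covC (c ++ _) c) (covC (c ++ _) e) !cov_cat !cov_scale (covC c e).
by move: (cov c c) (cov e c) (cov e e) => A B C; ring.
Qed.

(** Nonnegativity of the variance of [c] plus a multiple of [e]. If [e] has variance 0, a suitable
    multiple would make this variance -1 unless the covariance vanishes. *)
Lemma cov_sqr_le e c : cov e c ^+ 2 <= cov e e * cov c c.
Proof.
have q a := var_lin a e c; have q0 a : 0 <= cov c c + 2 * a * cov e c + a ^+ 2 * cov e e by rewrite -q var_ge0.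
have ve := var_ge0 e; have vc := var_ge0 c; move: ve vc q0; move: (cov e e) (cov c c) (cov e c) => A B C A0 B0 q0.
have [A1|A1] := eqVneq A 0.
 have [->|C0] := eqVneq C 0; first by rewrite expr0n mulr_ge0.
 have := q0 (- (B + 1) / (2 * C)); rewrite A1 mulr0 addr0.
 have -> : 2 * (- (B + 1) / (2 * C)) * C = - (B + 1) by field.
 by lra.
have Ap : 0 < A by lra.
have := q0 (- C / A); have -> : B + 2 * (- C / A) * C + (- C / A) ^+ 2 * A = (A * B - C ^+ 2) / A by field.
by rewrite ler_pdivlMr// mul0r subr_ge0.
Qed.

Lemma cov0_of_var0 e c : cov c c = 0 -> cov e c = 0.
Proof.
move=> v0; have := cov_sqr_le e c; rewrite v0 mulr0 => h.
by apply/eqP; rewrite -sqrf_eq0; apply/eqP/le_anti; rewrite h sqr_ge0.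
Qed.

(** Path continuity gives convergence of bounded cosine integrals. The squares of the cosine and
    sine integrals of a Gaussian variable add up to the exponential of minus its variance, so the
    variance tends to 0 without a uniform moment bound. *)
Lemma var_increment_cvg i (t : R) (u : nat -> R) : u n @[n --> \oo] --> t ->
 cov (pt i (u n) ++ scale (-1) (pt i t)) (pt i (u n) ++ scale (-1) (pt i t)) @[n --> \oo] --> (0 : R).
Proof.
move=> ut; pose dd n := pt i (u n) ++ scale (-1) (pt i t).
have lim w : \int[gamma]_x cos (coord_comb (dd n) x + w) @[n --> \oo] --> cos w.
 have -> : cos w = \int[gamma]_x (fun=> cos w) x by rewrite Rintegral_cst// gammaT mulr1.
 apply: (@bounded_cvg _ _ _ gamma _ _ 1).
 - move=> n; have mc : mfunT (fun y : R => cos (y + w)).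
 by apply: cont_meas; under eq_fun do rewrite -[X in X + _]mul1r; exact: continuous_cos_affine.
 exact: (mcomp mc (measurable_comb (dd n))).
 - by move=> n x; rewrite ler_norml cos_geN1 cos_le1.
 - move=> x; have [cx _ _] := cpathP x.
 have h : coord_comb (dd n) x + w @[n --> \oo] --> w.
 rewrite -[X in _ --> X]add0r; apply: cvgD; last exact: cvg_cst.
 under eq_fun do rewrite comb_cat comb_scale !comb_pt mulN1r.
 rewrite -(subrr (x t 0 i)); apply: cvgB; last exact: cvg_cst.
 apply/cvgrPdist_lt => ep ep0; have /cvgrPdist_lt/(_ _ ep0) hx := cvg_comp _ _ ut (cx t).
 near=> n; have -> : x t 0 i - x (u n) 0 i = (x t - x (u n)) 0 i by rewrite !mxE.
 by apply: le_lt_trans (mx_norm_ge _ _ _) _; near: n; exact: hx.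
 have := cvg_comp _ _ h (@continuous_cos R w); exact.
 - exact: measurable_cst.
have e1 : expR (- cov (dd n) (dd n)) @[n --> \oo] --> (1 : R).
 have -> : (fun n => expR (- cov (dd n) (dd n))) = (fun n =>
 (\int[gamma]_x cos (coord_comb (dd n) x + 0)) ^+ 2 + (\int[gamma]_x cos (coord_comb (dd n) x + - (pi / 2))) ^+ 2).
 apply/funext => n; rewrite !comb_cos addr0 cosBpihalf !exprMn -mulrDl cos2Dsin2 mul1r.
 by rewrite -expRM_natl; congr expR; field.
 rewrite [X in _ --> X](_ : 1 = cos 0 ^+ 2 + cos (- (pi / 2)) ^+ 2); last first.
 by rewrite cos0 cosN cos_pihalf expr1n expr0n addr0.
 by apply: cvgD; apply: cvgM; exact: lim.
rewrite -/(dd _) (_ : (fun n => _) = (fun n => - ln (expR (- cov (dd n) (dd n))))); last first.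
 by apply/funext => n; rewrite expRK opprK.
rewrite -oppr0 -(ln1 R); apply: cvgN; exact: (cvg_comp _ _ e1 (continuous_ln ltr01)).
Unshelve. all: by end_near. Qed.

Lemma cov_ext e c c' : (forall x : E, coord_comb c x = coord_comb c' x) -> cov e c = cov e c'.
Proof.
move=> cc'; have h : (coord_comb c : E -> R) = coord_comb c' by exact/funext.
by rewrite /cov /zeta /mean h.
Qed.

Lemma hpath_subproof e : is_cpath T 0 (fun t => \row_i cov e (pt i t)).
Proof.
split.
- move=> t; have ci i : (fun t : R => cov e (pt i t)) s @[s --> t] --> cov e (pt i t).
 apply: ((@cvg_nbhsP R R^o (fun s => cov e (pt i s)) t (cov e (pt i t))).2) => u ut; apply/cvgrPdist_le => ep ep0.
 have c0 : 0 < ep ^+ 2 / (cov e e + 1) by rewrite divr_gt0 ?exprn_gt0// ltr_wpDl ?var_ge0.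
 have /cvgrPdist_le/(_ _ c0) := @var_increment_cvg i t u ut; apply: filterS => n.
 rewrite sub0r normrN ger0_norm ?var_ge0// => h.
 have := cov_sqr_le e (pt i (u n) ++ scale (-1) (pt i t)).
 rewrite cov_cat cov_scale mulN1r => h'; rewrite distrC -(ler_pXn2r (n := 2))// ?nnegrE ?(ltW ep0)//.
 rewrite real_normK ?num_real//; apply: le_trans h' _.
 letr (ler_wpM2l (var_ge0 e) h).
 by rewrite mulrCA ler_piMr ?sqr_ge0// ler_pdivrMr ?ltr_wpDl ?var_ge0// mul1r lerDl.
 apply/cvgrPdist_le => ep ep0.
 have near_i i : \forall s \near t, `|cov e (pt i t) - cov e (pt i s)| <= ep by have /cvgrPdist_le/(_ _ ep0) := ci i.
 have := filter_forall (nbhs_filter t) near_i; apply: filterS => s h.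
 rewrite [leLHS]mx_normrE; apply: bigmax_le; first exact: ltW.
 by move=> [i j] _ /=; rewrite !mxE.
- apply/rowP => i; rewrite !mxE (cov_ext e (c' := [::])) ?cov_nil// => x.
 by rewrite comb_pt comb_nil; have [_ -> _] := cpathP x; rewrite mxE.
- move=> t; apply/rowP => i; rewrite !mxE; apply: cov_ext => x.
 by rewrite !comb_pt; have [_ _ ->] := cpathP x.
Qed.

(** The Cameron-Martin path represented by the centred combination [zeta gamma e]. *)
Definition hpath e : E := CPath (hpath_subproof e).

Lemma comb_hpath e c : coord_comb c (hpath e) = cov e c.
Proof.
elim: c => [|[[a i] t] c IH]; first by rewrite comb_nil cov_nil.
rewrite comb_cons IH /= mxE -cov_scale -cov_cat; apply: cov_ext => x.
by rewrite comb_cat comb_scale comb_pt comb_cons.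
Qed.

Lemma hpath_cm e : cm_represents gamma (hpath e) (zeta e).
Proof.
split; first exact: measurable_zeta.
- move=> ep ep0; exists e; rewrite (eq_integral (cst 0%E)) ?integral0//= => x _.
 by rewrite /zeta /mean subrr expr0n.
- move=> t i; rewrite /= mxE /cov.
 have iz : gamma.-integrable setT (fun x => (zeta e x)%:E).
 have := @integrable_sq (zeta e) (cst 1) (measurable_zeta e) (@measurable_cst _ _ _ _ _ _).
 under [X in _ -> _ -> _.-integrable _ X]eq_fun do rewrite mulr1.
 apply; first exact: integrable_zeta_sq.
 by under eq_fun do rewrite expr1n; exact: (integrable_cst gamma 1).
 have z0 : \int[gamma]_x zeta e x = 0.
 have [_ ic] := comb_gaussian e; rewrite RintegralB//; last exact: integrable_cst.
 by rewrite Rintegral_cst// gammaT mulr1 subrr.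
 have -> : \int[gamma]_x (zeta e x * x t 0 i) = \int[gamma]_x (zeta e x * zeta (pt i t) x + mean (pt i t) * zeta e x).
 by apply: eq_Rintegral => x _; rewrite /zeta comb_pt; ring.
 rewrite RintegralD ?integrable_zetaM//; first by rewrite RintegralZl// z0 mulr0 addr0.
 have -> : EFin \o (fun x => mean (pt i t) * zeta e x) = (fun x => (mean (pt i t))%:E * (zeta e x)%:E)%E by [].
 exact: integrableZl.
Qed.

Lemma cm_norm_hpath e : (cm_norm gamma (hpath e) <= (Num.sqrt (cov e e))%:E)%E.
Proof.
letr (ereal_inf_lbound (ex_intro2 _ _ _ (hpath_cm e) erefl)).
have -> : (\int[gamma]_x (zeta e x ^+ 2)%:E)%E = (cov e e)%:E.
 rewrite /cov /Rintegral; under [in RHS]eq_integral do rewrite -expr2.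
 by rewrite fineK//; apply: integrable_fin_num => //; exact: integrable_zeta_sq.
by [].
Qed.

End Covariance.

(** * Finite-dimensional form of the embedding constant *)

Section EmbeddingConstant.
Context {R : realType} {m : nat}.
Variables (T : R) (gamma : probability (cpath T (0 : 'rV[R]_m)) R).
Hypotheses (T0 : 0 < T) (hg : gaussian gamma).
Local Notation E := (cpath T (0 : 'rV[R]_m)).
Local Notation hpath := (hpath hg).
Local Notation cov := (cov gamma).
Implicit Types (c e : seq (R * 'I_m * R)).

Lemma path_pvar1_scale (x y : R -> 'rV[R]_m) (k M : R) : 0 <= k -> 0 <= M ->
 (forall t, y t = k *: x t) -> (path_pvar T 1 x <= M%:E)%E -> (path_pvar T 1 y <= (k * M)%:E)%E.
Proof.
move=> k0 M0 xy hx; apply: pvar_le => // [|u n gu]; first exact: mulr_ge0.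
have := @pvar_psum _ T 1 _ (fun s t => enorm (x t - x s)) M u n T0 ltr01 M0 hx.
rewrite !powRr1 ?mulr_ge0// /psum => H.
under eq_bigr do rewrite !xy -scalerBr enormZ powRr1 ?mulr_ge0// ger0_norm//.
rewrite -mulr_sumr ler_wpM2l//.
have {}H := H (fun s t => lexx _) (fun s t => enorm_ge0 _) _ gu.
under [X in X <= _]eq_bigr do rewrite -[enorm _]powRr1//.
by apply: H => s; rewrite subrr enorm0.
Qed.

Lemma hpath_scale a e t : hpath (scale a e) t = a *: hpath e t.
Proof. by apply/rowP => i; rewrite /= !mxE !(covC _ _ (pt i t)) (cov_scale hg). Qed.

Lemma var_scale a e : cov (scale a e) (scale a e) = a ^+ 2 * cov e e.
Proof. by rewrite (cov_scale hg) covC (cov_scale hg) mulrA -expr2. Qed.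

Hypothesis hiota : cm_embedded_1var gamma.

(** [kap] is the supremum of the 1-variations of [hpath e] over variance at most 1. Continuity of
    the embedding at the zero path and scaling make it finite, and [cm_norm_hpath] places it below
    the embedding norm. *)
Lemma embedding_constant : exists kap : R, [/\ 0 <= kap, (kap%:E <= cm_embedding_norm gamma)%E &
 forall e (v : R), 0 <= v -> cov e e <= v ^+ 2 -> (path_pvar T 1 (hpath e) <= (kap * v)%:E)%E].
Proof.
have cm e : cameron_martin gamma (hpath e) by exists (zeta gamma e); exact: hpath_cm.
have h0 t : hpath [::] t = 0 by apply/rowP => i; rewrite /= !mxE covC cov_nil.
have pv0 (x : R -> 'rV[R]_m) : (0 <= path_pvar T 1 x)%E.
 have D0 : itv_partition 0 T [:: T] by split; rewrite //= T0.
 by apply: le_trans (ereal_sup_ubound (ex_intro2 _ _ _ D0 erefl)); exact: poweR_ge0.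
have [_ /(_ _ (cm [::]) 1 ltr01) [de de0 hde]] := hiota.
have bnd e : cov e e <= 1 -> (path_pvar T 1 (hpath e) <= (2 / de)%:E)%E.
 move=> ve; have {}hde := hde _ (cm (scale (de / 2) e)).
 have d2 : 0 < de / 2 by pos.
 have := hde _; rewrite (_ : cpathD _ _ = hpath (scale (de / 2) e)); last first.
 apply: cpath_ext => t; have -> : cpathD (hpath (scale (de / 2) e)) (cpathN (hpath [::])) t =
 hpath (scale (de / 2) e) t - hpath [::] t by [].
 by rewrite h0 subr0.
 have nh : (cm_norm gamma (hpath (scale (de / 2) e)) < de%:E)%E.
 apply: le_lt_trans (cm_norm_hpath _ _) _; rewrite lte_fin var_scale.
 apply: (@le_lt_trans _ _ (Num.sqrt ((de / 2) ^+ 2))).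
 by rewrite ler_wsqrtr// ler_piMr// sqr_ge0.
 by rewrite sqrtr_sqr gtr0_norm// ltr_pdivrMr// ltr_pMr//; lra.
 move=> /(_ nh); rewrite /dpvar => /ltW H.
 rewrite -[2 / de]mulr1; apply: path_pvar1_scale H => //; first by pos.
 move=> t; rewrite h0 subr0 hpath_scale scalerA mulrA divfK ?gt_eqF// divff//.
 by rewrite scale1r.
pose A := [set path_pvar T 1 (hpath e) | e in [set e | cov e e <= 1]].
have A0 : A (path_pvar T 1 (hpath [::])) by exists [::] => //=; rewrite cov_nil.
have supge : (0 <= ereal_sup A)%E by apply: ereal_sup_ge; exists (path_pvar T 1 (hpath [::])).
have suple : (ereal_sup A <= (2 / de)%:E)%E by apply: ge_ereal_sup => _ [e ve <-]; exact: bnd.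
have fs : ereal_sup A \is a fin_num.
 by rewrite fin_numE; apply/andP; split; apply/eqP => H; move: supge suple; rewrite H.
exists (fine (ereal_sup A)); split; first exact: fine_ge0.
 rewrite fineK//; apply: le_ereal_sup => _ [e ve <-]; exists (hpath e) => //; split; first exact: cm.
 by letr (cm_norm_hpath _ _); rewrite lee_fin -(sqrtr1 R) ler_wsqrtr.
(* Since [v] may be 0, the rescaling to variance at most 1 uses a slightly larger [w]. *)
move=> e v v0 ve; apply/lee_addgt0Pr => d d0; rewrite -EFinD.
have k0 : 0 <= fine (ereal_sup A) by exact: fine_ge0.
set k := fine _ in k0 *; pose w := v + d / (k + 1).
have k1 : 0 < k + 1 by pos.
have w0 : 0 < w by pos.
have vw : v <= w by rewrite lerDl divr_ge0// ltW.
have H : (path_pvar T 1 (hpath (scale w^-1 e)) <= k%:E)%E.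
 rewrite fineK//; apply: ereal_sup_ubound; exists (scale w^-1 e) => //=; rewrite var_scale.
 rewrite exprVn ler_pdivrMl ?exprn_gt0// mulr1; apply: le_trans ve _.
 by rewrite ler_pXn2r// nnegrE// ltW.
letr (@path_pvar1_scale _ (hpath e) w k (ltW w0) k0 _ H).
 by move=> t; rewrite hpath_scale scalerA divff ?gt_eqF// scale1r.
rewrite lee_fin /w mulrDl mulrC lerD2l -mulrA ler_piMr ?(ltW d0)//.
by rewrite mulrC ler_pdivrMr// mul1r lerDl.
Qed.

End EmbeddingConstant.

(** * Resampling one Gaussian coordinate *)

Section Resampling.
Context {R : realType} {m : nat}.
Variables (T : R) (gamma : probability (cpath T (0 : 'rV[R]_m)) R).
Hypotheses (T0 : 0 < T) (hg : gaussian gamma).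
Local Notation E := (cpath T (0 : 'rV[R]_m)).
Local Notation hpath := (hpath hg).
Local Notation cov := (cov gamma).
Local Notation zeta := (zeta gamma).
Local Notation N01 := (normal_prob 0 1 : probability _ R).
Local Notation Rb := (g_sigma_algebraType R.-ocitv.-measurable).
Implicit Types (c e : seq (R * 'I_m * R)).

Lemma measurable_cos_affine (a w : R) : mfunT (fun z : R => cos (a * z + w)).
Proof. by apply: cont_meas; exact: continuous_cos_affine. Qed.

Lemma normal_prob_cos (k w : R) : \int[N01]_z cos (k * z + w) = cos w * expR (- (k ^+ 2 / 2)).
Proof.
have mF := measurable_cos_affine k w.
have iF : lebesgue_measure.-integrable setT (fun x : R => (cos (k * x + w) * normal_pdf 0 1 x)%:E).
 apply: (@normal_moment _ _ _ (oner_neq0 R) _ 1); first exact: continuous_cos_affine.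
 move=> x; rewrite mul1r; apply: le_trans (_ : 1 <= _); first by rewrite ler_norml cos_geN1 cos_le1.
 by rewrite lerDl sqr_ge0.
have [_ ->] := @density_real _ _ R (normal_prob 0 1 : {finite_measure set _ -> \bar R})
 lebesgue_measure (normal_pdf 0 1) _ (normal_pdf_ge0 0 1) (measurable_normal_pdf 0 1) mF (fun A _ => erefl) iF.
have := normal_cos 0 w (oner_neq0 R) k; rewrite expr1n mul1r => <-.
by apply: eq_Rintegral => x _; rewrite subr0.
Qed.

(* x with its coordinate zeta e x along hpath e replaced by z, if cov e e = 1 *)
Definition resample e (x : E) (z : R) : E := cpathD x (hpath (scale (z - zeta e x) e)).

Lemma comb_resample c e x z : coord_comb c (resample e x z) = coord_comb c x + (z - zeta e x) * cov e c.
Proof. by rewrite combD comb_hpath covC (cov_scale hg) covC. Qed.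

Lemma measurable_resample e : mfunT (fun p : E * Rb => resample e p.1 p.2).
Proof.
apply: (measurable_to_cpath T0) => i t.
have -> : (fun p : E * Rb => resample e p.1 p.2 t 0 i) =
 (fun p => coord_comb (pt i t) p.1 + (p.2 - zeta e p.1) * cov e (pt i t)).
 by apply/funext => p; rewrite -comb_resample comb_pt.
apply: measurable_funD; first by apply: (mcomp (measurable_comb (pt i t))); exact: measurable_fst.
apply: measurable_funM => //; apply: measurable_funB; first exact: measurable_snd.
by apply: (mcomp (measurable_zeta gamma e)); exact: measurable_fst.
Qed.

Lemma resample_cos e c w : cov e e = 1 -> \int[(gamma \x N01)%E]_p cos (coord_comb c (resample e p.1 p.2) + w) =
 \int[gamma]_x cos (coord_comb c x + w).
Proof.
move=> ve; pose k := cov e c.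
have me (x : E) (z : R) : coord_comb c (resample e x z) + w =
 k * z + (coord_comb (c ++ scale (- k) e) x + (k * mean gamma e + w)).
 by rewrite comb_resample comb_cat comb_scale /zeta -/k; ring.
have mf : mfunT (fun p : E * Rb => cos (coord_comb c (resample e p.1 p.2) + w)).
 have mc : mfunT (fun y : R => cos (y + w)) by have := measurable_cos_affine 1 w; under eq_fun do rewrite mul1r.
 apply: (mcomp mc); apply: (mcomp (measurable_comb c)); exact: measurable_resample.
have iF : (gamma \x N01)%E.-integrable setT (EFin \o (fun p : E * Rb => cos (coord_comb c (resample e p.1 p.2) + w))).
 by apply: (@bounded_integrable _ _ _ _ _ 1) => // p; rewrite ler_norml cos_geN1 cos_le1.
rewrite [LHS]/Rintegral -(integral12_prod_meas1 iF).
rewrite (eq_integral (fun x => (expR (- (k ^+ 2 / 2)) * cos (coord_comb (c ++ scale (- k) e) x + (k * mean gamma e + w)))%:E)); last first.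
 move=> x _; rewrite /fubini_F /=.
 have h := normal_prob_cos k (coord_comb (c ++ scale (- k) e) x + (k * mean gamma e + w)).
 rewrite mulrC -h /Rintegral fineK.
 by apply: eq_integral => z _; rewrite me.
 apply: integrable_fin_num => //; apply: (@bounded_integrable _ _ _ _ _ 1) => [|z].
 exact: measurable_cos_affine.
 by rewrite ler_norml cos_geN1 cos_le1.
rewrite -/(Rintegral _ _ _) RintegralZl//; last first.
 apply: (@bounded_integrable _ _ _ _ _ 1) => [|x]; last by rewrite ler_norml cos_geN1 cos_le1.
 have mc := measurable_cos_affine 1 (k * mean gamma e + w).
 have := mcomp mc (measurable_comb (T := T) (c ++ scale (- k) e)).
 by apply: eq_measurable_fun => x _ /=; rewrite mul1r.
rewrite !comb_cos// var_lin// mean_cat// mean_scale// ve -/k mulrCA -expRD.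
by congr (cos _ * expR _); [ring|field].
Qed.

(** For any [c], the part [c - cov e c * e] is uncorrelated with [e]; adding back an independent
    normal multiple of the same size restores the variance. All cosine integrals agree, hence so do
    the laws. This replaces a disintegration of [gamma]. *)
Theorem resample_law e (F : E -> \bar R) : cov e e = 1 -> (forall x, (0 <= F x)%E) ->
 mfunT F -> (\int[gamma]_x F x = \int[gamma]_x \int[N01]_z F (resample e x z))%E.
Proof.
move=> ve F0 mF; pose Psi : {mfun (E * Rb)%type >-> E} := mfun_Sub (mem_set (measurable_resample e)).
pose Q := distribution (gamma \x N01)%E Psi.
have eqQ A : measurable A -> gamma A = Q A.
 apply: (@fourier_unique _ _ _ gamma Q [set l | exists c, l = coord_comb c]).
 - by move=> _ [c ->]; exact: measurable_comb.
 - by move=> _ _ [c ->] [c' ->]; exists (c ++ c'); apply/funext => x; rewrite comb_cat.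
 - by move=> a _ [c ->]; exists (scale a c); apply/funext => x; rewrite comb_scale.
 - by exists [::]; apply/funext => x; rewrite comb_nil.
 - move=> _ w [c ->]; rewrite -(resample_cos c w ve).
 have mc : mfunT (fun x : E => cos (coord_comb c x + w)).
 have := mcomp (measurable_cos_affine 1 w) (measurable_comb (T := T) c).
 by apply: eq_measurable_fun => x _ /=; rewrite mul1r.
 have iQ : integT Q (fun x : E => cos (coord_comb c x + w)).
 by apply: (@bounded_integrable _ _ _ _ _ 1) => // x; rewrite ler_norml cos_geN1 cos_le1.
 have [_ H] := integral_law (measurable_resample e) (fun A _ => erefl (Q A)) mc iQ.
 by [].
 - rewrite borel_coord//; congr (<<s _ >>); apply/seteqP; split=> B.
 by move=> [c [a ->]]; exists (coord_comb c), a; split=> //; exists c.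
 by move=> [l [a [[c ->] ->]]]; exists c, a.
transitivity (\int[Q]_x F x)%E.
 by apply: eq_measure_integral => A mA _; exact: eqQ.
rewrite -(ge0_integral_law (measurable_resample e) (fun A _ => erefl (Q A)) F0 mF).
by rewrite fubini_tonelli1// ; exact: (mcomp mF (measurable_resample e)).
Qed.

End Resampling.

(** * Monotone rearrangement of densities on the line *)

Section Tilt.
Context d (T : measurableType d) (R : realType).
Variables (mu : {sigma_finite_measure set T -> \bar R}) (w : T -> R).
Hypotheses (mw : mfunT w) (w0 : forall x, 0 <= w x) (wfin : (\int[mu]_x (w x)%:E < +oo)%E).

(** The proofs are arguments so that the measure and finiteness instances below can be attached to
    the term. *)
Definition tilt of mfunT w & (forall x, 0 <= w x) & (\int[mu]_x (w x)%:E < +oo)%E :=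
 fun A : set T => (\int[mu]_(x in A) (w x)%:E)%E.

Local Notation tiltw := (tilt mw w0 wfin).
Let tilt0 : tiltw set0 = 0%E. Proof. by rewrite /tilt integral_set0. Qed.
Let tilt_ge0 A : (0 <= tiltw A)%E.
Proof. by apply: integral_ge0 => x _; rewrite lee_fin. Qed.
Let tilt_semi_sigma_additive : semi_sigma_additive tiltw.
Proof.
move=> F mF tF mUF; rewrite /tilt ge0_integral_bigcup//.
- by apply: is_cvg_ereal_nneg_natsum => n _; exact: tilt_ge0.
- by apply/measE; exact: measurable_funTS.
- by move=> x _; rewrite lee_fin.
Qed.

HB.instance Definition _ := isMeasure.Build _ _ _ tiltw tilt0 tilt_ge0 tilt_semi_sigma_additive.
Let tilt_fin : fin_num_fun tiltw.
Proof.
move=> A mA; rewrite ge0_fin_numE//; apply: le_lt_trans wfin.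
apply: ge0_subset_integral => //; first by apply/measE.
by move=> x _; rewrite lee_fin.
Qed.

HB.instance Definition _ := @Measure_isFinite.Build _ _ _ tiltw tilt_fin.

Lemma integral_tilt (F : T -> \bar R) : (forall x, (0 <= F x)%E) -> mfunT F ->
 (\int[tiltw]_x F x = \int[mu]_x (F x * (w x)%:E))%E.
Proof.
by move=> F0 mF; exact: (@integral_density _ _ _ tiltw mu w mw (fun A _ => erefl) F F0 mF).
Qed.

End Tilt.

Section DistributionFunction.
Context {R : realType}.
Local Notation mu := (@lebesgue_measure R).
Local Notation Rb := (g_sigma_algebraType R.-ocitv.-measurable).

Definition pdf (q : R -> R) := [/\ continuous q, forall x, 0 < q x & (\int[mu]_x (q x)%:E = 1)%E].

Definition df (q : R -> R) (x : R) : R := \int[mu]_(y in `]-oo, x]%classic) q y.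

Section Properties.
Variable q : R -> R.
Hypothesis hq : pdf q.
Let mq : mfunT (q : Rb -> R). Proof. by have [cq _ _] := hq; exact: cont_meas. Qed.
Let q0 x : 0 <= q x. Proof. by have [_ q0 _] := hq; exact: ltW. Qed.
Let qfin : (\int[mu]_x (q x)%:E < +oo)%E. Proof. by have [_ _ ->] := hq; rewrite ltry. Qed.

Lemma pdf_integrable (A : set R) : measurable A -> mu.-integrable A (EFin \o q).
Proof.
move=> mA; apply: (@integrableS _ _ _ mu setT) => //; apply/integrableP; split; first exact/measE.
by under eq_integral do rewrite /= ger0_norm//.
Qed.

Definition pdf_measure : {finite_measure set Rb -> \bar R} := @tilt _ Rb R mu q mq q0 qfin.

Lemma df_measure x : pdf_measure `]-oo, x]%classic = (df q x)%:E.
Proof. by rewrite /df /Rintegral fineK//; apply: integrable_fin_num => //; exact: pdf_integrable. Qed.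

Lemma df_measure_lt x : pdf_measure `]-oo, x[%classic = (df q x)%:E.
Proof.
rewrite -df_measure; apply: integral_itv_bndo_bndc.
by apply/measE; exact: measurable_funTS.
Qed.

Lemma is_derive_df (x : R) : is_derive x 1 (df q) (q x).
Proof.
have [cq _ _] := hq.
have [|] := @continuous_FTC1 R q -oo%O x (x + 1) (ltr_pwDr ltr01 (lexx x)) (pdf_integrable (measurable_itv _)) _ (cq x).
 by rewrite ltNyr.
by rewrite derive1E => d1 d2; exact: DeriveDef d1 d2.
Qed.

Lemma df_continuous : continuous (df q).
Proof. by move=> x; have := is_derive_df x => ?; exact/differentiable_continuous/derivable1_diffP. Qed.

Lemma df_lt : {homo df q : x y / x < y}.
Proof.
move=> x y xy; have [c _ E] := MVT xy (fun z _ => is_derive_df z) (continuous_subspaceT df_continuous).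
by rewrite -subr_gt0 E mulr_gt0 ?subr_gt0//; have [_ ->] := hq.
Qed.

Lemma df_inj : injective (df q).
Proof.
move=> x y E; have [/df_lt|/df_lt|//] := ltgtP x y; by rewrite E ltxx.
Qed.

Lemma df_gt0 x : 0 < df q x.
Proof.
have h : df q (x - 1) < df q x by apply: df_lt; rewrite ltrBlDr ltrDl.
by apply: le_lt_trans h; apply: Rintegral_ge0 => y _; exact: q0.
Qed.

Lemma df_lt1 x : df q x < 1.
Proof.
have h : df q x < df q (x + 1) by apply: df_lt; rewrite ltrDl.
apply: lt_le_trans h _; rewrite -lee_fin -df_measure.
have [_ _ <-] := hq; apply: ge0_subset_integral => //; first exact/measE.
by move=> y _; rewrite lee_fin.
Qed.

Lemma df_onto y : 0 < y < 1 -> exists x, df q x = y.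
Proof.
move=> /andP[y0 y1].
have [a ay] : exists a, df q a < y.
 have : pdf_measure \o (fun n => `]-oo, - n%:R]%classic : set R) @ \oo --> pdf_measure (\bigcap_n `]-oo, - (n%:R : R)]%classic).
 apply: nonincreasing_cvg_mu => //.
 - by rewrite -ge0_fin_numE//; exact: fin_num_measure.
 - by apply: bigcapT_measurable => n.
 - by move=> i j ij; apply/subsetPset; apply: subset_itvl; rewrite bnd_simp lerN2 ler_nat.
 have -> : \bigcap_n `]-oo, - (n%:R : R)]%classic = set0.
 apply/seteqP; split=> // x /(_ (Num.truncn `|x|).+1 I); rewrite /= in_itv /= => h.
 have := truncnS_gt `|x|; have := ler_norm (- x); rewrite normrN; move: h.
 by move=> h1 h2 h3; lra.
 rewrite measure0 => /fine_cvgP[_ /cvgrPdist_lt/(_ y y0)] [n _ /(_ n (leqnn n))] /=.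
 rewrite df_measure sub0r normrN => h; exists (- n%:R); apply: le_lt_trans h; exact: ler_norm.
have [b yb] : exists b, y < df q b.
 have : pdf_measure \o (fun n => `]-oo, n%:R]%classic : set R) @ \oo --> pdf_measure (\bigcup_n `]-oo, (n%:R : R)]%classic).
 apply: nondecreasing_cvg_mu => //.
 - by apply: bigcupT_measurable => n.
 - by move=> i j ij; apply/subsetPset; apply: subset_itvl; rewrite bnd_simp ler_nat.
 have -> : \bigcup_n `]-oo, (n%:R : R)]%classic = setT.
 apply/seteqP; split=> // x _; exists (Num.truncn `|x|).+1 => //=; rewrite in_itv /=.
 by letr (ler_norm x); exact/ltW/truncnS_gt.
 have -> : pdf_measure setT = 1%E by have [_ _ <-] := hq.
 have y1' : 0 < 1 - y by pos.
 move=> /fine_cvgP[_ /cvgrPdist_lt/(_ _ y1')] [n _ /(_ n (leqnn n))] /=.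
 rewrite df_measure => h; exists n%:R; move: (le_lt_trans (ler_norm _) h) => /=.
 lra.
have ab : a <= b by rewrite leNgt; apply/negP => /df_lt; lra.
have [||c _ E] := @IVT R (df q) a b y ab; first exact/continuous_subspaceT/df_continuous.
 have dab : df q a <= df q b by lra.
 by rewrite (min_idPl dab) (max_idPr dab) !ltW.
by exists c.
Qed.

End Properties.

Lemma measure_image d d' (T1 : measurableType d) (T2 : measurableType d')
 (m : {measure set T1 -> \bar R}) (f : T1 -> T2) : mfunT f ->
 exists P : {measure set T2 -> \bar R}, forall A, P A = m (f @^-1` A).
Proof. by move=> mf; unshelve eexists (pushforward m f : {measure set T2 -> \bar R}). Qed.

Section MonotoneMap.
Variables p q : R -> R.
Hypotheses (hp : pdf p) (hq : pdf q).

(** The quantile of [q] at level [df p z], that is, the increasing rearrangement of [p] into [q]. *)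
Definition monotone_map (z : R) : R := xget 0 [set u | df q u = df p z].
Local Notation t := monotone_map.

Lemma df_monotone_map z : df q (t z) = df p z.
Proof.
rewrite /t; case: xgetP => [y _ //|none].
have [u uE] := df_onto hq (introT andP (conj (df_gt0 hp z) (df_lt1 hp z))).
by have := none u.
Qed.

Lemma monotone_map_lt z u : (t z < u) = (df p z < df q u).
Proof.
rewrite -df_monotone_map; apply/idP/idP => [|h]; first exact: df_lt.
by rewrite ltNge le_eqVlt; apply/negP => /predU1P[E|/(df_lt hq)]; [move: h; rewrite E ltxx|lra].
Qed.

Lemma measurable_monotone_map : mfunT (t : Rb -> Rb).
Proof.
apply: (measurability _ (RGenInftyO.measurableE R)) => _ [_ [u ->] <-]; rewrite setTI.
have -> : t @^-1` `]-oo, u[%classic = (df p) @^-1` `]-oo, df q u[%classic.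
 by apply/seteqP; split=> z; rewrite /= !in_itv /= monotone_map_lt.
rewrite -[X in measurable X]setTI; apply: (cont_meas (df_continuous hp)) => //.
Qed.

Lemma monotone_map_law A : measurable A -> pdf_measure hp (t @^-1` A) = pdf_measure hq A.
Proof.
have [P PE] := measure_image (pdf_measure hp) measurable_monotone_map.
rewrite -PE; apply: (@measure_unique _ R Rb (@RGenInftyO.G R) (fun n => `]-oo, n%:R[%classic)) => //.
- exact: RGenInftyO.measurableE.
- by move=> _ _ [x ->] [y ->]; exists (Num.min x y); apply/seteqP; split=> z /=; rewrite !in_itv /= lt_min => /andP.
- by move=> n; exists n%:R.
- apply/seteqP; split=> // x _; exists (Num.truncn `|x|).+1 => //=; rewrite in_itv /=.
 by apply: le_lt_trans (ler_norm x) _; exact/truncnS_gt.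
- move=> _ [u ->]; rewrite PE; have [v vE] := df_onto hp (introT andP (conj (df_gt0 hq u) (df_lt1 hq u))).
 rewrite (_ : t @^-1` _ = `]-oo, v[%classic); first by apply: etrans (df_measure_lt hp v) _; rewrite vE; apply/esym/df_measure_lt.
 apply/seteqP; split=> z; rewrite /= !in_itv /= monotone_map_lt -vE; last exact: df_lt.
 by move=> h; rewrite ltNge le_eqVlt; apply/negP => /predU1P[E|/(df_lt hp)]; [move: h; rewrite E ltxx|lra].
- move=> k; rewrite PE -ge0_fin_numE//; apply: fin_num_measure.
 by rewrite -[X in measurable X]setTI; exact: measurable_monotone_map.
Qed.

Lemma ge0_integral_monotone_map (F : R -> \bar R) : (forall x, (0 <= F x)%E) -> mfunT (F : Rb -> \bar R) ->
 (\int[mu]_z (F (t z) * (p z)%:E) = \int[mu]_u (F u * (q u)%:E))%E.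
Proof.
move=> F0 mF; transitivity (\int[pdf_measure hp]_z F (t z))%E.
 apply/esym/integral_tilt => //; exact: (mcomp mF measurable_monotone_map).
rewrite (ge0_integral_law measurable_monotone_map monotone_map_law F0 mF).
exact: integral_tilt.
Qed.

(** Chain rule through the inverse of [df q], which is differentiable because [q] is positive; the
    formula is the Monge-Ampere equation in dimension one. *)
Lemma is_derive_monotone_map (z : R) : is_derive z 1 t (p z / q (t z)).
Proof.
pose g y := xget 0 [set u | df q u = y].
have gK : cancel (df q) g by move=> u; apply: (df_inj hq); rewrite /g; case: xgetP => [v _ //|/(_ u) /=].
have dg : is_derive (df q (t z)) 1 g (q (t z))^-1.
 apply: is_derive_inverse.
 - by near=> u; exact: gK.
 - by near=> u; exact: df_continuous.
 - exact: is_derive_df.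
 - by have [_ q0 _] := hq; rewrite gt_eqF.
rewrite df_monotone_map in dg; have dp := is_derive_df hp z.
rewrite mulrC; exact: (@is_derive1_comp R g (df p) z _ _ dg dp).
Unshelve. all: by end_near. Qed.

End MonotoneMap.

End DistributionFunction.

(** * Talagrand's inequality for the standard normal law *)

Section LogarithmBounds.
Context {R : realType}.
Implicit Types a b x : R.

Lemma ln_between a b x : 0 < a -> a <= x <= b -> `|ln x| <= `|ln a| + `|ln b|.
Proof.
move=> a0 /andP[h1 h2]; have x0 : 0 < x by lra.
have l1 : ln a <= ln x by rewrite ler_ln.
have l2 : ln x <= ln b by rewrite ler_ln ?posrE// (lt_le_trans x0).
have := ler_norm (ln b); have := ler_norm (- ln a); rewrite normrN ler_norml.
by move: (`|ln a|) (`|ln b|) (normr_ge0 (ln a)) (normr_ge0 (ln b)) => s t; lra.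
Qed.

Lemma ln_ge_1V x : 0 < x -> 1 - x^-1 <= ln x.
Proof.
move=> x0; have := @le_ln1Dx R (x^-1 - 1); rewrite ltrBrDl addrN invr_gt0 => /(_ x0).
by rewrite addrC subrK lnV//; lra.
Qed.

End LogarithmBounds.

Section GaussianTransport.
Context {R : realType}.
Local Notation mu := (@lebesgue_measure R).
Local Notation Rb := (g_sigma_algebraType R.-ocitv.-measurable).
Local Notation N01 := (normal_prob 0 1 : probability _ R).
Local Notation phi := (@normal_pdf R 0 1).

Lemma normal_pdfE (x : R) : phi x = normal_peak 1 * expR (- (x ^+ 2 / 2)).
Proof.
by rewrite normal_pdfE// /normal_fun subr0 expr1n mulNr.
Qed.

Lemma normal_peak1_gt0 : 0 < normal_peak (1 : R).
Proof. by apply: normal_peak_gt0; rewrite oner_neq0. Qed.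

Lemma pdf_normal : pdf phi.
Proof.
have [_ c] := normal_pdf_C1 0 (oner_neq0 R); split=> //.
 by move=> x; rewrite normal_pdfE mulr_gt0 ?expR_gt0// normal_peak1_gt0.
exact: integral_normal_pdf.
Qed.

Lemma integral_normal01 (F : R -> \bar R) : (forall x, (0 <= F x)%E) -> mfunT (F : Rb -> \bar R) ->
 (\int[N01]_x F x = \int[mu]_x (F x * (phi x)%:E))%E.
Proof.
move=> F0 mF; exact: (@integral_density _ Rb R (normal_prob 0 1 : {finite_measure set _ -> \bar R})
 lebesgue_measure phi (measurable_normal_pdf 0 1) (fun A _ => erefl) F F0 mF).
Qed.

Variables (g : R -> R) (c M : R).
Hypotheses (cg : continuous g) (c0 : 0 < c) (gcM : forall x, c <= g x <= M).
Hypothesis g1 : (\int[N01]_x (g x)%:E = 1)%E.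
Let g0 x : 0 < g x. Proof. by have /andP[h _] := gcM x; exact: lt_le_trans h. Qed.

Lemma pdf_normal_mul : pdf (fun x => g x * phi x).
Proof.
have [cp p0 p1] := pdf_normal; split.
- by move=> x; apply: cvgM; [exact: cg|exact: cp].
- by move=> x; pos.
- rewrite -g1 integral_normal01//; first by move=> x; rewrite lee_fin ltW.
 by apply/measE; exact: cont_meas.
Qed.

Local Notation t := (monotone_map phi (fun x => g x * phi x)).

Lemma ge0_integral_normal_map (F : R -> \bar R) : (forall x, (0 <= F x)%E) -> mfunT (F : Rb -> \bar R) ->
 (\int[N01]_z F (t z) = \int[N01]_u (F u * (g u)%:E))%E.
Proof.
move=> F0 mF; have mt := measurable_monotone_map pdf_normal pdf_normal_mul.
have g0' x : (0 <= (g x)%:E)%E by rewrite lee_fin ltW.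
rewrite integral_normal01//; last exact: (mcomp mF mt).
rewrite (ge0_integral_monotone_map pdf_normal pdf_normal_mul)// integral_normal01.
- by apply: eq_integral => x _; rewrite EFinM muleA.
- by move=> x; rewrite mule_ge0.
- by apply: emeasurable_funM => //; apply/measE; exact: cont_meas.
Qed.
Let ccomp (f h : R -> R) : continuous h -> (forall x, {for h x, continuous f}) -> continuous (fun y => f (h y)).
Proof. by move=> ch cf x; exact: (continuous_comp (ch x) (cf x)). Qed.
Let dt (z : R) : is_derive z 1 t (phi z / (g (t z) * phi (t z))).
Proof. exact: is_derive_monotone_map pdf_normal pdf_normal_mul z. Qed.
Let ct : continuous t.
Proof. by move=> x; have := dt x => ?; exact/differentiable_continuous/derivable1_diffP. Qed.
Let dte z : phi z / (g (t z) * phi (t z)) = expR ((t z ^+ 2 - z ^+ 2) / 2 - ln (g (t z))).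
Proof.
rewrite !normal_pdfE expRB lnK ?posrE// mulrBl expRB !expRN.
have := normal_peak1_gt0; move: (normal_peak _) (expR (z ^+ 2 / 2)) (expR (t z ^+ 2 / 2)) (expR_gt0 (z ^+ 2 / 2))
 (expR_gt0 (t z ^+ 2 / 2)) (g (t z)) (g0 (t z)) => k a b a0 b0 h h0 k0.
by field; rewrite !gt_eqF.
Qed.
(** The second moment of [t] under the normal law is the second moment of the law with density [g],
    finite because [g] is bounded; quadratic growth in [z] and [t z] is therefore integrable. *)
Let ibound (f : R -> R) K : continuous f -> (forall z, `|f z| <= K * (1 + z ^+ 2 + t z ^+ 2)) ->
 mu.-integrable setT (fun z => (f z * phi z)%:E).
Proof.
move=> cf fK; have [cp p0 _] := pdf_normal.
have i1 : mu.-integrable setT (fun z => ((1 + z ^+ 2) * phi z)%:E).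
 apply: (@normal_moment _ _ _ (oner_neq0 R) _ 1) => x.
 by apply: cvgD; [exact: cvg_cst|apply: exprn_continuous].
 by rewrite mul1r subr0 ger0_norm// addr_ge0// sqr_ge0.
have i2 : mu.-integrable setT (fun z => (t z ^+ 2 * phi z)%:E).
 apply/integrableP; split.
 apply/measE; apply: cont_meas => x.
 by apply: cvgM; [apply: cvgM; exact: ct|exact: cp].
 have sq0 (x : R) : (0 <= (x ^+ 2)%:E)%E by rewrite lee_fin sqr_ge0.
 have msq : mfunT (fun x : Rb => (x ^+ 2)%:E).
 by apply/measE; apply: cont_meas => x; exact: exprn_continuous.
 have -> : (\int[mu]_z `|(t z ^+ 2 * phi z)%:E| = \int[mu]_z ((t z ^+ 2)%:E * (phi z)%:E))%E.
 by apply: eq_integral => z _; rewrite -EFinM abse_EFin ger0_norm// mulr_ge0 ?sqr_ge0// ltW.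
 rewrite (ge0_integral_monotone_map pdf_normal pdf_normal_mul sq0 msq).
 have : mu.-integrable setT (fun z => (z ^+ 2 * g z * phi z)%:E).
 apply: (@normal_moment _ _ _ (oner_neq0 R) _ M) => x.
 by apply: cvgM; [apply: exprn_continuous|exact: cg].
 have /andP[_ gM] := gcM x; have q0 : 0 <= x ^+ 2 * g x by apply: mulr_ge0; [exact: sqr_ge0|exact: ltW].
 rewrite subr0 ger0_norm//; have := sqr_ge0 x; have := g0 x.
 by move: (x ^+ 2) (g x) gM => a b h1 h2 h3; nra.
 move=> /integrableP[_]; rewrite [X in (X < _)%E -> _](_ : _ = \int[mu]_u ((u ^+ 2)%:E * (g u * phi u)%:E))%E//.
 apply: eq_integral => z _; rewrite -EFinM abse_EFin mulrA ger0_norm// mulr_ge0 ?(ltW (p0 _))//.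
 by pos.
have i3 := integrableZl measurableT K (integrableD measurableT i1 i2).
apply: le_integrable i3 => //.
 by apply/measE; apply: cont_meas => x; apply: cvgM; [exact: cf|exact: cp].
move=> x _; have : `|f x * phi x| <= `|K * ((1 + x ^+ 2) * phi x + t x ^+ 2 * phi x)|; last by [].
rewrite -mulrDl mulrA !normrM (ger0_norm (ltW (p0 x))).
rewrite (ler_pM2r (p0 x)) -normrM; letr (fK x); exact: ler_norm.
Qed.

(** The derivative of [t] is [expr y] with [y = (t^2 - z^2) / 2 - ln (g t)], writing [expr] for the
    exponential. With [A = (t - z) phi], the bound [1 + y <= expr y] gives [- A' <= I], so the
    integral of [I] is nonnegative: the mean of [ln (g t)] dominates half the transport cost. *)
Theorem talagrand_normal : (\int[N01]_z ((t z - z) ^+ 2)%:E <= (2 * \int[N01]_z (g z * ln (g z)))%:E)%E.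
Proof.
have [cp p0 _] := pdf_normal.
have cln : continuous (fun z => ln (g z)) by exact: (ccomp cg (fun x => continuous_ln (g0 x))).
have clnt : continuous (fun z => ln (g (t z))) by exact: (ccomp ct (fun x => cln _)).
have cgp : continuous (fun z => g z * phi z) by move=> x; apply: cvgM; [exact: cg|exact: cp].
have cgpt : continuous (fun z => g (t z) * phi (t z)) by exact: (ccomp ct (fun x => cgp _)).
pose K := `|ln c| + `|ln M|.
have lnK x : `|ln (g x)| <= K by exact: ln_between.
have K0 : 0 <= K by pos.
have ctz : continuous (fun z => t z - z) by move=> x; apply: cvgB; [exact: ct|exact: cvg_id].
have csq : continuous (fun z => (t z - z) ^+ 2) by move=> x; apply: cvgM; exact: ctz.
have i1 : mu.-integrable setT (fun z => (ln (g (t z)) * phi z)%:E).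
 apply: (@ibound _ K) => // z; letr (lnK _); rewrite ler_peMr//.
 by rewrite -addrA lerDl addr_ge0 ?sqr_ge0.
have i2 : mu.-integrable setT (fun z => ((t z - z) ^+ 2 * phi z)%:E).
 apply: (@ibound _ 2) => // z; rewrite ger0_norm ?sqr_ge0//; move: (t z) => y.
 by have := sqr_ge0 (y + z); nra.
have i2' : mu.-integrable setT (fun z => ((2^-1)%:E * ((t z - z) ^+ 2 * phi z)%:E)%E) by exact: integrableZl.
have iA : mu.-integrable setT (fun z => ((t z - z) * phi z)%:E).
 apply: (@ibound _ 1) => // z; rewrite mul1r ler_norml; move: (t z) => y.
 have := sqr_ge0 (y - 1 / 2); have := sqr_ge0 (z + 1 / 2).
 by have := sqr_ge0 (y + 1 / 2); have := sqr_ge0 (z - 1 / 2) => h1 h2 h3 h4; apply/andP; split; nra.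
pose I z := (ln (g (t z)) - (t z - z) ^+ 2 / 2) * phi z.
have IE z : I z = ln (g (t z)) * phi z - 2^-1 * ((t z - z) ^+ 2 * phi z) by rewrite /I; field.
have iI : integT mu I.
 have -> : EFin \o I = (fun z => (ln (g (t z)) * phi z)%:E - (2^-1)%:E * ((t z - z) ^+ 2 * phi z)%:E)%E.
 by apply/funext => z /=; rewrite IE.
 exact: integrableB.
have cI : continuous I.
 move=> x; apply: cvgM; last exact: cp.
 by apply: cvgB; [exact: clnt|apply: cvgM; [exact: csq|exact: cvg_cst]].
pose A' z := (phi z / (g (t z) * phi (t z)) - 1) * phi z - (t z - z) * (z * phi z).
have dA (z : R) : is_derive z 1 (fun z => (t z - z) * phi z) (A' z).
 have [dp _] := normal_pdf_C1 0 (oner_neq0 R).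
 have := dp z => ?; have := dt z => ?; apply: is_derive_eq.
 by rewrite /A' /GRing.scale /= subr0 expr1n divr1; ring.
have cA' : continuous A'.
 move=> x; apply: cvgB; last first.
 by apply: cvgM; [exact: ctz|apply: cvgM; [exact: cvg_id|exact: cp]].
 apply: cvgM; last exact: cp.
 apply: cvgB; last exact: cvg_cst.
 apply: cvgM; first exact: cp.
 apply: cvgV; first by pos.
 exact: cgpt.
have AI z : - A' z <= I z.
 rewrite /A' /I dte; set y := _ / 2 - _.
 have := expR_ge1Dx y; have := p0 z; rewrite {2}/y; move: (expR y) (phi z) => w f f0 h.
 have -> : - ((w - 1) * f - (t z - z) * (z * f)) = (1 - w + (t z - z) * z) * f by ring.
 by rewrite ler_pM2r//; move: h; rewrite /y; move: (ln (g (t z))) (t z) => l s h; nra.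
have := integral_deriv_ge0 dA cA' cI AI iA iI.
have -> : (\int[mu]_x (I x)%:E = \int[mu]_x (ln (g (t x)) * phi x)%:E -
 (2^-1)%:E * \int[mu]_x ((t x - x) ^+ 2 * phi x)%:E)%E.
 rewrite -integralZl// -integralB//; apply: eq_integral => x _.
 by rewrite IE.
have E1 : (\int[mu]_x ((t x - x) ^+ 2 * phi x)%:E = \int[N01]_z ((t z - z) ^+ 2)%:E)%E.
 rewrite integral_normal01//; first by move=> x; rewrite lee_fin sqr_ge0.
 by apply/measE; exact: cont_meas.
(* As [t] sends the normal law to the one with density [g], the mean of [ln (g t)] is the entropy of
   [g]. Subtracting [ln c] keeps the integrands nonnegative. *)
have E2 : (\int[mu]_x (ln (g (t x)) * phi x)%:E = (\int[N01]_z (g z * ln (g z)))%:E)%E.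
 have f2 := integrable_fin_num measurableT i1; rewrite -(fineK f2).
 have mln : mfunT (fun z : Rb => ln (g (t z))) by exact: cont_meas.
 have [_ E5] := @density_real _ Rb R (normal_prob 0 1 : {finite_measure set _ -> \bar R})
 mu phi _ (normal_pdf_ge0 0 1) (measurable_normal_pdf 0 1) mln (fun A _ => erefl) i1.
 transitivity ((\int[N01]_z ln (g (t z)))%:E); first by congr EFin; exact/esym/E5.
 have F0 x : (0 <= (ln (g x) - ln c)%:E)%E.
 by rewrite lee_fin subr_ge0; have /andP[h _] := gcM x; rewrite ler_ln ?posrE.
 have mg : mfunT (g : Rb -> R) by exact: cont_meas.
 have mlg : mfunT (fun z : Rb => ln (g z)) by exact: cont_meas.
 have mF : mfunT (fun x : Rb => (ln (g x) - ln c)%:E) by apply/measE; apply: measurable_funB.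
 have gM x : `|g x| <= M by have /andP[_ h] := gcM x; rewrite ger0_norm// ltW.
 have ig : integT N01 g by exact: (@bounded_integrable _ Rb R N01 g M mg gM).
 have ilt : N01.-integrable setT (fun z => (ln (g (t z)))%:E) by exact: (@bounded_integrable _ Rb R N01 _ K mln (fun x => lnK (t x))).
 have igl : N01.-integrable setT (fun z => (g z * ln (g z))%:E).
 apply: (@bounded_integrable _ Rb R N01 _ (M * K)); first exact: measurable_funM.
 by move=> x; rewrite normrM; apply: ler_pM.
 have E3 : \int[N01]_z (ln (g (t z)) - ln c) = \int[N01]_z ((ln (g z) - ln c) * g z).
 by rewrite /Rintegral (ge0_integral_normal_map F0 mF).
 have E4 : \int[N01]_z g z = 1 by rewrite /Rintegral g1.
 have n1 : fine (N01 setT) = 1 by rewrite probability_setT.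
 move: E3; rewrite RintegralB//; last exact: integrable_cst.
 have -> : \int[N01]_z ((ln (g z) - ln c) * g z) = \int[N01]_z (g z * ln (g z) - ln c * g z).
 by apply: eq_Rintegral => x _; ring.
 rewrite RintegralB// ?RintegralZl// ?E4 ?Rintegral_cst// ?n1.
 by rewrite !mulr1 => h; congr EFin; apply: (addIr (- ln c)).
 have -> : EFin \o (fun z => ln c * g z) = (fun z => (ln c)%:E * (g z)%:E)%E by [].
 exact: integrableZl.
have := integrable_fin_num measurableT i2; rewrite E1 => f1.
rewrite E2 -(fineK f1) -EFinM -EFinB !lee_fin.
by move: (Rintegral _ _ _) (fine _) => u v; lra.
Qed.

End GaussianTransport.

(** * Transport along one Gaussian direction *)

Section BoundedExpectation.
Context d (T : measurableType d) (R : realType) (P : probability T R).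
Implicit Types f g : T -> R.

Lemma integ_between f a b : mfunT f -> (forall x, a <= f x <= b) -> integT P f.
Proof.
move=> mf fab; apply: (@bounded_integrable _ _ _ P f (`|a| + `|b|)) => // x.
have /andP[h1 h2] := fab x; have := ler_norm b; have := ler_norm (- a); rewrite normrN ler_norml.
by move: (`|a|) (`|b|) (normr_ge0 a) (normr_ge0 b) => s t; lra.
Qed.

Lemma EFin_expectation f a b : mfunT f -> (forall x, a <= f x <= b) -> (\int[P]_x f x)%:E = (\int[P]_x (f x)%:E)%E.
Proof.
move=> mf fab; rewrite fineK//; apply: integrable_fin_num => //; exact: integ_between mf fab.
Qed.

Lemma expectation_cst c : \int[P]_x c = c.
Proof. by have h : fine (P setT) = 1 by [rewrite probability_setT]; rewrite Rintegral_cst// h mulr1. Qed.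

Lemma expectation_between f a b : mfunT f -> (forall x, a <= f x <= b) -> a <= \int[P]_x f x <= b.
Proof.
move=> mf fab; have i := integ_between mf fab.
rewrite -{1}(expectation_cst a) -(expectation_cst b).
by apply/andP; split; apply: le_Rintegral => //; try exact: integrable_cst; move=> x _; have /andP[] := fab x.
Qed.

Lemma expectation_dist f g a b D : mfunT f -> mfunT g -> (forall x, a <= f x <= b) -> (forall x, a <= g x <= b) ->
 (forall x, `|f x - g x| <= D) -> `|\int[P]_x f x - \int[P]_x g x| <= D.
Proof.
move=> mf mg fab gab fgD; have i1 := integ_between mf fab.
have i2 := integ_between mg gab; rewrite -RintegralB//.
rewrite ler_norml; apply: expectation_between; first exact: measurable_funB.
by move=> x; rewrite -ler_norml.
Qed.

End BoundedExpectation.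

Section ResamplingCalculus.
Context {R : realType} {m : nat}.
Variables (T : R) (gamma : probability (cpath T (0 : 'rV[R]_m)) R).
Hypotheses (T0 : 0 < T) (hg : gaussian gamma).
Local Notation E := (cpath T (0 : 'rV[R]_m)).
Local Notation hpath := (hpath hg).
Local Notation cov := (cov gamma).
Local Notation zeta := (zeta gamma).
Local Notation Rb := (g_sigma_algebraType R.-ocitv.-measurable).
Local Notation N01 := (normal_prob 0 1 : probability Rb R).
Variable e : seq (R * 'I_m * R).
Hypothesis ve : cov e e = 1.
Local Notation rho := (resample hg e).

Lemma comb_inj (x y : E) : (forall c, coord_comb c x = coord_comb c y) -> x = y.
Proof. by move=> xy; apply: cpath_ext => t; apply/rowP => i; rewrite -!comb_pt xy. Qed.

Lemma comb_resample_self x z : coord_comb e (rho x z) = z + mean gamma e.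
Proof. by rewrite comb_resample ve mulr1 /zeta; ring. Qed.

Lemma zeta_resample x z : zeta e (rho x z) = z.
Proof. by rewrite /zeta comb_resample_self addrK. Qed.

Lemma resample_resample x z w : rho (rho x z) w = rho x w.
Proof.
by apply: comb_inj => c; rewrite 3!comb_resample zeta_resample; ring.
Qed.

Lemma measurable_resample_from x : mfunT (fun z : Rb => rho x z).
Proof.
exact: (mcomp (measurable_resample T0 hg e) (pair1_measurable x)).
Qed.

Lemma measurable_resample_integral (F : E -> \bar R) : (forall x, (0 <= F x)%E) ->
 mfunT F -> mfunT (fun x => \int[N01]_z F (rho x z))%E.
Proof.
move=> F0 mF.
apply: (@measurable_fun_fubini_tonelli_F _ _ E Rb R N01 (fun p => F (rho p.1 p.2))) => //.
exact: (mcomp mF (measurable_resample T0 hg e)).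
Qed.

Variables (f : E -> R) (a b : R).
Hypotheses (mf : mfunT f) (fab : forall x, a <= f x <= b).
Let mfr x : mfunT (fun z : Rb => f (rho x z)).
Proof. exact: (mcomp mf (measurable_resample_from x)). Qed.

Lemma measurable_resample_expectation : mfunT (fun x => \int[N01]_z f (rho x z)).
Proof.
have -> : (fun x => \int[N01]_z f (rho x z)) = (fun x => \int[N01]_z (f (rho x z) - a) + a).
 apply/funext => x; have i := integ_between N01 (mfr x) (fun z => fab (rho x z)).
 by rewrite RintegralB//; [rewrite expectation_cst subrK|exact: integrable_cst].
apply: measurable_funD => //.
have h : mfunT (fun x => \int[N01]_z (f (rho x z) - a)%:E)%E.
 apply: (@measurable_resample_integral (fun x => (f x - a)%:E)).
 by move=> x; rewrite lee_fin subr_ge0; have /andP[] := fab x.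
 by apply/measE; exact: measurable_funB.
exact: (mcomp (fine_measurable measurableT) h).
Qed.

Lemma resample_expectation : \int[gamma]_x f x = \int[gamma]_x \int[N01]_z f (rho x z).
Proof.
have ig : integT gamma f by exact: integ_between fab.
have fb x z : a <= f (rho x z) <= b by [].
have fb0 x z : 0 <= f (rho x z) - a <= b - a by rewrite subr_ge0 lerD2r.
have mfa x : mfunT (fun z : Rb => f (rho x z) - a) by apply: measurable_funB.
have E1 : \int[gamma]_x (f x - a) = \int[gamma]_x \int[N01]_z (f (rho x z) - a).
 rewrite [LHS]/Rintegral (resample_law T0 hg (F := fun x => (f x - a)%:E) ve).
 - rewrite [RHS]/Rintegral; congr fine; apply: eq_integral => x _.
 by rewrite (EFin_expectation N01 (mfa x) (fb0 x)).
 - by move=> x; rewrite lee_fin subr_ge0; have /andP[] := fab x.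
 - by apply/measE; exact: measurable_funB.
have E2 x : \int[N01]_z (f (rho x z) - a) = \int[N01]_z f (rho x z) - a.
 have i := integ_between N01 (mfr x) (fb x).
 by rewrite RintegralB//; [rewrite expectation_cst|exact: integrable_cst].
move: E1; under [in RHS]eq_Rintegral do rewrite E2.
have i2 : integT gamma (fun x => \int[N01]_z f (rho x z)).
 apply: integ_between; first exact: measurable_resample_expectation.
 by move=> x; apply: expectation_between (mfr x) (fb x).
have ia : integT gamma (cst a) by exact: integrable_cst.
by rewrite !RintegralB// !expectation_cst => /addIr.
Qed.

End ResamplingCalculus.
Lemma xlnx_between {R : realType} (a b x : R) : 0 < a -> a <= x <= b ->
 - (b * (`|ln a| + `|ln b|)) <= x * ln x <= b * (`|ln a| + `|ln b|).
Proof.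
move=> a0 xab; have /andP[h1 h2] := xab; have x0 : 0 < x by lra.
by rewrite -ler_norml normrM (gtr0_norm x0); apply: ler_pM => //; [exact: ltW|exact: ln_between].
Qed.

Section OneDirection.
Context {R : realType} {m : nat}.
Variables (T : R) (gamma : probability (cpath T (0 : 'rV[R]_m)) R).
Hypotheses (T0 : 0 < T) (hg : gaussian gamma).
Local Notation E := (cpath T (0 : 'rV[R]_m)).
Local Notation hpath := (hpath hg).
Local Notation cov := (cov gamma).
Local Notation zeta := (zeta gamma).
Local Notation Rb := (g_sigma_algebraType R.-ocitv.-measurable).
Local Notation N01 := (normal_prob 0 1 : probability Rb R).
Local Notation phi := (@normal_pdf R 0 1).

Definition comb_dist (s : seq (seq (R * 'I_m * R))) (x y : E) := \sum_(l <- s) `|coord_comb l x - coord_comb l y|.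

Lemma lipschitz_continuous (g : R -> R) (L : R) : (forall x y, `|g x - g y| <= L * `|x - y|) -> continuous g.
Proof.
move=> gL x; apply/cvgrPdist_le => ep ep0.
near=> y; letr (gL x y).
apply: le_trans (_ : (`|L| + 1) * `|x - y| <= _).
 by apply: ler_wpM2r => //; letr (ler_norm _); rewrite lerDl.
rewrite mulrC -ler_pdivlMr//; near: y.
by apply: cvgr_dist_le => //; rewrite divr_gt0.
Unshelve. all: by end_near. Qed.

Variable e : seq (R * 'I_m * R).
Hypothesis ve : cov e e = 1.
Local Notation rho := (resample hg e).
Variables (f : E -> R) (c C K : R) (s : seq (seq (R * 'I_m * R))).
Hypotheses (c0 : 0 < c) (K0 : 0 <= K) (fcC : forall x, c <= f x <= C)
 (flip : forall x y, `|f x - f y| <= K * comb_dist (e :: s) x y) (es : forall l, l \in s -> cov e l = 0).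

(** Conditional expectation of [f] given the coordinates uncorrelated with [e]. *)
Definition average (x : E) := \int[N01]_z f (rho x z).
Local Notation fbar := average.

Lemma measurable_lipschitz_comb : mfunT f.
Proof. exact: (measurable_comb_lipschitz flip). Qed.
Let mf := measurable_lipschitz_comb.
Let mfr x : mfunT (fun z : Rb => f (rho x z)).
Proof. exact: (mcomp mf (measurable_resample_from T0 hg _ x)). Qed.

Lemma average_between x : c <= fbar x <= C.
Proof. exact: (expectation_between N01 (mfr x) (fun z => fcC (rho x z))). Qed.
Let fbar0 x : 0 < fbar x. Proof. by have /andP[h _] := average_between x; exact: lt_le_trans h. Qed.
Let f0 x : 0 < f x. Proof. by have /andP[h _] := fcC x; exact: lt_le_trans h. Qed.
Let mfbar : mfunT fbar.
Proof. exact: (measurable_resample_expectation T0 hg e mf fcC). Qed.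

Lemma average_lipschitz x y : `|fbar x - fbar y| <= K * comb_dist s x y.
Proof.
apply: (expectation_dist N01 (mfr x) (mfr y) (fun z => fcC _) (fun z => fcC _)) => z.
letr (flip _ _); rewrite /comb_dist big_cons !comb_resample_self// subrr normr0 add0r.
rewrite le_eqVlt; apply/orP; left; apply/eqP; congr (_ * _); apply: eq_big_seq => l ls.
by rewrite !comb_resample (es ls) !mulr0 !addr0.
Qed.

Lemma average_resample x z : fbar (rho x z) = fbar x.
Proof. by apply: eq_Rintegral => w _; rewrite (resample_resample hg ve). Qed.

Lemma average_expectation : \int[gamma]_x fbar x = \int[gamma]_x f x.
Proof. by rewrite (resample_expectation T0 hg ve mf fcC). Qed.
(** Conditional density of the coordinate along [e], with respect to the standard normal law, under
    the measure with density [f]. *)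
Let g (y : E) (z : R) := f (rho y z) / fbar y.
Let c1 : 0 < c / C.
Proof. by rewrite divr_gt0//; have /andP[h1 h2] := fcC point; exact: lt_le_trans c0 (le_trans h1 h2). Qed.
Let gcC y z : c / C <= g y z <= C / c.
Proof.
have /andP[h1 h2] := fcC (rho y z); have /andP[h3 h4] := average_between y.
have b0 := fbar0 y; have C0 : 0 < C by lra.
rewrite /g; apply/andP; split.
 by rewrite ler_pdivrMr// mulrAC ler_pdivlMr//; apply: ler_pM => //; exact: ltW.
by rewrite ler_pdivlMr// mulrAC ler_pdivrMr//; apply: ler_pM => //; exact: ltW.
Qed.
Let cgy y : continuous (g y).
Proof.
apply: (@lipschitz_continuous _ (K * (\sum_(l <- e :: s) `|cov e l|) / fbar y)) => z w.
rewrite /g -mulrBl normrM normfV (gtr0_norm (fbar0 y)) mulrAC.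
apply: ler_wpM2r; first by pos.
letr (flip _ _); rewrite -mulrA; apply: ler_wpM2l => //.
rewrite /comb_dist mulr_suml; apply: ler_sum => l _.
have -> : coord_comb l (rho y z) - coord_comb l (rho y w) = cov e l * (z - w).
 by rewrite !comb_resample; move: (coord_comb l y) (cov e l) (zeta e y) => *; ring.
by rewrite normrM.
Qed.
Let mg y : mfunT (g y : Rb -> R).
Proof. by apply: measurable_funM => //; exact: mfr. Qed.
Let g1 y : (\int[N01]_z (g y z)%:E = 1)%E.
Proof.
rewrite -(EFin_expectation N01 (mg y) (gcC y)); congr EFin.
rewrite /g RintegralZr//; first by rewrite -/(fbar y) divff// gt_eqF.
exact: (integ_between N01 (mfr y) (fun z => fcC (rho y z))).
Qed.
Let tm (y : E) := monotone_map phi (fun z => g y z * phi z).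
Definition brenier_shift (y : E) := tm y (zeta e y) - zeta e y.
Local Notation delta := brenier_shift.
Definition brenier_map (y : E) := rho y (tm y (zeta e y)).
Local Notation Gam := brenier_map.
Let g_resample y z : g (rho y z) = g y.
Proof. by apply/funext => w; rewrite /g average_resample (resample_resample hg ve). Qed.
Let pdg y := pdf_normal_mul (@cgy y) c1 (gcC y) (g1 y).
(** The condition that the image lies below [u] compares two distribution functions. The conditional
    one, multiplied by [fbar y], is a partial integral of [f], measurable in [y] by Tonelli. *)
Let mtau : mfunT (fun y => tm y (zeta e y) : Rb).
Proof.
apply: (measurability _ (RGenInftyO.measurableE R)) => _ [_ [u ->] <-]; rewrite setTI.
pose F : E * Rb -> \bar R := (fun p : E * Rb => (f (rho p.1 p.2))%:E) \_ (snd @^-1` `]-oo, u]%classic).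
pose A y := fine (\int[N01]_z F (y, z))%E.
have F0 p : (0 <= F p)%E by rewrite /F /patch; case: ifP => // _; rewrite lee_fin ltW.
have mF : mfunT F.
 have mh : measurable (snd @^-1` `]-oo, u]%classic : set (E * Rb)).
 by rewrite -[X in measurable X]setTI; apply: measurable_snd => //; exact: measurable_itv.
 have h : mfunT (fun p : E * Rb => (f (rho p.1 p.2))%:E).
 apply/measE; exact: (mcomp mf (measurable_resample T0 hg e)).
 exact: ((measurable_restrictT _ mh).1 (measurable_funTS h)).
have AE y : A y = fbar y * df (fun z => g y z * phi z) u.
 have mFy : mfunT (fun z : Rb => F (y, z)).
 exact: (mcomp mF (pair1_measurable y)).
 rewrite /A /df /Rintegral integral_normal01//.
 have mu1 : measurable (`]-oo, u]%classic : set Rb) by [].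
 have i := integrable_fin_num mu1 (pdf_integrable (pdg y) mu1).
 rewrite -[fbar y]/(fine (fbar y)%:E) -fineM// -ge0_integralZl//; last first.
 - by rewrite lee_fin ltW.
 - by move=> z _; rewrite lee_fin mulr_ge0 ?normal_pdf_ge0// /g divr_ge0// ltW.
 - apply/measE; apply: measurable_funTS; apply: measurable_funM; first exact: mg.
 exact: measurable_normal_pdf.
 congr fine; rewrite [RHS]integral_mkcond; apply: eq_integral => z _.
 rewrite /F /patch; have -> : ((y, z) \in snd @^-1` `]-oo, u]%classic) = (z \in `]-oo, u]%classic).
 by [].
 case: ifP => _; last by rewrite mul0e.
 by rewrite -!EFinM /g mulrA [fbar y * _]mulrC divfK// gt_eqF.
have -> : (fun y => tm y (zeta e y)) @^-1` `]-oo, u[%classic = [set y | fbar y * df phi (zeta e y) < A y].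
 by apply/seteqP; split=> y; rewrite /= !in_itv /= AE ltr_pM2l// (monotone_map_lt pdf_normal (pdg y)).
rewrite -[X in measurable X]setTI; apply: measurable_fun_ltr => //.
 apply: measurable_funM => //.
 have md : mfunT (df phi) by apply: cont_meas; exact: (df_continuous pdf_normal).
 exact: (mcomp md (measurable_zeta gamma e)).
have mA : mfunT (fun y => \int[N01]_z F (y, z))%E.
 exact: (@measurable_fun_fubini_tonelli_F _ _ E Rb R N01 F).
exact: (mcomp (fine_measurable measurableT) mA).
Qed.

Lemma measurable_brenier_shift : mfunT delta.
Proof. by apply: measurable_funB; [exact: mtau|exact: measurable_zeta]. Qed.

Lemma measurable_brenier_map : mfunT Gam.
Proof.
have h : mfunT (fun y : E => (y, tm y (zeta e y)) : E * Rb) by apply: measurable_fun_pair => //; exact: mtau.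
exact: (mcomp (measurable_resample T0 hg e) h).
Qed.
Let Gam_resample y z : Gam (rho y z) = rho y (tm y z).
Proof.
have e1 := zeta_resample hg ve y z; have e2 := g_resample y z.
by rewrite /brenier_map /tm e1 e2; exact: resample_resample.
Qed.
Let delta_resample y z : delta (rho y z) = tm y z - z.
Proof.
have e1 := zeta_resample hg ve y z; have e2 := g_resample y z.
by rewrite /brenier_shift /tm e1 e2.
Qed.
Let push_fiber y (F : R -> \bar R) : (forall z, (0 <= F z)%E) -> mfunT (F : Rb -> \bar R) ->
 (\int[N01]_z (F (tm y z)) = \int[N01]_z (F z * (g y z)%:E))%E.
Proof. by move=> F0 mF; rewrite (ge0_integral_normal_map (@cgy y) c1 (gcC y) (g1 y)). Qed.

(** On each fibre the monotone map sends the normal law to the conditional density; [resample_law]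
    on both sides assembles the fibres. *)
Lemma brenier_map_law (F : E -> \bar R) : (forall x, (0 <= F x)%E) -> mfunT F ->
 (\int[gamma]_x (F (Gam x) * (fbar x)%:E) = \int[gamma]_x (F x * (f x)%:E))%E.
Proof.
move=> F0 mF; have mE (h : E -> R) : mfunT h -> mfunT (EFin \o h) by move=> ?; exact/measE.
have mE' (h : Rb -> R) : mfunT h -> mfunT (EFin \o h) by move=> ?; exact/measE.
rewrite (resample_law T0 hg (F := fun x => (F (Gam x) * (fbar x)%:E)%E) ve); first last.
- by apply: emeasurable_funM; [exact: (mcomp mF measurable_brenier_map)|exact: mE].
- by move=> x; rewrite mule_ge0// lee_fin ltW.
rewrite [RHS](resample_law T0 hg (F := fun x => (F x * (f x)%:E)%E) ve); first last.
- by apply: emeasurable_funM; [exact: mF|exact: mE].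
- by move=> x; rewrite mule_ge0// lee_fin ltW.
apply: eq_integral => y _.
have mFy : mfunT (fun z : Rb => F (rho y z)).
 exact: (mcomp mF (measurable_resample_from T0 hg _ y)).
under eq_integral do rewrite Gam_resample average_resample muleC.
have mt : mfunT (fun z : Rb => F (rho y (tm y z))).
 exact: (mcomp mFy (measurable_monotone_map pdf_normal (pdg y))).
rewrite ge0_integralZl ?lee_fin ?(ltW (fbar0 _))//.
rewrite (@push_fiber y (fun z => F (rho y z)))// -ge0_integralZl ?lee_fin ?(ltW (fbar0 _))//.
- apply: eq_integral => z _; rewrite muleCA -EFinM /g mulrCA divff ?mulr1// gt_eqF//.
- by apply: emeasurable_funM => //; apply: mE'; exact: mg.
- by move=> z _; rewrite mule_ge0// lee_fin; have /andP[h _] := gcC y z; exact: le_trans (ltW c1) h.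
Qed.

(** Talagrand's inequality on each fibre. By the chain rule [DE] the conditional entropies integrate
    to the entropy of [f] minus that of its average, so successive directions telescope. *)
Lemma brenier_shift_cost : (\int[gamma]_x ((delta x ^+ 2)%:E * (fbar x)%:E) <=
 (2 * (\int[gamma]_x (f x * ln (f x)) - \int[gamma]_x (fbar x * ln (fbar x))))%:E)%E.
Proof.
pose L := C * (`|ln c| + `|ln C|).
have xlnx x : c <= x <= C -> - L <= x * ln x <= L by exact: xlnx_between.
have mxlnx d (S : measurableType d) (h : S -> R) : mfunT h -> mfunT (fun x => h x * ln (h x)).
 by move=> mh; apply: measurable_funM => //; exact: (mcomp (@measurable_ln R) mh).
have mdl : mfunT (fun x => ((delta x ^+ 2)%:E * (fbar x)%:E)%E).
 by apply: emeasurable_funM; apply/measE => //; apply: measurable_funX; exact: measurable_brenier_shift.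
have mfl := mxlnx _ _ _ mf; have mfbl := mxlnx _ _ _ mfbar.
pose I y := \int[N01]_z (f (rho y z) * ln (f (rho y z))).
have mI : mfunT I := measurable_resample_expectation T0 hg e mfl (fun x => xlnx _ (fcC x)).
have IL y : - L <= I y <= L by apply: expectation_between => [|z]; [exact: mxlnx|exact: xlnx].
have DE y : fbar y * \int[N01]_z (g y z * ln (g y z)) = I y - fbar y * ln (fbar y).
 have i1 := integ_between N01 (mfr y) (fun z => fcC (rho y z)).
 have i2 := integ_between N01 (mxlnx _ _ _ (mfr y)) (fun z => xlnx _ (fcC (rho y z))).
 have i3 : integT N01 (fun z => ln (fbar y) * f (rho y z)).
 have -> : EFin \o (fun z => ln (fbar y) * f (rho y z)) = (fun z => (ln (fbar y))%:E * (f (rho y z))%:E)%E by [].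
 exact: integrableZl.
 have i4 := integ_between N01 (mxlnx _ _ _ (@mg y)) (fun z => xlnx_between c1 (gcC y z)).
 transitivity (\int[N01]_z (f (rho y z) * ln (f (rho y z)) - ln (fbar y) * f (rho y z))).
 rewrite -RintegralZl//; apply: eq_Rintegral => z _.
 rewrite /g ln_div ?posrE//; have := fbar0 y.
 move: (fbar y) (f _) (ln (f _)) (ln (fbar y)) => u v w x u0.
 by field; rewrite gt_eqF.
 by rewrite RintegralB// RintegralZl// [fbar y * _]mulrC.
rewrite (resample_law T0 hg (F := fun x => ((delta x ^+ 2)%:E * (fbar x)%:E)%E) ve); first last.
- exact: mdl.
- by move=> x; rewrite mule_ge0// lee_fin ?sqr_ge0// ltW.
via (\int[gamma]_y (2 * (I y - fbar y * ln (fbar y)))%:E)%E.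
 apply: ge0_le_integral => //.
 - by move=> y _; apply: integral_ge0 => z _; rewrite mule_ge0// lee_fin ?sqr_ge0// ltW.
 - apply: (measurable_resample_integral T0 hg e (F := fun x => ((delta x ^+ 2)%:E * (fbar x)%:E)%E)) => //.
 by move=> x; rewrite mule_ge0// lee_fin ?sqr_ge0// ltW.
 - by apply/measE; apply: measurable_funM => //; exact: measurable_funB.
 move=> y _; under eq_integral do rewrite delta_resample average_resample muleC.
 rewrite ge0_integralZl ?lee_fin ?(ltW (fbar0 _))//; last 2 first.
 - apply/measE; apply: measurable_funX; apply: measurable_funB => //.
 exact: (measurable_monotone_map pdf_normal (pdg y)).
 - by move=> z _; rewrite lee_fin sqr_ge0.
 apply: le_trans (_ : ((fbar y)%:E * (2 * \int[N01]_z (g y z * ln (g y z)))%:E <= _)%E).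
 by apply: lee_wpmul2l; [rewrite lee_fin ltW|exact: (talagrand_normal (@cgy y) c1 (gcC y) (g1 y))].
 by rewrite -EFinM lee_fin mulrCA DE.
have j1 := integ_between gamma mI IL.
have j2 := integ_between gamma mfbl (fun x => xlnx _ (average_between x)).
rewrite (resample_expectation T0 hg ve mfl (fun x => xlnx _ (fcC x))) -/I -RintegralB//.
have j3 : gamma.-integrable setT (fun y => (I y - fbar y * ln (fbar y))%:E).
 by rewrite (_ : (fun y => _) = (fun y => (I y)%:E - (fbar y * ln (fbar y))%:E)%E)//; exact: integrableB.
rewrite -RintegralZl// /Rintegral fineK//; apply: integrable_fin_num => //.
exact: (integrableZl measurableT 2 j3).
Qed.

End OneDirection.

(** * Triangular transport of cylindrical densities *)

Section CylinderTransport.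
Context {R : realType} {m : nat}.
Variables (T : R) (gamma : probability (cpath T (0 : 'rV[R]_m)) R).
Hypotheses (T0 : 0 < T) (hg : gaussian gamma).
Local Notation E := (cpath T (0 : 'rV[R]_m)).
Local Notation comb := (seq (R * 'I_m * R)).
Local Notation hpath := (hpath hg).
Local Notation cov := (cov gamma).
Local Notation zeta := (zeta gamma).

(* Th x = x + hpath (ev x) transports gamma to f gamma, at the quadratic cost v
   in the Cameron-Martin norm; the shifts stay in the span of s. *)
Definition shift_transport (s : seq comb) (f : E -> R) (ev : E -> comb) (v : E -> R) (Th : E -> E) :=
 [/\ [/\ mfunT Th, mfunT v & forall x, Th x = cpathD x (hpath (ev x))], forall x, cov (ev x) (ev x) <= v x,
 forall l, (forall k, k \in s -> cov l k = 0) -> forall x, cov l (ev x) = 0,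
 forall F : E -> \bar R, (forall x, (0 <= F x)%E) -> mfunT F ->
 (\int[gamma]_x F (Th x) = \int[gamma]_x (F x * (f x)%:E))%E &
 (\int[gamma]_x (v x)%:E <= (2 * \int[gamma]_x (f x * ln (f x)))%:E)%E].

Lemma zeta0_ae l : cov l l = 0 -> {ae gamma, forall x, coord_comb l x = mean gamma l}.
Proof.
move=> v0; have i := integrable_zeta_sq hg l.
have mz : mfunT (fun x => (zeta l x ^+ 2)%:E).
 by apply/measE; apply: measurable_funX; exact: measurable_zeta.
have I0 : (\int[gamma]_x `|(zeta l x ^+ 2)%:E| = 0)%E.
 under eq_integral do rewrite abse_EFin ger0_norm ?sqr_ge0//.
 rewrite -(fineK (integrable_fin_num measurableT i)); congr EFin; rewrite -v0.
 by [].
have := (ae_eq_integral_abs gamma measurableT mz).1 I0; apply: filterS => x /(_ I) /= [/eqP].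
by rewrite sqrf_eq0 subr_eq0 => /eqP.
Qed.

(** Almost surely all functionals in [r] equal their means. Since the measure is not 0, some path
    [x0] realises these values, and [f] is compared with its value there. *)
Lemma cylinder_ae_constant (f : E -> R) (K : R) (r : seq comb) :
 (forall l, l \in r -> cov l l = 0) -> (forall x y, `|f x - f y| <= K * comb_dist r x y) ->
 exists a, {ae gamma, forall x, f x = a}.
Proof.
move=> r0 flip; have : {ae gamma, forall x, forall l, l \in r -> coord_comb l x = mean gamma l}.
 elim: r r0 {flip} => [|l r IH] r0; first exact: aeW.
 have h1 := zeta0_ae (r0 l (mem_head _ _)).
 have r0' k : k \in r -> cov k k = 0 by move=> kr; apply: r0; rewrite inE kr orbT.
 have h2 := IH r0'.
 near=> x => k; rewrite inE => /predU1P[->|]; first by near: x.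
 by move: k; near: x.
move=> h.
have [x0 x0P] : exists x0 : E, forall l, l \in r -> coord_comb l x0 = mean gamma l.
 apply: contrapT => /forallNP none; have : gamma setT = 0%E.
 case: h => N [mN N0 sub]; apply/le_anti/andP; split=> //; rewrite -N0.
 by apply: le_measure; rewrite ?inE// => x _; apply: sub => H; exact: none x H.
 by rewrite probability_setT => /eqP; rewrite onee_eq0.
exists (f x0); apply: filterS h => x xP; apply/eqP; rewrite -subr_eq0 -normr_le0.
letr (flip x x0); rewrite /comb_dist big_seq big1 ?mulr0// => l lr.
by rewrite (xP l lr) (x0P l lr) subrr normr0.
Unshelve. all: by end_near. Qed.

Lemma entropy_ge0 (f : E -> R) (c C : R) : 0 < c -> mfunT f ->
 (forall x, c <= f x <= C) -> \int[gamma]_x f x = 1 -> 0 <= \int[gamma]_x (f x * ln (f x)).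
Proof.
move=> c0 mf fcC f1.
have mfl : mfunT (fun x => f x * ln (f x)).
 by apply: measurable_funM => //; exact: (mcomp (@measurable_ln R) mf).
have i1 := integ_between gamma mf fcC.
have i2 := integ_between gamma mfl (fun x => xlnx_between c0 (fcC x)).
have ic := integrable_cst gamma 1.
have <- : \int[gamma]_x (f x - 1) = 0 by rewrite RintegralB ?expectation_cst//; [rewrite -/(Rintegral _ _ _) f1 subrr|exact: ic].
apply: le_Rintegral => //.
 apply: (@integ_between _ _ _ _ _ (c - 1) (C - 1)); first exact: measurable_funB.
 by move=> x; rewrite !lerD2r.
move=> x _; have /andP[h _] := fcC x; have f0 : 0 < f x by lra.
have := ler_wpM2l (ltW f0) (ln_ge_1V f0); rewrite mulrBr mulr1 mulfV ?gt_eqF//.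
Qed.

Lemma cov_catl e c c' : cov (c ++ c') e = cov c e + cov c' e.
Proof. by rewrite covC (cov_cat hg) (covC _ e c) (covC _ e c'). Qed.
Let change_of_basis_bound (De D A B S sg : R) : 0 <= De -> 0 <= D -> 0 <= A -> 0 <= S -> 0 <= sg ->
 B <= D + S * De -> sg * De + (B + A) <= (1 + sg + S) * (De + (D + A)).
Proof.
move=> D0 D1 A0 S0 sg0 h; have := mulr_ge0 sg0 D1; have := mulr_ge0 sg0 A0.
by have := mulr_ge0 S0 D1; have := mulr_ge0 S0 A0; nra.
Qed.

(** Induction on the number of functionals in [s]. A degenerate one joins [r]. Otherwise it is
    normalised to [e] and the others are projected to be uncorrelated with [e]; the average over [e]
    is transported by induction, and the Brenier map along [e] finishes. *)
Theorem cylinder_transport (s : seq comb) : forall (f : E -> R) (c C K : R) (r : seq comb),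
 0 < c -> 0 <= K -> (forall x, c <= f x <= C) -> (forall l, l \in r -> cov l l = 0) ->
 (forall x y, `|f x - f y| <= K * comb_dist (s ++ r) x y) -> \int[gamma]_x f x = 1 ->
 exists ev v Th, shift_transport s f ev v Th.
Proof.
have [n] := ubnP (size s); elim: n s => // n IH [|k s] /=.
 move=> _ f c C K r c0 K0 fcC r0 flip f1.
 have mf : mfunT f := measurable_comb_lipschitz flip.
 have [a fa] := cylinder_ae_constant r0 flip.
 have a1 : a = 1.
 rewrite -f1 -[LHS](expectation_cst gamma); congr fine; apply: ae_eq_integral => //.
 exact/measE.
 by apply: filterS fa => x -> _.
 exists (fun=> [::]), (fun=> 0), id; split.
 - by split=> // x; apply: comb_inj => l; rewrite combD comb_hpath covC cov_nil addr0.
 - by move=> x; rewrite cov_nil.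
 - by move=> l _ x; rewrite cov_nil.
 - move=> F F0 mF; apply: ae_eq_integral => //.
 by apply: emeasurable_funM => //; exact/measE.
 by apply: filterS fa => x -> _; rewrite a1 mule1.
 - by rewrite integral0 lee_fin mulr_ge0// (entropy_ge0 c0 mf fcC f1).
rewrite ltnS => sn f c C K r c0 K0 fcC r0 flip f1.
have [k0|k1] := eqVneq (cov k k) 0.
 have r0' l : l \in k :: r -> cov l l = 0 by rewrite inE => /predU1P[->|/r0].
 have flip' x y : `|f x - f y| <= K * comb_dist (s ++ (k :: r)) x y.
 letr (flip x y); apply: ler_wpM2l => //.
 by rewrite /comb_dist big_cons !big_cat big_cons /= addrCA.
 have [ev [v [Th [h1 h2 h3 h4 h5]]]] := IH s sn f c C K (k :: r) c0 K0 fcC r0' flip' f1.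
 exists ev, v, Th; split; [exact: h1|exact: h2| |exact: h4|exact: h5].
 by move=> l ls; apply: h3 => j js; apply: ls; rewrite inE js orbT.
have kp : 0 < cov k k by rewrite lt_neqAle eq_sym k1 var_ge0.
pose sg := Num.sqrt (cov k k); have sg0 : 0 < sg by rewrite sqrtr_gt0.
pose e := scale sg^-1 k.
have ve : cov e e = 1 by rewrite var_scale// exprVn sqr_sqrtr ?ltW// mulVf.
pose proj l := l ++ scale (- cov e l) e.
pose s' := map proj s.
have eproj l : cov e (proj l) = 0 by rewrite cov_cat// cov_scale// ve mulr1 subrr.
have es l : l \in s' ++ r -> cov e l = 0.
 rewrite mem_cat => /orP[/mapP[j _ ->]|/r0]; [exact: eproj|exact: cov0_of_var0].
pose K' := K * (1 + sg + \sum_(l <- s) `|cov e l|).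
have sum0 : 0 <= \sum_(l <- s) `|cov e l| by apply: sumr_ge0.
have K'0 : 0 <= K' by pos.
have flip' x y : `|f x - f y| <= K' * comb_dist (e :: (s' ++ r)) x y.
 letr (flip x y); rewrite -mulrA; apply: ler_wpM2l => //.
 rewrite /comb_dist !big_cons !big_cat /= big_map; set De := `|coord_comb e x - _|.
 have -> : `|coord_comb k x - coord_comb k y| = sg * De.
 rewrite /De !comb_scale -mulrBr normrM gtr0_norm ?invr_gt0// mulrA mulfV ?gt_eqF//.
 by rewrite mul1r.
 have : \sum_(l <- s) `|coord_comb l x - coord_comb l y| <=
 \sum_(l <- s) `|coord_comb (proj l) x - coord_comb (proj l) y| + (\sum_(l <- s) `|cov e l|) * De.
 rewrite mulr_suml -big_split /=; apply: ler_sum => l _; rewrite -normrM.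
 apply: le_trans (ler_normD _ _); rewrite /proj !comb_cat !comb_scale.
 by rewrite le_eqVlt; apply/orP; left; apply/eqP; congr `|_|; ring.
 by apply: change_of_basis_bound; [exact: normr_ge0|apply: sumr_ge0|apply: sumr_ge0|exact: sum0|exact: ltW].
have sn' : (size s' < n)%N by rewrite size_map.
have af := average_between T0 hg fcC flip'.
have al := average_lipschitz T0 hg ve fcC flip' es.
have a1 : \int[gamma]_x average hg e f x = 1 by rewrite (average_expectation T0 hg ve fcC flip').
have [ev [v [Th [[mTh mv ThE] h2 h3 h4 h5]]]] := IH s' sn' _ c C K' r c0 K'0 af r0 al a1.
pose de := brenier_shift hg e f.
pose G := brenier_map hg e f.
have mde : mfunT de := measurable_brenier_shift T0 hg c0 K'0 fcC flip'.
have mG : mfunT G := measurable_brenier_map T0 hg c0 K'0 fcC flip'.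
have cov_e x : cov e (ev x) = 0 by apply: h3 => j /mapP[l _ ->].
exists (fun x => ev x ++ scale (de (Th x)) e), (fun x => v x + de (Th x) ^+ 2), (G \o Th); split.
- split.
 + exact: mcomp.
 + by apply: measurable_funD => //; apply: measurable_funX; exact: mcomp.
 + move=> x; apply: comb_inj => l.
 have -> : coord_comb l ((G \o Th) x) = coord_comb l (Th x) + cov (scale (de (Th x)) e) l.
 by rewrite -(comb_hpath hg) -combD.
 by rewrite ThE !combD !comb_hpath cov_catl addrA -ThE.
(* The earlier shifts are uncorrelated with [e], so the squared norms add. *)
- move=> x; rewrite var_lin// cov_e ve mulr0 addr0 mulr1.
 by rewrite lerD2r.
- move=> l lk x; have le0 : cov l e = 0 by rewrite cov_scale// lk ?mulr0// mem_head.
 rewrite cov_cat// cov_scale// le0 mulr0 addr0; apply: h3 => j /mapP[j' j's ->].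
 by rewrite cov_cat// cov_scale// le0 mulr0 addr0 lk// inE j's orbT.
- move=> F F0 mF; rewrite -(brenier_map_law T0 hg ve c0 K'0 fcC flip' F0 mF).
 by rewrite -(h4 (fun x => F (G x)))//; exact: mcomp.
- have v0 x : 0 <= v x by apply: le_trans (h2 x); exact: var_ge0.
 under eq_integral do rewrite EFinD.
 rewrite ge0_integralD//; last 4 first.
 + by move=> x _; rewrite lee_fin.
 + exact/measE.
 + by move=> x _; rewrite lee_fin sqr_ge0.
 + by apply/measE; apply: measurable_funX; exact: mcomp.
 rewrite (h4 (fun x => (de x ^+ 2)%:E)); last 2 first.
 + by move=> x; rewrite lee_fin sqr_ge0.
 + by apply/measE; exact: measurable_funX.
 letr (leeD h5 (brenier_shift_cost T0 hg ve c0 K'0 fcC flip')).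
 by rewrite -EFinD lee_fin -mulrDr [X in 2 * X <= _]addrC subrK.
Qed.

End CylinderTransport.

(** * Approximation of densities by cylindrical ones *)

Lemma max_dist {R : realType} (a b c d : R) : `|Num.max a b - Num.max c d| <= `|a - c| + `|b - d|.
Proof.
have h1 := ler_norm (a - c); have h2 := ler_norm (b - d).
have := ler_norm (d - b); have := ler_norm (c - a); rewrite (distrC d) (distrC c) => h3 h4.
rewrite ler_norml; move: (`|a - c|) (`|b - d|) (normr_ge0 (a - c)) (normr_ge0 (b - d)) h1 h2 h3 h4 => u v *.
by rewrite /Num.max; case: ltP => ?; case: ltP => ?; lra.
Qed.

Lemma min_dist {R : realType} (a b c d : R) : `|Num.min a b - Num.min c d| <= `|a - c| + `|b - d|.
Proof.
have := max_dist (- a) (- b) (- c) (- d); rewrite -!oppr_min !opprK !(addrC (- _)) -opprB normrN.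
by rewrite (distrC a) (distrC b).
Qed.

Lemma clip_dist {R : realType} (u : R) (n : nat) : 0 <= u -> `|u - Num.max n.+1%:R^-1 (Num.min n.+1%:R u)| <= u + 1 /\
 (u <= n.+1%:R -> `|u - Num.max n.+1%:R^-1 (Num.min n.+1%:R u)| <= n.+1%:R^-1).
Proof.
move=> u0; have h1 : 1 <= n.+1%:R :> R by rewrite ler1n.
have h2 : n.+1%:R^-1 <= 1 :> R by rewrite invf_le1.
have h3 : 0 < n.+1%:R^-1 :> R by [].
move: (n.+1%:R : R) (n.+1%:R^-1 : R) h1 h2 h3 => C c h1 h2 h3; rewrite /Num.min /Num.max.
split=> [|h4]; rewrite ler_norml; case: (ltP C u) => a.
- by case: (ltP c C) => b; lra.
- by case: (ltP c u) => b; lra.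
- lra; lra.
- by case: (ltP c u) => b; lra.
Qed.

Section CylinderDensity.
Context {R : realType} {m : nat}.
Variables (T : R) (gamma : probability (cpath T (0 : 'rV[R]_m)) R).
Hypotheses (T0 : 0 < T).
Local Notation E := (cpath T (0 : 'rV[R]_m)).
Local Notation comb := (seq (R * 'I_m * R)).
Local Notation integ f := (integT gamma (f : E -> R)).
Local Notation L1 f g := (\int[gamma]_x `|f x - g x|).
Implicit Types f g : E -> R.

Definition lip_cylinder f := exists s K, 0 <= K /\ forall x y, `|f x - f y| <= K * @comb_dist R m T s x y.

Lemma lip_cylinder_measurable f : lip_cylinder f -> mfunT f.
Proof. by move=> [s [K [_ h]]]; exact: measurable_comb_lipschitz h. Qed.

Lemma integ_measurable f : integ f -> mfunT f.
Proof. by move=> /measurable_int /measE. Qed.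

Lemma integrable_dist f g : integ f -> integ g -> integ (fun x => `|f x - g x|).
Proof.
move=> fi gi; apply: (@integrable_norm _ _ _ gamma setT (fun x => f x - g x)).
by rewrite (_ : EFin \o _ = (fun x => (f x)%:E - (g x)%:E)%E)//; exact: integrableB.
Qed.

Lemma L1_le f g f1 g1 f2 g2 : integ f -> integ g -> integ f1 -> integ g1 -> integ f2 -> integ g2 ->
 (forall x, `|f x - g x| <= `|f1 x - g1 x| + `|f2 x - g2 x|) -> L1 f g <= L1 f1 g1 + L1 f2 g2.
Proof.
move=> fi gi f1i g1i f2i g2i h; have j := integrable_dist fi gi.
have j1 := integrable_dist f1i g1i; have j2 := integrable_dist f2i g2i.
rewrite -RintegralD//; apply: le_Rintegral => //.
by rewrite (_ : EFin \o _ = (fun x => `|f1 x - g1 x|%:E + `|f2 x - g2 x|%:E)%E)//; exact: integrableD.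
Qed.

Definition approximable f := integ f /\ forall de, 0 < de -> exists g, [/\ lip_cylinder g, integ g & L1 f g <= de].

Lemma approximable_op (op : R -> R -> R) f g : (forall a b c d, `|op a b - op c d| <= `|a - c| + `|b - d|) ->
 (forall u v, integ u -> integ v -> integ (fun x => op (u x) (v x))) ->
 approximable f -> approximable g -> approximable (fun x => op (f x) (g x)).
Proof.
move=> lop iop [fi fa] [gi ga]; split; first exact: iop.
move=> de de0; have d2 : 0 < de / 2 by pos.
have [u [[s1 [K1 [K10 h1]]] ui u2]] := fa _ d2; have [v [[s2 [K2 [K20 h2]]] vi v2]] := ga _ d2.
exists (fun x => op (u x) (v x)); split; last first.
- rewrite [leRHS](splitr de); apply: le_trans (lerD u2 v2).
 by apply: L1_le => //; exact: iop.
- exact: iop.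
exists (s1 ++ s2), (K1 + K2); split; first exact: addr_ge0.
move=> x y; letr (lop _ _ _ _); letr (lerD (h1 x y) (h2 x y)).
rewrite /comb_dist big_cat /= mulrDr !mulrDl.
have S1 : 0 <= \sum_(l <- s1) `|coord_comb l x - coord_comb l y| by apply: sumr_ge0.
have S2 : 0 <= \sum_(l <- s2) `|coord_comb l x - coord_comb l y| by apply: sumr_ge0.
have := mulr_ge0 K10 S2; have := mulr_ge0 K20 S1; by lra.
Qed.

Lemma approximable_cylinder f : lip_cylinder f -> integ f -> approximable f.
Proof.
move=> fl fi; split=> // de de0; exists f; split=> //.
by under eq_Rintegral do rewrite subrr normr0; rewrite expectation_cst ltW.
Qed.

Lemma lip_cylinder_cst a : lip_cylinder (fun=> a).
Proof. by exists [::], 0; split=> // x y; rewrite subrr normr0 mul0r. Qed.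

Lemma integ_cst a : integ (fun=> a).
Proof. exact: (integrable_cst gamma a). Qed.

Lemma integZ a f : integ f -> integ (fun x => a * f x).
Proof. by move=> fi; rewrite (_ : EFin \o _ = (fun x => a%:E * (f x)%:E)%E)//; exact: integrableZl. Qed.

Lemma integD f g : integ f -> integ g -> integ (fun x => f x + g x).
Proof. by move=> fi gi; rewrite (_ : EFin \o _ = (fun x => (f x)%:E + (g x)%:E)%E)//; exact: integrableD. Qed.

Lemma approximableZ a f : approximable f -> approximable (fun x => a * f x).
Proof.
move=> [fi fa]; split; first exact: integZ.
move=> de de0; have a1 : 0 < `|a| + 1 by [].
have [g [[s [K [K0 h]]] gi g2]] := fa _ (divr_gt0 de0 a1).
exists (fun x => a * g x); split; last first.
- under eq_Rintegral do rewrite -mulrBr normrM.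
 rewrite RintegralZl//; last exact: integrable_dist.
 have I0 : 0 <= L1 f g by apply: Rintegral_ge0.
 apply: le_trans (_ : (`|a| + 1) * L1 f g <= _); first by apply: ler_wpM2r => //; rewrite lerDl.
 by rewrite mulrC -ler_pdivlMr.
- exact: integZ.
exists s, (`|a| * K); split; first exact: mulr_ge0.
by move=> x y; rewrite -mulrBr normrM -mulrA; apply: ler_wpM2l.
Qed.

Lemma approximableD f g : approximable f -> approximable g -> approximable (fun x => f x + g x).
Proof.
apply: approximable_op; last exact: integD.
by move=> a b c d; rewrite opprD addrACA; exact: ler_normD.
Qed.

Lemma approximable_lim (f_ : nat -> E -> R) f (M : R) : mfunT f -> (forall x, `|f x| <= M) ->
 (forall n, approximable (f_ n)) -> (forall n x, `|f_ n x| <= M) -> (forall x, f_ n x @[n --> \oo] --> f x) ->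
 approximable f.
Proof.
move=> mf fM fa fnM fl; have fi : integ f by exact: bounded_integrable fM.
split=> // de de0; have d2 : 0 < de / 2 by pos.
have lim : L1 f (f_ n) @[n --> \oo] --> (0 : R).
 rewrite -[X in _ --> X](_ : \int[gamma]_x (fun=> 0) x = 0); last by rewrite expectation_cst.
 apply: (@bounded_cvg _ _ _ gamma _ _ (M + M)) => //.
 - move=> n; have [fni _] := fa n.
 by apply: (integ_measurable (integrable_dist fi fni)).
 - by move=> n x; rewrite normr_id; letr (ler_normB _ _); exact: lerD.
 - move=> x; have := cvg_norm (cvgB (cvg_cst (f x)) (fl x)); rewrite subrr normr0.
 exact.
move: lim => /cvgrPdist_le/(_ _ d2) [n _ /(_ n (leqnn n))] /=; rewrite sub0r normrN => h.
have [fni /(_ _ d2) [g [gl gi g2]]] := fa n; exists g; split=> //.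
rewrite [leRHS](splitr de); apply: le_trans (lerD (le_trans (ler_norm _) h) g2).
by apply: L1_le => // x; exact: ler_distD.
Qed.

(** Sets with approximable indicator form a sigma-algebra, finite unions being maxima of indicators;
    half-spaces belong to it because ramps approximate their indicators. *)
Lemma approximable_indic (A : set E) : measurable A -> approximable \1_A.
Proof.
move=> mA; pose D : set (set E) := [set A | measurable A /\ approximable \1_A].
suff : D A by case.
have ind01 (B : set E) x : `|(\1_B x : R)| <= 1 by rewrite indicE; case: (_ \in _); rewrite ?normr1 ?normr0.
have sD : <<s [set A | exists c a, A = [set x : E | a < coord_comb c x]] >> `<=` D.
 apply: smallest_sub.
 split.
 - split=> //; rewrite (_ : \1_set0 = fun=> 0); last by apply/funext => x; rewrite indicE in_set0.
 by apply: approximable_cylinder; [exact: lip_cylinder_cst|exact: integ_cst].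
 - move=> B [mB aB]; split; first exact: measurableD.
 have -> : \1_(setT `\` B) = (fun x => 1 + -1 * \1_B x) :> (E -> R).
 by apply/funext => x; rewrite !indicE setTD in_setC mulN1r; case: (_ \in _); rewrite ?subrr ?subr0.
 apply: approximableD; last exact: approximableZ.
 by apply: approximable_cylinder; [exact: lip_cylinder_cst|exact: integ_cst].
 - move=> F DF; have mF n : measurable (F n) by have [] := DF n.
 split; first exact: bigcupT_measurable.
 pose U n := \big[setU/set0]_(i < n) F i.
 have aU n : approximable \1_(U n).
 elim: n => [|n IH].
 rewrite /U big_ord0 (_ : \1_set0 = fun=> 0); last by apply/funext => x; rewrite indicE in_set0.
 by apply: approximable_cylinder; [exact: lip_cylinder_cst|exact: integ_cst].
 have -> : \1_(U n.+1) = (fun x => Num.max (\1_(U n) x) (\1_(F n) x)) :> (E -> R).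
 apply/funext => x; rewrite /U big_ord_recr /= !indicE in_setU.
 by case: (_ \in _); case: (_ \in _); rewrite /= ?maxxx // /Num.max ?ltr01 ?ltr10.
 apply: approximable_op => //; last by have [] := DF n.
 exact: max_dist.
 move=> u v ui vi; have i : integ (fun x => `|u x| + `|v x|) by apply: integD; exact: integrable_norm.
 apply: le_integrable i => //.
 by apply/measE; apply: measurable_maxr; exact: integ_measurable.
 move=> x _; rewrite !abse_EFin lee_fin [leRHS]ger0_norm//.
 by have := max_dist (u x) (v x) 0 0; rewrite !subr0 maxxx subr0.
 apply: (@approximable_lim (fun n => \1_(U n)) _ 1) => //.
 by apply: measurable_indic; exact: bigcupT_measurable.
 move=> x; apply/cvgrPdist_le => ep ep0.
 have [[k _ Fk]|nF] := pselect ((\bigcup_n F n) x).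
 exists k.+1 => //= n kn; rewrite !indicE !mem_set ?subrr ?normr0 ?ltW//; last by exists k.
 by rewrite /U -bigcup_mkord; exists k.
 exists 0%N => //= n _; rewrite !indicE !memNset ?subrr ?normr0 ?ltW//.
 by rewrite /U -bigcup_mkord => -[k _ Fk]; apply: nF; exists k.
 move=> _ [c [a ->]].
 have mc := measurable_comb (T := T) c.
 have mB : measurable [set x : E | a < coord_comb c x].
 by rewrite -[X in measurable X]setTI; apply: measurable_fun_ltr.
 split=> //; pose w (n : nat) (x : E) := Num.max 0 (Num.min 1 (n%:R * (coord_comb c x - a))) : R.
 have w01 n x : `|w n x| <= 1 by rewrite ger0_norm ?le_max ?lexx// ge_max ler01 ge_min lexx.
 have wl n : lip_cylinder (w n).
 exists [:: c], n%:R; split=> // x y; rewrite /comb_dist big_seq1.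
 letr (max_dist _ _ _ _); rewrite subrr normr0 add0r.
 letr (min_dist _ _ _ _); rewrite subrr normr0 add0r -mulrBr opprB addrA subrK.
 by rewrite normrM ger0_norm.
 apply: (@approximable_lim w _ 1) => //.
 move=> n; apply: approximable_cylinder => //.
 by apply: bounded_integrable (w01 n); exact: lip_cylinder_measurable.
 move=> x; apply/cvgrPdist_le => ep ep0; rewrite indicE.
 have [ax|xa] := ltP a (coord_comb c x).
 have d0 : 0 < coord_comb c x - a by pos.
 exists (Num.truncn (coord_comb c x - a)^-1).+1 => //= n nk; rewrite mem_set// /w.
 have h : 1 <= n%:R * (coord_comb c x - a).
 rewrite -ler_pdivrMr// mul1r; letr (ltW (truncnS_gt _)).
 by rewrite ler_nat.
 by rewrite (min_idPl h) (max_idPr ler01) subrr normr0 ltW.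
 exists 0%N => //= n _; rewrite memNset /=; last by apply/negP; rewrite -leNgt.
 have h : n%:R * (coord_comb c x - a) <= 0 by rewrite mulr_ge0_le0// subr_le0.
 by rewrite /w (min_idPr (le_trans h ler01)) (max_idPl h) subrr normr0 ltW.
by apply: sD; rewrite -borel_coord.
Qed.

(** Induction on the number of layers of height [et]; each layer contributes the indicator of a
    superlevel set. *)
Lemma approximable_bounded (et : R) (n : nat) f : 0 < et -> mfunT f ->
 (forall x, 0 <= f x <= et *+ n) -> exists g, approximable g /\ forall x, 0 <= g x /\ 0 <= f x - g x <= et.
Proof.
move=> et0; elim: n f => [|n IH] f mf h.
 exists (fun=> 0); split.
 by apply: approximable_cylinder; [exact: lip_cylinder_cst|exact: integ_cst].
 by move=> x; have := h x; rewrite mulr0n subr0 => /andP[h1 h2]; rewrite h1 (le_trans h2 (ltW et0)).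
have [||g [ga gP]] := IH (fun x => Num.max (f x - et) 0).
- by apply: measurable_maxr => //; exact: measurable_funB.
- move=> x; rewrite le_max lexx orbT ge_max mulrn_wge0 ?(ltW et0)// andbT lerBlDr -mulrSr.
 by have /andP[] := h x.
have mA : measurable [set x | et <= f x] by rewrite -[X in measurable X]setTI; apply: measurable_fun_ler.
exists (fun x => g x + et * \1_[set x | et <= f x] x); split.
 by apply: approximableD => //; apply: approximableZ; exact: approximable_indic.
move=> x; have /andP[f0 _] := h x; have [g0] := gP x; rewrite indicE.
have [e1|e1] := leP et (f x).
 have m0 : Num.max (f x - et) 0 = f x - et by apply/max_idPl; rewrite subr_ge0.
 rewrite mem_set// mulr1 m0.
 by move: (f x) (g x) g0 f0 e1 => a b *; lra.
rewrite memNset /=; last by apply/negP; rewrite -ltNge.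
have m0 : Num.max (f x - et) 0 = 0 by apply/max_idPr; rewrite subr_le0 ltW.
rewrite mulr0 addr0 m0.
by move: (f x) (g x) g0 f0 e1 => a b *; lra.
Qed.

Lemma approximable_between f (c C : R) : mfunT f -> (forall x, c <= f x <= C) -> approximable f.
Proof.
move=> mf fcC; have fi : integ f by exact: integ_between fcC.
split=> // de de0; have d2 : 0 < de / 2 by pos.
have mfc : mfunT (fun x => f x - c) by exact: measurable_funB.
have [|h [ha hP]] := @approximable_bounded (de / 2) (Num.truncn ((C - c) / (de / 2))).+1 _ d2 mfc.
 move=> x; have /andP[h1 h2] := fcC x; rewrite subr_ge0 h1 /=.
 rewrite -(mulr_natl (de / 2)) -ler_pdivrMr//; apply: le_trans (ltW (truncnS_gt _)).
 by rewrite ler_pM2r ?invr_gt0// lerD2r.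
have [hi /(_ _ d2) [g [gl gi g2]]] : approximable (fun x => h x + c).
 by apply: approximableD => //; apply: approximable_cylinder; [exact: lip_cylinder_cst|exact: integ_cst].
exists g; split=> //; rewrite [leRHS](splitr de).
letr (L1_le fi gi fi hi hi gi (fun x => ler_distD (h x + c) (f x) (g x))); apply: lerD => //.
have := @expectation_between _ _ _ gamma (fun x => `|f x - (h x + c)|) 0 (de / 2).
case/(_ _ _)/andP => //; first exact: integ_measurable (integrable_dist fi hi).
move=> x; have [_] := hP x; rewrite normr_ge0 ler_norml /=.
by move: (f x) (h x) (de / 2) d2 => u v w *; lra.
Qed.

Lemma cylinder_dense f (c C de : R) : c <= C -> mfunT f -> (forall x, c <= f x <= C) -> 0 < de ->
 exists g, [/\ lip_cylinder g, forall x, c <= g x <= C & L1 f g <= de].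
Proof.
move=> cC mf fcC de0; have [fi /(_ _ de0) [g [[s [K [K0 h]]] gi g2]]] := approximable_between mf fcC.
pose k (u : R) := Num.max c (Num.min C u).
have kk u v : `|k u - k v| <= `|u - v|.
 letr (max_dist _ _ _ _); rewrite subrr normr0 add0r.
 by letr (min_dist _ _ _ _); rewrite subrr normr0 add0r.
have kc u : c <= k u <= C by rewrite le_max lexx /= ge_max cC ge_min lexx.
have gl : lip_cylinder (k \o g) by exists s, K; split=> // x y; exact: le_trans (kk _ _) (h x y).
exists (k \o g); split; [exact: gl|by move=> x; exact: kc|apply: le_trans g2].
have ki : integ (k \o g) by apply: integ_between (fun x => kc (g x)); exact: lip_cylinder_measurable.
have fk x : k (f x) = f x by have /andP[h1 h2] := fcC x; rewrite /k (min_idPr h2) (max_idPr h1).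
apply: le_Rintegral => //; [exact: integrable_dist|exact: integrable_dist|].
by move=> x _; rewrite -{1}(fk x); exact: kk.
Qed.
(** The entropy integrand minus its tangent at 1: it is nonnegative and has the same integral as
    [u * ln u] on probability densities. *)
Let psi (u : R) := u * ln u - u + 1.

Lemma entropy_fun_ge0 (u : R) : 0 <= u -> 0 <= psi u.
Proof.
rewrite /psi le_eqVlt => /predU1P[<-|u0]; first by rewrite mul0r; lra.
have := ler_wpM2l (ltW u0) (ln_ge_1V u0); rewrite mulrBr mulr1 mulfV ?gt_eqF//.
by lra.
Qed.

(* psi is convex with minimum at 1; this is the tangent inequality
   psi v >= psi u + (v - u) ln u. *)
Lemma entropy_fun_tangent (u v : R) : 0 < u -> 0 <= v -> psi u <= psi v + (u - v) * ln u.
Proof.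
move=> u0 v0; have := entropy_fun_ge0 (divr_ge0 v0 (ltW u0)); rewrite /psi.
have [->|v1] := eqVneq v 0; first by rewrite !mul0r; lra.
have vp : 0 < v by lra.
rewrite ln_div// => /(ler_wpM2l (ltW u0)); rewrite mulr0.
have -> : u * (v / u * (ln v - ln u) - v / u + 1) = v * (ln v - ln u) - v + u by field; rewrite gt_eqF.
by lra.
Qed.

(** Tangent inequality at the clipping level: [ln c <= 0 <= ln C] gives the correction the right
    sign on both sides. *)
Lemma entropy_fun_clip (c C v : R) : 0 < c -> c <= 1 -> 1 <= C -> 0 <= v -> psi (Num.max c (Num.min C v)) <= psi v.
Proof.
move=> c0 c1 C1 v0; have cC := le_trans c1 C1.
have [vc|cv] := leP v c.
 rewrite (min_idPr (le_trans vc cC)) (max_idPl vc).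
 letr (entropy_fun_tangent c0 v0); rewrite gerDl.
 by rewrite mulr_ge0_le0 ?subr_ge0// ln_le0.
have [Cv|vC] := leP C v; last by rewrite (max_idPr (ltW cv)).
rewrite (max_idPr cC); letr (entropy_fun_tangent (lt_le_trans ltr01 C1) v0).
by rewrite gerDl mulr_le0_ge0 ?subr_le0// ln_ge0.
Qed.
Let cylinder_budget (L de et : R) : 0 < de -> de * (4 * (L + 1)) <= et -> L * de <= et / 4.
Proof. by lra. Qed.
Let density_budget (a H et t : R) : a <= H + et / 4 -> 0 <= H -> 0 < et -> t * (4 * (H + 1)) <= et ->
 0 < t -> t <= 2^-1 -> a <= (H + et) * (1 - t).
Proof. by nra. Qed.

(** [F] is clipped, approximated in L1 by a cylindrical function within the same bounds, and
    normalised. Clipping does not raise [psi]; on the clipped range the tangent inequality bounds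
    its change by [L] times the L1 error; the mass [Z] is close to 1. *)
Theorem density_approx (F : E -> R) (H et : R) : (forall x, 0 <= F x) -> integ F -> \int[gamma]_x F x = 1 ->
 integ (fun x => F x * ln (F x)) -> \int[gamma]_x (F x * ln (F x)) = H -> 0 < et ->
 exists f c C s K, [/\ [/\ 0 < c, 0 <= K & forall x, c <= f x <= C],
 forall x y, `|f x - f y| <= K * @comb_dist R m T s x y, \int[gamma]_x f x = 1,
 L1 F f <= et & \int[gamma]_x (f x * ln (f x)) <= H + et].
Proof.
move=> F0 Fi F1 Fe FH et0.
have psiF : integ (fun x => psi (F x)).
 rewrite (_ : EFin \o _ = (fun x => (F x * ln (F x))%:E - (F x)%:E + 1%:E)%E)//.
 by apply: integrableD => //; [exact: integrableB|exact: integ_cst].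
have psiFH : \int[gamma]_x psi (F x) = H.
 rewrite /psi RintegralD//; [|rewrite (_ : EFin \o _ = (fun x => (F x * ln (F x))%:E - (F x)%:E)%E)//; exact: integrableB|exact: integ_cst].
 by rewrite RintegralB// FH F1 expectation_cst subrK.
have H0 : 0 <= H by rewrite -psiFH; apply: Rintegral_ge0 => x _; exact: entropy_fun_ge0.
(* Total L1 error allowed: [et / 2] because normalisation doubles it, one half to keep [Z] positive,
   and the last bound for dividing the entropy by [Z]. *)
pose t := Num.min (et / 2) (Num.min 2^-1 (et / (4 * (H + 1)))).
have t0 : 0 < t by rewrite !lt_min !divr_gt0 ?invr_gt0 ?mulr_gt0// ltr_wpDl.
have t1 : t <= et / 2 by rewrite ge_min lexx.
have t2 : t <= 2^-1 by rewrite !ge_min lexx orbT.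
have t3 : t * (4 * (H + 1)) <= et by rewrite -ler_pdivlMr ?mulr_gt0 ?ltr_wpDl// !ge_min lexx !orbT.
have mF := integ_measurable Fi.
pose k n (u : R) := Num.max n.+1%:R^-1 (Num.min n.+1%:R u).
have n1 n : 1 <= n.+1%:R :> R by rewrite ler1n.
have n2 n : n.+1%:R^-1 <= 1 :> R by rewrite invf_le1.
have n3 n : 0 < n.+1%:R^-1 :> R by [].
have nn n : n.+1%:R^-1 <= n.+1%:R :> R by exact: le_trans (n2 n) (n1 n).
have kb n u : n.+1%:R^-1 <= k n u <= n.+1%:R by rewrite /k le_max lexx /= ge_max nn ge_min lexx.
have mk n : mfunT (fun x => k n (F x)) by apply: measurable_maxr => //; apply: measurable_minr.
have ki n : integ (fun x => k n (F x)) := integ_between gamma (mk n) (fun x => kb n (F x)).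
have [n hn] : exists n, L1 F (fun x => k n (F x)) <= t / 2.
 have lim : (\int[gamma]_x (`|F x - k n (F x)|)%:E)%E @[n --> \oo] --> (\int[gamma]_x (cst 0 x))%E.
 apply: (@dominated_cvg _ _ _ gamma setT measurableT _ _ (fun x => (F x + 1)%:E)) => //.
 - by move=> n; apply/measE; exact: integ_measurable (integrable_dist Fi (ki n)).
 - move=> x _; apply: cvg_EFin; first exact: nearW.
 apply/cvgrPdist_le => ep ep0 /=; exists (Num.truncn (F x) + (Num.truncn ep^-1))%N => //= j jk.
 have j1 : F x <= j.+1%:R by letr (ltW (truncnS_gt _)); rewrite ler_nat ltnS (leq_trans (leq_addr _ _) jk).
 have j2 : ep^-1 <= j.+1%:R by letr (ltW (truncnS_gt _)); rewrite ler_nat ltnS (leq_trans (leq_addl _ _) jk).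
 have j3 : j.+1%:R^-1 <= ep by rewrite -[leRHS]invrK lef_pV2 ?posrE ?invr_gt0.
 rewrite sub0r normrN normr_id; apply: le_trans j3; exact: (clip_dist j (F0 x)).2.
 - by apply: integD => //; exact: integ_cst.
 - by move=> n x _; rewrite abse_EFin lee_fin normr_id; exact: (clip_dist n (F0 x)).1.
 rewrite integral0 in lim; have t20 : 0 < t / 2 by pos.
 move: lim => /fine_cvgP[_ /cvgrPdist_le/(_ _ t20) [n _ /(_ n (leqnn n))]] /=.
 by rewrite sub0r normrN => h; exists n; exact: le_trans (ler_norm _) h.
have {}kb := kb n; have {}mk := mk n; have {}ki := ki n; rewrite /k in kb mk ki hn.
move: (n.+1%:R : R) (n.+1%:R^-1 : R) (n1 n) (n2 n) (n3 n) (nn n) kb mk ki hn.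
move=> C c C1 c1 c0 cC kb mk ki hn {n1 n2 n3 nn k}.
pose k (u : R) := Num.max c (Num.min C u); rewrite -/k in mk ki hn.
pose L := `|ln c| + `|ln C|.
have L0 : 0 < L + 1 by pos.
pose de := Num.min (t / 2) (et / (4 * (L + 1))).
have de0 : 0 < de by rewrite lt_min !divr_gt0 ?mulr_gt0.
have de1 : de <= t / 2 by rewrite ge_min lexx.
have de2 : de * (4 * (L + 1)) <= et by rewrite -ler_pdivlMr ?mulr_gt0// ge_min lexx orbT.
have [g [gl gcC gde]] := cylinder_dense cC mk (fun x => kb (F x)) de0.
have mg := lip_cylinder_measurable gl; have gi := integ_between gamma mg gcC.
have g0 x : 0 < g x by have /andP[h _] := gcC x; exact: lt_le_trans h.
have xlC x : - (C * L) <= g x * ln (g x) <= C * L by exact: xlnx_between.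
have mgl : mfunT (fun x => g x * ln (g x)).
 by apply: measurable_funM => //; exact: (mcomp (@measurable_ln R) mg).
have gli := integ_between gamma mgl xlC.
have L1g : L1 F g <= t.
 rewrite [leRHS](splitr t).
 letr (L1_le Fi gi Fi ki ki gi (fun x => ler_distD (k (F x)) (F x) (g x))).
 by apply: lerD => //; exact: le_trans de1.
pose Z := \int[gamma]_x g x.
have Z1 : `|Z - 1| <= t.
 rewrite -F1 distrC /Z -RintegralB//; apply: le_trans L1g; apply: le_normr_Rintegral => //.
 by rewrite (_ : EFin \o _ = (fun x => (F x)%:E - (g x)%:E)%E)//; exact: integrableB.
have Zt : 1 - t <= Z by move: Z1; rewrite ler_distl => /andP[].
have Z0 : 0 < Z by apply: lt_le_trans Zt; rewrite subr_gt0 (le_lt_trans t2)// invf_lt1// ltr1n.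
have psigi : integ (fun x => psi (g x)).
 rewrite (_ : EFin \o _ = (fun x => (g x * ln (g x))%:E - (g x)%:E + 1%:E)%E)//.
 by apply: integrableD => //; [exact: integrableB|exact: integ_cst].
pose A := \int[gamma]_x psi (g x).
have AH : A <= H + et / 4.
 have i : integ (fun x => psi (F x) + L * `|k (F x) - g x|).
 by apply: integD => //; apply: integZ; exact: integrable_dist.
 letr (le_Rintegral measurableT psigi i _).
 move=> x _; apply: le_trans (_ : psi (k (F x)) + L * `|k (F x) - g x| <= _).
 have /andP[h1 _] := kb (F x); letr (entropy_fun_tangent (g0 x) (le_trans (ltW c0) h1)).
 rewrite lerD2l distrC mulrC; letr (ler_norm _); rewrite normrM.
 apply: ler_wpM2r => //.
 exact: ln_between (gcC x).
 by rewrite lerD2r; exact: entropy_fun_clip.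
 rewrite RintegralD ?RintegralZl ?psiFH ?lerD2l//; [|exact: integrable_dist|by apply: integZ; exact: integrable_dist].
 letr (ler_wpM2l _ gde); first by pos.
 exact: cylinder_budget.
exists (fun x => g x / Z), (c / Z), (C / Z).
have [s [K [K0 gK]]] := gl; exists s, (K / Z); split.
- split; [exact: divr_gt0|exact: divr_ge0 K0 (ltW Z0)|move=> x].
 by rewrite !ler_pM2r ?invr_gt0.
- move=> x y; rewrite -mulrBl normrM normfV (gtr0_norm Z0) mulrAC.
 by rewrite ler_pM2r ?invr_gt0.
- by rewrite RintegralZr// -/Z divff// gt_eqF.
- have fi : integ (fun x => g x / Z).
 by under [X in integ X]eq_fun do rewrite mulrC; exact: integZ.
 letr (L1_le Fi fi Fi gi gi fi (fun x => ler_distD (g x) (F x) (g x / Z))).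
 have -> : L1 g (fun x => g x / Z) = `|Z - 1|.
 transitivity (\int[gamma]_x (g x * (`|Z - 1| / Z))).
 apply: eq_Rintegral => x _; rewrite -{1}[g x]mulr1 -mulrBr normrM (gtr0_norm (g0 x)); congr (_ * _).
 have -> : 1 - Z^-1 = (Z - 1) / Z by rewrite mulrBl divff ?gt_eqF// mul1r.
 by rewrite normrM normfV (gtr0_norm Z0).
 by rewrite RintegralZr// -/Z mulrCA divff ?mulr1// gt_eqF.
 by letr (lerD L1g Z1); rewrite [leRHS]splitr lerD.
- have -> : \int[gamma]_x (g x / Z * ln (g x / Z)) = (A + Z - 1) / Z - ln Z.
 transitivity (\int[gamma]_x (Z^-1 * (g x * ln (g x)) - ln Z / Z * g x)).
 apply: eq_Rintegral => x _; rewrite ln_div ?posrE//.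
 by move: (ln _) (ln Z) => a b; field; rewrite gt_eqF.
 rewrite RintegralB ?RintegralZl -/Z//; last 2 first.
 + exact: integZ.
 + exact: integZ.
 have -> : \int[gamma]_x (g x * ln (g x)) = A + Z - 1.
 rewrite /A /psi RintegralD; [|by []| |exact: integ_cst].
 by rewrite RintegralB// expectation_cst -/Z; ring.
 by rewrite (_ : EFin \o _ = (fun x => (g x * ln (g x))%:E - (g x)%:E)%E)//; exact: integrableB.
 by move: (ln Z) => a; field; rewrite gt_eqF.
 have A0 : A <= (H + et) * Z.
 apply: le_trans (_ : (H + et) * (1 - t) <= _); last first.
 by apply: ler_wpM2l => //; rewrite addr_ge0// ltW.
 exact: density_budget AH H0 et0 t3 t0 t2.
 apply: le_trans (_ : A / Z <= _); last by rewrite ler_pdivrMr.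
 have -> : (A + Z - 1) / Z = A / Z + (1 - Z^-1) by field; rewrite gt_eqF.
 by rewrite -addrA gerDl subr_le0 ln_ge_1V.
Qed.

End CylinderDensity.

(** * Gaussian tails by Marton's argument *)

Section Concentration.
Context {R : realType} {m : nat}.
Variables (T : R) (gamma : probability (cpath T (0 : 'rV[R]_m)) R).
Hypotheses (T0 : 0 < T) (hg : gaussian gamma).
Local Notation E := (cpath T (0 : 'rV[R]_m)).
Local Notation cov := (cov gamma).

Lemma entropy_transport (F : E -> R) (H et : R) : (forall x, 0 <= F x) -> integT gamma F ->
 \int[gamma]_x F x = 1 -> integT gamma (fun x => F x * ln (F x)) -> \int[gamma]_x (F x * ln (F x)) = H -> 0 < et ->
 exists (f : E -> R) s ev v Th, [/\ (exists c C, 0 < c /\ forall x, c <= f x <= C), mfunT f,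
 \int[gamma]_x f x = 1, \int[gamma]_x `|F x - f x| <= et & shift_transport hg s f ev v Th] /\
 (\int[gamma]_x (v x)%:E <= (2 * (H + et))%:E)%E.
Proof.
move=> F0 Fi F1 Fe FH et0.
have [f [c [C [s [K [[c0 K0 fcC] fl f1 fF fH]]]]]] := density_approx T0 F0 Fi F1 Fe FH et0.
have fl' x y : `|f x - f y| <= K * comb_dist (s ++ [::]) x y by rewrite cats0.
have [ev [v [Th tr]]] := cylinder_transport T0 hg c0 K0 fcC (r := [::]) (fun l => ltac:(by [])) fl' f1.
exists f, s, ev, v, Th; split; first by split=> //; [exists c, C|exact: measurable_comb_lipschitz fl].
have [_ _ _ _ h] := tr; apply: le_trans h _.
by rewrite lee_fin ler_pM2l.
Qed.

Lemma shift_transport_integrable s f ev v Th H : shift_transport hg s f ev v Th -> (\int[gamma]_x (v x)%:E <= H%:E)%E ->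
 integT gamma v /\ \int[gamma]_x v x <= H.
Proof.
move=> [[_ mv _] cv _ _ _] vH.
have v0 x : 0 <= v x by apply: le_trans (cv x); exact: var_ge0.
have i : integT gamma v.
 apply/integrableP; split; first exact/measE.
 under eq_integral do rewrite /= ger0_norm//.
 by apply: le_lt_trans vH _; exact: ltry.
by split=> //; rewrite -lee_fin fineK//; exact: integrable_fin_num.
Qed.

Variables (B B' : nat -> set E) (kap dd : R).
Hypotheses (mB : forall n, measurable (B n)) (mB' : forall n, measurable (B' n)) (kap0 : 0 <= kap) (dd0 : 0 < dd)
 (finB' : forall x, exists n0, forall n, (n0 <= n)%N -> ~ B' n x)
 (shiftB : {ae gamma, forall x, forall e (v : R) n, cov e e <= v -> B n (cpathD x (hpath hg e)) ->
 exists k j, [/\ (n <= k + j)%N, B' k x & j%:R * dd <= kap * Num.sqrt v]}).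
Let D n := \bigcup_(k in [set k | (n <= k)%N]) B' k.
Let mD n : measurable (D n). Proof. exact: bigcup_measurable. Qed.
(** Every path has a finite count, so the sets [D n] decrease to the empty set; this qualitative
    fact starts the argument. *)
Let tail_start : exists n0, fine (gamma (D n0)) <= 4^-1.
Proof.
have : gamma \o D @ \oo --> gamma (\bigcap_n D n).
 apply: nonincreasing_cvg_mu => //.
 - by apply: le_lt_trans (probability_le1 gamma (mD 0)) (ltry _).
 - exact: bigcapT_measurable.
 - by move=> i j ij; apply/subsetPset => x [k /= jk Bk]; exists k => //=; exact: leq_trans jk.
have -> : \bigcap_n D n = set0.
 apply/seteqP; split=> // x Dx; have [n0 h] := finB' x.
 by have [k /= nk Bk] := Dx n0 I; exact: h nk Bk.
rewrite measure0 => /fine_cvgP[_ /cvgrPdist_le h].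
have q0 : 0 < 4^-1 :> R by [].
have [n _ /(_ n (leqnn n))] := h _ q0; rewrite /= sub0r normrN => hn.
by exists n; exact: le_trans (ler_norm _) hn.
Qed.
Let marton_budget (L2 V a b : R) : L2 <= V + L2 * a + L2 * b -> a <= 4^-1 -> b <= 4^-1 -> 0 <= L2 -> L2 <= 2 * V.
Proof. by nra. Qed.

(* The transport inequality turns gamma(D n0) <= 1/4 into a Gaussian tail. *)
Let marton n0 n : fine (gamma (D n0)) <= 4^-1 -> (n0 <= n)%N -> 0 < fine (gamma (B n)) ->
 ((n%:R - n0%:R) * dd) ^+ 2 <= 4 * kap ^+ 2 * (4^-1 - ln (fine (gamma (B n)))).
Proof.
move=> D4 nn; set b := fine _ => b0.
(* The density of [gamma] conditioned on [B n]; its entropy is [- ln b]. *)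
pose F x : R := \1_(B n) x / b.
have F0 x : 0 <= F x by pos.
have i1 : integT gamma (\1_(B n) : E -> R).
 by apply: (@integ_between _ _ _ _ _ 0 1) => // x; rewrite indicE; case: (_ \in _); rewrite ler01 lexx.
have I1 : \int[gamma]_x (\1_(B n) x : R) = b by rewrite /Rintegral integral_indic// setIT.
have Fi : integT gamma F.
 by rewrite (_ : EFin \o F = fun x => (b^-1)%:E * (\1_(B n) x)%:E)%E; [exact: integrableZl|apply/funext => x; rewrite -EFinM mulrC].
have F1 : \int[gamma]_x F x = 1 by rewrite /F RintegralZr// I1 divff// gt_eqF.
have FE x : F x * ln (F x) = - ln b * F x.
 by rewrite /F indicE; case: (_ \in _); rewrite ?mul0r ?mulr0// mul1r lnV// mulrC.
have Fe : integT gamma (fun x => F x * ln (F x)).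
 by rewrite (_ : EFin \o _ = fun x => (- ln b)%:E * (F x)%:E)%E; [exact: integrableZl|apply/funext => x /=; rewrite FE].
have FH : \int[gamma]_x (F x * ln (F x)) = - ln b by under eq_Rintegral do rewrite FE; rewrite RintegralZl// F1 mulr1.
have q0 : 0 < 4^-1 :> R by [].
have [f [s [ev [v [Th [[[c [C [c0 fcC]]] mf f1 fF tr] vH]]]]]] := entropy_transport F0 Fi F1 Fe FH q0.
have [vi vI] := shift_transport_integrable tr vH.
have [[mTh mv ThE] cv _ law _] := tr.
have v0 x : 0 <= v x by apply: le_trans (cv x); exact: var_ge0.
set L2 := _ ^+ 2; have L20 : 0 <= L2 by pos.
pose g x : R := \1_(~` B n) (Th x).
have mg : mfunT g by apply: (mcomp _ mTh); apply: measurable_indic; exact: measurableC.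
have g01 x : 0 <= g x <= 1 by rewrite /g indicE; case: (_ \in _); rewrite ler01 lexx.
have gi := integ_between gamma mg g01.
have gI : \int[gamma]_x g x <= 4^-1.
 have fi := integ_between gamma mf fcC.
 have mc : mfunT (\1_(~` B n) : E -> R) by apply: measurable_indic; exact: measurableC.
 have -> : \int[gamma]_x g x = \int[gamma]_x (\1_(~` B n) x * f x).
 by congr fine; apply: (law (fun x => (\1_(~` B n) x)%:E)) => [x|]; [rewrite lee_fin|exact/measE].
 apply: le_trans fF; apply: le_Rintegral => //; [|exact: integrable_dist|].
 apply: (@integ_between _ _ _ gamma _ 0 C) => [|x]; first exact: measurable_funM.
 have /andP[h1 h2] := fcC x; have f0 : 0 <= f x := le_trans (ltW c0) h1.
 by rewrite indicE; case: (_ \in _); rewrite ?mul1r ?mul0r ?lexx// (le_trans f0).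
 move=> x _; rewrite /F !indicE in_setC; case: (_ \in _); rewrite ?mul0r//= mul1r sub0r normrN.
 exact: ler_norm.
have Di : integT gamma (\1_(D n0) : E -> R).
 by apply: (@integ_between _ _ _ _ _ 0 1) => // x; rewrite indicE; case: (_ \in _); rewrite ler01 lexx.
have DI : \int[gamma]_x (\1_(D n0) x : R) <= 4^-1 by rewrite /Rintegral integral_indic// setIT.
(* Three alternatives cover almost every [x]: it lies in [D n0], its image misses [B n], or the
   shift is long enough to create the missing intervals. In each case one summand reaches [L2]. *)
pose G x := kap ^+ 2 * v x + L2 * \1_(D n0) x + L2 * g x.
have Gi : integT gamma G by apply: integD; [apply: integD|]; exact: integZ.
have Kv0 x : 0 <= kap ^+ 2 * v x by pos.
have LD0 x : 0 <= L2 * \1_(D n0) x by pos.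
have Lg0 x : 0 <= L2 * g x by pos; have /andP[] := g01 x.
have G0 x : 0 <= G x by pos.
have key : L2 <= \int[gamma]_x G x.
 rewrite -[leLHS](expectation_cst gamma) /Rintegral; apply: fine_le.
 - by apply: integrable_fin_num => //; exact: integ_cst.
 - exact: integrable_fin_num.
 apply: ae_ge0_le_integral => //.
 - by move=> x _; rewrite lee_fin.
 - by apply/measE; exact: integ_measurable Gi.
 apply: filterS shiftB => x sx _; rewrite lee_fin.
 have [Dx|nDx] := pselect (D n0 x).
 have D1 : \1_(D n0) x = 1 :> R by rewrite indicE mem_set.
 by rewrite /G D1 mulr1 addrAC lerDr addr_ge0.
 have [Bx|nBx] := pselect (B n (Th x)); last first.
 have g1 : g x = 1 by rewrite /g indicE mem_set.
 by rewrite /G g1 mulr1 lerDr addr_ge0.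
 rewrite ThE in Bx; have [k [j [nkj Bk jl]]] := sx _ _ _ (cv x) Bx.
 have kn0 : (k < n0)%N by rewrite ltnNge; apply/negP => h; apply: nDx; exists k.
 apply: le_trans (_ : kap ^+ 2 * v x <= _); last by rewrite /G -addrA lerDl addr_ge0.
 have nn' : (n0%:R : R) <= n%:R by rewrite ler_nat.
 rewrite -[v x]sqr_sqrtr// -exprMn /L2 ler_pXn2r ?nnegrE//; [|by pos|by pos].
 apply: le_trans jl; rewrite ler_pM2r// lerBlDr -natrD ler_nat addnC.
 by apply: leq_trans nkj _; rewrite leq_add2r ltnW.
have GE : \int[gamma]_x G x = kap ^+ 2 * \int[gamma]_x v x + L2 * \int[gamma]_x (\1_(D n0) x : R) + L2 * \int[gamma]_x g x.
 rewrite /G RintegralD//; [|apply: integD; exact: integZ|exact: integZ].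
 by rewrite RintegralD ?RintegralZl//; exact: integZ.
rewrite GE in key; letr (marton_budget key DI gI L20).
have := ler_wpM2l (sqr_ge0 kap) vI.
by move: (ln b) (\int[gamma]_x v x) (kap ^+ 2) => lb V K2; lra.
Qed.

(** [marton] bounds the squared distance to [n0] by the logarithm of the probability;
    [(u - w)^2 >= u^2 / 2 - w^2] removes the offset at the price of half the rate, and indices up to
    [n0] go into [K]. *)
Lemma gaussian_tail : exists a K : R, [/\ 0 < a, 0 <= K &
 forall n, (gamma (B n) <= (K * expR (- (a * n%:R ^+ 2)))%:E)%E].
Proof.
have [n0 D4] := tail_start.
pose a := dd ^+ 2 / (4 * (kap ^+ 2 + 1)).
have k1 : 0 < 4 * (kap ^+ 2 + 1) by pos.
have a0 : 0 < a by pos.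
exists (a / 2), (expR (4^-1 + a * n0%:R ^+ 2)); split; [by pos|exact: expR_ge0|move=> n].
rewrite -expRD; have fB : gamma (B n) \is a fin_num by exact: fin_num_measure.
have [nn|nn] := leqP n n0.
 letr (probability_le1 gamma (mB n)); rewrite lee_fin -[leLHS]expR0 ler_expR.
 have : (n%:R : R) ^+ 2 <= n0%:R ^+ 2 by rewrite ler_pXn2r ?nnegrE ?ler_nat.
 have : 0 <= (n%:R : R) ^+ 2 by [].
 by move: (n%:R ^+ 2 : R) (n0%:R ^+ 2 : R) => u w; nra.
rewrite -(fineK fB) lee_fin; have : 0 <= fine (gamma (B n)) by rewrite fine_ge0.
rewrite le_eqVlt => /predU1P[<-|b0]; first exact: expR_ge0.
have h := marton D4 (ltnW nn) b0.
have lb0 : ln (fine (gamma (B n))) <= 0 by apply: ln_le0; rewrite -lee_fin fineK//; exact: probability_le1.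
rewrite -[leLHS]lnK// ler_expR; move: (ln _) (n%:R : R) (n0%:R : R) lb0 h => lb u w lb0 h.
have h2 : a * (u - w) ^+ 2 <= 4^-1 - lb.
 rewrite /a mulrAC ler_pdivrMr// -exprMn [dd * _]mulrC; apply: le_trans h _.
 by move: (kap ^+ 2) => K2; nra.
by have := mulr_ge0 (ltW a0) (sqr_ge0 (u - 2 * w)); move: a h2 {a0} => a; nra.
Qed.

End Concentration.

(** * Exponential moments of the count *)

Section TailMoment.
Context d (T : measurableType d) (R : realType) (P : probability T R).
Variables (B : nat -> set T) (a K : R).
Hypotheses (mB : forall n, measurable (B n)) (finB : forall x, exists n, ~ B n.+1 x) (a0 : 0 < a) (K0 : 0 <= K)
 (tailB : forall n, (P (B n) <= (K * expR (- (a * n%:R ^+ 2)))%:E)%E).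

(** The index is shifted by one to match [rough_summary], which is stated under the failure of the
    count at [n.+1]; the count at 0 always holds. *)
Definition first_miss (x : T) : nat := xget 0%N [set n | ~ B n.+1 x /\ forall k, (k < n)%N -> B k.+1 x].
Local Notation N := first_miss.

Lemma first_missP x : ~ B (N x).+1 x /\ forall k, (k < N x)%N -> B k.+1 x.
Proof.
rewrite /N; case: xgetP => [n _ //|none].
have ex : exists n, `[< ~ B n.+1 x >] by have [n h] := finB x; exists n; apply/asboolP.
case: (ex_minnP ex) => n /asboolP nB nmin; case: (none n); split=> // k kn.
by apply: contrapT => kB; move: kn; rewrite ltnNge (nmin k)//; exact/asboolP.
Qed.
Let fiberE n : [set x | N x = n] = ~` B n.+1 `&` \bigcap_(k in `I_n) B k.+1.
Proof.
apply/seteqP; split=> [x <-|x [h1 h2]]; first by have [] := first_missP x.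
have [h3 h4] := first_missP x; rewrite /=; case: (ltngtP (N x) n) => // h; first by case: h3; exact: h2.
by case: h1; exact: h4.
Qed.
Let mfiber n : measurable [set x | N x = n].
Proof.
rewrite fiberE; apply: measurableI; first exact: measurableC.
by apply: bigcap_measurableType => k _; exact: mB.
Qed.

Lemma measurable_first_miss (h : nat -> R) : mfunT (fun x => h (N x)).
Proof.
move=> _ A mA; rewrite setTI (_ : _ @^-1` A = \bigcup_(n in [set n | A (h n)]) [set x | N x = n]).
 by apply: bigcup_measurable => n _; exact: mfiber.
by apply/seteqP; split=> [x hx|x [n /= An ->]//]; exists (N x).
Qed.

(** For [n > 0] the fibre over [n] lies in [B n]. Half of the Gaussian rate pays for the
    exponential, and the other half leaves a geometric series because [n <= n ^ 2]. *)
Lemma first_miss_moment : P.-integrable setT (fun x => (expR (a / 2 * (N x)%:R ^+ 2))%:E).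
Proof.
apply/integrableP; split; first exact/measE/(measurable_first_miss (fun n => expR (a / 2 * n%:R ^+ 2))).
under eq_integral do rewrite abse_EFin (ger0_norm (expR_ge0 _)).
have -> : setT = \bigcup_n [set x | N x = n] by apply/seteqP; split=> // x _; exists (N x).
rewrite ge0_integral_bigcup//; last 2 first.
- apply: measurable_funTS; apply/measE; exact: (measurable_first_miss (fun n => expR (a / 2 * n%:R ^+ 2))).
- by move=> i j _ _ [x [/= <- <-]].
pose r := expR (- (a / 2)); have r1 : r < 1 by rewrite expR_lt1 oppr_lt0 divr_gt0.
have term n : (\int[P]_(x in [set x | N x = n]) (expR (a / 2 * (N x)%:R ^+ 2))%:E <= (geometric (K + 1) r n)%:E)%E.
 rewrite (eq_integral (cst (expR (a / 2 * n%:R ^+ 2))%:E)); last by move=> x; rewrite inE /= => ->.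
 rewrite integral_cst//.
 have PN : (P [set x | N x = n] <= ((K + 1) * expR (- (a * n%:R ^+ 2)))%:E)%E.
 case: n => [|n].
 rewrite expr0n mulr0 oppr0 expR0 mulr1; letr (probability_le1 P (mfiber 0)).
 by rewrite lee_fin lerDr.
 letr (le_trans _ (tailB n.+1)).
 apply: le_measure; rewrite ?inE; [exact: mfiber|exact: mB|].
 by rewrite fiberE => x [_ h]; exact: (h n (ltnSn n)).
 by rewrite lee_fin ler_wpM2r// lerDl.
 letr (lee_wpmul2l _ PN); first by [].
 rewrite -EFinM lee_fin mulrCA -expRD /geometric /= -expRM_natr; apply: ler_wpM2l; first by pos.
 rewrite ler_expR; have : (n%:R : R) <= n%:R ^+ 2.
 by rewrite -natrX ler_nat; case: (n) => // k; rewrite expnS expn1 leq_pmulr.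
 by move: (n%:R : R) => u h; have := ler_wpM2l (ltW a0) h; lra.
apply: le_lt_trans (lee_nneseries (fun i _ _ => integral_ge0 _ (fun x _ => _)) (fun n _ => term n)) _.
 by move=> i _ _ x _; pos.
apply: le_lt_trans (_ : _ <= ((K + 1) * (1 - r)^-1)%:E)%E _; last exact: ltry.
apply: lime_le; first by apply: is_cvg_nneseries => n _ _; rewrite lee_fin geometric_ge0 ?expR_ge0// addr_ge0.
near=> n; rewrite sumEFin lee_fin; apply: geometric_le_lim; first exact: addr_ge0.
 exact: expR_gt0.
by rewrite ger0_norm// expR_ge0.
Unshelve. all: by end_near. Qed.

End TailMoment.

(** * Coupling of two densities *)

Section ProbabilityOf.
Context d (T : measurableType d) (R : realType).
Variables (mu : {measure set T -> \bar R}) (mu1 : mu setT = 1%E).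

Definition probability_of of mu setT = 1%E : set T -> \bar R := mu.
HB.instance Definition _ := Measure.on (probability_of mu1).
HB.instance Definition _ := @Measure_isProbability.Build _ _ _ (probability_of mu1) mu1.

End ProbabilityOf.

Import HBNNSimple.

(** Integrals of nonnegative functions are suprema over simple functions below them. This bounds the
    cost of a coupling without measurability of [dpvar]. *)
Lemma integral_le_simple d (T : measurableType d) (R : realType) (mu : {measure set T -> \bar R})
 (f : T -> \bar R) (b : \bar R) : (forall x, (0 <= f x)%E) ->
 (forall h : T -> R, (forall x, 0 <= h x) -> mfunT h -> (forall x, ((h x)%:E <= f x)%E) ->
 (\int[mu]_x (h x)%:E <= b)%E) -> (\int[mu]_x f x <= b)%E.
Proof.
move=> f0 fb; rewrite ge0_integralTE//; apply: ge_ereal_sup => _ [h hf <-].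
by rewrite -integralT_nnsfun; apply: fb => [x||x]; [exact: fun_ge0|by []|exact: hf].
Qed.

Section ResidualProduct.
Context d (T : measurableType d) (R : realType) (P : probability T R).
Variables (al be : T -> R) (r : R).
Hypotheses (mal : mfunT al) (mbe : mfunT be) (al0 : forall x, 0 <= al x) (be0 : forall x, 0 <= be x)
 (alr : (\int[P]_x (al x)%:E = r%:E)%E) (ber : (\int[P]_x (be x)%:E = r%:E)%E).
Let null_weight (f : T -> R) (phi : T -> \bar R) : mfunT f -> (forall x, 0 <= f x) ->
 (\int[P]_x (f x)%:E = 0)%E -> mfunT phi -> (\int[P]_x (phi x * (f x)%:E) = 0)%E.
Proof.
move=> mf f0 I0 mphi.
have : ae_eq P setT (EFin \o f) (cst 0%E).
 apply/(ae_eq_integral_abs P measurableT); first exact/measE.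
 by rewrite -[RHS]I0; apply: eq_integral => x _; rewrite abse_EFin ger0_norm.
move=> h; rewrite -[RHS](integral0 P setT); apply: ae_eq_integral => //.
 by apply: emeasurable_funM => //; exact/measE.
by apply: filterS h => x h xT; have /= -> := h xT; rewrite mule0.
Qed.

(** The normalised product of two weights of equal mass [r] has them as marginals. For [r = 0] both
    weights vanish almost everywhere, in accordance with [r^-1 = 0]. *)
Lemma residual_product (phi psi : T -> \bar R) : mfunT phi -> mfunT psi ->
 (forall x, (0 <= phi x)%E) -> (forall x, (0 <= psi x)%E) ->
 (\int[P]_y \int[P]_x ((phi y + psi x) * (r^-1 * al y * be x)%:E) =
 \int[P]_x (phi x * (al x)%:E) + \int[P]_x (psi x * (be x)%:E))%E.
Proof.
move=> mphi mpsi phi0 psi0; have [r0|r0] := eqVneq r 0.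
 move: alr ber; rewrite {1 2}r0 => a0 b0.
 rewrite (null_weight mal al0 a0 mphi) (null_weight mbe be0 b0 mpsi) adde0 r0.
 under eq_integral do under eq_integral do rewrite invr0 !mul0r mule0.
 by under eq_integral do rewrite integral0; rewrite integral0.
have rp : 0 <= r^-1 by rewrite invr_ge0 -lee_fin -alr; apply: integral_ge0 => x _; rewrite lee_fin.
have mEa : mfunT (EFin \o al) by exact/measE.
have mEb : mfunT (EFin \o be) by exact/measE.
have Ea x : (0 <= (al x)%:E)%E by rewrite lee_fin.
have Eb x : (0 <= (be x)%:E)%E by rewrite lee_fin.
have ra x : (0 <= (r^-1 * al x)%:E)%E by rewrite lee_fin mulr_ge0.
set Q := (\int[P]_x (psi x * (be x)%:E))%E.
have Q0 : (0 <= Q)%E by apply: integral_ge0 => x _; rewrite mule_ge0.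
transitivity (\int[P]_y (phi y * (al y)%:E + (r^-1 * al y)%:E * Q))%E.
 apply: eq_integral => y _.
 under eq_integral do rewrite ge0_muleDl// EFinM !(muleCA _ (r^-1 * al y)%:E).
 rewrite ge0_integralD//; last 4 first.
 - by move=> x _; rewrite !mule_ge0.
 - by apply: emeasurable_funM => //; apply: emeasurable_funM.
 - by move=> x _; rewrite !mule_ge0.
 - by apply: emeasurable_funM => //; apply: emeasurable_funM.
 rewrite !ge0_integralZl//; [|exact: emeasurable_funM|by move=> x _; rewrite mule_ge0|exact: emeasurable_funM|by move=> x _; rewrite mule_ge0].
 by rewrite -/Q ber; congr (_ + _)%E; rewrite muleCA -EFinM mulrAC mulVf// mul1r.
rewrite ge0_integralD//; last 4 first.
- by move=> x _; rewrite mule_ge0.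
- exact: emeasurable_funM.
- by move=> x _; rewrite mule_ge0.
- by apply: emeasurable_funM => //; apply/measE; exact: measurable_funM.
congr (_ + _)%E; rewrite ge0_integralZr//; last by apply/measE; exact: measurable_funM.
under eq_integral do rewrite EFinM.
by rewrite ge0_integralZl//; rewrite alr -EFinM mulVf// mul1e.
Qed.

End ResidualProduct.

Section TransportCoupling.
Context d dU (T : measurableType d) (U : measurableType dU) (R : realType).
Variables (P : probability T R) (nu mu : probability U R) (Y : T -> U) (F f : T -> R) (c : R) (Th : T -> T).
Hypotheses (mY : mfunT Y) (mF : mfunT F) (F0 : forall x, 0 <= F x)
 (F1 : (\int[P]_x (F x)%:E = 1)%E) (mf : mfunT f) (c0 : 0 < c) (cf : forall x, c <= f x)
 (f1 : (\int[P]_x (f x)%:E = 1)%E) (mTh : mfunT Th).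
Hypothesis Th_law : forall G : T -> \bar R, (forall x, (0 <= G x)%E) -> mfunT G ->
 (\int[P]_x G (Th x) = \int[P]_x (G x * (f x)%:E))%E.
Hypotheses (nuE : forall A, measurable A -> nu A = (\int[P]_x ((\1_A (Y x))%:E * (F x)%:E))%E)
 (muE : forall A, measurable A -> mu A = P (Y @^-1` A)).
Let m x := Num.min (F x) (f x).
Let w x := m (Th x) / f (Th x).
Let al x := F x - m x.
Let be x := 1 - w x.
Let r := fine (\int[P]_x (al x)%:E)%E.
Let f0 x : 0 < f x. Proof. exact: lt_le_trans (cf x). Qed.
Let m0 x : 0 <= m x. Proof. by rewrite /m le_min F0 ltW. Qed.
Let mm : mfunT m. Proof. exact: measurable_minr. Qed.
Let mq : mfunT (fun x => m x / f x).
Proof.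
rewrite (_ : (fun x => _) = fun x => m x * expR (- ln (f x))); last first.
 by apply/funext => x; rewrite expRN lnK ?posrE.
apply: measurable_funM => //; apply: (mcomp (@measurable_expR R)).
by apply: measurable_funN; exact: (mcomp (@measurable_ln R) mf).
Qed.
Let mw : mfunT w. Proof. exact: (mcomp mq mTh). Qed.
Let w01 x : 0 <= w x <= 1.
Proof. by rewrite divr_ge0 ?(ltW (f0 _))//= ler_pdivrMr// mul1r ge_min lexx orbT. Qed.
Let al0 x : 0 <= al x. Proof. by rewrite subr_ge0 ge_min lexx. Qed.
Let be0 x : 0 <= be x. Proof. by rewrite subr_ge0; have /andP[] := w01 x. Qed.
Let mal : mfunT al. Proof. exact: measurable_funB. Qed.
Let mbe : mfunT be. Proof. exact: measurable_funB. Qed.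
Let main_law (G : T -> \bar R) : (forall x, (0 <= G x)%E) -> mfunT G ->
 (\int[P]_x (G (Th x) * (w x)%:E) = \int[P]_x (G x * (m x)%:E))%E.
Proof.
move=> G0 mG; rewrite (Th_law (G := fun x => (G x * (m x / f x)%:E)%E)).
- by apply: eq_integral => x _; rewrite -muleA -EFinM divfK// gt_eqF.
- by move=> x; rewrite mule_ge0// lee_fin divr_ge0// ltW.
- by apply: emeasurable_funM => //; exact/measE.
Qed.
Let mfin : (\int[P]_x (m x)%:E <= 1)%E.
Proof.
rewrite -F1; apply: ge0_le_integral => //; try exact/measE.
- by move=> x _; rewrite lee_fin.
- by move=> x _; rewrite lee_fin ge_min lexx.
Qed.
Let wm : (\int[P]_x (w x)%:E = \int[P]_x (m x)%:E)%E.
Proof.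
have := main_law (G := cst 1%E) (fun x => lee01) (measurable_cst _).
by under eq_integral do rewrite mul1e; move=> ->; apply: eq_integral => x _; rewrite mul1e.
Qed.
Let alr : (\int[P]_x (al x)%:E = r%:E)%E.
Proof.
rewrite /r fineK// ge0_fin_numE; last by apply: integral_ge0 => x _; rewrite lee_fin.
apply: le_lt_trans (ltry 1); rewrite -F1; apply: ge0_le_integral => //; try exact/measE.
- by move=> x _; rewrite lee_fin.
- by move=> x _; rewrite lee_fin gerDl oppr_le0.
Qed.
Let split_mass (g h : T -> R) : mfunT g -> mfunT h -> (forall x, 0 <= g x) -> (forall x, 0 <= h x) ->
 (\int[P]_x (g x)%:E + \int[P]_x (h x)%:E = \int[P]_x (g x + h x)%:E)%E.
Proof.
move=> mg mh g0 h0; rewrite -ge0_integralD//; try exact/measE; by move=> x _; rewrite lee_fin.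
Qed.
Let ber : (\int[P]_x (be x)%:E = r%:E)%E.
Proof.
have w0 x : 0 <= w x by have /andP[] := w01 x.
have h1 : (\int[P]_x (al x)%:E + \int[P]_x (m x)%:E = 1)%E.
 by rewrite split_mass// -F1; apply: eq_integral => x _; rewrite subrK.
have h2 : (\int[P]_x (be x)%:E + \int[P]_x (m x)%:E = 1)%E.
 rewrite -wm split_mass//; under eq_integral do rewrite subrK.
 by transitivity (1 * P setT)%E; [exact: integral_cst|rewrite probability_setT mule1].
have mfn : (\int[P]_x (m x)%:E)%E \is a fin_num.
 by rewrite ge0_fin_numE ?(le_lt_trans mfin (ltry 1))//; apply: integral_ge0 => x _; rewrite lee_fin.
by rewrite -alr -[LHS](addeK _ mfn) h2 -h1 addeK.
Qed.
Let u (p : T * T) := r^-1 * al p.1 * be p.2.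
Let r0 : 0 <= r. Proof. by apply: fine_ge0; apply: integral_ge0 => x _; rewrite lee_fin. Qed.
Let u0 p : 0 <= u p. Proof. by pos. Qed.
Let mu_ : mfunT u.
Proof.
apply: measurable_funM; last exact: (mcomp mbe).
by apply: measurable_funM => //; exact: (mcomp mal).
Qed.
Let PP : probability (T * T)%type R := (P \x P)%E.
Let ufin : (\int[PP]_p (u p)%:E < +oo)%E.
Proof.
rewrite /PP fubini_tonelli1//; last exact/measE.
have := residual_product mal mbe al0 be0 alr ber (measurable_cst 1%E) (measurable_cst 0%E) (fun=> lee01) (fun=> lexx 0%E).
rewrite /fubini_F; under eq_integral do under eq_integral do rewrite adde0 mul1e.
move=> ->; under [X in (X + _)%E]eq_integral do rewrite mul1e.
under [X in (_ + X)%E]eq_integral do rewrite mul0e.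
by rewrite integral0 adde0 alr ltry.
Qed.
Let wfin : (\int[P]_x (w x)%:E < +oo)%E.
Proof. by rewrite wm; apply: le_lt_trans mfin (ltry _). Qed.
Let w0 x : 0 <= w x. Proof. by have /andP[] := w01 x. Qed.

(** The sum of two image measures: the shared mass goes along [Th], the leftovers are coupled by
    their normalised product. *)
Lemma coupling_exists : exists2 pi, couplings nu mu pi &
 forall h : U * U -> \bar R, (forall p, (0 <= h p)%E) -> mfunT h ->
 (\int[pi]_p h p = \int[P]_x (h (Y (Th x), Y x) * (w x)%:E) +
 \int[P]_y \int[P]_x (h (Y y, Y x) * (r^-1 * al y * be x)%:E))%E.
Proof.
have mY1 : mfunT (fun x => (Y (Th x), Y x)) by apply: measurable_fun_pair => //; exact: mcomp.
have mY2 : mfunT (fun p : T * T => (Y p.1, Y p.2)).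
 by apply: measurable_fun_pair; [exact: (mcomp mY)|exact: (mcomp mY)].
have [P1 P1E] := measure_image (tilt mw w0 wfin) mY1.
have [P2 P2E] := measure_image (@tilt _ _ _ PP u mu_ u0 ufin) mY2.
pose pi0 : {measure set (U * U) -> \bar R} := measure_add P1 P2.
have pi0E (h : U * U -> \bar R) : (forall p, (0 <= h p)%E) -> mfunT h ->
 (\int[pi0]_p h p = \int[P]_x (h (Y (Th x), Y x) * (w x)%:E) +
 \int[P]_y \int[P]_x (h (Y y, Y x) * (r^-1 * al y * be x)%:E))%E.
 move=> h0 mh; rewrite ge0_integral_measure_add//; congr (_ + _)%E.
 rewrite -(ge0_integral_law mY1 (fun A _ => esym (P1E A)) h0 mh) integral_tilt//.
 exact: (mcomp mh mY1).
 rewrite -(ge0_integral_law mY2 (fun A _ => esym (P2E A)) h0 mh) integral_tilt//; last exact: (mcomp mh mY2).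
 rewrite /PP fubini_tonelli1//; last by move=> p; rewrite mule_ge0// lee_fin.
 by apply: emeasurable_funM; [exact: (mcomp mh mY2)|exact/measE].
have mind (A : set U) : measurable A -> mfunT (fun x => (\1_A (Y x) : R)%:E).
 move=> mA; apply/measE; apply: (mcomp _ mY); exact: measurable_indic.
have mI (B : set (U * U)) : measurable B -> pi0 B = (\int[pi0]_p (\1_B p : R)%:E)%E.
 by move=> mB; rewrite integral_indic// setIT.
have RP := residual_product mal mbe al0 be0 alr ber.
have marg1 A : measurable A -> pi0 (A `*` setT) = nu A.
 move=> mA; have mB : measurable (A `*` [set: U]) by exact: measurableX.
 rewrite mI// pi0E//; last by apply/measE; exact: measurable_indic.
 have E1 z : \1_(A `*` setT) z = \1_A z.1 :> R by rewrite !indicE in_setX in_setT andbT.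
 under eq_integral do rewrite E1 /=.
 rewrite (main_law (G := fun x => (\1_A (Y x))%:E))//; last exact: mind.
 under [X in (_ + X)%E]eq_integral do under eq_integral do rewrite E1 /= -[X in (X * _)%E]adde0.
 rewrite (RP (fun x => (\1_A (Y x))%:E) (cst 0%E))//; last exact: mind.
 under [X in (_ + (_ + X))%E]eq_integral do rewrite mul0e.
 rewrite integral0 adde0 -ge0_integralD//; last 4 first.
 - by move=> x _; rewrite mule_ge0// lee_fin.
 - by apply: emeasurable_funM; [exact: mind|exact/measE].
 - by move=> x _; rewrite mule_ge0// lee_fin.
 - by apply: emeasurable_funM; [exact: mind|exact/measE].
 by rewrite nuE//; apply: eq_integral => x _; rewrite -ge0_muleDr ?lee_fin// -EFinD addrC subrK.
have marg2 A : measurable A -> pi0 (setT `*` A) = mu A.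
 move=> mA; have mB : measurable ([set: U] `*` A) by exact: measurableX.
 rewrite mI// pi0E//; last by apply/measE; exact: measurable_indic.
 have E1 z : \1_(setT `*` A) z = \1_A z.2 :> R by rewrite !indicE in_setX in_setT.
 under eq_integral do rewrite E1 /=.
 under [X in (_ + X)%E]eq_integral do under eq_integral do rewrite E1 /= -[X in (X * _)%E]add0e.
 rewrite (RP (cst 0%E) (fun x => (\1_A (Y x))%:E))//; last exact: mind.
 under [X in (_ + (X + _))%E]eq_integral do rewrite mul0e.
 rewrite integral0 add0e -ge0_integralD//; last 4 first.
 - by move=> x _; rewrite mule_ge0// lee_fin.
 - by apply: emeasurable_funM; [exact: mind|exact/measE].
 - by move=> x _; rewrite mule_ge0// lee_fin.
 - by apply: emeasurable_funM; [exact: mind|exact/measE].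
 rewrite muE// (eq_integral (fun x => (\1_(Y @^-1` A) x : R)%:E)).
 by rewrite integral_indic ?setIT// -[X in measurable X]setTI; exact: mY.
 by move=> x _; rewrite -ge0_muleDr ?lee_fin// -EFinD addrC subrK mule1 !indicE; congr (_%:R)%:E; apply/idP/idP; rewrite !inE.
have pi01 : pi0 setT = 1%E by rewrite -setXTT marg1// probability_setT.
exists (probability_of pi01); first by [].
by move=> h h0 mh; exact: pi0E.
Qed.

(** Along [Th] the cost is at most [G1]. On the product part it splits as [G2 y + G2 x], so only the
    leftover weight [al + be] enters, whose mass is controlled by the L1 distance of the
    densities. *)
Lemma coupling_cost (dist : U * U -> \bar R) (G1 : T -> \bar R) (G2 : T -> R) (Q : T -> Prop) (de : R) :
 (forall p, (0 <= dist p)%E) -> mfunT G1 -> mfunT G2 ->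
 (forall x, (0 <= G1 x)%E) -> (forall x, 0 <= G2 x) -> {ae P, forall x, (dist (Y (Th x), Y x) <= G1 x)%E} ->
 {ae P, forall x, Q x} -> (forall y x, Q y -> Q x -> (dist (Y y, Y x) <= (G2 y + G2 x)%:E)%E) ->
 (\int[P]_x `|F x - f x|%:E <= de%:E)%E ->
 exists pi (a : T -> R), [/\ couplings nu mu pi, mfunT a, forall x, 0 <= a x <= F x + 1,
 (\int[P]_x (a x)%:E <= (2 * de)%:E)%E & (\int[pi]_p dist p <= \int[P]_x G1 x + \int[P]_x (G2 x * a x)%:E)%E].
Proof.
move=> d0 mG1 mG2 G10 G20 d1 Qae d2 Ff; have [pi pic piE] := coupling_exists.
have mE (g : T -> R) : mfunT g -> mfunT (EFin \o g) by move=> ?; exact/measE.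
exists pi, (fun x => al x + be x); split=> //.
- exact: measurable_funD.
- move=> x; have /andP[w1 _] := w01 x; rewrite addr_ge0//= lerD//; first by rewrite gerDl oppr_le0.
 by rewrite gerDl oppr_le0.
- rewrite -split_mass// alr ber -EFinD lee_fin -mulr2n mulr_natl ler_pMn2r// -lee_fin -alr.
 apply: le_trans Ff; apply: ge0_le_integral => //; try by [exact: mE|move=> x _; rewrite lee_fin].
 by apply: mE; apply: (mcomp (@normr_measurable _ setT)); exact: measurable_funB.
 move=> x _; rewrite lee_fin /al /m; case: (leP (F x) (f x)) => h; first by rewrite subrr.
 exact: ler_norm.
apply: integral_le_simple => // h h0 mh hd.
have hE p : (0 <= (h p)%:E)%E by rewrite lee_fin.
have mhE : mfunT (EFin \o h) by exact/measE.
have mY1 : mfunT (fun x => (Y (Th x), Y x)) by apply: measurable_fun_pair => //; exact: mcomp.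
have mY2 : mfunT (fun p : T * T => (Y p.1, Y p.2)).
 by apply: measurable_fun_pair; [exact: (mcomp mY)|exact: (mcomp mY)].
rewrite (piE (fun p => (h p)%:E))//; apply: leeD.
 apply: ae_ge0_le_integral => //.
 - by move=> x _; rewrite mule_ge0// lee_fin.
 - by apply: emeasurable_funM; [exact: (mcomp mhE mY1)|exact: mE].
 apply: filterS d1 => x dx _; apply: le_trans (le_trans (hd _) dx).
 by rewrite -EFinM lee_fin ler_piMr//; have /andP[] := w01 x.
have G2E x : (0 <= (G2 x)%:E)%E by rewrite lee_fin.
have weight y x : (0 <= (r^-1 * al y * be x)%:E)%E by rewrite lee_fin (u0 (y, x)).
have -> : (\int[P]_x (G2 x * (al x + be x))%:E = \int[P]_x ((G2 x)%:E * (al x)%:E) + \int[P]_x ((G2 x)%:E * (be x)%:E))%E.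
 rewrite -ge0_integralD//; try by [move=> x _; rewrite mule_ge0// lee_fin|apply: emeasurable_funM; exact: mE].
 by apply: eq_integral => x _; rewrite mulrDr.
rewrite -(residual_product mal mbe al0 be0 alr ber (mE _ mG2) (mE _ mG2) G2E G2E).
have mw2 : mfunT (fun p : T * T => (r^-1 * al p.1 * be p.2)%:E) by exact/measE.
have mfst : mfunT (fun p : T * T => (G2 p.1)%:E) by apply/measE; exact: (mcomp mG2).
have msnd : mfunT (fun p : T * T => (G2 p.2)%:E) by apply/measE; exact: (mcomp mG2).
have m1 : mfunT (fun p : T * T => (h (Y p.1, Y p.2))%:E * (r^-1 * al p.1 * be p.2)%:E)%E.
 by apply: emeasurable_funM => //; exact: (mcomp mhE mY2).
have m2 : mfunT (fun p : T * T => ((G2 p.1)%:E + (G2 p.2)%:E) * (r^-1 * al p.1 * be p.2)%:E)%E.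
 by apply: emeasurable_funM => //; exact: emeasurable_funD.
apply: ae_ge0_le_integral => //.
- by move=> y _; apply: integral_ge0 => x _; rewrite mule_ge0.
- by apply: (@measurable_fun_fubini_tonelli_F _ _ T T R P (fun p => (h (Y p.1, Y p.2))%:E * (r^-1 * al p.1 * be p.2)%:E)%E) => // p; apply: mule_ge0.
- by move=> y _; apply: integral_ge0 => x _; apply: mule_ge0 => //; exact: (adde_ge0 (G2E y) (G2E x)).
- apply: (@measurable_fun_fubini_tonelli_F _ _ T T R P (fun p => ((G2 p.1)%:E + (G2 p.2)%:E) * (r^-1 * al p.1 * be p.2)%:E)%E) => // p.
 by apply: mule_ge0 => //; exact: (adde_ge0 (G2E p.1) (G2E p.2)).
apply: filterS (Qae) => y Qy _; apply: ae_ge0_le_integral => //.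
- by move=> x _; rewrite mule_ge0.
- exact: (mcomp m1 (pair1_measurable y)).
- by move=> x _; apply: mule_ge0 => //; exact: (adde_ge0 (G2E y) (G2E x)).
- exact: (mcomp m2 (pair1_measurable y)).
apply: filterS Qae => x Qx _; apply: lee_wpmul2r => //.
by apply: le_trans (hd _) (le_trans (d2 _ _ Qy Qx) _); rewrite EFinD.
Qed.

End TransportCoupling.

(** * Entropy and the abstract transport bound *)

Section EntropyDensity.
Context d (U : measurableType d) (R : realType) (nu mu : probability U R).

(** [lne] is -oo where the density vanishes, a set negligible for [nu]. The negative part of the
    logarithm is always integrable since [- rho * ln rho <= 1], so an entropy other than [+oo] is
    finite and [rho * ln rho] integrable. *)
Lemma entropy_density : entropy nu mu != +oo%E -> exists rho : U -> R, [/\ mfunT rho, forall x, 0 <= rho x,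
 forall A, measurable A -> nu A = (\int[mu]_(x in A) (rho x)%:E)%E,
 mu.-integrable setT (fun x => (rho x * ln (rho x))%:E) & entropy nu mu = (\int[mu]_x (rho x * ln (rho x)))%:E].
Proof.
rewrite /entropy; case: asboolP => // dom ent.
have f0 := Radon_Nikodym_SigmaFinite.f_ge0 dom; have ff := Radon_Nikodym_SigmaFinite.f_fin_num dom.
have fi := Radon_Nikodym_SigmaFinite.f_integrable dom.
pose rho x := fine (Radon_Nikodym_SigmaFinite.f nu mu x).
have rhoE x : (rho x)%:E = Radon_Nikodym_SigmaFinite.f nu mu x by rewrite fineK.
have mrho : mfunT rho by apply: mcomp => //; exact: measurable_int fi.
have rho0 x : 0 <= rho x by exact: fine_ge0.
have nuE A : measurable A -> nu A = (\int[mu]_(x in A) (rho x)%:E)%E.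
 by move=> mA; under eq_integral do rewrite rhoE; exact: Radon_Nikodym_SigmaFinite.f_integral.
have mL : mfunT (@ln R \o rho) by exact: (mcomp (@measurable_ln R)).
have mLE : mfunT (fun x => (ln (rho x))%:E) by exact/measE.
have domc : charge_of_finite_measure nu `<< mu by [].
pose D := Radon_Nikodym (charge_of_finite_measure nu) mu.
have mD : mfunT D by exact: measurable_int (Radon_Nikodym_integrable domc).
have lneD x : lne (D x) = if fine (D x) <= 0 then -oo%E else (ln (fine (D x)))%:E.
 by rewrite /D; have := Radon_Nikodym_fin_num x domc; case: (Radon_Nikodym _ _ x).
have pos : {ae nu, forall x, 0 < rho x}.
 have mZ : measurable (rho @^-1` `]-oo, 0]) by rewrite -[X in measurable X]setTI; exact: mrho.
 exists (rho @^-1` `]-oo, 0]); split=> //.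
 by rewrite nuE// integral0_eq// => x; rewrite /= in_itv/= => rx; congr _%:E; apply/le_anti; rewrite rx rho0.
 by move=> x /=; rewrite in_itv/= leNgt => /negP.
have entE : (\int[nu]_x lne (D x) = \int[nu]_x (ln (rho x))%:E)%E.
 apply: ae_eq_integral => //.
 under eq_fun do rewrite lneD.
 apply: measurable_fun_ifT; [|exact: measurable_cst|].
 by apply: measurable_fun_ler => //; exact: mcomp.
 by apply/measE; apply: (mcomp (@measurable_ln R)); exact: mcomp.
 have fD := null_dominates_ae_eq measurableT dom (ae_eq_Radon_Nikodym_SigmaFinite dom measurableT).
 apply: filterS2 pos fD => x rp fD _; rewrite /D -(fD I) -rhoE lne_EFin//.
have lnb x : - (ln (rho x) * rho x) <= 1.
 have := @entropy_fun_ge0 R _ (rho0 x); have := rho0 x; lra.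
have nb : (\int[nu]_x ((fun x => (ln (rho x))%:E)^\- x) <= 1)%E.
 rewrite (integral_density mrho nuE)//; last exact: measurable_funeneg.
 via (\int[mu]_x 1)%E; last by rewrite integral_cst// mul1e; exact: probability_le1.
 apply: ge0_le_integral => //.
 - by move=> x _; rewrite mule_ge0// lee_fin.
 - by apply: emeasurable_funM; [exact: measurable_funeneg|exact/measE].
 move=> x _; rewrite funenegE -EFinN -EFin_max -EFinM lee_fin /Num.max.
 by case: ifP => _; [rewrite mul0r|rewrite mulNr].
have Lfin : (\int[nu]_x (ln (rho x))%:E)%E \is a fin_num.
 move: ent; rewrite -/D entE => ent; rewrite fin_numE ent andbT integralE.
 have : (0 <= \int[nu]_x (fun x => (ln (rho x))%:E)^\+ x)%E by exact: integral_ge0.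
 have : (0 <= \int[nu]_x (fun x => (ln (rho x))%:E)^\- x)%E by exact: integral_ge0.
 move: nb; case: integral => //= a _ _; by case: integral.
have Li : integT nu (@ln R \o rho) by apply/integrableP; split=> //=; rewrite integral_fin_num_abs.
have rlE : (fun x => (rho x * ln (rho x))%:E) = (fun x => (ln (rho x) * rho x)%:E) by apply/funext => x; rewrite mulrC.
have rl : mu.-integrable setT (fun x => (ln (rho x) * rho x)%:E).
 have mlr : mfunT (fun x => ln (rho x) * rho x) by exact: measurable_funM.
 apply/integrableP; split; first exact/measE.
 have /integrableP[_] := Li; rewrite (integral_density mrho nuE)//; last exact: mcomp.
 by under eq_integral do rewrite -EFinM -[X in _ * X]ger0_norm// -normrM -abse_EFin.
have [_ E] := density_real rho0 mrho mL nuE rl.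
exists rho; split=> //; first by rewrite rlE.
rewrite -/D entE -(fineK Lfin) -/(Rintegral _ _ _) E; congr (_%:E).
by apply: eq_Rintegral => x _; rewrite mulrC.
Qed.

End EntropyDensity.

Section AbstractTransport.
Context d (T : measurableType d) (R : realType) (P : probability T R).
(** Legendre duality between the exponential and [F * ln F]. *)
Let young_exp (s g F : R) : 0 < s -> 0 <= g -> 0 <= F -> g * (F + 1) <= s^-1 * (2 * expR (s * g) + F * ln F).
Proof.
move=> s0 g0 F0; rewrite -(@ler_pM2l _ s)// mulrA mulrA mulfV ?gt_eqF// mul1r mulrDr mulr1.
have E1 : s * g <= expR (s * g) by have := expR_ge1Dx (s * g); lra.
suff E2 : s * g * F <= expR (s * g) + F * ln F by lra.
have [->|Fn0] := eqVneq F 0; first by rewrite mulr0 mul0r addr0 expR_ge0.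
have Fp : 0 < F by lra.
have := expR_ge1Dx (s * g - ln F); rewrite expRB lnK// ler_pdivlMr//; have := F0.
lra.
Qed.

(** By [young_exp] the function [g * (F + 1)] is integrable, so its part on large values of [g] is
    small and dominates [g * a] there; where [g] is bounded the small mass of [a] suffices. *)
Lemma uniform_small (s e : R) (g F : T -> R) : 0 < s -> 0 < e -> (forall x, 0 <= g x) -> (forall x, 0 <= F x) ->
 mfunT g -> mfunT F -> P.-integrable setT (fun x => (expR (s * g x))%:E) ->
 P.-integrable setT (fun x => (F x * ln (F x))%:E) ->
 exists2 de : R, 0 < de & forall a : T -> R, mfunT a -> (forall x, 0 <= a x <= F x + 1) ->
 (\int[P]_x (a x)%:E <= (2 * de)%:E)%E -> (\int[P]_x (g x * a x)%:E <= e%:E)%E.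
Proof.
move=> s0 e0 g0 F0 mg mF gi Fi.
have mW : mfunT (fun x => g x * (F x + 1)) by apply: measurable_funM => //; exact: measurable_funD.
have Wi : P.-integrable setT (fun x => (g x * (F x + 1))%:E).
 apply: (@le_integrable _ _ _ P _ measurableT _ (fun x => s^-1%:E * (2%:E * (expR (s * g x))%:E + (F x * ln (F x))%:E))%E).
 - exact/measE.
 - move=> x _; rewrite -!EFinM !abse_EFin lee_fin ger0_norm; last by pos.
 by letr (young_exp s0 (g0 x) (F0 x)); exact: ler_norm.
 by apply: integrableZl => //; apply: integrableD => //; exact: integrableZl.
pose W n x := ((g x * (F x + 1)) * \1_(g @^-1` `]n%:R, +oo[) x)%:E.
have mI n : mfunT (\1_(g @^-1` `](n%:R : R), +oo[) : T -> R).
 by apply: measurable_indic; rewrite -[X in measurable X]setTI; exact: mg.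
have Wcvg : (\int[P]_x W n x)%E @[n --> \oo] --> (\int[P]_x cst 0 x)%E.
 apply: (@dominated_cvg _ _ _ P setT measurableT _ _ (fun x => (g x * (F x + 1))%:E)) => //.
 - by move=> n; apply/measE; exact: measurable_funM.
 - move=> x _; apply: cvg_near_cst; exists (Num.truncn (g x)).+1 => // n /= gn.
 rewrite /W indicE memNset ?mulr0//= in_itv/= andbT; apply/negP; rewrite -leNgt.
 by letr (ltW (truncnS_gt _)); rewrite ler_nat.
 move=> n x _; rewrite abse_EFin lee_fin ger0_norm ?mulr_ge0 ?addr_ge0// ler_piMr ?mulr_ge0 ?addr_ge0//.
rewrite integral0 in Wcvg.
have [n _ /(_ n (leqnn n)) Wn] : \forall n \near \oo, (\int[P]_x W n x < (e / 2)%:E)%E.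
 apply: (Wcvg [set y | (y < (e / 2)%:E)%E]); apply: open_nbhs_nbhs; split; first exact: open_ereal_lt_ereal.
 by rewrite /= lte_fin divr_gt0.
exists (e / (4 * n.+1%:R)); first by pos.
move=> a ma aF aI.
have maE : mfunT (fun x => (a x)%:E) by exact/measE.
have a0 x : 0 <= a x by have /andP[] := aF x.
have W0 x : 0 <= g x * (F x + 1) * \1_(g @^-1` `]n%:R, +oo[) x by pos.
via (\int[P]_x (n.+1%:R%:E * (a x)%:E + W n x))%E.
 apply: ge0_le_integral => //; try by [move=> x _; rewrite lee_fin mulr_ge0].
 - by apply/measE; exact: measurable_funM.
 - by apply: emeasurable_funD; [exact: emeasurable_funM|apply/measE; exact: measurable_funM].
 move=> x _; rewrite /W -EFinM -EFinD lee_fin indicE; have [gn|gn] := boolP (_ \in _).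
 by rewrite mulr1; have /andP[_ aFx] := aF x; apply: ler_wpDl; [exact: mulr_ge0|exact: ler_wpM2l].
 rewrite mulr0 addr0; apply: ler_wpM2r => //; rewrite leNgt; apply/negP => ng; move/negP: gn; apply.
 by rewrite inE/= in_itv/= andbT (le_lt_trans _ ng)// ler_nat.
rewrite ge0_integralD//; first last.
- by apply/measE; exact: measurable_funM.
- by move=> x _; rewrite lee_fin.
- exact: emeasurable_funM.
- by move=> x _; rewrite lee_fin mulr_ge0.
rewrite ge0_integralZl//; last by move=> x _; rewrite lee_fin.
have -> : e = n.+1%:R * (2 * (e / (4 * n.+1%:R))) + e / 2.
 by have : n.+1%:R != 0 :> R; [rewrite pnatr_eq0|move: n.+1%:R => k k0; field].
rewrite EFinD EFinM; apply: leeD; last exact: ltW.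
by apply: lee_wpmul2l => //; rewrite lee_fin.
Qed.
(** Young's inequality for the exponents [2 / (2 - q)] and [2 / q], without optimal constants: both
    factors are bounded through the larger of the two terms. *)
Let young_powR (q L w : R) : 0 < q < 2 -> 0 <= L -> 0 <= w -> L `^ q * w `^ (q / 2) <= L `^ (2 * q / (2 - q)) + w.
Proof.
move=> /andP[q0 q2] L0 w0; set l := L `^ (_ / _); have l0 : 0 <= l by pos.
have r0 : 0 <= (2 - q) / 2 by pos.
have -> : L `^ q = l `^ ((2 - q) / 2) by rewrite /l -powRrM; congr (_ `^ _); field; rewrite subr_eq0 gt_eqF.
have [lM wM] : l <= Num.max l w /\ w <= Num.max l w by rewrite !le_max !lexx orbT.
via (Num.max l w); last by rewrite ge_max lerDl lerDr w0 l0.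
have M0 := le_trans l0 lM; have q20 : 0 <= q / 2 by pos.
via (Num.max l w `^ ((2 - q) / 2) * Num.max l w `^ (q / 2)).
 by apply: ler_pM; rewrite ?powR_ge0//; apply: ge0_ler_powR; rewrite ?nnegrE.
by rewrite -powRD_ge0// (_ : _ + _ = 1) ?powRr1//; lra.
Qed.
Let powR2_le2 (q : R) : 0 < q < 2 -> 2 `^ (q / 2) <= 2.
Proof. by move=> q02; rewrite -[leRHS]powRr1//; apply: ler_powR; lra. Qed.

Variables (dU : measure_display) (U : measurableType dU) (nu mu : probability U R) (Y : T -> U).
Variables (dist : U * U -> \bar R) (L g F : T -> R) (Q : T -> Prop) (q kap s H : R).
Hypotheses (mY : mfunT Y) (dist0 : forall p, (0 <= dist p)%E) (q02 : 0 < q < 2) (kap0 : 0 <= kap)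
 (L0 : forall x, 0 <= L x) (mL : mfunT L) (Li : P.-integrable setT (fun x => (L x `^ (2 * q / (2 - q)))%:E))
 (s0 : 0 < s) (g0 : forall x, 0 <= g x) (mg : mfunT g) (gi : P.-integrable setT (fun x => (expR (s * g x))%:E))
 (Qae : {ae P, forall x, Q x}) (dist_le : forall y x, Q y -> Q x -> (dist (Y y, Y x) <= (g y + g x)%:E)%E)
 (F0 : forall x, 0 <= F x) (mF : mfunT F) (F1 : (\int[P]_x (F x)%:E = 1)%E)
 (Fi : P.-integrable setT (fun x => (F x * ln (F x))%:E)) (H0 : 0 <= H)
 (nuE : forall A, measurable A -> nu A = (\int[P]_x ((\1_A (Y x))%:E * (F x)%:E))%E)
 (muE : forall A, measurable A -> mu A = P (Y @^-1` A))
 (transport : forall et : R, 0 < et -> exists (f : T -> R) (c : R) (v : T -> R) (Th : T -> T),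
 [/\ 0 < c, forall x, c <= f x, mfunT f, mfunT Th & forall G : T -> \bar R, (forall x, (0 <= G x)%E) -> mfunT G ->
 (\int[P]_x G (Th x) = \int[P]_x (G x * (f x)%:E))%E] /\
 [/\ (\int[P]_x `|F x - f x|%:E <= et%:E)%E, mfunT v, forall x, 0 <= v x,
 (\int[P]_x (v x)%:E <= (2 * (H + et))%:E)%E &
 {ae P, forall x, (dist (Y (Th x), Y x) <= ((kap * L x * Num.sqrt (v x)) `^ q)%:E)%E}]).

(** The random factor [L] is separated from the squared shift [v] by [young_powR]. The error [e] is
    shared by the independent part of the coupling and the excess [et] of the entropy. *)
Lemma transport_bound (e : R) : 0 < e -> exists2 pi, couplings nu mu pi & (\int[pi]_p dist p <=
 (4 * kap `^ q * (\int[P]_x (L x `^ (2 * q / (2 - q))) + 1) * H `^ (q / 2) + e)%:E)%E.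
Proof.
move=> e0; set A := \int[P]_x _; have /andP[q0 q2] := q02.
have A0 : 0 <= A by apply: Rintegral_ge0 => x _; exact: powR_ge0.
have q20 : 0 < q / 2 by pos.
have e20 : 0 < e / 2 by pos.
pose K := 4 * kap `^ q * (A + 1); have K0 : 0 <= K by pos.
have [de de0 small] := uniform_small s0 e20 g0 F0 mg mF gi Fi.
have [et1 et10 Ket] := @powR_small _ (q / 2) (e / 2 / (K + 1)) q20 (divr_gt0 e20 (ltr_wpDl K0 ltr01)).
pose et := Num.min et1 de; have et0 : 0 < et by rewrite lt_min et10.
have [f [c [v [Th [[c0 cf mf mTh Th_law] [Ff mv v0 vI dTh]]]]]] := transport et0.
pose G1 x := ((kap * L x * Num.sqrt (v x)) `^ q)%:E.
have mG1 : mfunT G1.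
 apply/measE; apply: (mcomp (measurable_powR q)).
 by apply: measurable_funM; [exact: measurable_funM|exact: (mcomp (cont_meas (@sqrt_continuous R)))].
have [pi [a [pic ma aF aI pid]]] := coupling_cost mY mF F0 F1 mf c0 cf mTh Th_law nuE muE dist0 mG1 mg
 (fun x => powR_ge0 _ _) g0 dTh Qae dist_le Ff.
exists pi => //; apply: le_trans pid _.
have ga : (\int[P]_x (g x * a x)%:E <= (e / 2)%:E)%E.
 by apply: small => //; letr aI; rewrite lee_fin ler_pM2l// ge_min lexx orbT.
(* Dividing [v] by the bound on its integral before using Young's inequality makes the estimate
   homogeneous of degree [q / 2] in the entropy. *)
pose E := 2 * (H + et); have E0 : 0 < E by pos.
pose W x := L x `^ (2 * q / (2 - q)) + E^-1 * v x.
have G1le x : (G1 x <= (kap `^ q * E `^ (q / 2))%:E * (W x)%:E)%E.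
 rewrite -EFinM lee_fin /W /G1 (powRM q (mulr_ge0 kap0 (L0 x)) (sqrtr_ge0 _)) (powRM q kap0 (L0 x)) -(mulrA (kap `^ q)) -(mulrA (kap `^ q)) ler_wpM2l ?powR_ge0//.
 have w0 : 0 <= E^-1 * v x by pos.
 have -> : Num.sqrt (v x) `^ q = E `^ (q / 2) * (E^-1 * v x) `^ (q / 2).
 by rewrite -powRM ?(ltW E0)// mulVKf ?gt_eqF// -powR12_sqrt// -powRrM mulrC.
 rewrite mulrCA; apply: ler_wpM2l; first exact: powR_ge0.
 exact: young_powR.
have : (\int[P]_x G1 x <= (kap `^ q * E `^ (q / 2) * (A + 1))%:E)%E.
 have mv' : mfunT (fun x => (E^-1 * v x)%:E) by apply/measE; exact: measurable_funM.
 have v0' x : (0 <= (E^-1 * v x)%:E)%E by rewrite lee_fin mulr_ge0// invr_ge0 ltW.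
 have mW : mfunT (fun x => (W x)%:E) by apply: (emeasurable_funD (measurable_int _ Li) mv').
 have W0 x : (0 <= (W x)%:E)%E by rewrite EFinD adde_ge0// lee_fin powR_ge0.
 have c0' : (0 <= (kap `^ q * E `^ (q / 2))%:E)%E by rewrite lee_fin mulr_ge0// powR_ge0.
 via (\int[P]_x ((kap `^ q * E `^ (q / 2))%:E * (W x)%:E))%E.
 apply: ge0_le_integral => //; first by move=> x _; rewrite lee_fin powR_ge0.
 exact: emeasurable_funM.
 rewrite ge0_integralZl// [leRHS]EFinM; apply: lee_wpmul2l => //.
 under eq_integral do rewrite EFinD.
 rewrite ge0_integralD//; first last.
 - exact: measurable_int Li.
 - by move=> x _; rewrite lee_fin powR_ge0.
 rewrite EFinD; apply: leeD; first by rewrite /A /Rintegral fineK// integrable_fin_num.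
 under eq_integral do rewrite EFinM.
 rewrite ge0_integralZl//; [|exact/measE|by move=> x _; rewrite lee_fin|by rewrite lee_fin invr_ge0 ltW].
 letr (lee_wpmul2l _ vI); first by rewrite lee_fin invr_ge0 ltW.
 by rewrite -EFinM lee_fin mulVf// gt_eqF.
move=> /leeD/(_ ga); rewrite -EFinD; move/le_trans; apply; rewrite lee_fin.
(* The 4 is twice the bound 2 on 2 to the power [q / 2]: once for the factor in [E], once for
   splitting the sum. *)
have Ele : E `^ (q / 2) <= 4 * (H `^ (q / 2) + et `^ (q / 2)).
 have et00 := ltW et0; rewrite /E powRM ?addr_ge0//.
 have := powR_add_le (ltW q20) H0 et00; have := powR2_le2 q02.
 have := powR_ge0 2 (q / 2); have := powR_ge0 (H + et) (q / 2).
 have := powR_ge0 H (q / 2); have := powR_ge0 et (q / 2).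
 move: (2 `^ _) (_ `^ _) (_ `^ _) (_ `^ _) => z x y w *.
 via (2 * (2 * (y + w))); last lra.
 by apply: ler_pM => //; via (z * (y + w)) => //; apply: ler_wpM2r => //; exact: addr_ge0.
have : K * et `^ (q / 2) <= e / 2.
 have h : et `^ (q / 2) <= e / 2 / (K + 1) by apply: Ket; rewrite ltW//= ge_min lexx.
 letr (ler_wpM2l K0 h); rewrite mulrA ler_pdivrMr ?ltr_wpDl// mulrC ler_pM2l// lerDl//.
have := ler_wpM2l (mulr_ge0 (powR_ge0 kap q) (addr_ge0 A0 ler01)) Ele.
rewrite /K; lra.
Qed.

End AbstractTransport.

(** * Moments of the random rates and final assembly *)

Lemma first_miss_integrable d (T : measurableType d) (R : realType) (P : probability T R)
 (B : nat -> set T) (a K : R) (h : nat -> R) c :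
 (forall n, measurable (B n)) -> (forall x, exists n, ~ B n.+1 x) -> 0 < a -> 0 <= K ->
 (forall n, (P (B n) <= (K * expR (- (a * n%:R ^+ 2)))%:E)%E) -> (forall n, 0 <= h n <= expR (a / 2 * n%:R ^+ 2 + c)) ->
 P.-integrable setT (fun x => (h (first_miss B x))%:E).
Proof.
move=> mB finB a0 K0 tailB hc.
have mi := integrableZl measurableT (expR c) (first_miss_moment mB finB a0 K0 tailB).
apply: (le_integrable measurableT _ _ mi) => //.
 by apply/measE; exact: measurable_first_miss.
move=> x _; have /andP[h0 hle] := hc (first_miss B x).
by rewrite !abse_EFin lee_fin !ger0_norm// mulrC -expRD.
Qed.

(** The image of [P] under [Th] has density [f], so null sets pull back to null sets. Thus
    properties that hold almost surely, such as solving the equation, hold at the shifted point. *)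
Lemma ae_comp_density d (T : measurableType d) (R : realType) (P : probability T R) (f : T -> R)
 (Th : T -> T) (Q : T -> Prop) : mfunT f -> mfunT Th ->
 (forall G : T -> \bar R, (forall x, (0 <= G x)%E) -> mfunT G -> (\int[P]_x G (Th x) = \int[P]_x (G x * (f x)%:E))%E) ->
 {ae P, forall x, Q x} -> {ae P, forall x, Q (Th x)}.
Proof.
move=> mf mTh law [A [mA A0 QA]]; exists (Th @^-1` A); split.
- by rewrite -[X in measurable X]setTI; exact: mTh.
- have mE : mfunT (fun x => (\1_A x : R)%:E) by apply/measE; exact: measurable_indic.
 have := law _ (fun x => _ : (0 <= (\1_A x : R)%:E)%E) mE.
 rewrite (eq_integral (fun x => (\1_(Th @^-1` A) x : R)%:E)); last by move=> x _; rewrite !indicE; congr (_%:R)%:E; apply/idP/idP; rewrite !inE.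
 rewrite integral_indic ?setIT//; last by rewrite -[X in measurable X]setTI; exact: mTh.
 move=> ->; last by move=> x; rewrite lee_fin.
 rewrite (_ : \int[P]_x _ = \int[P]_(x in A) (f x)%:E)%E.
 by apply: null_set_integral => //; apply/measE; exact: measurable_funTS.
 rewrite [RHS]integral_mkcond; apply: eq_integral => x _; rewrite patchE indicE.
 by case: (_ \in _); rewrite ?mul1e ?mul0e.
- by move=> x /= nQ; apply: QA.
Qed.

Lemma pvar_ge0 (R : realType) (T p : R) phi : 0 < T -> (0 <= pvar T p phi)%E.
Proof.
move=> T0; apply: le_trans (ereal_sup_ubound _); last by exists [:: T]; [exact: itv_partition1|].
exact: poweR_ge0.
Qed.

(** A rough triangle inequality: one factor 2 comes from the power of a sum, the other from adding
    the two powers, since [p >= 1]. *)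
Lemma dpvar_le_add (R : realType) (T p a b : R) (d : nat) (x y : R -> 'rV[R]_d) : 0 < T -> 1 <= p ->
 0 <= a -> 0 <= b -> (path_pvar T p x <= a%:E)%E -> (path_pvar T p y <= b%:E)%E ->
 (dpvar T p x y <= (4 * a + 4 * b)%:E)%E.
Proof.
move=> T0 p1 a0 b0 xa yb; have p0 : 0 < p by lra.
have en0 (z : R -> 'rV[R]_d) (s : R) : enorm (z s - z s) = 0 by rewrite subrr enorm0.
apply: pvar_le => //; first by pos.
move=> u n g.
have xs := pvar_psum T0 p0 a0 xa (fun s t => lexx _) (fun s t => enorm_ge0 _) (en0 x) g.
have ys := pvar_psum T0 p0 b0 yb (fun s t => lexx _) (fun s t => enorm_ge0 _) (en0 y) g.
have ap : a `^ p <= (a + b) `^ p by apply: ge0_ler_powR; rewrite ?nnegrE ?lerDl// ?addr_ge0// ltW.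
have bp : b `^ p <= (a + b) `^ p by apply: ge0_ler_powR; rewrite ?nnegrE ?lerDr// ?addr_ge0// ltW.
have two : 2 <= 2 `^ p by rewrite -[leLHS]powRr1//; apply: ler_powR => //; rewrite ler1n.
have -> : 4 * a + 4 * b = 2 * (2 * (a + b)) by ring.
rewrite !powRM ?mulr_ge0 ?addr_ge0//.
via (2 `^ p * (a `^ p + b `^ p)).
 letr (_ : _ <= 2 `^ p * (psum _ u n + psum _ u n)); last by apply: ler_wpM2l (lerD xs ys); exact: powR_ge0.
 rewrite -psumD /psum mulr_sumr; apply: ler_sum => k _.
 apply: le_trans (powR_add_le (ltW p0) (enorm_ge0 _) (enorm_ge0 _)).
 apply: ge0_ler_powR; rewrite ?nnegrE ?(ltW p0) ?addr_ge0//.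
 by rewrite opprD addrACA -opprD -[X in _ <= _ + X]enormN; exact: enormD.
apply: ler_wpM2l; first exact: powR_ge0.
move: (powR_ge0 (a + b) p) ap bp two; move: ((a + b) `^ p) (2 `^ p) => w z w0 aw bw z2.
by letr (lerD aw bw); rewrite -mulr2n -(mulr_natl w); exact: ler_wpM2r.
Qed.

Lemma powR_le_quadratic (R : realType) (q u w : R) : 0 <= q <= 2 -> 0 <= u -> 0 <= w ->
 (u + w) `^ q <= (3 + 3 * u ^+ 2) + (3 + 3 * w ^+ 2).
Proof.
move=> /andP[q0 q2] u0 w0; have s0 : 0 <= u + w by pos.
via ((1 + (u + w)) `^ q).
 by apply: ge0_ler_powR; rewrite ?nnegrE// ?lerDr// addr_ge0.
via ((1 + (u + w)) ^+ 2).
 by rewrite -powR_mulrn ?addr_ge0//; apply: ler_powR => //; rewrite lerDl.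
by have := sqr_ge0 (u - w); have := sqr_ge0 (1 - u); have := sqr_ge0 (1 - w); nra.
Qed.

(** The logarithm of the left side is affine in [n]; completing the square puts it below a quadratic
    with any positive leading coefficient. *)
Lemma rate_moment (R : realType) (r a C : R) : 0 < a -> 0 <= C ->
 exists c : R, forall n : nat, 0 <= (C * 16 ^+ n) `^ r <= expR (a / 2 * n%:R ^+ 2 + c).
Proof.
move=> a0 C0; have [->|Cn0] := eqVneq C 0.
 have [->|rn0] := eqVneq r 0.
 by exists 0 => n; rewrite powRr0 ler01 addr0 -expR0 ler_expR mulr_ge0// divr_ge0// ltW.
 by exists 0 => n; rewrite mul0r powR0// lexx expR_ge0.
have Cp : 0 < C by lra.
exists (r * ln C + (r * ln 16) ^+ 2 / (2 * a)) => n; rewrite powR_ge0/=.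
rewrite /powR gt_eqF ?mulr_gt0// ler_expR lnM ?posrE// lnXn// mulrDr -(mulr_natl (ln 16)).
move: (ln 16) (n%:R) (ln C) => l k lC.
have : 0 <= a / 2 * (k - r * l / a) ^+ 2 by pos.
have -> : a / 2 * (k - r * l / a) ^+ 2 = a / 2 * k ^+ 2 - r * (k * l) + (r * l) ^+ 2 / (2 * a).
 by field; rewrite gt_eqF.
lra.
Qed.

Lemma quadratic_moment (R : realType) (a C : R) : 0 < a -> 0 <= C -> exists s c : R, 0 < s /\ forall n : nat,
 0 <= expR (s * (3 + 3 * (4 * (C * n.+1%:R)) ^+ 2)) <= expR (a / 2 * n%:R ^+ 2 + c).
Proof.
(* The coefficient is [3 * 16 * 2], the last factor from [(n + 1)^2 <= 2 * (n^2 + 1)]. *)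
move=> a0 C0; pose D := 96 * C ^+ 2; have D0 : 0 <= D by pos.
pose s := a / 2 / (D + 1); have s0 : 0 < s by pos.
exists s, (s * (3 + D)); split=> // n; rewrite expR_ge0 ler_expR -natr1.
have sD : s * D <= a / 2 by rewrite /s mulrAC ler_pdivrMr ?ltr_wpDl// ler_pM2l ?divr_gt0// lerDl.
have : s * (3 + 3 * (4 * (C * (n%:R + 1))) ^+ 2) <= s * (3 + D * (n%:R ^+ 2 + 1)).
 rewrite ler_pM2l// lerD2l /D; have : 0 <= 48 * C ^+ 2 * (n%:R - 1) ^+ 2 by pos.
 by move: n%:R => k; lra.
have := ler_wpM2r (sqr_ge0 n%:R) sD; move: (n%:R ^+ 2) => k; lra.
Qed.

Theorem theorem2p14 (R : realType) (T p theta : R)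
  (hT : 0 < T) (hp : 1 <= p < 3) (htheta : p < theta)
  (m : nat)
  (gamma : probability (cpath T (0 : 'rV[R]_m)) R) (hgamma : gaussian gamma)
  (S : cpath T (0 : 'rV[R]_m) -> geom_rough_path T p m)
  (hSmeas : borel_measurable_lift S)
  (hSlift : {ae gamma, forall x, forall t, (S x t).1 = x t})
  (hiota : cm_embedded_1var gamma)
  (htrans : {ae gamma, forall x, forall h, cameron_martin gamma h ->
     is_translation T (Num.truncn p) h (S x) (S (cpathD x h))}) :
  forall eps beta : R, 0 < eps < 2 ->
  exists C : R,
  forall (d : nat) (xi : 'rV[R]_d)
    (b : 'rV[R]_d -> 'rV[R]_d) (sigma : 'I_m -> 'rV[R]_d -> 'rV[R]_d),
  (lip_norm theta b <= beta%:E)%E ->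
  (forall i, (lip_norm theta (sigma i) <= beta%:E)%E) ->
  forall Y : {mfun cpath T (0 : 'rV[R]_m) >-> cpath T xi},
  {ae gamma, forall x, rde_solution p b sigma (S x) (Y x)} ->
  forall nu : probability (cpath T xi) R,
  (transport_cost (fun x y : cpath T xi => dpvar T p x y) (2 - eps)
     nu (distribution gamma Y)
   <= entropy_bound (C%:E * cm_embedding_norm gamma)
        (entropy nu (distribution gamma Y)))%E.
Proof.
move=> eps beta /andP[eps0 eps2]; set q : R := 2 - eps.
have q02 : 0 < q < 2 by rewrite /q; apply/andP; split; lra.
have /andP[q0 q2] := q02; have q0n : q != 0 by rewrite gt_eqF.
have /andP[p1 p3] := hp; have p0 : 0 < p by exact: lt_le_trans p1.
(* The constants are obtained before [d], [xi] and the fields are introduced; the same holds for the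
   tail and the moments that follow, so the witness is uniform in them. *)
have [de [C0 [de0 de1 C00 RS]]] := @rough_summary R m T p theta beta hT p1 p3 htheta.
have [kap [kap0 kapn kapv]] := embedding_constant hT hgamma hiota.
pose B dl n := [set x | cnt (Num.truncn p) p (S x) dl n 0 T].
have mB dl n : measurable (B dl n) by exact: measurable_cnt.
have finB dl (dl0 : 0 < dl) x : exists n0, forall n, (n0 <= n)%N -> ~ B dl n x.
 exact: geom_rough_cnt_finite.
have finB1 x : exists n, ~ B de n.+1 x.
 by have [n0 nB] := finB _ de0 x; exists n0; exact: nB.
have cmh e : cameron_martin gamma (hpath hgamma e) by exists (zeta gamma e); exact: hpath_cm.
have pvar_h e (v : R) : cov gamma e e <= v -> (path_pvar T 1 (hpath hgamma e) <= (kap * Num.sqrt v)%:E)%E.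
 by move=> ev; apply: kapv; rewrite ?sqrtr_ge0// sqr_sqrtr// (le_trans _ ev)// var_ge0.
have shiftB : {ae gamma, forall x, forall e (v : R) n, cov gamma e e <= v -> B de n (cpathD x (hpath hgamma e)) ->
 exists k j, [/\ (n <= k + j)%N, B (de / 16) k x & j%:R * (de / 64) <= kap * Num.sqrt v]}.
 apply: filterS htrans => x tr e v n ev Bn.
 exact: (cnt_shift hT p1 p3 de0 de1 (tr _ (cmh e)) (pvar_h _ _ ev) Bn).
have d16 : 0 < de / 16 by rewrite divr_gt0.
have d64 : 0 < de / 64 by rewrite divr_gt0.
have [a [K [a0 K0 tail]]] := gaussian_tail hT (mB de) (mB _) kap0 d64 (finB _ d16) shiftB.
pose Nx := first_miss (B de).
pose L x := C0 * 16 ^+ Nx x.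
pose g x := 3 + 3 * (4 * (C0 * (Nx x).+1%:R)) ^+ 2.
have L0 x : 0 <= L x by rewrite mulr_ge0// exprn_ge0.
have mL : measurable_fun setT L by exact: (measurable_first_miss (mB de) finB1 (fun n => C0 * 16 ^+ n)).
have g0 x : 0 <= g x by rewrite addr_ge0// mulr_ge0// sqr_ge0.
have mg : measurable_fun setT g.
 exact: (measurable_first_miss (mB de) finB1 (fun n => 3 + 3 * (4 * (C0 * n.+1%:R)) ^+ 2)).
have Li : gamma.-integrable setT (fun x => (L x `^ (2 * q / (2 - q)))%:E).
 have [c Lc] := rate_moment (2 * q / (2 - q)) a0 C00.
 exact: (first_miss_integrable (mB de) finB1 a0 K0 tail Lc).
have [s [c [s0 gc]]] := quadratic_moment a0 C00.
have gi : gamma.-integrable setT (fun x => (expR (s * g x))%:E).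
 exact: (first_miss_integrable (mB de) finB1 a0 K0 tail gc).
set A := \int[gamma]_x (L x `^ (2 * q / (2 - q))).
have A0 : 0 <= A by apply: Rintegral_ge0 => x _; exact: powR_ge0.
(* The q-th root of the factor in [transport_bound], without the part [kap], which is bounded by the
   embedding norm at the end. *)
exists ((4 * (A + 1)) `^ q^-1) => d xi b sg hb hs Y Yrde nu.
have [->|Hn] := eqVneq (entropy nu (distribution gamma Y)) +oo%E; first by rewrite /entropy_bound/= leey.
have [rho [mrho rho0 nuE rhoi HE]] := entropy_density Hn.
have mY : measurable_fun setT Y by [].
have law := integral_law mY (fun _ _ => erefl (distribution gamma Y _)).
pose F x := rho (Y x).
have mF : measurable_fun setT F by exact: mcomp.
have F0 x : 0 <= F x by exact: rho0.
have F1 : (\int[gamma]_x (F x)%:E = 1)%E.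
 rewrite (ge0_integral_law mY (fun _ _ => erefl (distribution gamma Y _)) (F := EFin \o rho))//; last exact: mcomp.
 by rewrite -nuE// probability_setT.
have FI : integT gamma F.
 apply/integrableP; split; first exact: mcomp.
 by under eq_integral do rewrite abse_EFin ger0_norm//; rewrite F1 ltry.
have mlr : measurable_fun setT (fun y => rho y * ln (rho y)).
 by apply: measurable_funM => //; exact: (mcomp (@measurable_ln R)).
have [Fi FE] := law _ mlr rhoi.
set H := \int[_]_x _ in HE FE; rewrite HE /entropy_bound.
have FRI : \int[gamma]_x F x = 1 by rewrite /Rintegral F1.
have ET et : 0 < et -> _ := @entropy_transport R m T gamma hT hgamma F H et F0 FI FRI Fi FE.
(* The entropy plus any positive [et] dominates half of a nonnegative transport cost. *)
have H0 : 0 <= H.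
 rewrite -[leRHS]addr0; apply/ler_addgt0Pr => et et0; rewrite addr0.
 have [f [s' [ev [v [Th [[_ _ _ _ [_ vle _ _ _]] vI]]]]]] := ET _ et0.
 rewrite -(@pmulr_rge0 _ 2)// -lee_fin; apply: le_trans vI; apply: integral_ge0 => x _.
 by rewrite lee_fin; apply: le_trans (vle x); exact: var_ge0.
have nuE' D : measurable D -> nu D = (\int[gamma]_x ((\1_D (Y x))%:E * (F x)%:E))%E.
 move=> mD; rewrite nuE// integral_mkcond.
 rewrite -(ge0_integral_law mY (fun _ _ => erefl (distribution gamma Y _))).
 - by apply: eq_integral => x _; rewrite patchE indicE; case: (_ \in _); rewrite ?mul1e ?mul0e.
 - by move=> y; rewrite patchE; case: ifP; rewrite ?lee_fin.
 - by apply/(measurable_restrictT _ mD); apply: measurable_funTS; exact: mcomp.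
pose dist (z : cpath T xi * cpath T xi) := (dpvar T p z.1 z.2 `^ q)%E.
have dist_le (x y : cpath T xi) (M : R) : 0 <= M -> (dpvar T p x y <= M%:E)%E -> (dist (x, y) <= (M `^ q)%:E)%E.
 move=> M0 dM; rewrite /dist -poweR_EFin; apply: gt0_ler_poweR => //; first exact: ltW.
 by rewrite in_itv/= leey andbT; exact: pvar_ge0 hT.
 by rewrite in_itv/= leey andbT lee_fin.
have dg y x : rde_solution p b sg (S y) (Y y) -> rde_solution p b sg (S x) (Y x) ->
 (dist (Y y, Y x) <= (g y + g x)%:E)%E.
 move=> sy sx; have [ty _] := RS _ _ _ _ hb hs _ _ sy _ (first_missP finB1 y).1.
 have [tx _] := RS _ _ _ _ hb hs _ _ sx _ (first_missP finB1 x).1.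
 have n0 z : 0 <= C0 * (Nx z).+1%:R by exact: mulr_ge0.
 apply: le_trans (dist_le _ _ _ _ (dpvar_le_add hT p1 (n0 y) (n0 x) ty tx)) _.
 by rewrite addr_ge0// mulr_ge0.
 by rewrite lee_fin; apply: powR_le_quadratic; rewrite ?mulr_ge0// !ltW.
have TR et : 0 < et -> exists (f : _ -> R) (c : R) (v : _ -> R) Th,
 [/\ 0 < c, forall x, c <= f x, measurable_fun setT f, measurable_fun setT Th &
 forall G : _ -> \bar R, (forall x, (0 <= G x)%E) -> measurable_fun setT G ->
 (\int[gamma]_x G (Th x) = \int[gamma]_x (G x * (f x)%:E))%E] /\
 [/\ (\int[gamma]_x `|F x - f x|%:E <= et%:E)%E, measurable_fun setT v, forall x, 0 <= v x,
 (\int[gamma]_x (v x)%:E <= (2 * (H + et))%:E)%E &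
 {ae gamma, forall x, (dist (Y (Th x), Y x) <= ((kap * L x * Num.sqrt (v x)) `^ q)%:E)%E}].
 move=> et0; have [f [s' [ev [v [Th [[[c' [C' [c0 fcC]]] mf f1 Ff [[mTh mv ThE] vle _ Th_law _]] vI]]]]]] := ET _ et0.
 exists f, c', v, Th; split; first by split=> // x; have /andP[] := fcC x.
 have fi : integT gamma f by exact: integ_between mf fcC.
 split=> //.
 - have di : integT gamma (fun x => `|F x - f x|) by exact: integrable_dist.
 by rewrite -(fineK (integrable_fin_num measurableT di)) lee_fin.
 - by move=> x; apply: le_trans (vle x); exact: var_ge0.
 (* The solution at the shifted point is driven by the lift of the shifted path, which [tr]
    identifies as a translation of [S x]; [rough_summary] compares the two. *)
 have sTh := ae_comp_density mf mTh Th_law Yrde.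
 apply: filterS3 htrans Yrde sTh => x tr sx sTx.
 have [_ move] := RS _ _ _ _ hb hs _ _ sx _ (first_missP finB1 x).1.
 apply: dist_le; first by rewrite !mulr_ge0// sqrtr_ge0.
 rewrite (mulrC kap) -mulrA.
 apply: move sTx; last exact: pvar_h.
 by rewrite ThE; exact: tr.
pose Bd := (4 * (A + 1)) `^ q^-1 * (kap * Num.sqrt H).
have Bd0 : 0 <= Bd by rewrite !mulr_ge0 ?powR_ge0 ?sqrtr_ge0.
have BdE : Bd `^ q = 4 * kap `^ q * (A + 1) * H `^ (q / 2).
 have -> : H `^ (q / 2) = Num.sqrt H `^ q by rewrite -powR12_sqrt// -powRrM mulrC.
 rewrite /Bd powRM ?powR_ge0 ?mulr_ge0 ?sqrtr_ge0// (powRM _ kap0 (sqrtr_ge0 _)) -powRrM mulVf//.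
 rewrite powRr1 ?mulr_ge0 ?addr_ge0//; move: (kap `^ q) (_ `^ q) => z w; ring.
apply: (@le_trans _ _ Bd%:E).
 (* The room between the q-th powers of [Bd] and [Bd + e] serves as the error in [transport_bound];
    after taking the root only [e] is lost. *)
 apply/lee_addgt0Pr => e e0.
 have : 0 < (Bd + e) `^ q - Bd `^ q.
 by rewrite subr_gt0; apply: gt0_ltr_powR; rewrite ?nnegrE ?addr_ge0 ?ltrDl// ltW.
 move=> /(transport_bound (mu := distribution gamma Y) mY (dist := dist) (fun _ => poweR_ge0 _ _) q02 kap0 L0 mL Li s0 g0 mg gi Yrde dg F0 mF F1 Fi H0 nuE' (fun _ _ => erefl) TR)[pi pic].
 rewrite -/A -BdE addrC subrK => pid.
 apply: le_trans (ereal_inf_lbound _) _; first by exists pi.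
 have -> : (Bd%:E + e%:E = ((Bd + e) `^ q)%:E `^ q^-1)%E.
 by rewrite poweR_EFin -powRrM mulfV// powRr1// addr_ge0// ltW.
 apply: gt0_ler_poweR => //; first by rewrite invr_ge0 ltW.
 by rewrite in_itv/= leey andbT integral_ge0// => z _; exact: poweR_ge0.
 by rewrite in_itv/= leey andbT lee_fin powR_ge0.
rewrite /Bd mulrA !EFinM; apply: lee_wpmul2r; first by rewrite lee_fin sqrtr_ge0.
by apply: lee_wpmul2l => //; rewrite lee_fin powR_ge0.
Qed.
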